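(* Let $g:\Omega\times\mathbb{R}^d\times\mathbb{R}^m\times\mathbb{S}^{d-1}\to[0,+\infty)$ be an admissible random surface tension which is $\mathbb{R}^d$-stationary with respect to a measure-preserving group action $\{\tau_z\}_{z\in\mathbb{R}^d}$. Then there exists a function $g_{\rm hom}:\Omega\times\mathbb{R}^m\times\mathbb{R}^m\times\mathbb{S}^{d-1}\to[0,+\infty)$ such that almost surely, for all $(a,b)\in\mathcal{M}\times\mathcal{M}$ and all $\nu\in\mathbb{S}^{d-1}$, the limit $\lim_{t\to+\infty}X_{t,t}^{a,b,\nu}(g)(\omega)$ exists and $$\lim_{t\to+\infty}X_{t,t}^{a,b,\nu}(g)(\omega)=g_{\rm hom}(\omega,a,b,\nu).$$ Moreover, $g_{\rm hom}$ is invariant under $\{\tau_z\}_{z\in\mathbb{R}^d}$, and if $\{\tau_z\}_{z\in\mathbb{R}^d}$ is ergodic, then $g_{\rm hom}$ is deterministic (i.e. does not depend on $\omega$). Finally, let $\nu\in\mathbb{S}^{d-1}$ be fixed; then almost surely, for every $(a,b)\in\mathcal{M}\times\mathcal{M}$ we have $$\lim_{t\to+\infty}X_{t,\ell_t}^{a,b,\nu}(g)(\omega)=g_{\rm hom}(\omega,a,b,\nu)$$ under the assumption that $0<\ell_t\le t$ satisfies $\lim_{t\to+\infty}\ell_t=+\infty$.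
   Context: Let $d\ge 2$, $m\ge1$ and fix a finite set $\mathcal{M}\subset\mathbb{R}^m$. For $c\ge1$, $\mathcal{A}_c$ is the class of Borel functions $g:\mathbb{R}^d\times\mathbb{R}^m\times\mathbb{S}^{d-1}\to[0,+\infty)$ with $\frac1c\le g(x,\zeta,\nu)\le c$ and $g(x,\zeta,\nu)=g(x,-\zeta,-\nu)$ for all $(x,\zeta,\nu)$. For $g\in\mathcal{A}_c$ and $D\subset\mathbb{R}^d$ open with Lipschitz boundary, $E_g(u,D)=\int_{D\cap S_u}g(x,u^+-u^-,\nu_u)\,d\mathcal{H}^{d-1}$ if $u\in BV(D;\mathcal{M})$ (functions of bounded variation with values a.e. in $\mathcal{M}$; $S_u$ jump set, $u^\pm$ traces, $\nu_u$ normal) and $+\infty$ otherwise. $(\Omega,\mathcal{F},\mathbb{P})$ is a complete probability space. An admissible random surface tension is a jointly measurable $g:\Omega\times\mathbb{R}^d\times\mathbb{R}^m\times\mathbb{S}^{d-1}\to[0,+\infty)$ such that for some $c\ge1$, $g(\omega,\cdot,\cdot,\cdot)\in\mathcal{A}_c$ for every $\omega$; write $E_g(\omega)=E_{g(\omega,\cdot)}$. A measure-preserving group action $\{\tau_z\}_{z\in\mathbb{R}^k}$ is a family of $\mathcal{F}$-measurable maps $\tau_z:\Omega\to\Omega$ with $\mathbb{P}(\tau_zA)=\mathbb{P}(A)$ for all $A\in\mathcal{F}$, $\tau_0=\mathrm{id}$, $\tau_{z_1+z_2}=\tau_{z_2}\circ\tau_{z_1}$; it is ergodic if $\mathbb{P}(\tau_zA\Delta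 A)=0$ for all $z$ implies $\mathbb{P}(A)\in\{0,1\}$. $g$ is $\mathbb{R}^d$-stationary w.r.t. $\{\tau_z\}_{z\in\mathbb{R}^d}$ if $g(\tau_z\omega,x,\zeta,\nu)=g(\omega,x+z,\zeta,\nu)$ for all $\omega,z,x,\zeta,\nu$. Invariance of $g_{\rm hom}$ means $g_{\rm hom}(\tau_z\omega,a,b,\nu)=g_{\rm hom}(\omega,a,b,\nu)$. For $\nu\in\mathbb{S}^{d-1}$, $O_\nu$ is the orthogonal matrix of the linear map $x\mapsto 2\frac{\langle x,\nu+e_d\rangle}{|\nu+e_d|^2}(\nu+e_d)-x$ if $\nu\ne-e_d$, and $x\mapsto -x$ if $\nu=-e_d$; set $\nu_j=O_\nu e_j$ ($j=1,\dots,d-1$). For $t,\ell>0$, $R^\nu_{t,\ell}=\{x:|\langle x,\nu\rangle|<\ell/2,\ |\langle x,\nu_j\rangle|<t/2,\ j=1,\dots,d-1\}$. For $a,b\in\mathcal{M}$, $u^{a,b,\nu}(x)=b$ if $\langle x,\nu\rangle>0$ and $a$ otherwise. For $D$ open Lipschitz and $\bar u\in BV(D;\mathcal{M})$, $\mathscr{A}(\bar u,D)=\{u\in BV(D;\mathcal{M}): u=\bar u\text{ in a neighborhood of }\partial D\}$. Define $X_{t,\ell}^{a,b,\nu}(g)(\omega)=t^{1-d}\inf\{E_g(\omega)(u,R^\nu_{t,\ell}):u\in\mathscr{A}(u^{a,b,\nu},R^\nu_{t,\ell})\}$. *)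

(* Defs.v *)
From HB Require Import structures.
From mathcomp Require Import all_boot all_order all_algebra.
From mathcomp Require Import all_classical all_reals all_analysis.
Set Implicit Arguments. Unset Strict Implicit. Unset Printing Implicit Defensive.
Import Order.TTheory GRing.Theory Num.Theory.
Import numFieldNormedType.Exports.
Local Open Scope classical_set_scope.
Local Open Scope ring_scope.

Section GMT.
Variable R : realType.

Definition dotv {n} (x y : 'rV[R]_n) : R := \sum_(i < n) x ord0 i * y ord0 i.
Definition enorm {n} (x : 'rV[R]_n) : R := Num.sqrt (dotv x x).
Definition sphere n : set 'rV[R]_n := [set nu | enorm nu = 1].
(* ebase n j = e_{j+1}, the (j+1)-th canonical basis vector (j < n) *)
Definition ebase n (j : nat) : 'rV[R]_n := \row_(k < n) (nat_of_ord k == j)%:R.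

(* the orthogonal map O_nu (reflection sending e_d to nu, or -id) *)
Definition Onu {d} (nu x : 'rV[R]_d) : 'rV[R]_d :=
  let w := nu + ebase d d.-1 in
  if nu == - ebase d d.-1 then - x
  else (2 * dotv x w / dotv w w) *: w - x.

Definition rect {d} (nu : 'rV[R]_d) (t l : R) : set 'rV[R]_d :=
  [set x | `|dotv x nu| < l / 2 /\
           forall j : nat, (j < d.-1)%N -> `|dotv x (Onu nu (ebase d j))| < t / 2].

Definition ujump {d m} (a b : 'rV[R]_m) (nu : 'rV[R]_d) (x : 'rV[R]_d) : 'rV[R]_m :=
  if 0 < dotv x nu then b else a.

Definition obox {n} (lo hi : 'rV[R]_n) : set 'rV[R]_n :=
  [set x | forall i, lo ord0 i < x ord0 i < hi ord0 i].
Definition boxvol {n} (lo hi : 'rV[R]_n) : R :=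
  \prod_(i < n) Num.max 0 (hi ord0 i - lo ord0 i).
Definition leb_out n (A : set 'rV[R]_n) : \bar R :=
  ereal_inf [set s | exists lo hi : nat -> 'rV[R]_n,
     A `<=` \bigcup_k obox (lo k) (hi k) /\
     s = (\sum_(0 <= k <oo) (boxvol (lo k) (hi k))%:E)%E].
Definition lmeas n (A : set 'rV[R]_n) : Prop :=
  forall B, leb_out B = (leb_out (B `&` A) + leb_out (B `&` ~` A))%E.

Definition diam n (C : set 'rV[R]_n) : \bar R :=
  ereal_sup ([set 0%E] `|` [set (enorm (p.1 - p.2))%:E | p in C `*` C]).
Definition omega (s : nat) : R := fine (leb_out [set x : 'rV[R]_s | enorm x < 1]).
Definition hausd_delta n (s : nat) (delta : R) (A : set 'rV[R]_n) : \bar R :=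
  ereal_inf [set e | exists C : nat -> set 'rV[R]_n,
     A `<=` \bigcup_k C k /\ (forall k, (diam (C k) < delta%:E)%E) /\
     e = (\sum_(0 <= k <oo) (omega s * (fine (diam (C k)) / 2) ^+ s)%:E)%E].
Definition hausdorff n (s : nat) (A : set 'rV[R]_n) : \bar R :=
  ereal_sup [set hausd_delta s delta A | delta in [set delta : R | 0 < delta]].

(* ---------- integral of a nonnegative function w.r.t. an outer measure
   (layer-cake / Choquet formula; equals the Lebesgue integral with respect to
   the induced measure for measurable integrands) ---------- *)
Definition ointeg {T} (mu : set T -> \bar R) (f : T -> \bar R) : \bar R :=
  (\int[lebesgue_measure]_(s in [set s : R | (0 < s)%R]) mu [set x | s%:E < f x])%E.
Definition sointeg {T} (mu : set T -> \bar R) (h : T -> R) : \bar R :=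
  (ointeg mu (fun x => (Num.max (h x) 0)%:E)
   - ointeg mu (fun x => (Num.max (- h x) 0)%:E))%E.

Definition C1c n (D : set 'rV[R]_n) (phi : 'rV[R]_n -> R) : Prop :=
  (exists K, compact K /\ K `<=` D /\ forall x, ~ K x -> phi x = 0) /\
  forall j : 'I_n, (forall x, derivable phi x (ebase n j)) /\
                   continuous (fun x => derive phi x (ebase n j)).
Definition testfield n m (D : set 'rV[R]_n) (Phi : 'I_m -> 'I_n -> 'rV[R]_n -> R) :=
  (forall al i, C1c D (Phi al i)) /\
  forall x, \sum_(al < m) \sum_(i < n) (Phi al i x) ^+ 2 <= 1.
Definition divg n (phi : 'I_n -> 'rV[R]_n -> R) (x : 'rV[R]_n) : R :=
  \sum_(i < n) derive (phi i) x (ebase n i).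
Definition totvar n m (D : set 'rV[R]_n) (u : 'rV[R]_n -> 'rV[R]_m) : \bar R :=
  ereal_sup [set e | exists Phi, testfield D Phi /\
    e = (\sum_(al < m) sointeg (@leb_out n)
            (fun x => if x \in D then (u x ord0 al * divg (Phi al) x)%R else 0%R))%E].
Definition lmeas_fun n m (D : set 'rV[R]_n) (u : 'rV[R]_n -> 'rV[R]_m) : Prop :=
  forall U : set 'rV[R]_m, open U -> lmeas (D `&` u @^-1` U).
Definition BVM n m (M : seq 'rV[R]_m) (D : set 'rV[R]_n) (u : 'rV[R]_n -> 'rV[R]_m) : Prop :=
  [/\ lmeas_fun D u,
      leb_out (D `&` [set x | u x \notin M]) = 0%E,
      (ointeg (@leb_out n) (fun x => if x \in D then (enorm (u x))%:E else 0%E) < +oo)%E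
    & (totvar D u < +oo)%E].

Definition halfball {n} (x nu : 'rV[R]_n) (r : R) (pos : bool) : set 'rV[R]_n :=
  [set y | enorm (y - x) < r /\
           (if pos then 0 < dotv (y - x) nu else dotv (y - x) nu < 0)].
Definition aplim_half {n m} (u : 'rV[R]_n -> 'rV[R]_m) (x nu : 'rV[R]_n) (pos : bool)
    (a : 'rV[R]_m) : Prop :=
  forall eps : R, 0 < eps ->
    (fun r : R => fine (leb_out (halfball x nu r pos `&` [set y | eps < enorm (u y - a)]))
                  / fine (leb_out (halfball x nu r pos))) @ 0^'+ --> 0.
Definition jumptriple {n m} (u : 'rV[R]_n -> 'rV[R]_m) (x : 'rV[R]_n)
    (um up : 'rV[R]_m) (nu : 'rV[R]_n) : Prop :=
  [/\ sphere nu, up != um, aplim_half u x nu true up & aplim_half u x nu false um].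
(* energy density on the jump set (-oo off the jump set) *)
Definition jdens {n m} (g : 'rV[R]_n -> 'rV[R]_m -> 'rV[R]_n -> R)
    (u : 'rV[R]_n -> 'rV[R]_m) (x : 'rV[R]_n) : \bar R :=
  ereal_sup [set e | exists um up nu, jumptriple u x um up nu /\
                     e = (g x (up - um) nu)%:E].

Definition Eg {n m} (M : seq 'rV[R]_m) (g : 'rV[R]_n -> 'rV[R]_m -> 'rV[R]_n -> R)
    (u : 'rV[R]_n -> 'rV[R]_m) (D : set 'rV[R]_n) : \bar R :=
  if `[< BVM M D u >] then
    ointeg (@hausdorff n n.-1) (fun x => if x \in D then jdens g u x else 0%E)
  else +oo%E.

Definition Adm {n m} (M : seq 'rV[R]_m) (ubar : 'rV[R]_n -> 'rV[R]_m)
    (D : set 'rV[R]_n) (u : 'rV[R]_n -> 'rV[R]_m) : Prop :=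
  BVM M D u /\ exists U, [/\ open U, closure D `\` D `<=` U &
     leb_out (D `&` U `&` [set x | u x != ubar x]) = 0%E].

Definition Xcell {n m} (M : seq 'rV[R]_m) (g0 : 'rV[R]_n -> 'rV[R]_m -> 'rV[R]_n -> R)
    (a b : 'rV[R]_m) (nu : 'rV[R]_n) (t l : R) : \bar R :=
  ((t ^- n.-1)%:E *
   ereal_inf [set Eg M g0 u (rect nu t l) | u in Adm M (ujump a b nu) (rect nu t l)])%E.

End GMT.

Section Random.
Variables (R : realType) (dO : measure_display) (Om : measurableType dO).

Definition complete_prob (P : probability Om R) : Prop :=
  forall N : set Om, P.-negligible N -> measurable N.

Definition rects d m : set (set (Om * ('rV[R]_d * ('rV[R]_m * 'rV[R]_d)))) :=
  [set S | exists (A : set Om) (U : set 'rV[R]_d) (V : set 'rV[R]_m) (W : set 'rV[R]_d),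
     [/\ measurable A, open U, open V, open W & S = A `*` (U `*` (V `*` W))]].

Definition admissible_rst d m (g : Om -> 'rV[R]_d -> 'rV[R]_m -> 'rV[R]_d -> R) : Prop :=
  (forall s : R, smallest (sigma_algebra setT) (@rects d m)
     [set p | sphere p.2.2.2 /\ s < g p.1 p.2.1 p.2.2.1 p.2.2.2]) /\
  exists c : R, 1 <= c /\ forall w x zeta nu, sphere nu ->
     [/\ c^-1 <= g w x zeta nu, g w x zeta nu <= c & g w x zeta nu = g w x (- zeta) (- nu)].

Definition mp_action d (P : probability Om R) (tau : 'rV[R]_d -> Om -> Om) : Prop :=
  [/\ forall z, measurable_fun setT (tau z),
      forall z A, measurable A -> P (tau z @` A) = P A,
      tau 0 = id
    & forall z1 z2, tau (z1 + z2) = tau z2 \o tau z1].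

Definition ergodic d (P : probability Om R) (tau : 'rV[R]_d -> Om -> Om) : Prop :=
  forall A, measurable A ->
    (forall z, P ((tau z @` A `\` A) `|` (A `\` tau z @` A)) = 0%E) ->
    P A = 0%E \/ P A = 1%E.

Definition stationary d m (g : Om -> 'rV[R]_d -> 'rV[R]_m -> 'rV[R]_d -> R)
    (tau : 'rV[R]_d -> Om -> Om) : Prop :=
  forall w z x zeta nu, g (tau z w) x zeta nu = g w (x + z) zeta nu.

End Random.

(* Main.v *)
(* Write k = d - 1 and let F(t, l) be the infimum of the energy on the rectangle of width t and height l, so that X = t^-k F.

Gluing competitors along disjoint rectangles, with partitions of unity to keep the total variation finite, costs at most a constant times the Hausdorff measure of the mismatch on the interface. Hence F is almost subadditive over bricks lying along the hyperplane, is nonincreasing in l, and changes little under translations and small rotations of the rectangle.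

Measurability of F in omega: competitors are coded by points of Baire space (finitely many G_delta sets built from rational boxes). The jump set is a countable intersection of countable unions of compact sets described by densities of half balls, which makes the energy jointly measurable in omega and the code; finiteness of the Hausdorff measure on compact sets comes from testing the total variation with disjoint bumps. Since the probability is complete, the projection of a measurable subset of Omega times Baire space is measurable.

Convergence for one direction: let f_* and f^* be the lower and upper limits of X(t, t). They are invariant, and by a maximal inequality (Vitali's covering lemma) most bricks of a large box are good along almost every realization. Grouping good bricks into disjoint cubes where X is close to f_* covers a fixed proportion theta of the box, and the other bricks have X at most f^* + e. So the upper limit of X(t, L) for some fixed L is at most theta f_* + (1 - theta) f^* + e, which forces f^* = f_* and handles all heights L <= l(t) <= t as well.

A countable dense set of directions, containing the exceptional direction -e_d where the frame is discontinuous, controls all directions. *)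

(* Energies are layer-cake integrals against outer measures. Upper bounds on them therefore rest on
   monotonicity and subadditivity, which hold for arbitrary sets; for the Hausdorff measure,
   Caratheodory measurability enters only for the dependence on omega.

   The action is not jointly measurable in z. Averages are therefore taken along a lattice of
   translations in the hyperplane orthogonal to the direction, whereas [fs] and [fS], the lower and
   upper limits along integer sizes, are invariant under every translation and for every omega,
   because moving a rectangle costs a vanishing fraction of its area. One pair of thresholds thus
   serves all bricks of an orbit.

   Any fixed theta > 0 is enough: once [fS] is at most theta [fs] + (1 - theta) [fS] + e for all e >
   0, the two limits coincide. This is why a crude greedy covering with constant 2^k suffices.

   Since [fs] is defined at every omega, the homogenized density is invariant everywhere. In the
   ergodic case it is evaluated at one typical realization, which makes it constant on all of
   Omega. *)
Require Import Defs.
From HB Require Import structures.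
From mathcomp Require Import all_boot all_order all_algebra.
From mathcomp Require Import all_classical all_reals all_analysis.
From mathcomp Require Import measurable_realfun numfun ring lra zify.
Import Order.TTheory GRing.Theory Num.Theory.
Import numFieldNormedType.Exports.
Local Open Scope classical_set_scope.
Local Open Scope ring_scope.
Set Implicit Arguments. Unset Strict Implicit. Unset Printing Implicit Defensive.

(** * Lebesgue and Hausdorff outer measures *)

Section CoverOuter.
Variables (R : realType) (T : Type) (I : choiceType) (S : I -> set T) (w : I -> \bar R).
Hypothesis w0 : forall i, (0 <= w i)%E.
Variable i0 : I.
Hypotheses (Si0 : S i0 = set0) (wi0 : w i0 = 0%E).
Local Open Scope ereal_scope.

(** The common form of the Lebesgue outer measure (covers by boxes) and of each Hausdorff premeasure
    (covers by sets of diameter below delta), so that countable subadditivity is proved once. *)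
Definition covout (A : set T) : \bar R :=
  ereal_inf [set s | exists i : nat -> I, A `<=` \bigcup_k S (i k) /\
     s = \sum_(0 <= k <oo) w (i k)].

Lemma covout_ge0 A : 0 <= covout A.
Proof. by apply: le_ereal_inf_tmp => _ [i [_ ->]]; exact: nneseries_ge0. Qed.

Lemma covout_le A i : A `<=` \bigcup_k S (i k) -> covout A <= \sum_(0 <= k <oo) w (i k).
Proof. by move=> Ai; apply: ereal_inf_lbound; exists i. Qed.

Lemma covout_adh A (e : R) : (0 < e)%R -> covout A < +oo ->
  exists2 i : nat -> I, A `<=` \bigcup_k S (i k) & \sum_(0 <= k <oo) w (i k) <= covout A + e%:E.
Proof.
move=> e0 Aoo.
have fA : covout A \is a fin_num by rewrite ge0_fin_numE// covout_ge0.
have [_ [i [Ai ->]] /ltW h] := lb_ereal_inf_adherent e0 fA.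
by exists i.
Qed.

Lemma covout_subset A F : subset_sigma_subadditive covout A F.
Proof.
move=> AF.
have [[i ioo]|] := pselect (exists i, covout (F i) = +oo).
  rewrite (eseries_pinfty _ _ ioo) ?leey// => n _.
  by rewrite -ltNye (lt_le_trans _ (covout_ge0 _)).
rewrite -forallNE => Foo.
apply/lee_addgt0Pr => e e0.
apply: (le_trans _ (epsilon_trick _ _ (ltW e0))); last by move=> n; exact: covout_ge0.
have H n : exists i : nat -> I, F n `<=` \bigcup_k S (i k) /\
    \sum_(0 <= k <oo) w (i k) <= covout (F n) + (e / (2 ^ n.+1)%:R)%:E.
  have [||i] := @covout_adh (F n) (e / (2 ^ n.+1)%:R)%R.
  - by rewrite divr_gt0// ltr0n expn_gt0.
  - by rewrite ltey; apply/eqP/Foo.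
  by exists i.
have {H} [G HG] := choice H.
have /card_esym/ppcard_eqP[f] := card_nat2.
apply: (@le_trans _ _ (\sum_(0 <= l <oo) w (G (f l).1 (f l).2))).
  apply: covout_le => x /AF[n _ Fx]; have [k _ Sx] := (HG n).1 _ Fx.
  by exists (f^-1%FUN (n, k)) => //=; rewrite invK ?inE.
rewrite nneseries_esumT//.
rewrite -(@reindex_esum R _ _ setT setT f (fun k => w (G k.1 k.2))); last exact: (@bij _ _ _ _ f).
have -> : [set: nat * nat] = setT `*`` (fun=> setT) by apply/seteqP; split.
rewrite -(@esum_esum _ _ _ setT (fun=> setT) (fun i j => w (G i j)))//.
rewrite nneseries_esumT; last by move=> n; rewrite adde_ge0 ?covout_ge0// lee_fin divr_ge0// ltW.
apply: le_esum => n _.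
by rewrite -nneseries_esumT//; apply: (HG n).2.
Qed.

Lemma covout0 : covout set0 = 0.
Proof.
apply/eqP; rewrite eq_le covout_ge0 andbT.
apply: (le_trans (@covout_le _ (fun=> i0) _)); first by [].
by rewrite eseries0// => k _ _; rewrite wi0.
Qed.
End CoverOuter.

Section LebOuter.
Variables (R : realType) (n : nat).
Local Notation V := 'rV[R]_n.+1.
Implicit Types A B : set V.

Lemma leb_outE : @leb_out R n.+1 = covout (fun c : V * V => obox c.1 c.2) (fun c => (boxvol c.1 c.2)%:E).
Proof.
apply/funext => A; congr (ereal_inf _); apply/seteqP; split => s.
  by move=> [lo [hi [h ->]]]; exists (fun k => (lo k, hi k)).
by move=> [i [h ->]]; exists (fun k => (i k).1), (fun k => (i k).2).
Qed.

Lemma boxvol_ge0 (lo hi : V) : 0 <= boxvol lo hi.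
Proof. by apply: prodr_ge0 => i _; rewrite le_max lexx. Qed.

Let obox00 : obox (0 : V) 0 = set0.
Proof. by rewrite -subset0 => x /(_ ord0); rewrite mxE => /andP[/ltW]; rewrite leNgt => /negbTE ->. Qed.

(** The dimension is positive here: the empty product would give every box volume 1, and finite
    covers could not be padded with empty boxes. *)
Let boxvol00 : (boxvol (0 : V) 0)%:E = 0%E :> \bar R.
Proof. by congr EFin; rewrite /boxvol big_ord_recl mxE subrr maxxx mul0r. Qed.

Lemma leb_out0 : leb_out (set0 : set V) = 0%E.
Proof. by rewrite leb_outE (@covout0 _ _ _ _ _ _ (0, 0))// => c; rewrite lee_fin boxvol_ge0. Qed.

Lemma leb_out_ge0 A : (0 <= leb_out A)%E.
Proof. by rewrite leb_outE; apply: covout_ge0 => c; rewrite lee_fin boxvol_ge0. Qed.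

Lemma leb_out_subset A F : subset_sigma_subadditive (@leb_out R n.+1) A F.
Proof. by rewrite leb_outE; apply: covout_subset => // c; rewrite lee_fin boxvol_ge0. Qed.

HB.instance Definition _ := isSubsetOuterMeasure.Build R V (@leb_out R n.+1)
  leb_out0 leb_out_ge0 leb_out_subset.
End LebOuter.

Section HausOuter.
Variables (R : realType) (n s : nat).
Local Notation V := 'rV[R]_n.
Local Notation hd := (@hausd_delta R n s.+1).
Local Notation H := (@hausdorff R n s.+1).
Local Open Scope ereal_scope.

Lemma diam_ge0 (C : set V) : 0 <= diam C.
Proof. by apply: ereal_sup_ubound; left. Qed.

Lemma diam0 : diam (set0 : set V) = 0.
Proof.
apply/eqP; rewrite eq_le diam_ge0 andbT; apply: ge_ereal_sup => _ [->//|[p [[]]]].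
Qed.

Lemma omega_ge0 k : (0 <= omega R k)%R.
Proof. by rewrite /omega fine_ge0//; apply: le_ereal_inf_tmp => _ [lo [hi [_ ->]]];
  apply: nneseries_ge0 => i _ _; rewrite lee_fin; apply: prodr_ge0 => j _; rewrite le_max lexx. Qed.

Lemma diam_le (C D : set V) : C `<=` D -> diam C <= diam D.
Proof.
move=> CD; apply: ge_ereal_sup => _ [->|[[p q] [/= Cp Cq] <-]]; first exact: diam_ge0.
by apply: ereal_sup_ubound; right; exists (p, q) => //; split; apply: CD.
Qed.

(** The exponent is positive so that the empty set contributes 0, as 0 to the power 0 is 1. *)
Definition hterm (C : set V) : \bar R := (omega R s.+1 * (fine (diam C) / 2) ^+ s.+1)%:E.

Lemma hterm_ge0 C : 0 <= hterm C.
Proof. by rewrite lee_fin mulr_ge0 ?omega_ge0// exprn_ge0// divr_ge0// fine_ge0 ?diam_ge0. Qed.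

Lemma hterm0 : hterm set0 = 0.
Proof. by rewrite /hterm diam0/= mul0r expr0n/= mulr0. Qed.

Let I (delta : R) := {C : set V | (diam C < delta%:E)}.

Lemma hausd_deltaE delta : (0 < delta)%R -> hd delta =
  covout (fun c : I delta => projT1 c) (fun c => hterm (projT1 c)).
Proof.
move=> d0; apply/funext => A; congr (ereal_inf _); apply/seteqP; split => e.
  by move=> [C [h1 [h2 ->]]]; exists (fun k => exist _ (C k) (h2 k)).
move=> [i [h ->]]; exists (fun k => projT1 (i k)); split => //; split => // k.
exact: (projT2 (i k)).
Qed.

Lemma hausd_delta0 delta : (0 < delta)%R -> hd delta set0 = 0.
Proof.
move=> d0; rewrite hausd_deltaE//.
have h : diam (set0 : set V) < delta%:E by rewrite diam0 lte_fin.
by apply: (@covout0 _ _ _ _ _ _ (exist _ set0 h : I delta)); rewrite ?hterm0// => c; exact: hterm_ge0.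
Qed.

Lemma hausd_delta_ge0 delta A : 0 <= hd delta A.
Proof. by apply: le_ereal_inf_tmp => _ [C [_ [_ ->]]]; apply: nneseries_ge0 => k _ _; exact: hterm_ge0. Qed.

Lemma hausd_delta_subset delta A F : (0 < delta)%R -> subset_sigma_subadditive (hd delta) A F.
Proof. by move=> d0; rewrite hausd_deltaE//; apply: covout_subset => // c; exact: hterm_ge0. Qed.

Lemma hausd_delta_anti delta delta' A : (delta <= delta')%R -> hd delta' A <= hd delta A.
Proof.
move=> dd; apply: ereal_inf_le_tmp => e [C [h1 [h2 ->]]]; exists C; split => //; split => // k.
by rewrite (lt_le_trans (h2 k))// lee_fin.
Qed.

Lemma hausd_delta_le delta A : (0 < delta)%R -> hd delta A <= H A.
Proof. by move=> d0; apply: ereal_sup_ubound; exists delta. Qed.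

Lemma hausdorff_le A x : (forall delta, (0 < delta)%R -> hd delta A <= x) -> H A <= x.
Proof. by move=> h; apply: ge_ereal_sup => _ [delta /= d0 <-]; apply: h. Qed.

Lemma hausdorff_ge0 A : 0 <= H A.
Proof. by apply: (le_trans _ (hausd_delta_le A ltr01)); apply: hausd_delta_ge0. Qed.

Lemma hausdorff0 : H set0 = 0.
Proof.
apply/eqP; rewrite eq_le hausdorff_ge0 andbT; apply: hausdorff_le => d d0.
by rewrite hausd_delta0.
Qed.

Lemma hausdorff_subset A F : subset_sigma_subadditive H A F.
Proof.
move=> AF; apply: hausdorff_le => d d0.
apply: (le_trans (hausd_delta_subset d0 AF)).
apply: lee_nneseries => k _; first by move=> _; exact: hausd_delta_ge0.
exact: hausd_delta_le.
Qed.

HB.instance Definition _ := isSubsetOuterMeasure.Build R V H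
  hausdorff0 hausdorff_ge0 hausdorff_subset.
End HausOuter.

(** * Euclidean inner product, norm and topology *)

Section Euclid.
Variables (R : realType) (n : nat).
Local Notation V := 'rV[R]_n.
Implicit Types x y z : V.

Lemma dotvC x y : dotv x y = dotv y x.
Proof. by apply: eq_bigr => i _; rewrite mulrC. Qed.
Lemma dotvDl x y z : dotv (x + y) z = dotv x z + dotv y z.
Proof. by rewrite /dotv -big_split/=; apply: eq_bigr => i _; rewrite mxE mulrDl. Qed.
Lemma dotvZl a x z : dotv (a *: x) z = a * dotv x z.
Proof. by rewrite /dotv mulr_sumr; apply: eq_bigr => i _; rewrite mxE mulrA. Qed.
Lemma dotvDr x y z : dotv z (x + y) = dotv z x + dotv z y.
Proof. by rewrite dotvC dotvDl !(dotvC z). Qed.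
Lemma dotvZr a x z : dotv z (a *: x) = a * dotv z x.
Proof. by rewrite dotvC dotvZl (dotvC z). Qed.
Lemma dotvNl x z : dotv (- x) z = - dotv x z.
Proof. by rewrite -scaleN1r dotvZl mulN1r. Qed.
Lemma dotvNr x z : dotv z (- x) = - dotv z x.
Proof. by rewrite dotvC dotvNl dotvC. Qed.
Lemma dotvBl x y z : dotv (x - y) z = dotv x z - dotv y z.
Proof. by rewrite dotvDl dotvNl. Qed.
Lemma dotvBr x y z : dotv z (x - y) = dotv z x - dotv z y.
Proof. by rewrite dotvDr dotvNr. Qed.
Lemma dotv0l x : dotv 0 x = 0.
Proof. by rewrite -(scale0r x) dotvZl mul0r. Qed.
Lemma dotvv_ge0 x : 0 <= dotv x x.
Proof. by apply: sumr_ge0 => i _; rewrite -expr2 sqr_ge0. Qed.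
Lemma enorm_ge0 x : 0 <= enorm x.
Proof. exact: sqrtr_ge0. Qed.
Lemma sqr_enorm x : enorm x ^+ 2 = dotv x x.
Proof. by rewrite /enorm sqr_sqrtr// dotvv_ge0. Qed.
Lemma dotvv_eq0 x : (dotv x x == 0) = (x == 0).
Proof.
apply/eqP/eqP => [/eqP|->]; last by rewrite dotv0l.
rewrite psumr_eq0 => [/allP h|i _]; last by rewrite -expr2 sqr_ge0.
apply/rowP => i; rewrite mxE; apply/eqP.
by have := h i (mem_index_enum _); rewrite mulf_eq0 orbb.
Qed.
Lemma enorm_eq0 x : (enorm x == 0) = (x == 0).
Proof. by rewrite -dotvv_eq0 -sqr_enorm sqrf_eq0. Qed.
Lemma enorm0 : enorm (0 : V) = 0.
Proof. by apply/eqP; rewrite enorm_eq0. Qed.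
Lemma enormZ a x : enorm (a *: x) = `|a| * enorm x.
Proof. by rewrite /enorm dotvZl dotvZr mulrA -expr2 sqrtrM ?sqr_ge0// sqrtr_sqr. Qed.
Lemma enormN x : enorm (- x) = enorm x.
Proof. by rewrite /enorm dotvNl dotvNr opprK. Qed.
Lemma enormB x y : enorm (x - y) = enorm (y - x).
Proof. by rewrite -enormN opprB. Qed.

Lemma dotv_CS x y : `|dotv x y| <= enorm x * enorm y.
Proof.
rewrite -ler_sqr ?nnegrE ?mulr_ge0 ?enorm_ge0 ?normr_ge0//.
rewrite exprMn !sqr_enorm real_normK ?num_real//.
have [->|x0] := eqVneq x 0; first by rewrite !dotv0l expr0n/= mul0r.
have xx : 0 < dotv x x by rewrite lt_def dotvv_eq0 x0 dotvv_ge0.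
have := dotvv_ge0 (y - (dotv x y / dotv x x) *: x).
rewrite dotvBl !dotvBr !dotvZl !dotvZr (dotvC y x).
set p := dotv x y; set q := dotv x x; set r := dotv y y => h.
have e : r - p / q * p - (p / q * p - p / q * (p / q * q)) = r - p ^+ 2 / q.
  by field; rewrite gt_eqF.
by move: h; rewrite e subr_ge0 ler_pdivrMr// mulrC.
Qed.

Lemma dotv_le x y : dotv x y <= enorm x * enorm y.
Proof. exact: le_trans (ler_norm _) (dotv_CS x y). Qed.

Lemma enormD x y : enorm (x + y) <= enorm x + enorm y.
Proof.
rewrite -ler_sqr ?nnegrE ?addr_ge0 ?enorm_ge0//.
rewrite sqr_enorm dotvDl !dotvDr (dotvC y x) sqrrD !sqr_enorm.
by have := dotv_le x y; lra.
Qed.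

Lemma enorm_sub_le x y z : enorm (x - z) <= enorm (x - y) + enorm (y - z).
Proof. by rewrite -(subrKA y x (- z)) enormD. Qed.

Lemma enorm_leD x y : enorm x <= enorm (x - y) + enorm y.
Proof. by rewrite -{1}(subrK y x) enormD. Qed.

Lemma coord_le_enorm x i : `|x ord0 i| <= enorm x.
Proof.
rewrite -ler_sqr ?nnegrE ?enorm_ge0//.
rewrite sqr_enorm real_normK ?num_real// /dotv (bigD1 i)//= -expr2 lerDl.
by apply: sumr_ge0 => j _; rewrite -expr2 sqr_ge0.
Qed.

Lemma enorm_le_sum x : enorm x <= \sum_(i < n) `|x ord0 i|.
Proof.
have s0 : 0 <= \sum_(i < n) `|x ord0 i| by apply: sumr_ge0.
rewrite -ler_sqr ?nnegrE ?enorm_ge0// sqr_enorm expr2 mulr_sumr.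
apply: ler_sum => i _; apply: (le_trans (ler_norm _)).
rewrite normrM ler_wpM2r// (bigD1 i)//= lerDl.
by apply: sumr_ge0.
Qed.

Lemma norm_le_enorm x : `|x| <= enorm x.
Proof.
rewrite [leLHS]/Num.Def.normr/= mx_normrE; apply/bigmax_leP; split; first exact: enorm_ge0.
by move=> -[i j] _ /=; rewrite (ord1 i) coord_le_enorm.
Qed.

Lemma coord_le_norm x i : `|x ord0 i| <= `|x|.
Proof.
by rewrite [leRHS]/Num.Def.normr/= mx_normrE; apply/bigmax_geP; right; exists (ord0, i).
Qed.

Lemma enorm_le_norm x : enorm x <= n%:R * `|x|.
Proof.
apply: (le_trans (enorm_le_sum x)); rewrite -[n in n%:R]card_ord mulrC mulr_natr -sumr_const.
by apply: ler_sum => i _; exact: coord_le_norm.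
Qed.

Lemma dotv_ebase (i : 'I_n) x : dotv x (ebase R n i) = x ord0 i.
Proof.
rewrite /dotv (bigD1 i)//= big1 => [|j ji]; first by rewrite mxE eqxx mulr1 addr0.
by rewrite mxE (inj_eq val_inj) (negbTE ji) mulr0.
Qed.

Lemma cvg_enorm (T : Type) (F : set_system T) {FF : Filter F} (f : T -> V) (l : V) :
  f @ F --> l <-> (fun t => enorm (f t - l)) @ F --> (0 : R).
Proof.
split => h.
  apply/cvgr0Pnorm_lt => e e0.
  have [n0|n0] := posnP n.
    by near=> t; rewrite ger0_norm ?enorm_ge0// (le_lt_trans (enorm_le_sum _))// big1// => -[i hi]; exfalso; move: hi; rewrite n0.
  have e1 : 0 < e / n%:R by rewrite divr_gt0// ltr0n.
  move/cvgrPdist_lt : h => /(_ _ e1); apply: filterS => t.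
  rewrite ltr_pdivlMr ?ltr0n// => ht; rewrite ger0_norm ?enorm_ge0//.
  by rewrite enormB (le_lt_trans (enorm_le_norm _))// mulrC.
apply/cvgrPdist_lt => e e0.
move/cvgr0Pnorm_lt : h => /(_ _ e0); apply: filterS => t.
rewrite ger0_norm ?enorm_ge0// enormB; exact: le_lt_trans (norm_le_enorm _).
Unshelve. all: by end_near. Qed.

Lemma cvg_enorm_id x : (fun y => enorm (y - x)) @ x --> (0 : R).
Proof. by have [h _] := @cvg_enorm _ (nbhs x) (nbhs_filter x) id x; apply: h; exact: cvg_id. Qed.

Lemma nbhs_enorm x (e : R) : 0 < e -> nbhs x [set y | enorm (y - x) < e].
Proof.
move=> e0; have [n0|n0] := posnP n.
  apply: (@filterS _ _ (nbhs_filter x) _ _ _ (@filterT _ _ (nbhs_filter x))) => y _ /=.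
  by rewrite (le_lt_trans (enorm_le_sum _))// big1// => -[i hi]; exfalso; move: hi; rewrite n0.
apply/nbhs_ballP; exists (e / n%:R) => /=; first by rewrite divr_gt0// ltr0n.
move=> y; rewrite -ball_normE /= ltr_pdivlMr ?ltr0n// => h.
by rewrite enormB (le_lt_trans (enorm_le_norm _))// mulrC.
Qed.

Lemma enorm_lip x y : `|enorm x - enorm y| <= enorm (x - y).
Proof.
by rewrite ler_norml; apply/andP; split; have := enorm_leD x y; have := enorm_leD y x;
  rewrite (enormB y x); lra.
Qed.

Lemma continuous_lip (f : V -> R) (K : R) :
  (forall x y, `|f x - f y| <= K * enorm (x - y)) -> continuous f.
Proof.
move=> h x; apply: (proj2 (@cvgrPdist_lt _ _ _ (nbhs x) (nbhs_filter x) f (f x))) => e e0.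
have K0 : 0 < `|K| + 1 by have := normr_ge0 K; lra.
have eK : 0 < e / (`|K| + 1) by rewrite divr_gt0.
apply: (@filterS _ _ (nbhs_filter x) _ _ _ (nbhs_enorm x eK)) => y /= hy.
apply: (le_lt_trans (h _ _)); rewrite enormB.
have := hy; rewrite ltr_pdivlMr// mulrC; apply: le_lt_trans.
by rewrite ler_wpM2r ?enorm_ge0//; have := ler_norm K; lra.
Qed.

Lemma continuous_enorm : continuous (@enorm R n).
Proof. by apply: (@continuous_lip _ 1) => x y; rewrite mul1r enorm_lip. Qed.

Lemma continuous_dotv y : continuous (fun x => dotv x y).
Proof.
apply: (@continuous_lip _ (enorm y)) => x z; rewrite -dotvBl mulrC; exact: dotv_CS.
Qed.

Lemma continuous_enormB y : continuous (fun x => enorm (x - y)).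
Proof.
apply: (@continuous_lip _ 1) => x z; rewrite mul1r (le_trans (enorm_lip _ _))//.
by rewrite opprB addrA subrK.
Qed.

Lemma open_ltf (f : V -> R) c : continuous f -> open [set x | c < f x].
Proof. by move=> fc; apply: (@open_comp _ _ f [set y | c < y]); [move=> x _; exact (fc x)|exact: open_gt]. Qed.
Lemma open_gtf (f : V -> R) c : continuous f -> open [set x | f x < c].
Proof. by move=> fc; apply: (@open_comp _ _ f [set y | y < c]); [move=> x _; exact (fc x)|exact: open_lt]. Qed.
Lemma closed_lef (f : V -> R) c : continuous f -> closed [set x | f x <= c].
Proof. by move=> fc; apply: (@preimage_closed _ _ f [set y | y <= c]); [move=> x _; exact (fc x)|exact: closed_le]. Qed.
Lemma closed_gef (f : V -> R) c : continuous f -> closed [set x | c <= f x].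
Proof. by move=> fc; apply: (@preimage_closed _ _ f [set y | c <= y]); [move=> x _; exact (fc x)|exact: closed_ge]. Qed.

Lemma openE_enorm (U : set V) : open U <-> forall x, U x -> exists2 r, 0 < r & forall y, enorm (y - x) < r -> U y.
Proof.
split=> [oU x Ux|h].
    have /nbhs_ballP[e /= e0 he] : nbhs x U by exact: open_nbhs_nbhs.
  exists e => // y yx; apply: he; rewrite -ball_normE /= distrC.
  exact: le_lt_trans (norm_le_enorm _) yx.
rewrite openE => x /h[r r0 hr].
exact: (@filterS _ _ (nbhs_filter x) _ _ hr (nbhs_enorm x r0)).
Qed.

Lemma compact_closed_enorm (A : set V) (K : R) :
  closed A -> (forall x, A x -> enorm x <= K) -> compact A.
Proof.
move=> cA hA; apply: bounded_closed_compact => //.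
exists K; split; first exact: num_real.
by move=> M KM x /hA xK /=; rewrite (le_trans (norm_le_enorm _))// (le_trans xK)// ltW.
Qed.

Lemma compact_enorm_bounded (A : set V) : compact A -> exists K, forall x, A x -> enorm x <= K.
Proof.
move=> /compact_bounded[M [_ hM]]; exists (n%:R * (M + 1)) => x Ax.
by rewrite (le_trans (enorm_le_norm _))// ler_wpM2l// hM// ltrDl.
Qed.
End Euclid.

(** An interval is cut at c and its left part is prolonged by t. The prolongation lets open boxes
    cover the points lying exactly on the cut. *)
Lemma max_cut (R : realType) (c t l h : R) : 0 < t ->
  Num.max 0 (h - Num.max c l) + Num.max 0 (Num.min (c + t) h - l) <= Num.max 0 (h - l) + t.
Proof. by move=> t0; rewrite /Num.max /Num.min; repeat case: ifPn; rewrite -?leNgt => *; lra. Qed.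

(** * Caratheodory measurable sets, translations and dilations *)

Section LebMeas.
Variables (R : realType) (n : nat).
Local Notation V := 'rV[R]_n.+1.
Local Notation leb := (@leb_out R n.+1).
Definition oleb : {outer_measure set V -> \bar R} := leb.
Local Notation mV := (caratheodory_type oleb).
Definition mleb : set mV -> \bar R := oleb.
HB.instance Definition _ := Measure.copy mleb (oleb : set mV -> \bar R).
Implicit Types A B : set V.

Definition updr (x : V) i a : V := \row_j (if j == i then a else x ord0 j).

Lemma boxvol_updr_hi (lo hi : V) i a : boxvol lo (updr hi i a) =
  Num.max 0 (a - lo ord0 i) * \prod_(j < n.+1 | j != i) Num.max 0 (hi ord0 j - lo ord0 j).
Proof.
rewrite /boxvol (bigD1 i)//= mxE eqxx; congr *%R; apply: eq_bigr => j ji.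
by rewrite mxE (negbTE ji).
Qed.
Lemma boxvol_updr_lo (lo hi : V) i a : boxvol (updr lo i a) hi =
  Num.max 0 (hi ord0 i - a) * \prod_(j < n.+1 | j != i) Num.max 0 (hi ord0 j - lo ord0 j).
Proof.
rewrite /boxvol (bigD1 i)//= mxE eqxx; congr *%R; apply: eq_bigr => j ji.
by rewrite mxE (negbTE ji).
Qed.
Lemma boxvolD1 (lo hi : V) i : boxvol lo hi =
  Num.max 0 (hi ord0 i - lo ord0 i) * \prod_(j < n.+1 | j != i) Num.max 0 (hi ord0 j - lo ord0 j).
Proof. by rewrite /boxvol (bigD1 i). Qed.

(** Each box of an almost optimal cover is cut by the hyperplane; the lower half is enlarged a
    little to catch the hyperplane itself, at a total cost of e/2. *)
Lemma lmeas_gt i (c : R) : lmeas [set x : V | c < x ord0 i].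
Proof.
apply: le_caratheodory_measurable => X; set A := [set x | _].
change (leb (X `&` A) + leb (X `&` ~` A) <= leb X)%E.
have [Xoo|Xoo] := eqVneq (leb X) +oo%E; first by rewrite Xoo leey.
have Xlt : (leb X < +oo)%E by rewrite ltey.
apply/lee_addgt0Pr => e e0.
have Xlt' := Xlt; rewrite leb_outE in Xlt'.
have w0 (c0 : V * V) : (0 <= (boxvol c0.1 c0.2)%:E)%E by rewrite lee_fin boxvol_ge0.
have e2 : 0 < e / 2 by rewrite divr_gt0.
have [C XC HC] := covout_adh w0 e2 Xlt'.
rewrite -leb_outE in HC.
pose P k := \prod_(j < n.+1 | j != i) Num.max 0 ((C k).2 ord0 j - (C k).1 ord0 j).
have P0 k : 0 <= P k by apply: prodr_ge0 => j _; rewrite le_max lexx.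
(* Enlarging box k by [eta k] adds at most [eta k * P k], a term of a geometric series; the summand
   1 guards against a degenerate face with [P k] = 0. *)
pose eta k := e / 2 / (2 ^ k.+1)%:R / (P k + 1).
have eta0 k : 0 < eta k by rewrite !divr_gt0// ?ltr0n ?expn_gt0// ltr_wpDl.
pose C1 k := (updr (C k).1 i (Num.max c ((C k).1 ord0 i)), (C k).2).
pose C2 k := ((C k).1, updr (C k).2 i (Num.min (c + eta k) ((C k).2 ord0 i))).
have h1 : (leb (X `&` A) <= \sum_(0 <= k <oo) (boxvol (C1 k).1 (C1 k).2)%:E)%E.
  rewrite leb_outE; apply: covout_le => x [/XC[k _ Ck] Ax]; exists k => // j.
  by rewrite /= mxE; case: eqP => [->|_]; last exact: Ck;
    have := Ck i => /andP[? ?]; rewrite gt_max; apply/andP; split => //; apply/andP.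
have h2 : (leb (X `&` ~` A) <= \sum_(0 <= k <oo) (boxvol (C2 k).1 (C2 k).2)%:E)%E.
  rewrite leb_outE; apply: covout_le => x [/XC[k _ Ck] /negP]; rewrite -leNgt => Ax; exists k => // j.
  rewrite /= mxE; case: eqP => [->|_]; last exact: Ck.
  have /andP[-> ?] := Ck i; rewrite lt_min; apply/andP; split => //.
  by rewrite (le_lt_trans Ax)// ltrDl.
apply: (le_trans (leeD h1 h2)).
rewrite -nneseriesD; [|by move=> *; exact: w0..].
apply: (@le_trans _ _ (\sum_(0 <= k <oo) ((boxvol (C k).1 (C k).2)%:E + (e / 2 / (2 ^ k.+1)%:R)%:E))%E).
  apply: lee_nneseries => k _; first by move=> _; rewrite adde_ge0 ?w0.
  rewrite -!EFinD lee_fin boxvol_updr_lo boxvol_updr_hi (boxvolD1 _ _ i) -/(P k).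
  have eP : eta k * P k <= e / 2 / (2 ^ k.+1)%:R.
    by rewrite /eta -mulrA ler_piMr ?divr_ge0 ?ltW//  mulrC ltr_pdivrMr ?ltr_wpDl// mul1r ltrDl.
  rewrite -mulrDl; apply: (@le_trans _ _ ((Num.max 0 ((C k).2 ord0 i - (C k).1 ord0 i) + eta k) * P k)); last first.
    by rewrite mulrDl lerD2l.
  apply: ler_wpM2r => //; have := eta0 k; move: (eta k) => t t0.
  exact: max_cut.
apply: (le_trans (epsilon_trick _ _ (ltW e2))) => //.
rewrite (le_trans (leeD2r _ HC))// -addeA -EFinD -splitr//.
Qed.

Lemma measurable_mx_gt i c : measurable ([set x : V | c < x ord0 i] : set mV).
Proof. exact: lmeas_gt. Qed.

Lemma measurable_mx_lt i c : measurable ([set x : V | x ord0 i < c] : set mV).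
Proof.
rewrite (_ : [set _ | _] = \bigcup_k ~` [set x : V | c - k.+1%:R^-1 < x ord0 i]).
  by apply: bigcup_measurable => k _; apply: measurableC; exact: measurable_mx_gt.
apply/seteqP; split => x /=.
  move=> xc; have : 0 < c - x ord0 i by rewrite subr_gt0.
  move=> /ltr_add_invr[k hk]; exists k => //; apply/negP; rewrite -leNgt.
  move: hk; rewrite add0r => hk; apply: ltW; rewrite ltrBrDr addrC -ltrBrDr; exact hk.
move=> [k _ /negP]; rewrite -leNgt => h; apply: (le_lt_trans h).
by rewrite ltrBlDr ltrDl invr_gt0 ltr0n.
Qed.

Lemma measurable_obox lo hi : measurable (obox lo hi : set mV).
Proof.
rewrite (_ : obox _ _ = \bigcap_(i in [set: 'I_n.+1]) ([set x : V | lo ord0 i < x ord0 i] `&` [set x | x ord0 i < hi ord0 i])).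
  by apply: fin_bigcap_measurable => // i _; apply: measurableI; [exact: measurable_mx_gt|exact: measurable_mx_lt].
apply/seteqP; split => x /= h i; first by move=> _; have /andP[] := h i.
by apply/andP; have [] := h i I.
Qed.

(** A countable basis of the topology indexed by nat, with the empty set at the integers that code
    no pair. It is later the alphabet in which competitors are coded. *)
Definition qbox k : set V :=
  if (choice.unpickle k : option ('rV[rat]_n.+1 * 'rV[rat]_n.+1)) is Some (lo, hi)
  then obox (map_mx ratr lo) (map_mx ratr hi) else set0.

Lemma measurable_qbox k : measurable (qbox k : set mV).
Proof. by rewrite /qbox; case: choice.unpickle => [[lo hi]|]; [exact: measurable_obox|exact: measurable0]. Qed.

Lemma open_qbox (U : set V) x : open U -> U x -> exists k, qbox k x /\ qbox k `<=` U.
Proof.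
move=> /openE_enorm oU /oU[r r0 hr].
pose s := r / n.+1%:R.
have s0 : 0 < s by rewrite divr_gt0.
have Hlo (i : 'I_n.+1) : exists q : rat, x ord0 i - s < ratr q < x ord0 i.
  have [|q] := @rat_in_itvoo R (x ord0 i - s) (x ord0 i); first by rewrite ltrBlDr ltrDl.
  by rewrite in_itv/=; exists q.
have Hhi (i : 'I_n.+1) : exists q : rat, x ord0 i < ratr q < x ord0 i + s.
  have [|q] := @rat_in_itvoo R (x ord0 i) (x ord0 i + s); first by rewrite ltrDl.
  by rewrite in_itv/=; exists q.
have [lo hlo] := choice Hlo; have [hi hhi] := choice Hhi.
exists (choice.pickle (\row_i lo i, \row_i hi i)); rewrite /qbox choice.pickleK; split.
  by move=> i; rewrite !mxE; have /andP[_ ->] := hlo i; have /andP[->] := hhi i.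
move=> y hy; apply: hr; apply: (le_lt_trans (enorm_le_sum _)).
have -> : r = \sum_(i < n.+1) s by rewrite sumr_const card_ord -[s *+ _]mulr_natr divfK.
apply: ltr_sum; first by apply/hasP; exists ord0 => //; rewrite mem_index_enum.
move=> i _; have := hy i; rewrite !mxE; have := hlo i; have := hhi i.
by move=> /andP[? ?] /andP[? ?] /andP[? ?]; rewrite ltr_norml; apply/andP; split; lra.
Qed.

Lemma open_bigcup_qbox (U : set V) : open U ->
  U = \bigcup_k (if `[< qbox k `<=` U >] then qbox k else set0).
Proof.
move=> oU; apply/seteqP; split => [x /(open_qbox oU)[k [kx kU]]|x [k _]]; last by case: asboolP => // kU /kU.
by exists k => //; case: asboolP.
Qed.

Lemma measurable_open (U : set V) : open U -> measurable (U : set mV).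
Proof.
move=> oU; rewrite (open_bigcup_qbox oU); apply: bigcup_measurable => k _.
by case: ifPn => _; [exact: measurable_qbox|exact: measurable0].
Qed.

Lemma measurable_closed (U : set V) : closed U -> measurable (U : set mV).
Proof. by move=> cU; rewrite -(setCK U); apply: measurableC; apply: measurable_open; exact: closed_openC. Qed.

Lemma leb_le_box A lo hi : A `<=` obox lo hi -> (leb A <= (boxvol lo hi)%:E)%E.
Proof.
move=> h; rewrite leb_outE.
pose C k := if k is 0%N then (lo, hi) else (0 : V, 0 : V).
apply: (@le_trans _ _ (\sum_(0 <= k <oo) (boxvol (C k).1 (C k).2)%:E)%E).
  by apply: covout_le => x /h hx; exists 0%N.
rewrite nneseries_recl//; last by move=> k _; rewrite lee_fin boxvol_ge0.
rewrite eseries0 ?adde0// => -[|k]// _ _.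
by congr EFin; rewrite /boxvol big_ord_recl mxE subrr maxxx mul0r.
Qed.

Lemma leb_bounded_fin A K : (forall x, A x -> enorm x <= K) -> (leb A < +oo)%E.
Proof.
move=> h; have K1 : A `<=` obox (const_mx (- K - 1) : V) (const_mx (K + 1)).
  move=> x /h xK i; rewrite !mxE; have := coord_le_enorm x i; rewrite ler_norml => /andP[? ?].
  by apply/andP; split; lra.
by apply: (le_lt_trans (leb_le_box K1)); rewrite ltey.
Qed.

(** Only the effect of [f] on boxes matters. Applied to a bijection and to its inverse this gives
    equality, hence the behaviour under translations, reflection and dilations. *)
Lemma leb_preim_le (f : V -> V) (k : R) A : 0 < k ->
  (forall lo hi, exists lo' hi', f @^-1` (obox lo hi) `<=` obox lo' hi' /\ boxvol lo' hi' <= k * boxvol lo hi) ->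
  (leb (f @^-1` A) <= k%:E * leb A)%E.
Proof.
move=> k0 hf; have kge0 := ltW k0.
have w0 (c0 : V * V) : (0 <= (boxvol c0.1 c0.2)%:E)%E by rewrite lee_fin boxvol_ge0.
have [g hg] := choice (fun c : V * V => let: ex_intro lo (ex_intro hi h) := hf c.1 c.2 in
  ex_intro (fun d : V * V => f @^-1` (obox c.1 c.2) `<=` obox d.1 d.2 /\ boxvol d.1 d.2 <= k * boxvol c.1 c.2) (lo, hi) h).
have H (C : nat -> V * V) : A `<=` \bigcup_k obox (C k).1 (C k).2 ->
    (leb (f @^-1` A) <= k%:E * \sum_(0 <= j <oo) (boxvol (C j).1 (C j).2)%:E)%E.
  move=> AC; rewrite -nneseriesZl; last by move=> *; exact: w0.
  rewrite leb_outE; apply: (@le_trans _ _ (\sum_(0 <= j <oo) (boxvol (g (C j)).1 (g (C j)).2)%:E)%E).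
    apply: (@covout_le _ _ _ (fun c : V * V => obox c.1 c.2) _ _ (g \o C)) => x /AC[j _ fj].
    by exists j => //; apply: (hg (C j)).1.
  by apply: lee_nneseries => j _ //; rewrite -EFinM lee_fin (hg (C j)).2.
have [Aoo|Aoo] := eqVneq (leb A) +oo%E; first by rewrite Aoo gt0_muley ?lte_fin// leey.
have Alt : (leb A < +oo)%E by rewrite ltey.
apply/lee_addgt0Pr => e e0.
have ek : 0 < e / k by rewrite divr_gt0.
have Alt' := Alt; rewrite leb_outE in Alt'.
have [C AC HC] := covout_adh w0 ek Alt'.
apply: (le_trans (H _ AC)); rewrite -leb_outE in HC.
apply: (le_trans (lee_wpmul2l _ HC)); first by rewrite lee_fin ltW.
rewrite ge0_muleDr; [|exact: leb_out_ge0|by rewrite lee_fin ltW].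
by rewrite -EFinM (mulrC k) divfK ?gt_eqF.
Qed.

Lemma leb_preimE (f g : V -> V) (k : R) A : 0 < k -> cancel f g -> cancel g f ->
  (forall lo hi, exists lo' hi', f @^-1` (obox lo hi) `<=` obox lo' hi' /\ boxvol lo' hi' <= k * boxvol lo hi) ->
  (forall lo hi, exists lo' hi', g @^-1` (obox lo hi) `<=` obox lo' hi' /\ boxvol lo' hi' <= k^-1 * boxvol lo hi) ->
  (leb (f @^-1` A) = k%:E * leb A)%E.
Proof.
move=> k0 fg gf hf hg; apply/eqP; rewrite eq_le leb_preim_le//=.
have k1 : 0 < k^-1 by rewrite invr_gt0.
have := @leb_preim_le g k^-1 (f @^-1` A) k1 hg.
rewrite (_ : g @^-1` (f @^-1` A) = A); last by apply/seteqP; split => x /=; rewrite gf.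
move=> /(lee_wpmul2l (_ : 0 <= k%:E)%E); rewrite muleA -EFinM divff ?gt_eqF// mul1e; apply.
by rewrite lee_fin ltW.
Qed.

Lemma leb_shift A z : leb [set x | A (x + z)] = leb A.
Proof.
rewrite -[RHS]mul1e; apply: (@leb_preimE (fun x => x + z) (fun x => x - z)) => //.
- by move=> x; rewrite addrK.
- by move=> x; rewrite subrK.
- move=> lo hi; exists (lo - z), (hi - z); split.
    by move=> x h i; have := h i; rewrite !mxE ltrBlDr ltrBrDr.
  by rewrite mul1r le_eqVlt; apply/orP; left; apply/eqP; apply: eq_bigr => i _; rewrite !mxE opprB addrA subrK.
- move=> lo hi; exists (lo + z), (hi + z); split.
    by move=> x h i; have := h i; rewrite !mxE ltrBrDr ltrBlDr.
  by rewrite invr1 mul1r le_eqVlt; apply/orP; left; apply/eqP; apply: eq_bigr => i _; rewrite !mxE opprD addrACA subrr addr0.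
Qed.

Lemma leb_opp A : leb [set x | A (- x)] = leb A.
Proof.
have h (lo hi : V) : exists lo' hi', -%R @^-1` (obox lo hi) `<=` obox lo' hi' /\ boxvol lo' hi' <= boxvol lo hi.
  exists (- hi), (- lo); split.
    by move=> x h i; have := h i; rewrite !mxE => /andP[? ?]; apply/andP; split; lra.
  by rewrite le_eqVlt; apply/orP; left; apply/eqP; apply: eq_bigr => i _; rewrite !mxE opprK addrC.
rewrite -[RHS]mul1e; apply: (@leb_preimE -%R -%R) => //; try exact: opprK.
- by move=> lo hi; have [a [b [? ?]]] := h lo hi; exists a, b; rewrite mul1r.
- by move=> lo hi; have [a [b [? ?]]] := h lo hi; exists a, b; rewrite invr1 mul1r.
Qed.

Lemma leb_scale A r : 0 < r -> leb [set x | A (r *: x)] = ((r ^- n.+1)%:E * leb A)%E.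
Proof.
move=> r0.
have h t (lo hi : V) : 0 < t -> exists lo' hi', (fun x => t *: x) @^-1` (obox lo hi) `<=` obox lo' hi' /\ boxvol lo' hi' <= t ^- n.+1 * boxvol lo hi.
  move=> t0; exists (t^-1 *: lo), (t^-1 *: hi); split.
    by move=> x h i; have := h i; rewrite !mxE ltr_pdivrMl// ltr_pdivlMl.
  rewrite -exprVn -[X in _ ^+ X]card_ord -prodr_const -big_split le_eqVlt/=; apply/orP; left; apply/eqP; apply: eq_bigr => i _.
  by rewrite !mxE -mulrBr maxr_pMr ?mulr0// invr_ge0 ltW.
apply: (@leb_preimE _ (fun x => r^-1 *: x)).
- by rewrite invr_gt0 exprn_gt0.
- by move=> x; rewrite scalerA mulVf ?scale1r// gt_eqF.
- by move=> x; rewrite scalerA divff ?scale1r// gt_eqF.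
- by move=> lo hi; exact: h.
- move=> lo hi; have [|a [b [h1 h2]]] := h r^-1 lo hi; first by rewrite invr_gt0.
  by exists a, b; split => //; rewrite exprVn in h2.
Qed.
End LebMeas.
Arguments mleb : clear implicits.

(** * Volumes of the cube, of balls and of slabs *)

Section LebPos.
Variables (R : realType) (n : nat).
Local Notation V := 'rV[R]_n.+1.
Local Notation leb := (@leb_out R n.+1).
Local Notation mV := (caratheodory_type (oleb R n)).
Implicit Types A B : set V.

Lemma count_nat_itv (N : nat) (a b : R) :
  \sum_(j < N) ((a < j%:R < b)%R)%:R <= Num.max 0 (b - a) + 1 :> R.
Proof.
(* Strengthened for the induction on N: the interval is cut at N - 1, the last integer counted. *)
suff h : \sum_(j < N) ((a < j%:R < b)%R)%:R <= Num.max 0 (Num.min b (N%:R - 1) - a + 1) :> R.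
  by apply: (le_trans h); rewrite /Num.max /Num.min; repeat case: ifPn; rewrite -?leNgt => *; lra.
elim: N => [|N IH]; first by rewrite big_ord0 le_max lexx.
rewrite big_ord_recr/= -natr1 addrK; case: (boolP (a < N%:R < b)) => /=; last first.
  move=> _; rewrite addr0; apply: (le_trans IH).
  by rewrite /Num.max /Num.min; repeat case: ifPn; rewrite -?leNgt => *; lra.
move=> /andP[aN Nb]; apply: (@le_trans _ _ (N%:R - a + 1)); last first.
  by rewrite /Num.max /Num.min; repeat case: ifPn; rewrite -?leNgt => *; lra.
rewrite lerD2r; apply: (le_trans IH).
by rewrite /Num.max /Num.min; repeat case: ifPn; rewrite -?leNgt => *; lra.
Qed.

Let cube : set V := [set x | forall i, x ord0 i \in `[0, 1]%R].

Let cube_compact : compact cube.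
Proof. by apply: (@rV_compact R n.+1 (fun=> `[0, 1]%classic)) => _; exact: segment_compact. Qed.

Lemma open_obox (lo hi : V) : open (obox lo hi).
Proof.
rewrite (_ : obox _ _ = \bigcap_(i in [set: 'I_n.+1]) ([set x : V | lo ord0 i < x ord0 i] `&` [set x | x ord0 i < hi ord0 i])).
  rewrite bigcap_fset_set; last exact: finite_finset.
  apply: big_ind => [|A B|i _]; [exact: openT|exact: openI|].
  by apply: openI; [apply: open_ltf|apply: open_gtf]; exact: coord_continuous.
apply/seteqP; split => x /= h i; first by move=> _; have /andP[] := h i.
by apply/andP; have [] := h i I.
Qed.

(* Counting the points of the lattice (1/N)Z^(n+1) in a finite cover by boxes. *)
Lemma leb_cube_ge1 : (1 <= leb cube)%E.
Proof.
rewrite leNgt; apply/negP => lt1.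
have lt1' := lt1; rewrite leb_outE in lt1'; have [_ [C [KC ->]] sC] := ereal_inf_lt lt1'.
have [D _ KD] : finite_subset_cover setT (fun k => obox (C k).1 (C k).2) cube.
  move: cube_compact; rewrite compact_cover; apply => // k _; exact: open_obox.
pose m := (\max_(k <- finmap.enum_fset D) k).+1.
pose L k (i : 'I_n.+1) := Num.max 0 ((C k).2 ord0 i - (C k).1 ord0 i).
(* At 1/N this polynomial bounds the number of lattice points in the boxes divided by N^(n+1), so it
   is at least 1 there; at 0 it is the total volume of the boxes, below 1. Continuity at 0 gives the
   contradiction. *)
pose Q : {poly R} := \sum_(k < m) \prod_(i < n.+1) ('X + (L k i)%:P).
have Q0 : Q.[0] < 1.
  rewrite -lte_fin; apply: le_lt_trans sC.
  have -> : Q.[0]%:E = (\sum_(0 <= k < m) (boxvol (C k).1 (C k).2)%:E)%E.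
    rewrite sumEFin big_mkord; congr EFin; rewrite horner_sum; apply: eq_bigr => k _.
    by rewrite horner_prod; apply: eq_bigr => i _; rewrite !hornerE.
  by apply: nneseries_lim_ge => k _ _; rewrite lee_fin boxvol_ge0.
have Qn N : (0 < N)%N -> 1 <= Q.[N%:R^-1].
  move=> N0; have N0' : 0 < N%:R :> R by rewrite ltr0n.
  have key : N%:R ^+ n.+1 <= \sum_(k < m) \prod_(i < n.+1) (N%:R * L k i + 1).
    apply: (@le_trans _ _ (\sum_(f : {ffun 'I_n.+1 -> 'I_N}) 1)).
      by rewrite sumr_const card_ffun !card_ord natrX.
    apply: (@le_trans _ _ (\sum_(f : {ffun 'I_n.+1 -> 'I_N}) \sum_(k < m)
       \prod_(i < n.+1) ((N%:R * (C k).1 ord0 i < (f i)%:R < N%:R * (C k).2 ord0 i)%R%:R))).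
      apply: ler_sum => f _.
      have [|k /= kD fk] := KD (\row_i ((f i)%:R / N%:R)).
        move=> i; rewrite mxE in_itv/= divr_ge0//= ler_pdivrMr// mul1r ler_nat.
        exact: ltnW.
      have km : (k < m)%N by rewrite ltnS; apply: leq_bigmax_seq.
      rewrite (bigD1 (Ordinal km))//= big1 => [|i _]; last first.
        have := fk i; rewrite mxE ltr_pdivrMr// ltr_pdivlMr//.
        by rewrite !(mulrC N%:R) => ->.
      rewrite lerDl; apply: sumr_ge0 => k' _; exact: prodr_ge0.
    rewrite exchange_big/=; apply: ler_sum => k _.
    rewrite -(bigA_distr_bigA (fun i (j : 'I_N) => (N%:R * (C k).1 ord0 i < j%:R < N%:R * (C k).2 ord0 i)%R%:R)).
    apply: ler_prod => i _; rewrite sumr_ge0//=.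
    apply: (le_trans (count_nat_itv _ _ _)); rewrite lerD2r -mulrBr /L.
    by rewrite maxr_pMr ?mulr0// ltW.
  rewrite -(@ler_pM2l _ (N%:R ^+ n.+1)) ?exprn_gt0// mulr1; apply: (le_trans key).
  rewrite horner_sum mulr_sumr; apply: ler_sum => k _.
  rewrite horner_prod -[X in _ ^+ X]card_ord -prodr_const -big_split le_eqVlt/=; apply/orP; left; apply/eqP; apply: eq_bigr => i _.
  by rewrite !hornerE mulrDr divff ?gt_eqF// addrC.
have cQ : (fun N : nat => Q.[N.+1%:R^-1]) @ \oo --> Q.[0].
  by apply: (continuous_cvg _ (@continuous_horner _ Q 0)); exact: cvg_harmonic.
have : 1 <= Q.[0].
  rewrite -(cvg_lim (@Rhausdorff R) cQ); apply: limr_ge; first by apply/cvg_ex; exists Q.[0].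
  by apply: nearW => N; exact: Qn.
by rewrite leNgt Q0.
Qed.

Lemma leb_ball_gt0 x (r : R) : 0 < r -> (0 < leb [set y : V | (enorm (y - x) < r)%R])%E.
Proof.
move=> r0.
have e : [set y : V | enorm (y - x) < r] = [set y | [set z : V | enorm z < r] (y - x)] by [].
rewrite e (@leb_shift _ _ [set z : V | enorm z < r]).
(* The n+1 coordinates of a point of the scaled cube are at most r/(n+2) each, so their sum stays
   below r. *)
pose s := r / (n.+2)%:R.
have s0 : 0 < s by rewrite divr_gt0.
have h : [set y : V | cube (s^-1 *: y)] `<=` [set z : V | enorm z < r].
  move=> y hy /=; apply: (le_lt_trans (enorm_le_sum _)).
  apply: (@le_lt_trans _ _ (\sum_(i < n.+1) s)).
    apply: ler_sum => i _; have := hy i; rewrite !mxE in_itv/= => /andP[].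
    rewrite pmulr_rge0 ?invr_gt0// ler_pdivrMl// mulr1 => ? ?.
    by rewrite ger0_norm.
  by rewrite sumr_const card_ord -[_ *+ _]mulr_natr /s mulrAC ltr_pdivrMr// ltr_pM2l// ltr_nat.
apply: (lt_le_trans _ (le_outer_measure leb _ _ h)).
change (0 < leb_out [set y : V | cube (s^-1 *: y)])%E.
rewrite leb_scale ?invr_gt0//.
apply: (@lt_le_trans _ _ ((s^-1 ^- n.+1)%:E * 1)%E).
  by rewrite mule1 lte_fin invr_gt0 exprn_gt0// invr_gt0.
by apply: lee_wpmul2l; [rewrite lee_fin invr_ge0 exprn_ge0// invr_ge0 ltW|exact: leb_cube_ge1].
Qed.

(* The slab has [1/h] disjoint translates inside a bounded box. *)
Lemma leb_slab (K : R) : exists2 C : R, 0 <= C & forall (nu : V) (c h : R), enorm nu = 1 -> 0 <= h ->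
  (leb [set x | (enorm x <= K /\ `|dotv x nu - c| <= h)%R] <= (C * h)%:E)%E.
Proof.
pose B : set V := [set x | enorm x <= K + 6].
have Bfin : (leb B < +oo)%E by apply: (@leb_bounded_fin _ _ _ (K + 6)).
have Bge0 : (0 <= leb B)%E by exact: leb_out_ge0.
pose b := fine (leb B); have bE : leb B = b%:E by rewrite fineK// ge0_fin_numE.
have b0 : 0 <= b by rewrite -lee_fin -bE.
have [K0|K0] := ltP K 0.
  exists 0 => // nu c h _ _; rewrite mul0r.
  rewrite (_ : [set x | _] = set0) ?leb_out0// -subset0 => x [/= xK _].
  by have := enorm_ge0 x; rewrite leNgt (le_lt_trans xK K0).
exists (2 * b) => [|nu c h nu1 h0]; first by rewrite mulr_ge0.
set S := [set x | _].
(* Stated for every t above h so that the case h = 0 follows by letting t tend to 0. *)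
have main (t : R) : 0 < t -> h <= t -> (leb S <= (2 * b * t)%:E)%E.
  move=> t0 ht.
  have [t1|t1] := ltP 1 t.
    apply: (@le_trans _ _ (leb B)).
      by apply: le_outer_measure => x [xK _]; rewrite /B /= (le_trans xK)// lerDl.
    by rewrite bE lee_fin; clear - t1 b0; nra.
  pose N := (Num.truncn t^-1).
  have N1 : (N%:R : R) <= t^-1 by rewrite truncn_le invr_ge0 ltW.
  have N2 : t^-1 < N.+1%:R :> R by exact: truncnS_gt.
  have N0 : (0 < N)%N by rewrite truncn_gt0 invf_ge1.
  (* Steps of 3t separate slabs of half-width at most t. As j t is at most 1, the translates stay
     within distance 3 of the original, inside the ball of radius K + 6. *)
  pose F (j : nat) : set mV := [set x : V | S (x + (- (3 * j%:R * t)) *: nu)].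
  have mS : measurable (S : set mV).
    apply: measurable_closed; apply: closedI; first by apply: closed_lef; exact: continuous_enorm.
    apply: closed_lef; apply: (@continuous_lip _ _ _ 1) => x y.
    rewrite mul1r (le_trans (ler_dist_dist _ _))// opprB addrA subrK -dotvBl.
    by rewrite (le_trans (dotv_CS _ _))// nu1 mulr1.
  have mF j : measurable (F j).
    apply: measurable_closed; apply: closedI => /=.
      apply: closed_lef; apply: (@continuous_lip _ _ _ 1) => x y.
      by rewrite mul1r (le_trans (enorm_lip _ _))// opprD addrACA subrr addr0.
    apply: closed_lef; apply: (@continuous_lip _ _ _ 1) => x y.
    rewrite mul1r (le_trans (ler_dist_dist _ _))// opprB addrA subrK -dotvBl opprD addrACA subrr addr0.
    by rewrite (le_trans (dotv_CS _ _))// nu1 mulr1.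
  have lF j : leb (F j) = leb S by rewrite /F leb_shift.
  have tF : trivIset setT F.
    apply/trivIsetP => i j _ _ ij; rewrite -subset0 => x [/= [_ h1] [_ h2]].
    move: h1 h2; rewrite !dotvDl !dotvZl -!sqr_enorm nu1 expr1n !mulr1 !ler_norml => /andP[h1 h2] /andP[h3 h4].
    wlog ij' : i j ij h1 h2 h3 h4 / (i < j)%N.
      move=> W; have [?|?|e] := ltngtP i j; [exact: (W i j)|apply: (W j i) => //; by rewrite eq_sym|].
      by move: ij; rewrite e eqxx.
    have : (i%:R + 1 : R) <= j%:R by rewrite natr1 ler_nat.
    by move=> hh; clear - t0 ht h1 h2 h3 h4 hh; nra.
  have sub : \bigcup_(j < N) F j `<=` B.
    move=> x [j /= jN [xK _]]; rewrite /B /=.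
    apply: (le_trans (enorm_leD _ (3 * j%:R * t *: nu))).
    rewrite enormZ nu1 mulr1; apply: lerD; first by move: xK; rewrite scaleNr.
    have jR : (j%:R : R) <= N%:R by rewrite ler_nat ltnW.
    have : j%:R * t <= 1 :> R.
      by apply: (@le_trans _ _ (t^-1 * t)); [rewrite ler_pM2r// (le_trans jR)|rewrite mulVf ?gt_eqF].
    by move=> hh; rewrite ger0_norm; [clear -hh; lra|rewrite !mulr_ge0// ltW].
  have mm := @measure_bigsetU _ _ _ (mleb R n) F mF tF N.
  have : (\sum_(j < N) mleb R n (F j) <= leb B)%E.
    by rewrite -mm; apply: le_outer_measure; rewrite -bigcup_mkord.
  rewrite (eq_bigr (fun=> leb S)) => [|j _]; last exact: lF.
  have Sfin : leb S \is a fin_num.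
    rewrite ge0_fin_numE ?leb_out_ge0//; apply: (le_lt_trans _ Bfin).
    by apply: le_outer_measure => x [xK _]; rewrite /B /= (le_trans xK)// lerDl.
  rewrite -(fineK Sfin) sumEFin sumr_const card_ord bE !lee_fin -mulr_natr.
  set s := fine _ => sN.
  have s0 : 0 <= s by rewrite fine_ge0// leb_out_ge0.
  have Nt : 1 <= 2 * N%:R * t.
    have : 1 < N.+1%:R * t by rewrite -ltr_pdivrMr// mul1r.
    have : 1 <= N%:R :> R by rewrite ler1n.
    by rewrite -(natr1 N) => a1 a2; clear - a1 a2 t0; nra.
  by clear - Nt s0 sN t0; nra.
have [hpos|hneg] := ltP 0 h; first exact: main.
have -> : h = 0 by apply/eqP; rewrite eq_le h0 hneg.
rewrite mulr0; apply/lee_addgt0Pr => e e0; rewrite add0e.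
apply: (le_trans (main (e / (2 * b + 1)) _ _)).
- by rewrite divr_gt0//; clear -b0; lra.
- by rewrite (le_trans hneg)// divr_ge0 ?ltW//; clear -b0; lra.
- by rewrite lee_fin mulrA ler_pdivrMr; clear -b0 e0; [nra|lra].
Qed.
End LebPos.

(** * The layer-cake formula *)

Section LayerCake.
Local Open Scope ereal_scope.

Lemma rat_between (R : realType) (s : R) (y : \bar R) : s%:E < y ->
  exists q : rat, (s < ratr q)%R /\ (ratr q)%:E < y.
Proof.
case: y => [y| |]//; last first.
  move=> _; have [|q] := @rat_in_itvoo R s (s + 1)%R; first by rewrite ltrDl.
  by rewrite in_itv/= => /andP[? ?]; exists q; rewrite ltry.
rewrite lte_fin => sy; have [q] := rat_in_itvoo sy.
by rewrite in_itv/= => /andP[? ?]; exists q.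
Qed.

(** Tonelli on the subgraph of [f], which is a countable union of rectangles over rational
    levels. *)
Lemma layer_cake d (T : measurableType d) (R : realType)
   (mu : {sigma_finite_measure set T -> \bar R}) (f : T -> \bar R) :
  measurable_fun setT f -> (forall x, 0 <= f x) ->
  \int[lebesgue_measure]_(s in [set s : R | (0 < s)%R]) mu [set x | s%:E < f x] = \int[mu]_x f x.
Proof.
move=> mf f0.
pose A : set (T * R) := [set p | (0 < p.2)%R /\ p.2%:E < f p.1].
have mA : measurable A.
  have -> : A = \bigcup_(q : rat) ((setT `&` [set x | (ratr q)%:E < f x]) `*` `]0%R, ratr q[%classic).
    apply/seteqP; split => -[x s] /=.
      move=> [s0 /rat_between[q [h1 h2]]]; exists q => //; split => //=.
      by rewrite in_itv/= s0.
    move=> [q _ /= [[_ h1]]]; rewrite in_itv/= => /andP[s0 sq]; split => //.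
    by apply: lt_trans h1; rewrite lte_fin.
  apply: bigcupT_measurable_rat => q; apply: measurableX; last exact: measurable_itv.
  by apply: emeasurable_fun_o_infty.
have := @indic_fubini_tonelli _ _ _ _ _ mu (@lebesgue_measure R) A mA.
rewrite indic_fubini_tonelli_FE// indic_fubini_tonelli_GE//= => H.
have -> : \int[mu]_x f x = \int[mu]_x (@lebesgue_measure R) (xsection A x).
  apply: eq_integral => x _.
  have -> : xsection A x = [set s : R | (0 < s)%R /\ s%:E < f x].
    by apply/seteqP; split => s; rewrite /xsection /= inE.
  case: (f x) (f0 x) => [y| |]//= y0.
    have -> : [set s : R | (0 < s)%R /\ s%:E < y%:E] = `]0%R, y[%classic.
      by apply/seteqP; split => s /=; rewrite lte_fin in_itv/=; [move=> [-> ->]|move=> /andP].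
    rewrite lebesgue_measure_itv/= lte_fin; case: ltP => [_|yle]; first by rewrite sube0.
    by rewrite lee_fin in y0; congr EFin; apply/eqP; rewrite eq_le yle y0.
  have -> : [set s : R | (0 < s)%R /\ s%:E < +oo] = `]0%R, +oo[%classic.
    by apply/seteqP; split => s /=; rewrite in_itv/= andbT ?ltry; [case|].
  by rewrite lebesgue_measure_itv/= ltry.
rewrite H integral_mkcond; apply: eq_integral => s _; rewrite patchE.
case: ifPn => [|/negP]; rewrite inE/= => s0.
  by congr (mu _); apply/seteqP; split => x; rewrite /ysection /= inE/= => // -[].
rewrite (_ : ysection A s = set0) ?measure0// -subset0 => x.
by rewrite /ysection /= inE /A /= => -[].
Qed.
End LayerCake.

Section LebIntegral.
Variables (R : realType) (n : nat).
Local Notation V := 'rV[R]_n.+1.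
Local Notation leb := (@leb_out R n.+1).
Local Notation mV := (caratheodory_type (oleb R n)).

Lemma mleb_sigma_finite : sigma_finite setT (mleb R n).
Proof.
exists (fun k : nat => [set x : V | (enorm x <= k%:R)%R]).
  apply/seteqP; split => // x _; exists (Num.truncn (enorm x)).+1 => //=.
  exact/ltW/truncnS_gt.
move=> k; split; first by apply: measurable_closed; apply: closed_lef; exact: continuous_enorm.
exact: (@leb_bounded_fin _ _ _ k%:R).
Qed.
HB.instance Definition _ := @Measure_isSigmaFinite.Build _ _ _ (mleb R n) mleb_sigma_finite.

Lemma ointegE (f : mV -> \bar R) : measurable_fun setT f -> (forall x, (0 <= f x)%E) ->
  ointeg leb f = (\int[mleb R n]_x f x)%E.
Proof. by move=> mf f0; rewrite -(@layer_cake _ _ _ (mleb R n)). Qed.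

Lemma sointegE (h : mV -> R) : measurable_fun setT h ->
  sointeg leb h = (\int[mleb R n]_x (h x)%:E)%E.
Proof.
move=> mh; have mh' : measurable_fun setT (EFin \o h) by exact/measurable_EFinP.
rewrite /sointeg [RHS]integralE -!ointegE.
- by congr (_ - _)%E; congr ointeg; apply/funext => x; rewrite EFin_max ?funeposE ?funenegE ?EFinN.
- exact: measurable_funeneg.
- by move=> x; exact: funeneg_ge0.
- exact: measurable_funepos.
- by move=> x; exact: funepos_ge0.
Qed.

Lemma continuous_measurable (f : V -> R) : continuous f -> measurable_fun setT (f : mV -> R).
Proof.
move=> cf; apply: (measurability _ (RGenOpens.measurableE R)).
move=> _ [_ [a [b ->]] <-]; rewrite setTI; apply: measurable_open.
by apply: (@open_comp _ _ f `]a, b[%classic); [move=> x _; exact (cf x)|exact: interval_open].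
Qed.
End LebIntegral.

(** * Integrals against test fields *)

Section Bcs.
Variables (R : realType) (n : nat).
Local Notation V := 'rV[R]_n.+1.
Local Notation leb := (@leb_out R n.+1).
Local Notation mV := (caratheodory_type (oleb R n)).
Implicit Types (h w : V -> R) (A B : set V).

Lemma lmeasP A : lmeas A <-> measurable (A : set mV).
Proof. by []. Qed.

Lemma lmeas_shift A z : lmeas A -> lmeas [set x | A (x + z)].
Proof.
move=> mA B; have e (C : set V) : C = [set x | [set y | C (y - z)] (x + z)].
  by apply/seteqP; split => x /=; rewrite addrK.
rewrite {1}(e B) leb_shift (mA [set y | B (y - z)]); congr (_ + _)%E.
  by rewrite (e (B `&` _)) leb_shift; congr leb_out; apply/seteqP; split => x /=; rewrite subrK.
by rewrite (e (B `&` _)) leb_shift; congr leb_out; apply/seteqP; split => x /=; rewrite subrK.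
Qed.

Lemma lmeas_opp A : lmeas A -> lmeas [set x | A (- x)].
Proof.
move=> mA B; have e (C : set V) : C = [set x | [set y | C (- y)] (- x)].
  by apply/seteqP; split => x /=; rewrite opprK.
rewrite {1}(e B) leb_opp (mA [set y | B (- y)]); congr (_ + _)%E.
  by rewrite (e (B `&` _)) leb_opp; congr leb_out; apply/seteqP; split => x /=; rewrite opprK.
by rewrite (e (B `&` _)) leb_opp; congr leb_out; apply/seteqP; split => x /=; rewrite opprK.
Qed.

Lemma measurable_fun_shift h z : measurable_fun setT (h : mV -> R) ->
  measurable_fun setT ((fun x => h (x + z)) : mV -> R).
Proof. by move=> mh _ Y mY; rewrite setTI; apply: (@lmeas_shift (h @^-1` Y)); rewrite -[_ @^-1` _]setTI; exact: mh. Qed.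
Lemma measurable_fun_opp h : measurable_fun setT (h : mV -> R) ->
  measurable_fun setT ((fun x => h (- x)) : mV -> R).
Proof. by move=> mh _ Y mY; rewrite setTI; apply: (@lmeas_opp (h @^-1` Y)); rewrite -[_ @^-1` _]setTI; exact: mh. Qed.

(** Corresponding level sets differ by part of a null set, so subadditivity gives both inequalities
    for arbitrary functions. *)
Lemma ointeg_ae (f f' : V -> \bar R) : leb [set x | f x <> f' x] = 0%E -> ointeg leb f = ointeg leb f'.
Proof.
move=> h; congr (integral _ _ _); apply/funext => s.
have key (g g' : V -> \bar R) : leb [set x | g x <> g' x] = 0%E ->
    (leb [set x | s%:E < g x] <= leb [set x | s%:E < g' x])%E.
  move=> h0; rewrite -[leRHS]adde0 -h0; apply: le_trans (outer_measureU2 (oleb R n) _ _).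
  by apply: le_outer_measure => x /= sx; have [e|e] := pselect (g x = g' x); [left; rewrite -e|right].
apply/eqP; rewrite eq_le; apply/andP; split; apply: key => //.
by rewrite -h; congr leb_out; apply/seteqP; split => x /= /nesym.
Qed.

Lemma leb_sub0 A B : A `<=` B -> leb B = 0%E -> leb A = 0%E.
Proof.
move=> AB B0; apply/eqP; rewrite eq_le leb_out_ge0 andbT -B0.
exact: (le_outer_measure (oleb R n)).
Qed.

Lemma lmeas_null A : leb A = 0%E -> lmeas A.
Proof.
move=> A0 B; rewrite (leb_sub0 (@subIsetr _ B A) A0) add0e.
apply/eqP; rewrite eq_le; apply/andP; split; last exact: (le_outer_measure (oleb R n)).
rewrite -[leRHS]add0e -A0; apply: le_trans (outer_measureU2 (oleb R n) _ _).
by apply: le_outer_measure => x Bx; have [?|?] := pselect (A x); [left|right].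
Qed.

Lemma sointeg_ae h h' : leb [set x | h x <> h' x] = 0%E -> sointeg leb h = sointeg leb h'.
Proof.
move=> e; rewrite /sointeg; apply: (congr2 (fun u v : \bar R => (u - v)%E)); apply: ointeg_ae; apply: leb_sub0 e => x /= hx hh; apply: hx; rewrite hh; reflexivity.
Qed.

(** Bounded measurable functions supported in a ball: on them both parts of [sointeg] are finite,
    and the integral becomes a real linear functional. *)
Definition bcs h := measurable_fun setT (h : mV -> R) /\
  exists K B : R, forall x, `|h x| <= B /\ (K < enorm x -> h x = 0).

Lemma measurable_eball (K : R) : measurable ([set x : V | enorm x <= K] : set mV).
Proof. by apply: measurable_closed; apply: closed_lef; exact: continuous_enorm. Qed.

Lemma bcs_integrable h : bcs h -> (mleb R n).-integrable setT (EFin \o h).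
Proof.
move=> [mh [K [B hB]]]; apply/integrableP; split; first exact/measurable_EFinP.
have B0 : 0 <= B by have [h0 _] := hB 0; exact: le_trans (normr_ge0 _) h0.
apply: (@le_lt_trans _ _ (\int[mleb R n]_(x in [set x : V | (enorm x <= K)%R]) B%:E)%E).
  rewrite [leRHS]integral_mkcond; apply: ge0_le_integral.
  - exact: measurableT.
  - by move=> x _; exact: abse_ge0.
  - by apply: measurableT_comp; [exact: abse_measurable|exact/measurable_EFinP].
  - apply/measurable_restrict => //; first exact: measurable_eball.
  - move=> x _; rewrite patchE; have [hx h0] := hB x; case: ifPn => [_|]; first by rewrite lee_fin.
    by move=> /negP; rewrite inE /= => /negP; rewrite -ltNge => /h0 /= ->; rewrite normr0.
rewrite integral_cst; last exact: measurable_eball.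
have fK : (leb [set x : V | (enorm x <= K)%R] < +oo)%E by apply: (@leb_bounded_fin _ _ _ K).
by apply: lte_mul_pinfty => //; rewrite ?lee_fin// ge0_fin_numE.
Qed.

Definition J h : R := Rintegral (mleb R n) setT h.

Lemma JE h : bcs h -> sointeg leb h = (J h)%:E.
Proof.
move=> bh; rewrite sointegE; last by case: bh.
by rewrite /J /Rintegral fineK//; apply: integrable_fin_num => //; exact: bcs_integrable.
Qed.

Lemma bcsD h w : bcs h -> bcs w -> bcs (fun x => h x + w x).
Proof.
move=> [mh [K [B hB]]] [mw [K' [B' wB]]]; split; first exact: measurable_funD.
exists (Num.max K K'), (B + B') => x; have [? h0] := hB x; have [? w0] := wB x; split.
  by rewrite (le_trans (ler_normD _ _))// lerD.
by rewrite gt_max => /andP[/h0 -> /w0 ->]; rewrite addr0.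
Qed.

Lemma bcsMl w h (C : R) : measurable_fun setT (w : mV -> R) -> (forall x, `|w x| <= C) -> bcs h ->
  bcs (fun x => w x * h x).
Proof.
move=> mw wC [mh [K [B hB]]]; split; first exact: measurable_funM.
exists K, (C * B) => x; have [? h0] := hB x; split; last by move=> /h0 ->; rewrite mulr0.
by rewrite normrM ler_pM.
Qed.

Lemma bcsZ (a : R) h : bcs h -> bcs (fun x => a * h x).
Proof. by apply: (@bcsMl (fun=> a) _ `|a|). Qed.

Lemma bcsN h : bcs h -> bcs (fun x => - h x).
Proof. by move=> /(bcsZ (-1)); congr bcs; apply/funext => x; rewrite mulN1r. Qed.

Lemma bcsB h w : bcs h -> bcs w -> bcs (fun x => h x - w x).
Proof. by move=> bh bw; exact: (bcsD bh (bcsN bw)). Qed.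

Lemma bcs0 : bcs (fun=> 0).
Proof. by split; [exact: measurable_cst|exists 0, 0 => x; rewrite normr0]. Qed.

Lemma bcs_sum (I : Type) (r : seq I) (F : I -> V -> R) : (forall i, bcs (F i)) ->
  bcs (fun x => \sum_(i <- r) F i x).
Proof.
move=> bF; elim: r => [|i r IH].
  by under eq_fun do rewrite big_nil; exact: bcs0.
by under eq_fun do rewrite big_cons; exact: bcsD.
Qed.

Lemma bcs_shift h z : bcs h -> bcs (fun x => h (x + z)).
Proof.
move=> [mh [K [B hB]]]; split; first exact: measurable_fun_shift.
exists (K + enorm z), B => x; split; first by have [] := hB (x + z).
move=> Kx; apply: (hB _).2; rewrite -(ltrD2r (enorm z)); apply: (lt_le_trans Kx).
by rewrite -{1}(addrK z x) (le_trans (enormD _ _))// enormN.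
Qed.

Lemma bcs_opp h : bcs h -> bcs (fun x => h (- x)).
Proof.
move=> [mh [K [B hB]]]; split; first exact: measurable_fun_opp.
by exists K, B => x; have := hB (- x); rewrite enormN.
Qed.

Lemma JD h w : bcs h -> bcs w -> J (fun x => h x + w x) = J h + J w.
Proof. by move=> bh bw; rewrite /J RintegralD//; exact: bcs_integrable. Qed.

Lemma JB h w : bcs h -> bcs w -> J (fun x => h x - w x) = J h - J w.
Proof. by move=> bh bw; rewrite /J RintegralB//; exact: bcs_integrable. Qed.

Lemma JZ (a : R) h : bcs h -> J (fun x => a * h x) = a * J h.
Proof. by move=> bh; rewrite /J RintegralZl//; exact: bcs_integrable. Qed.

Lemma J0 : J (fun=> 0) = 0.
Proof. by rewrite /J Rintegral_cst// mul0r. Qed.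

Lemma J_sum (I : Type) (r : seq I) (F : I -> V -> R) : (forall i, bcs (F i)) ->
  J (fun x => \sum_(i <- r) F i x) = \sum_(i <- r) J (F i).
Proof.
move=> bF; elim: r => [|i r IH].
  by under eq_fun do rewrite big_nil; rewrite big_nil J0.
under eq_fun do rewrite big_cons.
by rewrite (JD (bF i) (bcs_sum r bF)) big_cons IH.
Qed.

Lemma J_le h w : bcs h -> bcs w -> (forall x, h x <= w x) -> J h <= J w.
Proof. by move=> bh bw hw; apply: le_Rintegral => //; exact: bcs_integrable. Qed.

Lemma J_ae h w : bcs h -> bcs w -> leb [set x | h x <> w x] = 0%E -> J h = J w.
Proof. by move=> bh bw /sointeg_ae; rewrite !JE// => -[]. Qed.

(** The layer-cake integral sees only measures of level sets, so invariance of the outer measure is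
    enough. *)
Lemma J_shift h z : bcs h -> J (fun x => h (x + z)) = J h.
Proof.
move=> bh; have := JE (bcs_shift z bh); rewrite /sointeg /ointeg.
have e (g : V -> R) (s : R) : leb [set x | (s%:E < (g (x + z))%:E)%E] = leb [set x | (s%:E < (g x)%:E)%E].
  exact: (@leb_shift _ _ [set x | (s%:E < (g x)%:E)%E]).
under eq_integral do rewrite (e (fun x => Num.max (h x) 0)).
under [X in (_ - X)%E]eq_integral do rewrite (e (fun x => Num.max (- h x) 0)).
by rewrite -/(ointeg _ _) -/(ointeg _ _) -/(sointeg _ _) JE// => -[].
Qed.

Lemma J_opp h : bcs h -> J (fun x => h (- x)) = J h.
Proof.
move=> bh; have := JE (bcs_opp bh); rewrite /sointeg /ointeg.
have e (g : V -> R) (s : R) : leb [set x | (s%:E < (g (- x))%:E)%E] = leb [set x | (s%:E < (g x)%:E)%E].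
  exact: (@leb_opp _ _ [set x | (s%:E < (g x)%:E)%E]).
under eq_integral do rewrite (e (fun x => Num.max (h x) 0)).
under [X in (_ - X)%E]eq_integral do rewrite (e (fun x => Num.max (- h x) 0)).
by rewrite -/(ointeg _ _) -/(ointeg _ _) -/(sointeg _ _) JE// => -[].
Qed.

Lemma bcs_indic A (K : R) : measurable (A : set mV) -> (forall x, A x -> enorm x <= K) -> bcs (\1_A).
Proof.
move=> mA AK; split; first exact: measurable_indic.
exists K, 1 => x; split; first by rewrite indicE; case: (_ \in _); rewrite ?normr1 ?normr0.
by move=> Kx; rewrite indicE; case: (boolP (x \in A)) => //; rewrite inE => /AK; rewrite leNgt Kx.
Qed.

Lemma J_indic A (K : R) : measurable (A : set mV) -> (forall x, A x -> enorm x <= K) -> (J \1_A)%:E = leb A.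
Proof.
move=> mA AK; rewrite -JE; last exact: bcs_indic mA AK.
by rewrite sointegE ?integral_indic ?setIT//; exact: measurable_indic.
Qed.

Lemma J_bound h A (B K : R) : bcs h -> measurable (A : set mV) -> (forall x, A x -> enorm x <= K) ->
  (forall x, `|h x| <= B) -> (forall x, ~ A x -> h x = 0) -> `|J h| <= B * fine (leb A).
Proof.
move=> bh mA AK hB h0; rewrite -(J_indic mA AK) /= -JZ; last exact: bcs_indic mA AK.
have bA : bcs (fun x => B * \1_A x) by apply: bcsZ; exact: bcs_indic mA AK.
have hle x : `|h x| <= B * \1_A x.
  rewrite indicE; case: (boolP (x \in A)); first by rewrite mulr1.
  by move=> /negP; rewrite inE => /h0 ->; rewrite normr0 mulr0.
rewrite ler_norml; apply/andP; split; last first.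
  by apply: J_le => // x; rewrite (le_trans (ler_norm _)).
have -> : - J (fun x => B * \1_A x) = J (fun x => (-1) * (B * \1_A x)) by rewrite (JZ (-1) bA) mulN1r.
by apply: (J_le (bcsZ _ bA) bh) => x; rewrite mulN1r lerNl (le_trans _ (hle x))// -normrN ler_norm.
Qed.

Lemma J_cvg (f : nat -> V -> R) h (B K : R) :
  (forall k, bcs (f k)) -> bcs h -> (forall k x, `|f k x| <= B) -> (forall k x, K < enorm x -> f k x = 0) ->
  (forall x, f ^~ x @ \oo --> h x) -> J (f k) @[k --> \oo] --> J h.
Proof.
move=> bf bh fB fK fh.
have B0 : 0 <= B by apply: le_trans (fB 0%N 0).
pose G x := B * \1_[set x : V | enorm x <= K] x.
have bG : bcs G by apply: bcsZ; apply: (bcs_indic (K := K) (measurable_eball K)).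
have [|||||i1 _ cv] := @dominated_convergence _ mV R (mleb R n) setT measurableT (fun k => EFin \o f k) (EFin \o h) (EFin \o G).
- by move=> k; apply/measurable_EFinP; case: (bf k).
- by apply/measurable_EFinP; case: bh.
- by apply: aeW => x _; apply: cvg_EFin; [exact: nearW|exact: fh].
- exact: bcs_integrable.
- apply: aeW => x k _; rewrite /= lee_fin /G indicE; case: (boolP (x \in _)); first by rewrite mulr1.
  by move=> /negP; rewrite inE /= => /negP; rewrite -ltNge => /fK ->; rewrite normr0 mulr0.
have fJ (g : V -> R) : bcs g -> (\int[mleb R n]_x (EFin \o g) x)%E = (J g)%:E.
  by move=> bg; rewrite -JE// sointegE//; case: bg.
rewrite fJ// in cv.
have {}cv : (EFin \o (fun k => J (f k))) @ \oo --> (J h)%:E.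
  rewrite (_ : EFin \o _ = fun k => (\int[mleb R n]_x (EFin \o f k) x)%E)//.
  by apply/funext => k; rewrite fJ.
exact: fine_cvg cv.
Qed.
End Bcs.

(** * Calculus of C^1 functions and cutoffs *)

Section C1calc.
Variables (R : realType) (n : nat).
Local Notation V := 'rV[R]_n.+1.
Local Notation e_ := (ebase R n.+1).
Local Notation mV := (caratheodory_type (oleb R n)).
Implicit Types (f g chi : V -> R) (x y : V).

Lemma is_derive_line f x v (d : R) (t : R) :
  is_derive (x + t *: v) v f d -> is_derive t (1 : R) (fun s => f (x + s *: v)) d.
Proof.
have e : (fun h : R => h^-1 *: ((f \o shift (x + t *: v)) (h *: v) - f (x + t *: v))) =
         (fun h : R => h^-1 *: (((fun s : R => f (x + s *: v)) \o shift t) (h *: (1 : R)) - f (x + t *: v))).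
  apply/funext => h /=; congr (_ *: (f _ - _)).
  by rewrite [h *: (1 : R)]mulr1 scalerDl addrCA.
move=> [df dv]; split.
  by rewrite /derivable -e.
by rewrite -dv /derive -e.
Qed.

Lemma is_derive_line0 f x v (d : R) :
  is_derive (0 : R) (1 : R) (fun s => f (x + s *: v)) d -> is_derive x v f d.
Proof.
have e : (fun h : R => h^-1 *: ((f \o shift x) (h *: v) - f x)) =
         (fun h : R => h^-1 *: (((fun s : R => f (x + s *: v)) \o shift 0) (h *: (1 : R)) - f (x + 0 *: v))).
  apply/funext => h /=; congr (_ *: (f _ - _)); last by rewrite scale0r addr0.
  by rewrite [h *: (1 : R)]mulr1 addr0 addrC.
by move=> [df dv]; split; [rewrite /derivable e|rewrite -dv /derive e].
Qed.

(** The partial derivatives are carried explicitly, so that sums, products and compositions come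
    with formulas for them. *)
Definition C1d f (df : 'I_n.+1 -> V -> R) := continuous f /\
  forall j : 'I_n.+1, (forall x, is_derive x (e_ j) f (df j x)) /\ continuous (df j).

Lemma continuous_add f g : continuous f -> continuous g -> continuous (fun x => f x + g x).
Proof. by move=> cf cg x; apply: (@continuousD _ _ _ f g x); [exact (cf x)|exact (cg x)]. Qed.
Lemma continuous_mul f g : continuous f -> continuous g -> continuous (fun x => f x * g x).
Proof. by move=> cf cg x; apply: (@continuousM _ _ f g x); [exact (cf x)|exact (cg x)]. Qed.

Lemma continuous_cst_fun (c : R) : continuous (fun _ : V => c).
Proof. by apply: (@continuous_lip _ _ _ 0) => x y; rewrite subrr normr0 mul0r. Qed.

Lemma C1d_cst (c : R) : C1d (fun=> c) (fun _ _ => 0).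
Proof.
split; first exact: continuous_cst_fun.
by move=> j; split => [x|]; [exact: is_derive_cst|exact: continuous_cst_fun].
Qed.

Lemma C1dD f df g dg : C1d f df -> C1d g dg -> C1d (fun x => f x + g x) (fun j x => df j x + dg j x).
Proof.
move=> [cf hf] [cg hg]; split; first exact: continuous_add.
move=> j; have [df' cdf] := hf j; have [dg' cdg] := hg j; split; last exact: continuous_add.
by move=> x; apply: is_deriveD.
Qed.

Lemma C1dM f df g dg : C1d f df -> C1d g dg ->
  C1d (fun x => f x * g x) (fun j x => f x * dg j x + g x * df j x).
Proof.
move=> [cf hf] [cg hg]; split; first exact: continuous_mul.
move=> j; have [df' cdf] := hf j; have [dg' cdg] := hg j; split.
  by move=> x; apply: is_deriveM.
by apply: continuous_add; exact: continuous_mul.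
Qed.

Lemma C1dZ (c : R) f df : C1d f df -> C1d (fun x => c * f x) (fun j x => c * df j x).
Proof.
move=> hf; have := C1dM (C1d_cst c) hf.
by congr C1d; apply/funext => j; apply/funext => x; rewrite mulr0 addr0.
Qed.

Lemma C1d_sum (I : Type) (r : seq I) (F : I -> V -> R) dF : (forall i, C1d (F i) (dF i)) ->
  C1d (fun x => \sum_(i <- r) F i x) (fun j x => \sum_(i <- r) dF i j x).
Proof.
move=> h; elim: r => [|i r IH].
  have := C1d_cst 0; congr C1d; first by apply/funext => x; rewrite big_nil.
  by apply/funext => j; apply/funext => x; rewrite big_nil.
have := C1dD (h i) IH; congr C1d; first by apply/funext => x; rewrite big_cons.
by apply/funext => j; apply/funext => x; rewrite big_cons.
Qed.

Lemma C1d_prod (I : Type) (r : seq I) (F : I -> V -> R) : (forall i, exists dF, C1d (F i) dF) ->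
  exists dG, C1d (fun x => \prod_(i <- r) F i x) dG.
Proof.
move=> h; elim: r => [|i r [dG IH]].
  by exists (fun _ _ => 0); have := C1d_cst 1; congr C1d; apply/funext => x; rewrite big_nil.
have [dF hF] := h i; eexists; have := C1dM hF IH; congr C1d.
by apply/funext => x; rewrite big_cons.
Qed.

Lemma C1d_dot nu : C1d (fun x => dotv x nu) (fun j _ => nu ord0 j).
Proof.
split; first exact: continuous_dotv.
move=> j; split; last exact: continuous_cst_fun.
move=> x; apply: is_derive_line0.
have -> : (fun s : R => dotv (x + s *: e_ j) nu) = (fun s : R => dotv x nu + s * nu ord0 j).
  by apply/funext => s; rewrite dotvDl dotvZl (dotvC (e_ j)) dotv_ebase.
have := @is_deriveD R _ _ (cst (dotv x nu)) _ (0 : R) 1 _ _ (is_derive_cst _ _ _) (@is_deriveM R _ id (cst (nu ord0 j)) 0 1 _ _ (is_derive_id _ _) (is_derive_cst _ _ _)).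
by congr is_derive; rewrite scaler0 !add0r [_ *: _]mulr1.
Qed.

Lemma C1d_comp (k k' : R -> R) f df : (forall s, is_derive s (1 : R) k (k' s)) -> continuous k' ->
  C1d f df -> C1d (fun x => k (f x)) (fun j x => k' (f x) * df j x).
Proof.
move=> hk ck' [cf hf].
have ck : continuous k.
  by move=> s; apply: differentiable_continuous; apply/derivable1_diffP; case: (hk s).
have comp (h : R -> R) : continuous h -> continuous (fun x => h (f x)).
  by move=> ch x; apply: (@continuous_comp _ _ _ f h x); [exact (cf x)|exact: ch].
split; first exact: comp.
move=> j; have [df' cdf] := hf j; split; last by apply: continuous_mul => //; exact: comp.
move=> x; apply: is_derive_line0.
apply: (@is_derive1_comp _ k (fun s => f (x + s *: e_ j))).
  by rewrite scale0r addr0.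
by apply: is_derive_line; rewrite scale0r addr0.
Qed.

(** The simplest function of class C^1 vanishing exactly on a half-line; all cutoffs and bumps are
    built from it. *)
Definition pos2 (s : R) := Num.max s 0 ^+ 2.

Lemma pos2_derive s : is_derive s (1 : R) pos2 (2 * Num.max s 0).
Proof.
(* A quadratic remainder: after division by h the error is at most |h|. *)
have key (h : R) : `|pos2 (s + h) - pos2 s - 2 * Num.max s 0 * h| <= h ^+ 2.
  rewrite /pos2 /Num.max; repeat case: ifPn; rewrite -?leNgt => *;
  by rewrite ler_norml; apply/andP; split; nra.
have cv : (fun h : R => h^-1 *: ((pos2 \o shift s) (h *: (1 : R)) - pos2 s)) @ 0^' --> 2 * Num.max s 0.
  apply/cvgrPdist_lt => e e0; near=> h.
  have h0 : h != 0 by near: h; exact: nbhs_dnbhs_neq.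
  have he : `|h| < e by near: h; apply: dnbhs0_lt.
  apply: le_lt_trans he.
  rewrite /= [h *: 1]mulr1 [_ *: _]/(_ * _) distrC.
  have -> : h^-1 * (pos2 (h + s) - pos2 s) - 2 * Num.max s 0 =
            h^-1 * (pos2 (s + h) - pos2 s - 2 * Num.max s 0 * h).
    by rewrite (addrC h) [in RHS]mulrBr (mulrC h^-1 (_ * h)) mulfK.
  rewrite normrM normfV mulrC ler_pdivrMr ?normr_gt0// -normrM -expr2 [leRHS]ger0_norm ?sqr_ge0//.
by split; [apply/cvg_ex; exists (2 * Num.max s 0)|exact: cvg_lim].
Unshelve. all: by end_near. Qed.

Lemma continuous_pos1 : continuous (fun s : R => 2 * Num.max s 0).
Proof.
move=> s; apply/cvgrPdist_lt => e e0; near=> t.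
have : `|s - t| < e / 2 by near: t; apply: cvgr_dist_lt; rewrite ?divr_gt0.
rewrite !ltr_norml => /andP[? ?]; rewrite /Num.max; repeat case: ifPn; rewrite -?leNgt => *;
by apply/andP; split; lra.
Unshelve. all: by end_near. Qed.

(** Quadratic spline with second derivative 4 on (0, 1/2) and -4 on (1/2, 1): a C^1 step from 0 to
    1. *)
Definition smstep (s : R) := 2 * pos2 s - 4 * pos2 (s - 1 / 2) + 2 * pos2 (s - 1).

Lemma pos2_le0 (s : R) : s <= 0 -> pos2 s = 0.
Proof. by move=> s0; rewrite /pos2 max_r// expr0n. Qed.
Lemma pos2_ge0 (s : R) : 0 <= s -> pos2 s = s ^+ 2.
Proof. by move=> s0; rewrite /pos2 max_l. Qed.

Lemma smstep_le0 (s : R) : s <= 0 -> smstep s = 0.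
Proof. by move=> s0; rewrite /smstep !pos2_le0; lra. Qed.
Lemma smstep_ge1 (s : R) : 1 <= s -> smstep s = 1.
Proof. by move=> s0; rewrite /smstep !pos2_ge0; try lra; field. Qed.
Lemma smstep_01 s : 0 <= smstep s <= 1.
Proof. by rewrite /smstep /pos2 /Num.max; repeat case: ifPn; rewrite -?leNgt => *; apply/andP; split; nra. Qed.

Lemma smstep_C1 : exists k', (forall s, is_derive s (1 : R) smstep (k' s)) /\ continuous k'.
Proof.
pose p (s : R) := 2 * Num.max s 0.
exists (fun s => 2 * p s - 4 * p (s - 1 / 2) + 2 * p (s - 1)); split.
  move=> s.
  have sh (c : R) : is_derive s (1 : R) (fun s => pos2 (s - c)) (p (s - c)).
    rewrite -[p _]mulr1; apply: (@is_derive1_comp _ pos2 (fun s => s - c)); first exact: pos2_derive.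
    by rewrite -[X in is_derive _ _ _ X]subr0; apply: is_deriveB.
  have s2 (c : R) (q : R -> R) (d : R) : is_derive s (1 : R) q d -> is_derive s (1 : R) (fun s => c * q s) (c * d).
    by move=> h; exact: (@is_deriveZ _ _ _ q c s 1 d).
  apply: (@is_deriveD _ _ _ (fun s => 2 * pos2 s - 4 * pos2 (s - 1 / 2)) (fun s => 2 * pos2 (s - 1))).
    apply: (@is_deriveB _ _ _ (fun s => 2 * pos2 s) (fun s => 4 * pos2 (s - 1 / 2))).
      exact: (s2 2 pos2 _ (pos2_derive s)).
have cp (c : R) : continuous (fun s => p (s - c)).
  move=> s; apply: (@continuous_comp _ _ _ (fun s => s - c) p s); last exact: continuous_pos1.
  by apply: continuousB; [exact: cvg_id|exact: cvg_cst].
move=> s; apply: cvgD; first (apply: cvgB); apply: cvgM; try exact: cvg_cst.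
- exact: continuous_pos1.
- exact: cp.
- exact: cp.
Qed.

Lemma C1d_smstep f df : C1d f df -> exists dg, C1d (fun x => smstep (f x)) dg.
Proof.
by move=> hf; have [k' [h1 h2]] := smstep_C1; eexists; exact: (C1d_comp h1 h2 hf).
Qed.

Lemma C1d_sqdist p : C1d (fun x => dotv (x - p) (x - p)) (fun j x => 2 * (x - p) ord0 j).
Proof.
have -> : (fun x => dotv (x - p) (x - p)) = (fun x => \sum_(i < n.+1) (dotv x (e_ i) + - p ord0 i) * (dotv x (e_ i) + - p ord0 i)).
  by apply/funext => x; apply: eq_bigr => i _; rewrite dotv_ebase !mxE.
have h := C1d_sum (index_enum 'I_n.+1) (fun i : 'I_n.+1 => let h := C1dD (C1d_dot (e_ i)) (C1d_cst (- p ord0 i)) in C1dM h h).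
move: h => /=; congr C1d; apply/funext => j; apply/funext => x.
rewrite (bigD1 j)//= big1 => [|i ij]; last by rewrite mxE (inj_eq val_inj) eq_sym (negbTE ij) addr0 mulr0 addr0.
by rewrite dotv_ebase !mxE eqxx !addr0 mulr1 mulr_natl mulr2n.
Qed.

Lemma C1d_C1c f df (D K : set V) : C1d f df -> compact K -> K `<=` D -> (forall x, ~ K x -> f x = 0) -> C1c D f.
Proof.
move=> [cf hf] cK KD f0; split; first by exists K.
move=> j; have [hd cd] := hf j; split; first by move=> x; case: (hd x).
by rewrite (_ : (fun x => _) = df j)//; apply/funext => x; case: (hd x).
Qed.

End C1calc.

Lemma in_bigsetU (T : Type) q (S : 'I_q -> set T) x : (\big[setU/set0]_(i < q) S i) x <-> exists i, S i x.
Proof.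
split; last by move=> [i Si]; rewrite (bigD1 i)//=; left.
by elim/big_ind: _ => // [A B hA hB [/hA|/hB]|i _ Si]//; exists i.
Qed.

(** * Test functions and finite total variation *)

Section C1cFacts.
Variables (R : realType) (n : nat).
Local Notation V := 'rV[R]_n.+1.
Local Notation leb := (@leb_out R n.+1).
Local Notation e_ := (ebase R n.+1).
Local Notation mV := (caratheodory_type (oleb R n)).
Implicit Types (D : set V) (phi f : V -> R).

Lemma enorm_ebase (j : 'I_n.+1) : enorm (e_ j) = 1.
Proof. by rewrite /enorm dotv_ebase mxE eqxx sqrtr1. Qed.

Lemma cont_bounded f (K : R) : continuous f -> exists B, forall x, enorm x <= K -> `|f x| <= B.
Proof.
move=> cf; pose A : set V := [set x | enorm x <= K].
have cA : compact A.
  by apply: (@compact_closed_enorm _ _ _ K) => //; apply: closed_lef; exact: continuous_enorm.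
have : compact (f @` A) by apply: continuous_compact => //; exact: continuous_subspaceT.
move=> /compact_bounded[M [_ hM]]; exists (M + 1) => x xK.
by apply: (hM (M + 1)); [rewrite ltrDl|exists x].
Qed.

Lemma derive_off f (S : set V) (v : V) x : closed S -> (forall x, ~ S x -> f x = 0) -> ~ S x -> derive f x v = 0.
Proof.
move=> cS f0 Sx; rewrite (@near_eq_derive _ _ _ f (cst 0)) ?derive_cst//.
have oS : open (~` S) by exact: closed_openC.
have : nbhs x (~` S) by apply: open_nbhs_nbhs.
by move=> hS; apply: (@filterS _ _ (nbhs_filter x) _ _ _ hS) => y /f0.
Qed.

Lemma MVT_line f (v : V) (L : R) x (t : R) : (forall y, derivable f y v) -> (forall y, `|derive f y v| <= L) ->
  `|f (x + t *: v) - f x| <= L * `|t|.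
Proof.
move=> df dL.
have main y (s : R) : 0 <= s -> `|f (y + s *: v) - f y| <= L * s.
  move=> s0; have hd (r : R) : is_derive r (1 : R) (fun r => f (y + r *: v)) (derive f (y + r *: v) v).
    by apply: is_derive_line; exact/derivableP.
  have [|c _] := @MVT_segment R (fun r => f (y + r *: v)) (fun r => derive f (y + r *: v) v) 0 s s0.
    by apply: derivable_within_continuous => r _; case: (hd r).
  by rewrite scale0r addr0 subr0 => ->; rewrite normrM (ger0_norm s0) ler_wpM2r.
have [t0|t0] := lerP 0 t; first by rewrite (ger0_norm t0) main.
have := main (x + t *: v) (- t); rewrite -addrA -scalerDl subrr scale0r addr0 distrC (ltr0_norm t0).
by apply; rewrite oppr_ge0 ltW.
Qed.

Lemma enorm_cont_closed (K : R) : closed [set x : V | enorm x <= K].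
Proof. by apply: closed_lef; exact: continuous_enorm. Qed.

(** [C1c] speaks only of partial derivatives; the Lipschitz bound comes from moving one coordinate
    at a time with the mean value theorem. *)
Lemma C1c_facts D phi : C1c D phi -> exists L K : R,
  [/\ 0 <= L, forall x y, `|phi x - phi y| <= L * enorm (x - y),
      forall x, K < enorm x -> phi x = 0,
      forall (j : 'I_n.+1) x, `|derive phi x (e_ j)| <= L &
      forall (j : 'I_n.+1) x, K < enorm x -> derive phi x (e_ j) = 0].
Proof.
move=> [[S [cS [SD phi0]]] hd].
have [K SK] := compact_enorm_bounded cS.
have out x : K < enorm x -> phi x = 0.
  by move=> xK; apply: phi0 => /SK; rewrite leNgt xK.
have dout (j : 'I_n.+1) x : K < enorm x -> derive phi x (e_ j) = 0.
  move=> xK; apply: (@derive_off phi [set x : V | enorm x <= K]).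
  - exact: enorm_cont_closed.
  - by move=> y /= /negP; rewrite -ltNge; exact: out.
  - by rewrite /= => /(lt_le_trans xK); rewrite ltxx.
have HB (j : 'I_n.+1) : exists B : R, 0 <= B /\ forall x, `|derive phi x (e_ j)| <= B.
  have [B hB] := @cont_bounded _ K (hd j).2; exists (Num.max B 0); split; first by rewrite le_max lexx orbT.
  move=> x; have [/hB h|/dout ->] := leP (enorm x) K; first by rewrite le_max h.
  by rewrite normr0 le_max lexx orbT.
have [B {}HB] := choice HB.
pose L0 := \sum_(j < n.+1) B j.
have L00 : 0 <= L0 by apply: sumr_ge0 => j _; exact: (HB j).1.
have dL0 (j : 'I_n.+1) x : `|derive phi x (e_ j)| <= L0.
  apply: (le_trans ((HB j).2 x)); rewrite /L0 (bigD1 j)//= lerDl.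
  by apply: sumr_ge0 => i _; exact: (HB i).1.
have n1 : (1 : R) <= n.+1%:R by rewrite ler1n.
exists (L0 * n.+1%:R), K; split => //.
- by rewrite mulr_ge0.
- move=> x y; rewrite distrC.
  (* A path from x to y along the axes: [z k] already has the first k coordinates of y. *)
  pose z (k : nat) : V := \row_i (if (i < k)%N then y ord0 i else x ord0 i).
  have z0 : z 0%N = x by apply/rowP => i; rewrite mxE.
  have zn : z n.+1 = y by apply/rowP => i; rewrite mxE ltn_ord.
  have zS (k : 'I_n.+1) : z k.+1 = z k + (y ord0 k - x ord0 k) *: e_ k.
    apply/rowP => i; rewrite !mxE ltnS leq_eqVlt.
    have [/val_inj ->|ik] /= := eqVneq (i : nat) k; last by rewrite mulr0 addr0.
    by rewrite ltnn mulr1 addrC subrK.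
  have -> : phi y - phi x = \sum_(k < n.+1) (phi (z k.+1) - phi (z k)).
    rewrite -z0 -{1}zn -(telescope_sumr (fun k => phi (z k)))// big_mkord//.
  apply: (le_trans (ler_norm_sum _ _ _)).
  apply: (@le_trans _ _ (\sum_(k < n.+1) L0 * enorm (x - y))).
    apply: ler_sum => k _; rewrite zS (le_trans (@MVT_line _ _ L0 _ _ (hd k).1 (dL0 k)))//.
    by rewrite ler_wpM2l// distrC; have := coord_le_enorm (x - y) k; rewrite !mxE.
  by rewrite sumr_const card_ord -[_ *+ _]mulr_natr mulrAC.
- by move=> j x; rewrite (le_trans (dL0 j x))// ler_peMr.
Qed.

Lemma C1c_continuous D phi : C1c D phi -> continuous phi.
Proof. by move=> /C1c_facts[L [K [L0 lip _ _ _]]]; exact: continuous_lip lip. Qed.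

Lemma cont_bcs f (K : R) : continuous f -> (forall x, K < enorm x -> f x = 0) -> bcs f.
Proof.
move=> cf fK; split; first exact: continuous_measurable.
have [B hB] := cont_bounded K cf; exists K, (Num.max B 0) => x; split => [|/fK//].
have [/hB h|/fK ->] := leP (enorm x) K; first by rewrite le_max h.
by rewrite normr0 le_max lexx orbT.
Qed.

Lemma C1c_bcs D phi : C1c D phi -> bcs phi.
Proof.
move=> h; have [L [K [_ _ K0 _ _]]] := C1c_facts h.
exact: (cont_bcs (C1c_continuous h) K0).
Qed.

Lemma C1c_derive_bcs D phi (j : 'I_n.+1) : C1c D phi -> bcs (fun x => derive phi x (e_ j)).
Proof.
move=> h; have [L [K [_ _ _ _ K0]]] := C1c_facts h.
by case: h => _ /(_ j)[_ cd]; exact: (cont_bcs cd (K0 j)).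
Qed.

Lemma fine_leb_le (A : set V) (c : R) : (leb A <= c%:E)%E -> fine (leb A) <= c.
Proof.
have := @leb_out_ge0 R n A; case: (leb A) => [r| |]//=; rewrite ?lee_fin//.
Qed.

(* Difference quotients move from [phi] to [w]. *)
Lemma J_deriv_bound D phi (j : 'I_n.+1) (w : V -> R) (B b C h0 K : R) : C1c D phi -> (forall x, `|phi x| <= b) ->
  measurable_fun setT (w : mV -> R) -> (forall x, `|w x| <= B) -> 0 < h0 -> 0 <= C ->
  (forall x, K < enorm x -> phi x = 0) ->
  (forall h, 0 < h -> h < h0 -> exists A : set V, [/\ measurable (A : set mV),
     forall x, A x -> enorm x <= K, (leb A <= (C * h)%:E)%E &
     forall x, enorm x <= K -> w (x - h *: e_ j) <> w x -> A x]) ->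
  `|J (fun x => w x * derive phi x (e_ j))| <= 2 * B * b * C.
Proof.
move=> hphi phib mw wB h00 C0 phiK HA.
have [L [K' [L0 lip phiK' dL dK]]] := C1c_facts hphi.
have bphi := C1c_bcs hphi; have bd := C1c_derive_bcs j hphi.
have b0 : 0 <= b by apply: le_trans (phib 0).
have B0 : 0 <= B by apply: le_trans (wB 0).
pose h k : R := (k.+1%:R)^-1.
have hpos k : 0 < h k by rewrite invr_gt0.
have hle1 k : h k <= 1 by rewrite invf_le1 ?ler1n.
pose q k x := (h k)^-1 * (phi (x + h k *: e_ j) - phi x).
pose F k x := w x * q k x.
have bq k : bcs (q k) by apply: bcsZ; apply: bcsB; [exact: (bcs_shift _ bphi)|exact: bphi].
have bF k : bcs (F k) by exact: (bcsMl mw wB (bq k)).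
have qL k x : `|q k x| <= L.
  rewrite /q normrM normfV (gtr0_norm (hpos k)) ler_pdivrMl//.
  rewrite mulrC; apply: (le_trans (@MVT_line phi (e_ j) L x (h k) _ _)).
  - by case: hphi => _ /(_ j)[].
  - by move=> y; exact: dL.
  by rewrite gtr0_norm.
have cv : J (F k) @[k --> \oo] --> J (fun x => w x * derive phi x (e_ j)).
  apply: (@J_cvg _ _ F _ (B * L) (K' + 1)); [exact: bF|exact: (bcsMl mw wB bd)| | |].
  - by move=> k x; rewrite normrM ler_pM.
  - move=> k x xK; rewrite /F /q phiK' ?phiK'//; [by rewrite subr0 !mulr0|by rewrite (le_lt_trans _ xK)// lerDl|].
    have : enorm x <= enorm (x + h k *: e_ j) + h k.
      rewrite -{1}(addrK (h k *: e_ j) x) (le_trans (enormD _ _))// enormN enormZ enorm_ebase mulr1 gtr0_norm//.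
    by move=> H; have := hle1 k; clear - H xK; lra.
  - move=> x; apply: cvgM; first exact: cvg_cst.
    have /derivableP[hd _] : derivable phi x (e_ j) by case: hphi => _ /(_ j)[].
    have hcv : h k @[k --> \oo] --> 0^'.
      move=> P P0; have h0c : h k @[k --> \oo] --> (0 : R) by exact: cvg_harmonic.
      have H : \forall k \near \oo, h k != 0 -> P (h k) by exact: (h0c _ P0).
      change (\forall k \near \oo, P (h k)).
      by apply: filterS H => k; apply; rewrite (gt_eqF (hpos k)).
    rewrite (_ : (fun k => q k x) = (fun t : R => t^-1 *: ((phi \o shift x) (t *: e_ j) - phi x)) \o h).
      exact: (cvg_comp _ _ hcv hd).
    by apply/funext => k; rewrite /q /= (addrC x).
have bnd : \forall k \near \oo, `|J (F k)| <= 2 * B * b * C.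
  have hk0 : \forall k \near \oo, h k < h0 by exact: (near_infty_natSinv_lt (PosNum h00)).
  apply: filterS hk0 => k hk; have [A [mA AK lA wA]] := HA _ (hpos k) hk.
  (* Discrete integration by parts: by translation invariance the difference quotient falls on [w].
     Since W - w vanishes on the support of [phi] outside a set of measure at most C h, dividing by
     h leaves a bound independent of h. *)
  pose W x := w (x + (- h k) *: e_ j).
  have mW : measurable_fun setT (W : mV -> R) by exact: measurable_fun_shift.
  have bG : bcs (fun x => W x * phi x) by apply: (bcsMl mW (C := B)) => // x; exact: wB.
  have bwp : bcs (fun x => w x * phi x) by exact: (bcsMl mw wB).
  have -> : J (F k) = (h k)^-1 * J (fun x => (W x - w x) * phi x).
    have -> : (fun x => (W x - w x) * phi x) = (fun x => W x * phi x - w x * phi x).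
      by apply/funext => x; rewrite mulrBl.
    rewrite (JB bG bwp) -(J_shift (h k *: e_ j) bG).
    rewrite -(JB (bcs_shift _ bG) bwp) -JZ; last exact: (bcsB (bcs_shift _ bG) bwp).
    congr J; apply/funext => x; rewrite /F /q /W -addrA -scalerDl subrr scale0r addr0.
    by rewrite mulrCA mulrBr.
  rewrite normrM normfV (gtr0_norm (hpos k)) ler_pdivrMl//.
  have bd2 : bcs (fun x => (W x - w x) * phi x).
    apply: (bcsMl (C := B + B)); [exact: (measurable_funB mW mw)| |exact: bphi].
    by move=> x; rewrite (le_trans (ler_normB _ _))// lerD// wB.
  apply: (le_trans (@J_bound _ _ _ A (2 * B * b) K bd2 mA AK _ _)).
  - move=> x; rewrite normrM ler_pM// (le_trans (ler_normB _ _))//.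
    by have := wB x; have := wB (x + (- h k) *: e_ j); rewrite /W => p1 p2; clear - p1 p2; lra.
  - move=> x Ax; have [xK|/phiK ->] := leP (enorm x) K; last by rewrite mulr0.
    have [e|ne] := eqVneq (W x) (w x); first by rewrite e subrr mul0r.
    by case: Ax; apply: wA => //; rewrite -scaleNr; exact/eqP.
  have := fine_leb_le lA; move: (fine _) => a aC.
  have e : h k * (2 * B * b * C) = 2 * B * b * (C * h k) by ring.
  by rewrite e; apply: ler_wpM2l => //; rewrite !mulr_ge0.
have cn : `|J (F k)| @[k --> \oo] --> `|J (fun x => w x * derive phi x (e_ j))| by exact: cvg_norm.
rewrite -(cvg_lim (@Rhausdorff R) cn); apply: limr_le => //.
by apply/cvg_ex; eexists; exact: cn.
Qed.

Lemma divg_bcs D (Phi : 'I_n.+1 -> V -> R) : (forall i, C1c D (Phi i)) -> bcs (divg Phi).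
Proof. by move=> h; apply: bcs_sum => i; exact: C1c_derive_bcs (h i). Qed.

Lemma divg_off D (Phi : 'I_n.+1 -> V -> R) x (S : 'I_n.+1 -> set V) :
  (forall i, closed (S i)) -> (forall i y, ~ S i y -> Phi i y = 0) -> (forall i, ~ S i x) -> divg Phi x = 0.
Proof. by move=> cS P0 Sx; rewrite /divg big1// => i _; exact: (@derive_off (Phi i) (S i) (e_ i) x (cS i) (P0 i) (Sx i)). Qed.

Section TV.
Variable m : nat.
Implicit Types (w v u : V -> 'rV[R]_m) (Phi : 'I_m -> 'I_n.+1 -> V -> R).

Definition bmeas w := (exists B : R, forall x al, `|w x ord0 al| <= B) /\
  forall al, measurable_fun setT ((fun x => w x ord0 al) : mV -> R).

Definition Tint w Phi : R := \sum_(al < m) J (fun x => w x ord0 al * divg (Phi al) x).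

(** Finiteness of the total variation without its value: admissibility asks for nothing more, as the
    energy is read on the jump set. *)
Definition TVfin D w := exists C : R, forall Phi, testfield D Phi -> Tint w Phi <= C.

Lemma bmeas_bcs D w Phi al : bmeas w -> testfield D Phi -> bcs (fun x => w x ord0 al * divg (Phi al) x).
Proof. by move=> [[B wB] mw] [hPhi _]; apply: (bcsMl (mw al) (C := B)) => //; exact: divg_bcs (hPhi al). Qed.

Lemma testfield_bound D Phi al i x : testfield D Phi -> `|Phi al i x| <= 1.
Proof.
move=> [_ /(_ x) h]; rewrite -(@expr_le1 _ 2)// real_normK ?num_real//; apply: le_trans h.
rewrite (bigD1 al)//= (bigD1 i)//= -addrA lerDl addr_ge0//; first by apply: sumr_ge0 => j _; exact: sqr_ge0.
by apply: sumr_ge0 => j _; apply: sumr_ge0 => k _; exact: sqr_ge0.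
Qed.

Lemma Tint_ae D w w' Phi : bmeas w -> bmeas w' -> testfield D Phi -> leb (D `&` [set x | w x <> w' x]) = 0%E ->
  Tint w Phi = Tint w' Phi.
Proof.
move=> bw bw' hPhi h; apply: eq_bigr => al _; apply: J_ae; try exact: (bmeas_bcs al _ hPhi).
apply: leb_sub0 h => x /= neq; split; last by move=> e; apply: neq; rewrite e.
apply: contrapT => Dx; apply: neq.
have Sf i : exists S, [/\ closed S, S `<=` D & forall y, ~ S y -> Phi al i y = 0].
  case: hPhi => /(_ al i)[[S [cS [SD S0]]] _] _; exists S; split => //.
  exact: (compact_closed (@norm_hausdorff _ _) cS).
have [S hS] := choice Sf.
by rewrite (@divg_off D (Phi al) x S) ?mulr0// => i; have [? SD ?] := hS i => // /SD.
Qed.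

(** A function constant on the cells cut out by finitely many hyperplanes changes under a
    translation by h only within distance h of one of them, a set of measure O(h) by [leb_slab];
    [J_deriv_bound] then applies. *)
Lemma polyhedral_TVfin D (K : R) (q : nat) (nu : 'I_q -> V) (c : 'I_q -> R) v :
  (forall x, D x -> enorm x <= K) -> (forall i, enorm (nu i) = 1) -> bmeas v ->
  (forall x y, (forall i, (c i < dotv x (nu i)) = (c i < dotv y (nu i))) -> v x = v y) ->
  TVfin D v.
Proof.
move=> DK nu1 bv vE; have [[B vB] mv] := bv.
have [m0|m0] := posnP m.
  by exists 0 => Phi _; rewrite /Tint big1// => -[al hal]; exfalso; move: hal; rewrite m0.
have B0 : 0 <= B by apply: le_trans (vB 0 (Ordinal m0)).
have [C C0 slab] := @leb_slab R n K.
pose CC := C * q%:R.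
have CC0 : 0 <= CC by rewrite mulr_ge0.
exists (\sum_(al < m) \sum_(j < n.+1) 2 * B * 1 * CC) => Phi hPhi.
apply: ler_sum => al _.
have C1 i := hPhi.1 al i.
have -> : J (fun x => v x ord0 al * divg (Phi al) x) =
   \sum_(j < n.+1) J (fun x => v x ord0 al * derive (Phi al j) x (e_ j)).
  rewrite -J_sum; last by move=> j; exact: (bcsMl (mv al) (fun x => vB x al) (C1c_derive_bcs j (C1 j))).
  by congr J; apply/funext => x; rewrite /divg mulr_sumr.
apply: ler_sum => j _; apply: (le_trans (ler_norm _)).
apply: (@J_deriv_bound D (Phi al j) j (fun x => v x ord0 al) B 1 CC 1 K) => //.
- by move=> x; exact: (testfield_bound _ _ _ hPhi).
- move=> x xK; have [[S [_ [SD S0]]] _] := C1 j; apply: S0 => /SD/DK; rewrite leNgt xK//.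
move=> h h0 _; pose S (i : 'I_q) : set V := [set x | enorm x <= K /\ `|dotv x (nu i) - c i| <= h].
have mS i : measurable (S i : set mV).
  apply: measurable_closed; apply: closedI; first exact: enorm_cont_closed.
  apply: closed_lef; apply: (@continuous_lip _ _ _ 1) => x y.
  rewrite mul1r (le_trans (ler_dist_dist _ _))// opprB addrA subrK -dotvBl.
  by rewrite (le_trans (dotv_CS _ _))// nu1 mulr1.
exists (\big[setU/set0]_(i < q) S i); split.
- exact: bigsetU_measurable.
- by move=> x /in_bigsetU[i []].
- have sub := @outer_measure_subadditive _ _ (oleb R n) (fun i => if insub i is Some k then S k else set0) q.
  have e : \big[setU/set0]_(i < q) (if insub (i : nat) is Some k then S k else set0) = \big[setU/set0]_(i < q) S i.
    by apply: eq_bigr => i _; rewrite valK.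
  rewrite e in sub; apply: (le_trans sub).
  apply: (@le_trans _ _ (\sum_(i < q) (C * h)%:E)%E).
    by apply: lee_sum => i _; rewrite valK; apply: slab => //; exact: ltW.
  by rewrite sumEFin sumr_const card_ord lee_fin /CC -[_ *+ _]mulr_natr mulrAC.
move=> x xK neq; apply/in_bigsetU.
apply: contrapT => /forallNP hn; apply: neq.
suff -> : v (x - h *: e_ j) = v x by [].
apply: vE => i.
have := hn i; rewrite /S /= => /not_andP[//|/negP]; rewrite -ltNge dotvBl dotvZl.
rewrite (dotvC (e_ j)) dotv_ebase.
have := coord_le_enorm (nu i) j; rewrite nu1.
move: (nu i ord0 j) (dotv x (nu i)) (c i) => a s c0; rewrite ler_norml lter_normr => /andP[a1 a2] hs.
have ah : - h <= h * a <= h by apply/andP; split; nra.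
case/andP: ah => ah1 ah2.
case/orP: hs => hs; first by rewrite [in RHS]ltNge [in LHS]ltNge; congr (~~ _); apply/idP/idP => hh; clear - hs ah1 ah2 hh; lra.
by apply/idP/idP => hh; clear - hs ah1 ah2 hh; lra.
Qed.
End TV.
End C1cFacts.

(** * Representatives of BV functions with values in M *)

Section Rep.
Variables (R : realType) (n m : nat).
Local Notation V := 'rV[R]_n.+1.
Local Notation W := 'rV[R]_m.
Local Notation leb := (@leb_out R n.+1).
Local Notation e_ := (ebase R n.+1).
Local Notation mV := (caratheodory_type (oleb R n)).
Implicit Types (D : set V) (w u : V -> W) (Phi : 'I_m -> 'I_n.+1 -> V -> R) (M : seq W).

Lemma C1c_C1d D (phi : V -> R) : C1c D phi -> C1d phi (fun j x => derive phi x (e_ j)).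
Proof.
move=> h; split; first exact: C1c_continuous h.
by case: h => _ h j; have [hd cd] := h j; split => // x; exact/derivableP.
Qed.

Lemma compact_closedV (K : set V) : compact K -> closed K.
Proof. exact: (compact_closed (@norm_hausdorff _ _)). Qed.

Lemma testfield_supp D Phi al : testfield D Phi -> exists S : 'I_n.+1 -> set V,
  forall i, [/\ compact (S i), S i `<=` D & forall y, ~ S i y -> Phi al i y = 0].
Proof.
move=> [h _]; have Sf i : exists S : set V, [/\ compact S, S `<=` D & forall y : V, ~ S y -> Phi al i y = 0].
  by have [[S [cS [SD S0]]] _] := h al i; exists S.
by have [S hS] := choice Sf; exists S.
Qed.

(** The test field, not the function, is split. Each [chi i] times Phi is again a test field on
    [Dp i] because |chi i| is at most 1, its pairing with [w] equals that with [wp i], and the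
    divergences add up to that of Phi since the [chi i] sum to 1. *)
Lemma TVfin_glue D (N : nat) (Dp S : 'I_N -> set V) (wp : 'I_N -> V -> W) (chi : 'I_N -> V -> R) dchi w :
  bmeas w -> (forall i, bmeas (wp i)) ->
  (forall i, C1d (chi i) (dchi i)) -> (forall i x, `|chi i x| <= 1) ->
  (forall x, D x -> \sum_(i < N) chi i x = 1) ->
  (forall i, closed (S i)) -> (forall i x, ~ S i x -> chi i x = 0) -> (forall i x, S i x -> D x -> Dp i x) ->
  (forall i, leb (S i `&` D `&` [set x | w x <> wp i x]) = 0%E) ->
  (forall i, TVfin (Dp i) (wp i)) -> TVfin D w.
Proof.
move=> bw bwp C1chi chi1 chisum cS chi0 SDp wS hTV.
have [C hC] := choice hTV.
exists (\sum_(i < N) C i) => Phi hPhi.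
pose P i al j x := chi i x * Phi al j x.
have C1P i al j : C1d (P i al j) (fun k x => chi i x * derive (Phi al j) x (e_ k) + Phi al j x * dchi i k x).
  exact: (C1dM (C1chi i) (C1c_C1d (hPhi.1 al j))).
have tP i : testfield (Dp i) (P i).
  split => [al j|x]; last first.
    apply: le_trans (hPhi.2 x); apply: ler_sum => al _; apply: ler_sum => j _.
    by rewrite /P exprMn ler_piMl ?sqr_ge0// -[leRHS](expr1n _ 2) -real_normK ?num_real// lerXn2r ?nnegrE// chi1.
  have [[K [cK [KD K0]]] _] := hPhi.1 al j.
  apply: (C1d_C1c (K := S i `&` K) (C1P i al j)).
  - by rewrite setIC; apply: compact_closedI.
  - by move=> x [Sx /KD]; exact: SDp.
  - move=> x /not_andP[/chi0|/K0]; rewrite /P => ->; by rewrite ?mul0r ?mulr0.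
have tPD i : testfield D (P i).
  split => [al j|x]; last exact: (tP i).2.
  have [[K [cK [KD K0]]] _] := hPhi.1 al j.
  apply: (C1d_C1c (K := K) (C1P i al j)) => // x /K0; rewrite /P => ->; by rewrite mulr0.
have -> : Tint w Phi = \sum_(i < N) Tint w (P i).
  rewrite exchange_big/=; apply: eq_bigr => al _; rewrite -J_sum; last by move=> i; exact: (bmeas_bcs al bw (tPD i)).
  congr J; apply/funext => x; rewrite -mulr_sumr; congr (_ * _).
  rewrite /divg exchange_big/=; apply: eq_bigr => j _.
  have := C1d_sum (index_enum 'I_N) (fun i => C1P i al j).
  rewrite (_ : (fun x => _) = Phi al j).
    move=> [_ /(_ j)[/(_ x)[_ ->]]] _; apply: eq_bigr => i _.
    by case: (C1P i al j) => _ /(_ j)[/(_ x)[_ ->]].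
  apply/funext => y; rewrite /P -mulr_suml.
  have [Dy|Dy] := pselect (D y); first by rewrite chisum// mul1r.
  by have [[K [cK [KD K0]]] _] := hPhi.1 al j; rewrite K0 ?mulr0// => /KD.
apply: ler_sum => i _; apply: le_trans (hC i _ (tP i)).
rewrite le_eqVlt; apply/orP; left; apply/eqP.
apply: eq_bigr => al _; apply: J_ae; [exact: (bmeas_bcs al bw (tPD i))|exact: (bmeas_bcs al (bwp i) (tPD i))|].
have [K hK] := testfield_supp al hPhi.
apply: leb_sub0 (wS i) => x /= neq.
have div0 : ~ (S i x /\ D x) -> divg (P i al) x = 0.
  move=> nSD; rewrite /divg big1// => j _.
  have [cK KD K0] := hK j.
  apply: (@derive_off _ _ (P i al j) (S i `&` K j)).
  - by apply: closedI => //; exact: compact_closedV.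
  - by move=> y /not_andP[/chi0|/K0]; rewrite /P => ->; rewrite ?mul0r ?mulr0.
  - by move=> [Sx /KD Dx]; apply: nSD.
split; last by move=> e; apply: neq; rewrite e.
by apply: contrapT => /div0 e; apply: neq; rewrite e !mulr0.
Qed.

Lemma derive_shift (f : V -> R) x v z : is_derive (x + z) v f (derive f (x + z) v) ->
  is_derive x v (fun y => f (y + z)) (derive f (x + z) v).
Proof.
move=> h; apply: is_derive_line0.
have := @is_derive_line _ _ f (x + z) v (derive f (x + z) v) 0.
rewrite scale0r addr0 => /(_ h); congr is_derive.
by apply/funext => s; rewrite addrAC.
Qed.

Lemma continuous_shiftV (z : V) : continuous (fun x : V => x + z).
Proof.
move=> x; apply: (proj2 (@cvg_enorm R _ _ (nbhs x) (nbhs_filter x) (fun y => y + z) (x + z))).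
rewrite (_ : (fun t => _) = (fun t => enorm (t - x))); first exact: cvg_enorm_id.
by apply/funext => t; rewrite opprD addrACA subrr addr0.
Qed.

Lemma C1c_shift D (phi : V -> R) z : C1c [set x | D (x - z)] phi -> C1c D (fun x => phi (x + z)).
Proof.
move=> h; have [[K [cK [KD K0]]] hd] := h.
have [B KB] := compact_enorm_bounded cK.
pose K' : set V := [set x | K (x + z)].
have ct := @continuous_shiftV z.
have cK' : compact K'.
  apply: (@compact_closed_enorm _ _ _ (B + enorm z)).
    apply: (@preimage_closed _ _ (fun x : V => x + z) K); last exact: compact_closedV.
    by move=> x _; exact: ct.
  by move=> x /KB h1; rewrite -{1}(addrK z x) (le_trans (enormD _ _))// enormN lerD2r.
have cphi := C1c_C1d h.
apply: (@C1d_C1c _ _ _ (fun j x => derive phi (x + z) (e_ j)) D K'); [|exact: cK'| |].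
- split; first by move=> x; apply: (@continuous_comp _ _ _ (fun x : V => x + z) phi x); [exact: ct|exact (cphi.1 _)].
  move=> j; split; first by move=> x; apply: derive_shift; case: (cphi.2 j).
  move=> x; apply: (@continuous_comp _ _ _ (fun x : V => x + z) (fun x => derive phi x (e_ j)) x); [exact: ct|].
  exact ((cphi.2 j).2 _).
- by move=> x /KD /=; rewrite addrK.
- by move=> x /K0.
Qed.

Lemma TVfin_shift D w z : bmeas w -> TVfin D w -> TVfin [set x | D (x - z)] (fun x => w (x - z)).
Proof.
move=> bw [C hC]; exists C => Phi hPhi.
pose P al i x := Phi al i (x + z).
have tP : testfield D P by split => [al i|x]; [exact: (C1c_shift (hPhi.1 al i))|exact: hPhi.2].
apply: le_trans (hC _ tP); rewrite le_eqVlt; apply/orP; left; apply/eqP; apply: eq_bigr => al _.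
rewrite -[RHS](J_shift (- z)); last exact: (bmeas_bcs al bw tP).
congr J; apply/funext => x; congr (_ * _); apply: eq_bigr => i _.
have [_ /(_ i)[h _]] := C1c_C1d (hPhi.1 al i).
have := derive_shift (x := x - z) (z := z); rewrite subrK => /(_ _ _ (h x))[_ <-].
by [].
Qed.

(** Representatives defined everywhere with values in M, whereas [BVM] constrains a function only
    almost everywhere on D. *)
Definition Mfun M w := (forall x, w x \in M) /\ forall a, lmeas (w @^-1` [set a]).

Lemma Mfun_preim M w (U : set W) : Mfun M w -> lmeas (w @^-1` U).
Proof.
move=> [wM mw]; rewrite (_ : _ @^-1` _ = \bigcup_(a in [set` M] `&` U) (w @^-1` [set a])).
  apply: (@fin_bigcup_measurable _ mV); last by move=> a _; exact: mw.
  by apply: finite_setIl; exact: finite_seq.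
by apply/seteqP; split => x /=; [move=> Ux; exists (w x) => //; split => //=; exact: wM|move=> [a [_ Ua] /= ->]].
Qed.

Lemma Mfun_bmeas M w : Mfun M w -> bmeas w.
Proof.
move=> hw; split; last by move=> al _ Y mY; rewrite setTI; exact: (@Mfun_preim M w [set v | Y (v ord0 al)] hw).
exists (\sum_(a <- M) enorm a) => x al; apply: (le_trans (coord_le_enorm _ _)).
rewrite (big_rem (w x)) ?lerDl; last exact: hw.1.
by apply: sumr_ge0 => a _; exact: enorm_ge0.
Qed.

Lemma totvar_term D w u Phi al : open D -> bmeas w -> testfield D Phi -> leb (D `&` [set x | u x <> w x]) = 0%E ->
  sointeg leb (fun x => if x \in D then u x ord0 al * divg (Phi al) x else 0) =
  (J (fun x => w x ord0 al * divg (Phi al) x))%:E.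
Proof.
move=> oD bw hPhi uw; rewrite -JE; last exact: (bmeas_bcs al bw hPhi).
apply: sointeg_ae; apply: leb_sub0 uw => x /=; have [Dx|Dx] := pselect (D x).
  by rewrite mem_set// => h; split => // e; apply: h; rewrite e.
rewrite memNset// => h; case: h.
have [S hS] := testfield_supp al hPhi.
rewrite (@divg_off _ _ D (Phi al) x S) ?mulr0// => i; have [cS SD S0] := hS i => //; last by move=> /SD.
exact: compact_closedV.
Qed.

(** Divergences of test fields vanish off D, so the restriction to D inside [totvar] may be dropped
    and [u] replaced by its representative. *)
Lemma totvarE D w u : open D -> bmeas w -> leb (D `&` [set x | u x <> w x]) = 0%E ->
  (totvar D u < +oo)%E <-> TVfin D w.
Proof.
move=> oD bw uw.
have tE Phi : testfield D Phi -> (\sum_(al < m) sointeg leb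
     (fun x => if x \in D then (u x ord0 al * divg (Phi al) x)%R else 0%R))%E = (Tint w Phi)%:E.
  by move=> hPhi; rewrite /Tint -sumEFin; apply: eq_bigr => al _; exact: totvar_term.
split=> [h|[C hC]]; last first.
  apply: (@le_lt_trans _ _ C%:E); last exact: ltry.
  by apply: ge_ereal_sup => _ [Phi [hPhi ->]]; rewrite tE// lee_fin hC.
have le Phi : testfield D Phi -> ((Tint w Phi)%:E <= totvar D u)%E.
  by move=> hPhi; apply: ereal_sup_ubound; exists Phi; rewrite tE.
case E : (totvar D u) h le => [r| |]//= _ le; first by exists r => Phi /le; rewrite lee_fin.
by exists 0 => Phi /le; rewrite leeNy_eq.
Qed.

(** Setting the value to [a0] off D and wherever [u] leaves M alters [u] on a null part of D
    only. *)
Lemma BVM_rep M D u a0 : a0 \in M -> open D -> BVM M D u ->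
  exists w, [/\ Mfun M w, leb (D `&` [set x | u x <> w x]) = 0%E & TVfin D w].
Proof.
move=> a0M oD [mu uM _ tv].
pose w x := if (x \in D) && (u x \in M) then u x else a0.
have mD : measurable (D : set mV) by exact: measurable_open.
have mDu a : measurable ((D `&` u @^-1` [set a]) : set mV).
  have -> : D `&` u @^-1` [set a] = D `\` (D `&` u @^-1` (~` [set a])).
    apply/seteqP; split => x /= [Dx ux]; split => //; first by move=> [_].
    by apply: contrapT => h; apply: ux.
  apply: measurableD => //; apply: (mu (~` [set a])); apply: closed_openC.
  by apply: (compact_closed (@norm_hausdorff _ _)); exact: compact_set1.
have hw : Mfun M w.
  split=> [x|a]; first by rewrite /w; case: ifP => // /andP[].
  have [aM|aM] := boolP (a \in M); last first.
    rewrite (_ : _ @^-1` _ = set0); first exact: (@measurable0 _ mV).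
    rewrite -subset0 => x /= wa; move: aM; rewrite -wa /w; case: ifP => [/andP[_ ->]//|_]; by rewrite a0M.
  have [->|aa0] := eqVneq a a0.
    rewrite (_ : _ @^-1` _ = ~` (\bigcup_(b in [set` M] `&` [set b | b <> a0]) (D `&` u @^-1` [set b]))).
      apply: (@measurableC _ mV); apply: (@fin_bigcup_measurable _ mV) => //.
      by apply: finite_setIl; exact: finite_seq.
    apply/seteqP; split => x /=.
      by move=> wx [b [bM ba] [Dx /= ux]]; apply: ba; rewrite -wx /w (mem_set Dx) ux /= bM.
    move=> h; rewrite /w; case: ifP => // /andP[/set_mem Dx uxM].
    by apply: contrapT => ne; apply: h; exists (u x).
  rewrite (_ : _ @^-1` _ = D `&` u @^-1` [set a]); first exact: mDu.
  apply/seteqP; split => x /=.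
    by rewrite /w; case: ifP => [/andP[/set_mem Dx _] //|_ e]; move: aa0; rewrite e eqxx.
  by move=> [Dx ux]; rewrite /w (mem_set Dx) ux aM.
have uw : leb (D `&` [set x | u x <> w x]) = 0%E.
  apply: leb_sub0 uM => x /= [Dx]; rewrite /w (mem_set Dx)/=; by case: ifPn.
by exists w; split => //; apply/(totvarE oD (Mfun_bmeas hw) uw).
Qed.

Lemma BVM_of_rep M D u w (K : R) : open D -> (forall x, D x -> enorm x <= K) -> Mfun M w ->
  leb (D `&` [set x | u x <> w x]) = 0%E -> TVfin D w -> BVM M D u.
Proof.
move=> oD DK hw uw tv; have bw := Mfun_bmeas hw.
have mD : measurable (D : set mV) by exact: measurable_open.
split.
- move=> U oU; pose N := D `&` [set x | u x <> w x].
  have mN A : measurable ((N `&` A) : set mV) by apply: lmeas_null; apply: leb_sub0 uw; exact: subIsetl.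
  have -> : D `&` u @^-1` U = ((D `&` w @^-1` U) `\` N) `|` (N `&` u @^-1` U).
    apply/seteqP; split => x /=.
      move=> [Dx Ux]; have [e|e] := pselect (u x = w x); last by right.
      by left; split; [split => //=; rewrite /preimage /= -e|move=> [_]].
    move=> [[[Dx wU] nN]|[[Dx _] Ux]]//; split => //.
    by rewrite /preimage /=; have [->//|e] := pselect (u x = w x); case: nN.
  apply: (@measurableU _ mV) => //; apply: (@measurableD _ mV).
    by apply: (@measurableI _ mV) => //; exact: (Mfun_preim _ hw).
  by have := mN setT; rewrite setIT.
- apply: leb_sub0 uw => x /= [Dx uM]; split => // e; move: uM.
  by rewrite e hw.1.
- have [[B wB] mw] := bw.
  pose f (x : V) : \bar R := if x \in D then (enorm (w x))%:E else 0%E.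
  rewrite (@ointeg_ae _ _ _ f); last first.
    apply: leb_sub0 uw => x /=; rewrite /f; case: ifPn => [/set_mem Dx h|//]; split => // e.
    by apply: h; rewrite e.
  pose h (x : V) : R := \1_D x * enorm (w x).
  have bh : bcs h.
    have bD := bcs_indic mD DK.
    rewrite (_ : h = fun x => enorm (w x) * \1_D x); last by apply/funext => x; rewrite mulrC.
    apply: (bcsMl (C := \sum_(a <- M) enorm a)); [|  |exact: bD].
      by move=> _ Y mY; rewrite setTI; exact: (Mfun_preim (fun v => Y (enorm v)) hw).
    move=> x; rewrite ger0_norm ?enorm_ge0// (big_rem (w x)) ?lerDl; last exact: hw.1.
    by apply: sumr_ge0 => a _; exact: enorm_ge0.
  have -> : f = EFin \o h.
    apply/funext => x; rewrite /f /h /= indicE; case: ifP => _; by rewrite ?mul1r ?mul0r.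
  rewrite ointegE; last 2 first.
  - by apply/measurable_EFinP; case: bh.
  - by move=> x; rewrite lee_fin mulr_ge0 ?enorm_ge0.
  by rewrite -sointegE ?JE ?ltry//; case: bh.
by apply/(totvarE oD bw uw).
Qed.
End Rep.

(** * Approximate limits and jump points *)

Section Jumps.
Variables (R : realType) (n m : nat).
Local Notation V := 'rV[R]_n.+1.
Local Notation W := 'rV[R]_m.
Local Notation leb := (@leb_out R n.+1).
Local Notation mV := (caratheodory_type (oleb R n)).
Implicit Types (D : set V) (w u : V -> W) (M : seq W) (g : V -> W -> V -> R) (nu x z : V).

Definition eball x (r : R) : set V := [set y | enorm (y - x) < r].

Lemma leb_le (A B : set V) : A `<=` B -> (leb A <= leb B)%E.
Proof. exact: (le_outer_measure (oleb R n)). Qed.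

Lemma open_eball x (r : R) : open (eball x r).
Proof. by apply: open_gtf; exact: continuous_enormB. Qed.

Lemma eball_fin x (r : R) : leb (eball x r) \is a fin_num.
Proof.
rewrite ge0_fin_numE ?leb_out_ge0//; apply: (@leb_bounded_fin _ _ _ (r + enorm x)) => y /= h.
by rewrite (le_trans (enorm_leD y x))// lerD2r ltW.
Qed.

Definition vball : R := fine (leb (eball 0 1)).

Lemma vball_gt0 : 0 < vball.
Proof. by rewrite -lte_fin fineK ?eball_fin//; exact: leb_ball_gt0. Qed.

Lemma leb_eball x (r : R) : 0 < r -> leb (eball x r) = (vball * r ^+ n.+1)%:E.
Proof.
move=> r0.
have -> : eball x r = [set y | [set y' | eball 0 1 (r^-1 *: y')] (y + (- x))].
  apply/seteqP; split => y /=; rewrite /eball /= subr0 enormZ gtr0_norm ?invr_gt0//;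
  by rewrite ltr_pdivrMl// mulr1.
rewrite leb_shift leb_scale ?invr_gt0// exprVn invrK -(fineK (eball_fin _ _)) -EFinM mulrC.
by [].
Qed.

Lemma halfball_sub x nu (r : R) pos : halfball x nu r pos `<=` eball x r.
Proof. by move=> y []. Qed.

Lemma halfball_fin x nu (r : R) pos (A : set V) : leb (halfball x nu r pos `&` A) \is a fin_num.
Proof.
rewrite ge0_fin_numE ?leb_out_ge0//; apply: (@le_lt_trans _ _ (leb (eball x r))).
  by apply: leb_le => y [/halfball_sub].
by rewrite -ge0_fin_numE ?leb_out_ge0// eball_fin.
Qed.

(** The sign by which both half balls become one formula, see [halfballP]. *)
Definition sg (pos : bool) : R := if pos then 1 else -1.

Lemma halfballP x nu (r : R) pos y : halfball x nu r pos y <-> enorm (y - x) < r /\ 0 < sg pos * dotv (y - x) nu.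
Proof.
rewrite /halfball /sg /=; case: pos; rewrite ?mul1r// mulN1r oppr_gt0//.
Qed.

Lemma halfball_ball x nu (r : R) pos p (rho : R) : sphere nu -> 0 < r -> enorm p + rho <= 1 ->
  rho <= sg pos * dotv p nu -> eball (x + r *: p) (r * rho) `<=` halfball x nu r pos.
Proof.
move=> nu1 r0 p1 p2 y yp; apply/halfballP.
have -> : y - x = r *: p + (y - (x + r *: p)) by apply/rowP => i; rewrite !mxE; ring.
set q := y - _ in yp *.
have qr : enorm q < r * rho by exact: yp.
split.
  apply: (le_lt_trans (enormD _ _)); rewrite enormZ gtr0_norm//.
  by apply: (@lt_le_trans _ _ (r * enorm p + r * rho)); [rewrite ltrD2l|rewrite -mulrDr ler_piMr// ltW].
rewrite dotvDl dotvZl mulrDr mulrCA.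
have h : - enorm q <= sg pos * dotv q nu.
  have := dotv_CS q nu; rewrite nu1 mulr1 ler_norml => /andP[? ?].
  by rewrite /sg; case: pos p2 => _; rewrite ?mul1r ?mulN1r// lerN2.
have : r * rho <= r * (sg pos * dotv p nu) by rewrite ler_pM2l.
by move: h qr; move: (enorm q) (sg pos * dotv q nu) (r * rho) (r * (sg pos * dotv p nu)) => a b c d; clear; lra.
Qed.

(** The density condition freed from the quotient: the exceptional part of the half ball is compared
    with a power of the radius. *)
Lemma aplim_fact w x nu pos a (eps eta : R) : aplim_half w x nu pos a -> 0 < eps -> 0 < eta ->
  exists2 r0, 0 < r0 & forall r, 0 < r -> r < r0 ->
   (leb (halfball x nu r pos `&` [set y | (eps < enorm (w y - a))%R]) <= (eta * r ^+ n.+1)%:E)%E.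
Proof.
move=> ha eps0 eta0.
have e0 : 0 < eta / vball by rewrite divr_gt0 ?vball_gt0.
have /cvgr0Pnorm_lt/(_ _ e0) := ha _ eps0; rewrite near_withinE => /nbhs_ballP[r0 /= r00 h].
exists r0 => // r rpos rr0; have := h r; rewrite /ball/= sub0r normrN gtr0_norm// => /(_ rr0 rpos).
set A := leb (_ `&` _); set B := leb (halfball _ _ _ _).
have fA : A \is a fin_num by exact: halfball_fin.
have fB : B \is a fin_num by rewrite /B -(setIT (halfball _ _ _ _)); exact: halfball_fin.
have A0 : 0 <= fine A by rewrite fine_ge0// leb_out_ge0.
have B0 : 0 <= fine B by rewrite fine_ge0// leb_out_ge0.
have Bv : fine B <= vball * r ^+ n.+1.
  rewrite -lee_fin fineK// -(leb_eball x rpos); apply: leb_le; exact: halfball_sub.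
rewrite -(fineK fA) lee_fin ger0_norm ?divr_ge0// => hlt.
(* A quotient by 0 is 0 and would say nothing, but then the smaller set is null as well. *)
have [B00|Bn0] := eqVneq (fine B) 0.
  have : (A <= B)%E by apply: leb_le; exact: subIsetl.
  rewrite -(fineK fA) -(fineK fB) lee_fin B00 => /le_trans; apply.
  by rewrite mulr_ge0 ?exprn_ge0// ltW.
have Bp : 0 < fine B by rewrite lt_def Bn0.
move: hlt; rewrite ltr_pdivrMr// => /ltW/le_trans; apply.
rewrite mulrAC ler_pdivrMr ?vball_gt0// -mulrA ler_wpM2l//; first exact: ltW.
by rewrite mulrC.
Qed.

(** At every scale r the two half balls share a ball of radius rho r. If a and a' differ, each of
    its points is far from one of them, yet the two exceptional sets fill at most two thirds of that
    ball. *)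
Lemma aplim_meet w x nu pos a nu' pos' a' p (rho : R) : sphere nu -> sphere nu' ->
  aplim_half w x nu pos a -> aplim_half w x nu' pos' a' -> 0 < rho -> enorm p + rho <= 1 ->
  rho <= sg pos * dotv p nu -> rho <= sg pos' * dotv p nu' -> a = a'.
Proof.
move=> nu1 nu1' h h' rho0 p1 pn pn'; apply/eqP; apply: contraT => aa.
have e0 : 0 < enorm (a - a') / 3 by rewrite divr_gt0// lt_def enorm_eq0 subr_eq0 aa enorm_ge0.
pose eta := vball * rho ^+ n.+1 / 3.
have eta0 : 0 < eta by rewrite divr_gt0// mulr_gt0 ?vball_gt0// exprn_gt0.
have [r1 r10 h1] := aplim_fact h e0 eta0; have [r2 r20 h2] := aplim_fact h' e0 eta0.
pose r := Num.min r1 r2 / 2.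
have m0 : 0 < Num.min r1 r2 by rewrite lt_min r10.
have r0 : 0 < r by rewrite divr_gt0.
have rr : r < Num.min r1 r2 by rewrite /r ltr_pdivrMr// ltr_pMr// ltr1n.
have {}h1 := h1 _ r0 (lt_le_trans rr (_ : Num.min r1 r2 <= r1)).
have {}h2 := h2 _ r0 (lt_le_trans rr (_ : Num.min r1 r2 <= r2)).
rewrite ge_min lexx in h1; have {}h1 := h1 isT; rewrite ge_min lexx orbT in h2; have {}h2 := h2 isT.
have sub : eball (x + r *: p) (r * rho) `<=`
   (halfball x nu r pos `&` [set y | enorm (a - a') / 3 < enorm (w y - a)]) `|`
   (halfball x nu' r pos' `&` [set y | enorm (a - a') / 3 < enorm (w y - a')]).
  move=> y hy; have [l|l] := ltP (enorm (a - a') / 3) (enorm (w y - a)).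
    by left; split => //; exact: (halfball_ball nu1 r0 p1 pn).
  right; split; first exact: (halfball_ball nu1' r0 p1 pn').
  have := enorm_sub_le a (w y) a'; rewrite (enormB a (w y)) /=; move: l e0; clear; lra.
have := le_trans (leb_le sub) (le_trans (outer_measureU2 (oleb R n) _ _) (leeD h1 h2)).
rewrite leb_eball ?mulr_gt0// -EFinD lee_fin exprMn /eta.
have : 0 < vball * rho ^+ n.+1 * r ^+ n.+1 by rewrite !mulr_gt0 ?vball_gt0 ?exprn_gt0.
by clear; lra.
Qed.

Lemma sphere_dot nu : sphere nu -> dotv nu nu = 1.
Proof. by move=> h; rewrite -sqr_enorm h expr1n. Qed.

Lemma sg_sq pos : sg pos * sg pos = 1.
Proof. by rewrite /sg; case: pos; rewrite ?mulr1 ?mulrNN ?mulr1. Qed.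

Lemma aplim_same w x nu pos a a' : sphere nu -> aplim_half w x nu pos a -> aplim_half w x nu pos a' -> a = a'.
Proof.
move=> nu1 h h'.
have e : sg pos * dotv ((sg pos / 2) *: nu) nu = 1 / 2 by rewrite dotvZl sphere_dot// mulr1 mulrA sg_sq.
apply: (@aplim_meet _ _ _ _ _ _ _ _ ((sg pos / 2) *: nu) (1 / 2) nu1 nu1 h h') => //; rewrite ?e//.
rewrite enormZ nu1 mulr1 normrM normfV (gtr0_norm (ltr0n _ 2)).
by rewrite /sg; case: pos h h' e => *; rewrite ?normrN normr1; lra.
Qed.

Lemma aplim_ae u w x (r0 : R) nu pos a : 0 < r0 -> leb (eball x r0 `&` [set y | u y <> w y]) = 0%E ->
  aplim_half u x nu pos a -> aplim_half w x nu pos a.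
Proof.
move=> r00 uw h eps /h hcv; apply: cvg_trans hcv; apply: near_eq_cvg.
near=> r; have rr : r < r0 by near: r; exact: nbhs_right_lt.
congr (fine _ / _).
have key (f f' : V -> W) : leb (eball x r0 `&` [set y | f y <> f' y]) = 0%E ->
   (leb (halfball x nu r pos `&` [set y | (eps < enorm (f y - a))%R]) <=
    leb (halfball x nu r pos `&` [set y | (eps < enorm (f' y - a))%R]))%E.
  move=> h0; rewrite -[leRHS]adde0 -h0; apply: le_trans (outer_measureU2 (oleb R n) _ _).
  apply: leb_le => y [hy /= e]; have [ff|ff] := pselect (f y = f' y); first by left; split => //=; rewrite -ff.
  by right; split => //; have /= := halfball_sub hy; move=> h1; apply: lt_trans rr.
apply/eqP; rewrite eq_le; apply/andP; split; apply: key => //.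
by rewrite -uw; congr (leb (_ `&` _)); apply/seteqP; split => y /= /nesym.
Unshelve. all: by end_near. Qed.

Lemma ae_sym u w (A : set V) : leb (A `&` [set y | u y <> w y]) = 0%E -> leb (A `&` [set y | w y <> u y]) = 0%E.
Proof. by move=> <-; congr (leb (_ `&` _)); apply/seteqP; split => y /= /nesym. Qed.

Lemma jt_ae u w x (r0 : R) um up nu : 0 < r0 -> leb (eball x r0 `&` [set y | u y <> w y]) = 0%E ->
  jumptriple u x um up nu -> jumptriple w x um up nu.
Proof. by move=> r00 uw [h1 h2 h3 h4]; split; [exact: h1|exact: h2|exact: (aplim_ae r00 uw h3)|exact: (aplim_ae r00 uw h4)]. Qed.

Lemma jdens_ae g u w x (r0 : R) : 0 < r0 -> leb (eball x r0 `&` [set y | u y <> w y]) = 0%E ->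
  jdens g u x = jdens g w x.
Proof.
move=> r00 uw; rewrite /jdens; apply: congr1; apply/seteqP; split => e [um [up [nu [h ->]]]]; exists um, up, nu.
  by split; [exact: (jt_ae r00 uw h)|reflexivity].
by split; [exact: (jt_ae r00 (ae_sym uw) h)|reflexivity].
Qed.

Lemma jt_const w x (r0 : R) c um up nu : 0 < r0 -> leb (eball x r0 `&` [set y | w y <> c]) = 0%E ->
  ~ jumptriple w x um up nu.
Proof.
move=> r00 wc /(jt_ae (w := fun=> c) r00 wc)[nu1 ne hp hm].
have hc pos : aplim_half (fun=> c) x nu pos c.
  move=> eps e0; rewrite (_ : (fun r => _) = fun=> 0); first exact: cvg_cst.
  apply/funext => r; rewrite (_ : _ `&` _ = set0) ?leb_out0 ?mul0r//.
  by rewrite -subset0 => y [_ /=]; rewrite subrr enorm0 ltNge (ltW e0).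
by move/negP: ne; apply; rewrite (aplim_same nu1 hp (hc true)) (aplim_same nu1 hm (hc false)).
Qed.

(** The value -oo exceeds no level s > 0, so such points are invisible to [ointeg]. *)
Lemma jdens_const g w x (r0 : R) c : 0 < r0 -> leb (eball x r0 `&` [set y | w y <> c]) = 0%E ->
  jdens g w x = -oo%E.
Proof.
move=> r00 wc; rewrite /jdens (_ : mkset _ = set0) ?ereal_sup0// -subset0 => e [um [up [nu [h _]]]].
exact: (jt_const r00 wc h).
Qed.

Lemma jdens_le g w x (c : R) : (forall z zeta nu, sphere nu -> g z zeta nu <= c) -> (jdens g w x <= c%:E)%E.
Proof. by move=> gc; apply: ge_ereal_sup => _ [um [up [nu [[h _ _ _] ->]]]]; rewrite lee_fin gc. Qed.

Lemma halfball_shift x nu (r : R) pos z : halfball (x + z) nu r pos = [set y | halfball x nu r pos (y - z)].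
Proof. by apply/seteqP; split => y /=; rewrite /halfball /= opprD addrA addrAC. Qed.

Lemma aplim_shift w x nu pos a z : aplim_half (fun y => w (y - z)) (x + z) nu pos a -> aplim_half w x nu pos a.
Proof.
move=> h eps /h; suff -> : (fun r : R => fine (leb (halfball (x + z) nu r pos `&` [set y | eps < enorm (w (y - z) - a)]))
   / fine (leb (halfball (x + z) nu r pos))) = (fun r : R => fine (leb (halfball x nu r pos `&` [set y | eps < enorm (w y - a)]))
   / fine (leb (halfball x nu r pos))) by [].
apply/funext => r; rewrite halfball_shift.
apply: (congr2 (fun u v : \bar R => fine u / fine v)); last exact: (@leb_shift _ _ (halfball x nu r pos) (- z)).
exact: (@leb_shift _ _ (halfball x nu r pos `&` [set y | eps < enorm (w y - a)]) (- z)).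
Qed.

Lemma jdens_shift g w x z : (jdens g (fun y => w (y - z)%R) x <= jdens (fun y => g (y + z)%R) w (x - z)%R)%E.
Proof.
apply: ge_ereal_sup => _ [um [up [nu [[h1 h2 h3 h4] ->]]]]; apply: ereal_sup_ubound.
exists um, up, nu; split; last by rewrite subrK.
by split; [exact: h1|exact: h2| |]; apply: (aplim_shift (z := z)); rewrite subrK; [exact: h3|exact: h4].
Qed.
End Jumps.

(** * Layer-cake integrals against outer measures *)

Section Monotone.
Variable R : realType.
(** The measure of the superlevel set decreases with the level, so the outer integral in [ointeg]
    has a measurable integrand whatever the function. *)
Lemma noninc_measurable (h : R -> \bar R) : {homo h : x y / x <= y >-> (y <= x)%E} -> measurable_fun setT h.
Proof.
move=> hh; apply: (measurability _ (ErealGenOInfty.measurableE R)).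
move=> _ [_ [c ->] <-]; rewrite setTI; apply: is_interval_measurable => s t /= hs ht r /andP[sr rt].
move: ht; rewrite /preimage /= !in_itv/= !andbT => ht.
exact: lt_le_trans ht (hh _ _ rt).
Qed.

Lemma ointeg_measurable T (mu : {outer_measure set T -> \bar R}) (f : T -> \bar R) (D : set R) :
  measurable_fun D (fun s : R => mu [set x | (s%:E < f x)%E]).
Proof.
apply: (@measurable_funS _ _ _ _ setT) => //; apply: noninc_measurable => s t st.
by apply: le_outer_measure => x /=; apply: le_lt_trans; rewrite lee_fin.
Qed.

Lemma measurable_pos : measurable [set s : R | 0 < s].
Proof. by rewrite (_ : [set s | _] = `]0, +oo[%classic)//; apply/seteqP; split => s /=; rewrite in_itv/= andbT. Qed.

Lemma ointeg_ge0 T (mu : {outer_measure set T -> \bar R}) (f : T -> \bar R) : (0 <= ointeg mu f)%E.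
Proof. by apply: integral_ge0 => s _; exact: outer_measure_ge0. Qed.

Lemma ointeg_mono T (mu : {outer_measure set T -> \bar R}) (f f' : T -> \bar R) :
  (forall x, (f x <= f' x)%E) -> (ointeg mu f <= ointeg mu f')%E.
Proof.
move=> ff; apply: ge0_le_integral; [exact: measurable_pos| | | |].
- by move=> s _; exact: outer_measure_ge0.
- exact: ointeg_measurable.
- exact: ointeg_measurable.
- by move=> s _; apply: le_outer_measure => x /= h; apply: lt_le_trans (ff x).
Qed.

(** The inequality behind gluing: the energy is at most the sum of the energies of the pieces plus c
    times the measure of the mismatch [S]. It is subadditivity level by level; levels from c upwards
    do not see [S]. *)
Lemma ointeg_cover T (mu : {outer_measure set T -> \bar R}) (f : T -> \bar R) (N : nat)
   (F : 'I_N -> T -> \bar R) (S : set T) (c : R) : 0 <= c ->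
  (forall x, (f x <= 0)%E \/ (exists i, (f x <= F i x)%E) \/ (S x /\ (f x <= c%:E)%E)) ->
  (ointeg mu f <= \sum_(i < N) ointeg mu (F i) + c%:E * mu S)%E.
Proof.
move=> c0 H.
pose G (s : R) : \bar R := if (s < c)%R then mu S else 0%E.
have G0 s : (0 <= G s)%E by rewrite /G; case: ifP => _ //; exact: outer_measure_ge0.
have mG : measurable_fun [set s : R | 0 < s] G.
  apply: (@measurable_funS _ _ _ _ setT) => //; apply: noninc_measurable => s t st; rewrite /G.
  case: ltP => tc; first by rewrite (le_lt_trans st tc).
  by case: ifP => _ //; exact: outer_measure_ge0.
have iG : (\int[lebesgue_measure]_(s in [set s : R | (0 < s)%R]) G s <= c%:E * mu S)%E.
  apply: (@le_trans _ _ (\int[lebesgue_measure]_(s in `]0%R, c[) mu S)%E); last first.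
    rewrite integral_cst//= lebesgue_measure_itv/= lte_fin muleC; case: ifP => [_|]; first by rewrite sube0.
    by rewrite mul0e => _; rewrite mule_ge0// outer_measure_ge0.
  rewrite integral_mkcond [leRHS]integral_mkcond; apply: ge0_le_integral => //.
  - by move=> s _; rewrite patchE; case: ifP.
  - by apply/measurable_restrict => //; [exact: measurable_pos|rewrite setTI].
  - by apply/measurable_restrict.
  - move=> s _; rewrite !patchE; case: ifPn => [/set_mem /= s0|_]; last by case: ifP => _ //; exact: outer_measure_ge0.
    rewrite /G; case: ltP => sc; first by rewrite ifT// inE /= in_itv/= s0.
    by case: ifP => _ //; exact: outer_measure_ge0.
apply: (@le_trans _ _ (\int[lebesgue_measure]_(s in [set s : R | (0 < s)%R])
   (\sum_(i < N) mu [set x | s%:E < F i x] + G s))%E); last first.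
  rewrite ge0_integralD; [|exact: measurable_pos| | |by []|exact: mG].
  - rewrite ge0_integral_sum; [|exact: measurable_pos| |].
    + by rewrite leeD2l.
    + by move=> i; exact: ointeg_measurable.
    + by move=> i s _; exact: outer_measure_ge0.
  - by move=> s _; apply: sume_ge0 => i _; exact: outer_measure_ge0.
  - by apply: emeasurable_sum => i; exact: ointeg_measurable.
apply: ge0_le_integral; [exact: measurable_pos| | | |].
- by move=> s _; exact: outer_measure_ge0.
- exact: ointeg_measurable.
- by apply: emeasurable_funD => //; apply: emeasurable_sum => i; exact: ointeg_measurable.
move=> s /= s0; pose A i := [set x | (s%:E < F i x)%E].
apply: (@le_trans _ _ (mu ((\big[setU/set0]_(i < N) A i) `|` (if (s < c)%R then S else set0)))).
  apply: le_outer_measure => x /= sf; have [f0|[[i fi]|[Sx fc]]] := H x.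
  - by move: (lt_le_trans sf f0); rewrite lte_fin ltNge (ltW s0).
  - by left; apply/in_bigsetU; exists i; exact: lt_le_trans sf fi.
  - by right; have := lt_le_trans sf fc; rewrite lte_fin => ->.
apply: (le_trans (outer_measureU2 _ _ _)); apply: leeD; last by rewrite /G; case: ifP => _ //; rewrite outer_measure0.
have sub := @outer_measure_subadditive _ _ mu (fun i => if insub i is Some k then A k else set0) N.
have e : \big[setU/set0]_(i < N) (if insub (i : nat) is Some k then A k else set0) = \big[setU/set0]_(i < N) A i.
  by apply: eq_bigr => i _; rewrite valK.
by rewrite e in sub; apply: (le_trans sub); apply: lee_sum => i _; rewrite valK.
Qed.
End Monotone.

(** * Surface energies and cell infima *)

Section Surf.
Variables (R : realType) (n m : nat).
Local Notation V := 'rV[R]_n.+2.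
Local Notation W := 'rV[R]_m.
Local Notation leb := (@leb_out R n.+2).
Local Notation H := (@hausdorff R n.+2 n.+1).
Implicit Types (D : set V) (w u : V -> W) (M : seq W) (g : V -> W -> V -> R) (nu x z : V).

Lemma diam_shift (C : set V) z : diam [set x | C (x - z)] = diam C.
Proof.
have key (A : set V) y : (diam [set x | A (x - y)%R] <= diam A)%E.
  apply: ge_ereal_sup => _ [->|[[p q] [/= Ap Aq] <-]]; first exact: diam_ge0.
  apply: ereal_sup_ubound; right; exists (p - y, q - y)%R => //=.
  by rewrite opprB addrA subrK.
apply/eqP; rewrite eq_le key/=.
have := key [set x | C (x - z)%R] (- z); congr (diam _ <= _)%E.
by apply/seteqP; split => x /=; rewrite opprK addrK.
Qed.

Lemma hausdorff_shift (A : set V) z : H [set x | A (x - z)] = H A.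
Proof.
have key (B : set V) y : (H [set x | B (x - y)%R] <= H B)%E.
  apply: hausdorff_le => d d0; apply: (le_trans _ (hausd_delta_le n B d0)).
  apply: ereal_inf_le_tmp => e [C [h1 [h2 ->]]].
  exists (fun k => [set x | C k (x - y)%R]); split; first by move=> x /= /h1[k _ Ck]; exists k.
  by split => [k|]; [rewrite diam_shift|congr (limn _); apply/funext => N; apply: eq_bigr => k _; rewrite diam_shift].
apply/eqP; rewrite eq_le key/=.
have := key [set x | A (x - z)%R] (- z); congr (H _ <= _)%E.
by apply/seteqP; split => x /=; rewrite opprK addrK.
Qed.

(** The finite branch of [Eg]; membership in BV is recorded apart, in [admW]. *)
Definition Esurf g w D : \bar R := ointeg H (fun x => if x \in D then jdens g w x else 0%E).

Lemma Esurf_ge0 g w D : (0 <= Esurf g w D)%E.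
Proof. exact: ointeg_ge0. Qed.

Lemma open_eball_in D x : open D -> D x -> exists2 r : R, 0 < r & eball x r `<=` D.
Proof. by move=> /openE_enorm oD /oD[r r0 h]; exists r. Qed.

Lemma Esurf_ae g u w D : open D -> leb (D `&` [set x | u x <> w x]) = 0%E -> Esurf g u D = Esurf g w D.
Proof.
move=> oD uw; have e : (fun x : V => if x \in D then jdens g u x else 0%E) = (fun x : V => if x \in D then jdens g w x else 0%E).
  apply/funext => x; case: (boolP (x \in D)) => [/set_mem Dx|_]; last by [].
  have [r r0 rD] := open_eball_in oD Dx; apply: (jdens_ae g r0).
  by apply: leb_sub0 uw => y [/rD].
exact (f_equal (fun F => ointeg H F) e).
Qed.

Lemma Esurf_shift g w D z : (Esurf g (fun y => w (y - z)%R) [set x | D (x - z)%R] <= Esurf (fun y => g (y + z)%R) w D)%E.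
Proof.
apply: (@le_trans _ _ (ointeg H (fun x => if (x - z)%R \in D then jdens (fun y => g (y + z)%R) w (x - z)%R else 0%E))).
  apply: ointeg_mono => x; have -> : (x \in [set x | D (x - z)%R]) = ((x - z)%R \in D) by apply/idP/idP; rewrite !inE.
  by case: ifP => _; [exact: jdens_shift|exact: lexx].
rewrite le_eqVlt; apply/orP; left; apply/eqP; apply: eq_integral => s _.
exact: (hausdorff_shift [set x | (s%:E < (if x \in D then jdens (fun y => g (y + z)%R) w x else 0%E))%E]).
Qed.

Definition near_bdry D w (ub : V -> W) := exists U, [/\ open U, closure D `\` D `<=` U &
   leb (D `&` U `&` [set x | w x <> ub x]) = 0%E].
Definition admW M (ub : V -> W) D w := [/\ Mfun M w, TVfin D w & near_bdry D w ub].

Definition cell M g (ub : V -> W) D : \bar R := ereal_inf [set Eg M g u D | u in Adm M ub D].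

Lemma cell_le M g ub D w (K : R) : open D -> (forall x, D x -> enorm x <= K) -> admW M ub D w ->
  (cell M g ub D <= Esurf g w D)%E.
Proof.
move=> oD DK [hw tv [U [oU bU h]]].
have bv : BVM M D w.
  apply: (BVM_of_rep oD DK hw _ tv).
  by rewrite (_ : _ `&` _ = set0) ?leb_out0// -subset0 => x [_ /=].
apply: ereal_inf_lbound; exists w; last by rewrite /Eg asboolT.
by split => //; exists U; split => //; apply: leb_sub0 h => x [[Dx Ux] /= /eqP].
Qed.

(** Almost optimal competitors may be taken with values in M everywhere: passing to the
    representative changes neither the energy nor the boundary condition. *)
Lemma cell_adh M g ub D a0 (y : \bar R) : a0 \in M -> open D -> (cell M g ub D < y)%E ->
  exists2 w, admW M ub D w & (Esurf g w D < y)%E.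
Proof.
move=> a0M oD /ereal_inf_lt[_ [u [bv [U [oU bU h]]] <-]].
rewrite /Eg asboolT// => lt.
have [w [hw uw tv]] := BVM_rep a0M oD bv.
exists w; last by rewrite -(Esurf_ae _ oD uw).
split => //; exists U; split => //.
apply/eqP; rewrite eq_le leb_out_ge0 andbT -(adde0 0%E) -{1}h -uw.
apply: le_trans (outer_measureU2 (oleb R n.+1) _ _); apply: leb_le => x [[Dx Ux] /= wx].
have [e|e] := pselect (u x = w x); last by right.
by left; split => //=; apply/eqP; rewrite e.
Qed.
End Surf.

(** * Rectangles and gluing *)

Section Frames.
Variables (R : realType) (n : nat).
Local Notation V := 'rV[R]_n.+2.
Implicit Types (nu x y z : V).

Lemma Onu_w nu : (nu == - ebase R n.+2 n.+1) = false -> dotv (nu + ebase R n.+2 n.+1) (nu + ebase R n.+2 n.+1) != 0.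
Proof. by move=> h; rewrite dotvv_eq0 addr_eq0 h. Qed.

Lemma Onu_sym nu x y : dotv (Onu nu x) y = dotv x (Onu nu y).
Proof.
rewrite /Onu /=; case: ifP => _; first by rewrite dotvNl dotvNr.
rewrite dotvBl dotvBr dotvZl dotvZr; congr (_ - _).
rewrite (dotvC _ y); set D := (dotv (_ + _) (_ + _))^-1; ring.
Qed.

Lemma OnuK nu x : Onu nu (Onu nu x) = x.
Proof.
rewrite {1}/Onu /=; case: ifP => h; first by rewrite /Onu /= h opprK.
have w0 := Onu_w h; rewrite /Onu /= h; set w := nu + _ in w0 *.
have e : 2 * dotv ((2 * dotv x w / dotv w w) *: w - x) w / dotv w w = 2 * dotv x w / dotv w w.
  by rewrite dotvBl dotvZl; field.
by rewrite e opprB addrC subrK.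
Qed.

Lemma Onu_iso nu x y : dotv (Onu nu x) (Onu nu y) = dotv x y.
Proof. by rewrite Onu_sym OnuK. Qed.
Lemma enorm_Onu nu x : enorm (Onu nu x) = enorm x.
Proof. by rewrite /enorm Onu_iso. Qed.

Lemma Onu_last nu : sphere nu -> Onu nu (ebase R n.+2 n.+1) = nu.
Proof.
move=> nu1; rewrite /Onu /=; case: ifP => [/eqP -> //|h].
have w0 := Onu_w h; set e := ebase R n.+2 n.+1 in h w0 *.
have ee : dotv e e = 1 by rewrite (dotv_ebase (ord_max : 'I_n.+2)) mxE eqxx.
have nn := sphere_dot nu1.
have E : dotv (nu + e) (nu + e) = 2 * dotv e (nu + e).
  by rewrite dotvDl !dotvDr ee nn (dotvC e nu); ring.
by rewrite -E divff// scale1r addrK.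
Qed.

Lemma Onu_dot nu (j : 'I_n.+2) x : dotv x (Onu nu (ebase R n.+2 j)) = Onu nu x ord0 j.
Proof. by rewrite -Onu_sym dotv_ebase. Qed.

Definition fr nu (j : 'I_n.+2) : V := Onu nu (ebase R n.+2 j).
Lemma fr_last nu : sphere nu -> fr nu ord_max = nu.
Proof. exact: Onu_last. Qed.
Lemma fr_unit nu j : enorm (fr nu j) = 1.
Proof. by rewrite /fr enorm_Onu enorm_ebase. Qed.
Lemma fr_dot nu i j : dotv (fr nu i) (fr nu j) = (i == j)%:R.
Proof. by rewrite /fr Onu_iso dotv_ebase mxE (inj_eq val_inj) eq_sym. Qed.

Definition wid (t l : R) (j : 'I_n.+2) : R := if (j < n.+1)%N then t else l.

Lemma rectP nu (t l : R) x : sphere nu -> rect nu t l x <-> forall j, `|dotv x (fr nu j)| < wid t l j / 2.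
Proof.
move=> h; split.
  move=> [h1 h2] j; rewrite /wid; case: ltnP => jn; first exact: h2.
  have -> : j = ord_max by apply/val_inj/eqP; rewrite eqn_leq jn /= -ltnS ltn_ord.
  by rewrite fr_last.
move=> hj; split; first by have := hj ord_max; rewrite fr_last// /wid ltnn.
move=> j jn; have jn1 : (j < n.+1)%N := jn.
have jn2 : (j < n.+2)%N := ltnW jn1.
by have := hj (Ordinal jn2); rewrite /wid /= jn1.
Qed.

Definition crect nu (t l : R) : set V := [set x | forall j, `|dotv x (fr nu j)| <= wid t l j / 2].

Lemma enorm_le_fr nu x (c : R) : 0 <= c -> (forall j, `|dotv x (fr nu j)| <= c) -> enorm x <= n.+2%:R * c.
Proof.
move=> c0 h; rewrite -(enorm_Onu nu); apply: (le_trans (enorm_le_sum _)).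
apply: (@le_trans _ _ (\sum_(j < n.+2) c)); last by rewrite sumr_const card_ord mulr_natl.
by apply: ler_sum => j _; rewrite -Onu_dot; exact: h.
Qed.

Lemma crect_bounded nu (t l : R) x : 0 <= t -> 0 <= l -> crect nu t l x -> enorm x <= n.+2%:R * (t + l).
Proof.
move=> t0 l0 h; apply: (@enorm_le_fr nu); first exact: addr_ge0.
by move=> j; apply: (le_trans (h j)); rewrite /wid; case: ifP => _; lra.
Qed.

Lemma lip_dot (nu z : V) x y : `|dotv (x - z) nu - dotv (y - z) nu| <= enorm nu * enorm (x - y).
Proof. have e : x - z - (y - z) = x - y by rewrite opprB addrA subrK.
by rewrite -dotvBl e mulrC; exact: dotv_CS. Qed.

Lemma continuous_absdot nu z : continuous (fun x => `|dotv (x - z) nu|).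
Proof.
apply: (@continuous_lip _ _ _ (enorm nu)) => x y.
exact: le_trans (ler_dist_dist _ _) (lip_dot _ _ _ _).
Qed.

Lemma rectE nu (t l : R) : sphere nu -> rect nu t l = \bigcap_(j in [set: 'I_n.+2]) [set x | `|dotv (x - 0) (fr nu j)| < wid t l j / 2].
Proof. move=> h; apply/seteqP; split => x.
  by move=> /(rectP _ _ _ h) hx j _ /=; rewrite subr0.
by move=> hx; apply/(rectP _ _ _ h) => j; have := hx j I; rewrite /= subr0. Qed.

Lemma open_rect nu (t l : R) : sphere nu -> open (rect nu t l).
Proof.
move=> h; rewrite rectE// bigcap_fset_set; last exact: finite_finset.
apply: big_ind => [|A B|i _]; [exact: openT|exact: openI|].
by apply: open_gtf; exact: continuous_absdot.
Qed.

Lemma closed_crect nu (t l : R) : closed (crect nu t l).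
Proof.
rewrite (_ : crect nu t l = \bigcap_(j in [set: 'I_n.+2]) [set x | `|dotv (x - 0) (fr nu j)| <= wid t l j / 2]).
  by apply: closed_bigI => j _; apply: closed_lef; exact: continuous_absdot.
apply/seteqP; split => x hx j; first by move=> _ /=; rewrite subr0.
by have := hx j I; rewrite /= subr0.
Qed.

Lemma rect_crect nu (t l : R) : sphere nu -> rect nu t l `<=` crect nu t l.
Proof. by move=> h x /(rectP _ _ _ h) hx j; exact/ltW/hx. Qed.

Lemma crect_rect nu (t l t' l' : R) : sphere nu -> t < t' -> l < l' -> crect nu t l `<=` rect nu t' l'.
Proof.
move=> h tt ll x hx; apply/(rectP _ _ _ h) => j; apply: (le_lt_trans (hx j)).
by rewrite ltr_pM2r// /wid; case: ifP.
Qed.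

Lemma closure_rect nu (t l : R) : sphere nu -> closure (rect nu t l) `<=` crect nu t l.
Proof.
move=> h x hx; apply: (closed_crect (nu := nu) (t := t) (l := l)).
by apply: closure_subset hx; exact: rect_crect.
Qed.

(** The closed rectangle minus U is compact and, as U contains the boundary, is covered by the
    increasing open rectangles shrunk by [q k]; one of them contains it. *)
Lemma rect_collar nu (t l : R) (U : set V) : sphere nu -> 0 < t -> 0 < l -> open U ->
  closure (rect nu t l) `\` rect nu t l `<=` U ->
  exists s : R, [/\ 0 < s, s < t, s < l & forall x, rect nu t l x -> ~ rect nu (t - s) (l - s) x -> U x].
Proof.
move=> h t0 l0 oU bU.
pose K := closure (rect nu t l) `&` ~` U.
have cK : compact K.
  apply: (@compact_closed_enorm _ _ _ (n.+2%:R * (t + l))).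
    by apply: closedI; [exact: closed_closure|exact: open_closedC].
  by move=> x [/(closure_rect h) hx _]; apply: crect_bounded hx; exact: ltW.
(* At most half of the smaller side, so that the shrunk sides stay positive. *)
pose q (k : nat) : R := Num.min t l / k.+2%:R.
have m0 : 0 < Num.min t l by rewrite lt_min t0.
have q0 k : 0 < q k by rewrite divr_gt0.
have [F _ KF] : finite_subset_cover setT (fun k => rect nu (t - q k) (l - q k)) K.
  move: cK; rewrite compact_cover; apply; first by move=> k _; exact: open_rect.
  move=> x [cx nU]; have /(rectP _ _ _ h) hx : rect nu t l x by apply: contrapT => nr; apply: nU; exact: bU.
  have HJ (j : 'I_n.+2) : \forall k \near \oo, `|dotv x (fr nu j)| < wid (t - q k) (l - q k) j / 2.
    have d0 : 0 < wid t l j - 2 * `|dotv x (fr nu j)| by have := hx j; lra.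
    have := near_infty_natSinv_lt (PosNum (divr_gt0 d0 m0)); apply: filterS => k /=.
    rewrite ltr_pdivlMr// mulrC => hk.
    have hq : q k <= Num.min t l * k.+1%:R^-1 by rewrite /q ler_pM2l// lef_pV2 ?posrE// ler_nat.
    have := le_lt_trans hq hk; rewrite /wid; case: ifP => _; lra.
  have : \forall k \near \oo, forall j : 'I_n.+2, `|dotv x (fr nu j)| < wid (t - q k) (l - q k) j / 2.
    exact: filter_forall.
  by move=> /filter_ex[k hk]; exists k => //; apply/(rectP _ _ _ h).
pose k0 := \max_(k <- finmap.enum_fset F) k.
have q12 : q k0 <= Num.min t l / 2.
  by rewrite /q ler_pM2l// lef_pV2 ?posrE// ler_nat.
have mt : Num.min t l <= t by rewrite ge_min lexx.
have ml : Num.min t l <= l by rewrite ge_min lexx orbT.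
exists (q k0); split => //; [move: q12 mt t0; clear; lra|move: q12 ml l0; clear; lra|].
move=> x rx nrx; apply: contrapT => nU.
have [|k /= kF rk] := KF x; first by split => //; exact: subset_closure.
apply: nrx; apply/(rectP _ _ _ h) => j; have /(rectP _ _ _ h)/(_ j) rj := rk; apply: (lt_le_trans rj).
have kk0 : (k <= k0)%N by exact: leq_bigmax_seq.
have : q k0 <= q k by rewrite /q ler_pM2l// lef_pV2 ?posrE// ler_nat !ltnS.
by rewrite ler_pM2r// /wid; case: ifP => _; lra.
Qed.

(** A product over the frame directions of smooth steps. Each is a function of the square of the
    coordinate, normalised to be 1 up to [B j] and 0 beyond [A j], which keeps it C^1 at the
    origin. *)
Lemma rect_cutoff nu z (t l s : R) : sphere nu -> 0 < s -> s < t -> s < l -> exists (chi : V -> R) dchi,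
  [/\ C1d chi dchi, forall x, 0 <= chi x <= 1,
      forall x, rect nu (t - s) (l - s) (x - z) -> chi x = 1 &
      forall x, ~ crect nu (t - s / 2) (l - s / 2) (x - z) -> chi x = 0].
Proof.
move=> h s0 st sl.
pose A j := (wid t l j - s / 2) / 2; pose B j := (wid t l j - s) / 2.
have B0 j : 0 < B j by rewrite /B /wid; case: ifP => _; lra.
have AB j : B j < A j by rewrite /A /B; lra.
pose y j x := dotv x (fr nu j) + - dotv z (fr nu j).
have yE j x : y j x = dotv (x - z) (fr nu j) by rewrite dotvBl.
pose c j := (A j ^+ 2 - B j ^+ 2)^-1.
have c0 j : 0 < c j by rewrite invr_gt0 subr_gt0; have := AB j; have := B0 j; nra.
pose p j x := smstep (c j * (A j ^+ 2 + (-1) * (y j x * y j x))).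
have Cy j := C1dD (C1d_dot (fr nu j)) (@C1d_cst _ n.+1 (- dotv z (fr nu j))).
have Cp j : exists dp, C1d (p j) dp.
  apply: C1d_smstep.
  exact: (C1dZ (c j) (C1dD (@C1d_cst _ n.+1 (A j ^+ 2)) (C1dZ (-1) (C1dM (Cy j) (Cy j))))).
have [dchi hchi] := C1d_prod (index_enum 'I_n.+2) Cp.
exists (fun x => \prod_j p j x), dchi; split => //.
- by move=> x; apply/andP; split; [apply: prodr_ge0 => j _|apply: prodr_ile1 => j _]; have := smstep_01 (c j * (A j ^+ 2 + (-1) * (y j x * y j x))) => // /andP[].
- move=> x /(rectP _ _ _ h) hx; rewrite big1// => j _; apply: smstep_ge1.
  have : `|y j x| < B j.
    by have := hx j; rewrite yE /B /wid; case: ifP => _.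
  rewrite ltr_norml => /andP[h1 h2].
  have AB2 : 0 < A j ^+ 2 - B j ^+ 2 by rewrite -invr_gt0; exact: c0.
  by rewrite /c mulrC ler_pdivlMr// mul1r; have := B0 j; move: h1 h2; clear; nra.
- move=> x /existsNP[j hj]; rewrite (bigD1 j)//= /p smstep_le0 ?mul0r//.
  have : A j < `|y j x|.
    by move/negP: hj; rewrite -ltNge yE /A /wid; case: ifP => _.
  have A0 : 0 < A j by exact: lt_trans (B0 j) (AB j).
  rewrite pmulr_rle0//; rewrite lter_normr => /orP[]; nra.
Qed.
End Frames.

(** * Gluing competitors along disjoint rectangles *)

Section Glue.
Variables (R : realType) (n m : nat).
Local Notation V := 'rV[R]_n.+2.
Local Notation W := 'rV[R]_m.
Local Notation leb := (@leb_out R n.+2).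
Local Notation H := (@hausdorff R n.+2 n.+1).
Local Notation mV := (caratheodory_type (oleb R n.+1)).
Implicit Types (nu x y : V) (M : seq W).

Definition glue (N : nat) (E : 'I_N -> set V) (v : 'I_N -> V -> W) (v0 : V -> W) x :=
  if [pick i | x \in E i] is Some i then v i x else v0 x.

Lemma glue_in N (E : 'I_N -> set V) v v0 i x : (forall i j x, E i x -> E j x -> i = j) -> E i x ->
  glue E v v0 x = v i x.
Proof.
move=> dis Ex; rewrite /glue; case: pickP => [j /set_mem Ejx|/(_ i)]; last by rewrite mem_set.
by rewrite (dis _ _ _ Ex Ejx).
Qed.
Lemma glue_out N (E : 'I_N -> set V) v v0 x : (forall i, ~ E i x) -> glue E v v0 x = v0 x.
Proof. by move=> nE; rewrite /glue; case: pickP => // j /set_mem /nE. Qed.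

Lemma glue_Mfun N (E : 'I_N -> set V) v v0 M : (forall i j x, E i x -> E j x -> i = j) ->
  (forall i, open (E i)) -> (forall i, Mfun M (v i)) -> Mfun M v0 -> Mfun M (glue E v v0).
Proof.
move=> dis oE hv hv0; split; first by move=> x; rewrite /glue; case: pickP => [i _|_]; [exact: (hv i).1|exact: hv0.1].
move=> a; have -> : glue E v v0 @^-1` [set a] =
  (\big[setU/set0]_(i < N) (E i `&` v i @^-1` [set a])) `|` (~` (\big[setU/set0]_(i < N) E i) `&` v0 @^-1` [set a]).
  apply/seteqP; split => x /=.
    have [[i Ex]|nE] := pselect (exists i, E i x).
      by rewrite (glue_in _ _ dis Ex) => e; left; apply/in_bigsetU; exists i.
    rewrite glue_out => [e|i Ex]; last by apply: nE; exists i.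
    by right; split => // /in_bigsetU.
  move=> [/in_bigsetU[i [Ex e]]|[nE e]]; first by rewrite (glue_in _ _ dis Ex).
  by rewrite glue_out// => i Ex; apply: nE; apply/in_bigsetU; exists i.
apply/lmeasP; apply: measurableU.
  apply: bigsetU_measurable => i _; apply: measurableI; first exact: measurable_open.
  exact: (proj1 (lmeasP _) ((hv i).2 a)).
apply: measurableI; last exact: (proj1 (lmeasP _) (hv0.2 a)).
by apply: measurableC; apply: bigsetU_measurable => i _; exact: measurable_open.
Qed.

Lemma Mfun_shift M (w : V -> W) z : Mfun M w -> Mfun M (fun x => w (x - z)).
Proof. by move=> [h1 h2]; split => // a; exact: (lmeas_shift (- z) (h2 a)). Qed.

Lemma Mfun_ujump M a b nu : a \in M -> b \in M -> Mfun M (ujump a b nu).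
Proof.
move=> aM bM; split; first by move=> x; rewrite /ujump; case: ifP.
have o : measurable ([set x | 0 < dotv x nu] : set mV).
  by apply: measurable_open; apply: open_ltf; exact: continuous_dotv.
move=> v; apply/lmeasP.
have -> : ujump a b nu @^-1` [set v] = ([set x | 0 < dotv x nu] `&` (if b == v then setT else set0)) `|`
   (~` [set x | 0 < dotv x nu] `&` (if a == v then setT else set0)).
  apply/seteqP; split => x; rewrite /preimage /= /ujump.
    by case: ifPn => h <-; [left|right]; rewrite eqxx; split => //; exact/negP.
  move=> [[h hb]|[/negP/negbTE h ha]]; rewrite h.
    by move: hb; case: (b =P v).
  by move: ha; case: (a =P v).
apply: measurableU; apply: measurableI => //; try by case: ifP.
exact: measurableC.
Qed.

Lemma polyhedral_TVfinI (I : finType) (D : set V) (K : R) (nu : I -> V) (c : I -> R) (v : V -> W) :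
  (forall x, D x -> enorm x <= K) -> (forall i, enorm (nu i) = 1) -> bmeas v ->
  (forall x y, (forall i, (c i < dotv x (nu i)) = (c i < dotv y (nu i))) -> v x = v y) -> TVfin D v.
Proof.
move=> DK nu1 bv hv.
apply: (polyhedral_TVfin (nu := fun i : 'I_#|I| => nu (enum_val i)) (c := fun i => c (enum_val i)) DK) => //.
by move=> x y h; apply: hv => i; have := h (enum_rank i); rewrite enum_rankK.
Qed.

Variables (N : nat) (z nu : 'I_N -> V) (t l : 'I_N -> R).
Definition piece i : set V := [set x | rect (nu i) (t i) (l i) (x - z i)].
Definition cpiece i : set V := [set x | crect (nu i) (t i) (l i) (x - z i)].
Hypotheses (nu1 : forall i, sphere (nu i)) (t0 : forall i, 0 < t i) (l0 : forall i, 0 < l i).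
Hypothesis dis : forall i j x, piece i x -> piece j x -> i = j.
Variables (nu' : V) (t' l' : R) (M : seq W) (a b : W).
Hypotheses (nu'1 : sphere nu') (t'0 : 0 < t') (l'0 : 0 < l') (aM : a \in M) (bM : b \in M).
Let D := rect nu' t' l'.
Hypothesis sub : forall i, piece i `<=` D.

Lemma open_shift (A : set V) y : open A -> open [set x | A (x - y)].
Proof. by move=> oA; apply: open_comp => // x _; exact: (@continuous_shiftV _ _ (- y) x). Qed.
Lemma closed_shift (A : set V) y : closed A -> closed [set x | A (x - y)].
Proof. by move=> cA; apply: closed_comp => // x _; exact: (@continuous_shiftV _ _ (- y) x). Qed.
Lemma open_piece i : open (piece i).
Proof. exact/open_shift/open_rect. Qed.

(** The boundary data glued together: a polyhedral function that agrees with the glued competitor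
    outside the cores of the pieces, hence controls its variation there. *)
Let v0 := glue piece (fun i x => ujump a b (nu i) (x - z i)) (ujump a b nu').

Lemma v0_Mfun : Mfun M v0.
Proof.
by apply: glue_Mfun; [exact: dis|exact: open_piece|move=> i; apply: Mfun_shift; exact: Mfun_ujump|exact: Mfun_ujump].
Qed.

Lemma v0_TVfin : TVfin D v0.
Proof.
(* The hyperplanes across which [v0] may change: that of D, that of each piece, and the two faces of
   each piece in every frame direction. Opposite signs for the two faces turn both strict
   inequalities of the open piece into the form c < <x, nu>. *)
pose I : finType := option ('I_N * option (bool * 'I_n.+2))%type.
pose NU (i : I) : V := match i with None => nu' | Some (i, None) => nu i
  | Some (i, Some (s, j)) => if s then fr (nu i) j else - fr (nu i) j end.
pose C (i : I) : R := match i with None => 0 | Some (i, None) => dotv (z i) (nu i)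
  | Some (i, Some (s, j)) => if s then dotv (z i) (fr (nu i) j) - wid (t i) (l i) j / 2
       else - (dotv (z i) (fr (nu i) j) + wid (t i) (l i) j / 2) end.
apply: (@polyhedral_TVfinI I _ (n.+2%:R * (t' + l')) NU C).
- by move=> x /(rect_crect nu'1) h; apply: (crect_bounded _ _ h); exact: ltW.
- move=> [[i [[[] j]|]]|] /=; [exact: fr_unit|by rewrite enormN fr_unit|exact: nu1|exact: nu'1].
- exact: (Mfun_bmeas v0_Mfun).
move=> x y h; have hp i : (x \in piece i) = (y \in piece i).
  have key u v : (forall i : I, (C i < dotv u (NU i)) = (C i < dotv v (NU i))) -> piece i u -> piece i v.
    move=> huv /(rectP _ _ _ (nu1 i)) hu; apply/(rectP _ _ _ (nu1 i)) => j.
    have h1 := huv (Some (i, Some (true, j))); have h2 := huv (Some (i, Some (false, j))).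
    move: h1 h2 (hu j); rewrite /= !dotvNr !ltrN2 !dotvBl !ltr_norml => h1 h2 /andP[h3 h4].
    have e1 : dotv (z i) (fr (nu i) j) - wid (t i) (l i) j / 2 < dotv u (fr (nu i) j) by lra.
    have e2 : dotv u (fr (nu i) j) < dotv (z i) (fr (nu i) j) + wid (t i) (l i) j / 2 by lra.
    by rewrite h1 in e1; rewrite h2 in e2; apply/andP; split; lra.
  by apply/idP/idP => /set_mem hx; apply/mem_set; apply: key hx => // k; rewrite h.
rewrite /v0 /glue (eq_pick hp); case: pickP => [i _|_].
  by have := h (Some (i, None)); rewrite /= /ujump !dotvBl !subr_gt0 => ->.
by have := h None; rewrite /= /ujump => ->.
Qed.

Variable w : 'I_N -> V -> W.
Hypothesis hw : forall i, admW M (ujump a b (nu i)) (rect (nu i) (t i) (l i)) (w i).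
Let wg := glue piece (fun i x => w i (x - z i)) (ujump a b nu').

Let hs4 (A B C E : Prop) (h : [/\ A, B, C & E]) : E. Proof. by case: h. Qed.

Lemma collars : exists s : 'I_N -> R, forall i, [/\ 0 < s i, s i < t i, s i < l i &
  leb [set x | [/\ piece i x, ~ rect (nu i) (t i - s i) (l i - s i) (x - z i) &
      w i (x - z i) <> ujump a b (nu i) (x - z i)]] = 0%E].
Proof.
suff /choice[s hs] : forall i, exists s, [/\ 0 < s, s < t i, s < l i &
  leb [set x | [/\ piece i x, ~ rect (nu i) (t i - s) (l i - s) (x - z i) &
      w i (x - z i) <> ujump a b (nu i) (x - z i)]] = 0%E] by exists s.
move=> i; have [_ _ [U [oU bU hU]]] := hw i.
have [s [s0 st sl h]] := rect_collar (nu1 i) (t0 i) (l0 i) oU bU.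
exists s; split => //; apply: (@leb_sub0 _ _ _ [set x | (rect (nu i) (t i) (l i) `&` U `&` [set x | w i x <> ujump a b (nu i) x]) (x + (- z i))]).
  by move=> x [px nr wx]; split => //; split => //; exact: h.
by rewrite (leb_shift _ (- z i)).
Qed.

Lemma wg_Mfun : Mfun M wg.
Proof.
apply: glue_Mfun; [exact: dis|exact: open_piece| |exact: Mfun_ujump].
by move=> i; apply: Mfun_shift; case: (hw i).
Qed.

Lemma leb_bigU0 (A : 'I_N -> set V) : (forall i, leb (A i) = 0%E) -> leb (\big[setU/set0]_(i < N) A i) = 0%E.
Proof.
move=> h; elim/big_ind: _ => [|B C hB hC|i _]; [exact: leb_out0| |exact: h].
apply/eqP; rewrite eq_le leb_out_ge0 andbT -(adde0 0%E) -{1}hB -hC.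
exact: (outer_measureU2 (oleb R n.+1)).
Qed.

(** A partition of unity with N + 1 members: [chi i] is 1 on the core of piece i and supported
    inside it, and [chi0] is the rest. On the support of [chi0] the glued function is almost
    everywhere [v0], since there every competitor equals its datum. *)
Lemma wg_TVfin : TVfin D wg.
Proof.
have [s hs] := collars.
pose S i : set V := [set x | crect (nu i) (t i - s i / 2) (l i - s i / 2) (x - z i)].
have Sp i : S i `<=` piece i by move=> x; apply: crect_rect => //; have [? ? ? _] := hs i; lra.
have /choice[chi hchi] i : exists chi, exists dchi, [/\ C1d chi dchi, forall x, 0 <= chi x <= 1,
   forall x, rect (nu i) (t i - s i) (l i - s i) (x - z i) -> chi x = 1 & forall x, ~ S i x -> chi x = 0].
  by have [s0 st sl _] := hs i; exact: (rect_cutoff (z i) (nu1 i) s0 st sl).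
have [dchi hd] := choice hchi.
pose chi0 x := 1 + (-1) * \sum_(i < N) chi i x.
have C0 : C1d chi0 (fun j x => 0 + (-1) * \sum_(i < N) dchi i j x).
  by apply: C1dD; [exact: C1d_cst|apply: C1dZ; apply: C1d_sum => i; case: (hd i)].
have sum1 x : (exists2 i, chi0 x = 1 - chi i x & S i x) \/ (chi0 x = 1 /\ forall i, ~ S i x).
  have [[i Sx]|nS] := pselect (exists i, S i x).
    left; exists i => //; rewrite /chi0 (bigD1 i)//= big1 ?addr0 ?mulN1r// => j ji.
    have [_ _ _ ->//] := hd j => Sj; move/eqP: ji; apply; apply: dis (Sp _ _ Sj) (Sp _ _ Sx).
  right; split; last by move=> i Sx; apply: nS; exists i.
  rewrite /chi0 big1 ?mulr0 ?addr0// => i _.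
  by have [_ _ _ ->//] := hd i => Sx; apply: nS; exists i.
pose ext (T : Type) (f0 : T) (f : 'I_N -> T) (k : 'I_N.+1) := if unlift ord0 k is Some i then f i else f0.
pose S0 : set V := ~` \big[setU/set0]_(i < N) [set x | rect (nu i) (t i - s i) (l i - s i) (x - z i)].
have extP (T : Type) (f0 : T) (f : 'I_N -> T) (Q : T -> Prop) : Q f0 -> (forall i, Q (f i)) -> forall k, Q (ext T f0 f k).
  by move=> h0 hf k; rewrite /ext; case: (unlift _ _).
apply: (@TVfin_glue _ _ _ _ N.+1 (ext _ D piece) (ext _ S0 S) (ext _ v0 (fun i x => w i (x - z i))) (ext _ chi0 chi)
   (ext _ _ dchi)).
- exact: (Mfun_bmeas wg_Mfun).
- apply: (extP _ _ _ (fun v => bmeas v)); first exact: (Mfun_bmeas v0_Mfun).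
  by move=> i; apply: (@Mfun_bmeas _ _ _ M); apply: Mfun_shift; case: (hw i).
- by move=> k; rewrite /ext; case: (unlift _ _) => [i|]; [case: (hd i)|exact: C0].
- move=> k x; rewrite /ext; case: (unlift _ _) => [i|].
    by have [_ /(_ x)/andP[h1 h2] _ _] := hd i; rewrite ger0_norm.
  have [[i -> _]|[-> _]] := sum1 x; last by rewrite normr1.
  by have [_ /(_ x)/andP[h1 h2] _ _] := hd i; rewrite ler_norml; apply/andP; split; lra.
- move=> x _; rewrite big_ord_recl {1}/ext unlift_none.
  under eq_bigr do rewrite /ext liftK.
  by rewrite /chi0 mulN1r subrK.
- apply: (extP _ _ _ (fun A => closed A)); last by move=> i; apply: closed_shift; exact: closed_crect.
  apply: open_closedC; apply: big_ind => [|A B|i _]; [exact: open0|exact: openU|].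
  by apply: open_shift; exact: open_rect.
- move=> k x; rewrite /ext; case: (unlift _ _) => [i|]; first by have [_ _ _ h] := hd i; exact: h.
  move=> /contrapT /in_bigsetU[i /= ri]; have [_ _ h1 _] := hd i.
  have Six : S i x by apply: rect_crect => //; apply: crect_rect (rect_crect _ ri) => //; have [? ? ? _] := hs i; lra.
  have [[j e Sj]|[_ /(_ i)//]] := sum1 x.
  by rewrite e (dis (Sp _ _ Sj) (Sp _ _ Six)) h1// subrr.
- by move=> k x; rewrite /ext; case: (unlift _ _) => [i|]; [move=> /Sp|].
- move=> k; rewrite /ext; case: (unlift _ _) => [i|].
    rewrite (_ : _ `&` _ = set0) ?leb_out0// -subset0 => x [[/Sp px _] /=]; apply.
    by rewrite /wg (glue_in _ _ dis px).
  have hz := leb_bigU0 (fun i => hs4 (hs i)).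
  apply: leb_sub0 hz => x [[nS Dx] /= wv].
  have [[i px]|np] := pselect (exists i, piece i x).
    apply/in_bigsetU; exists i; split => //; first by move=> rx; apply: nS; apply/in_bigsetU; exists i.
    by move: wv; rewrite /wg /v0 !(glue_in _ _ dis px).
  by exfalso; apply: wv; rewrite /wg /v0 !glue_out// => i px; apply: np; exists i.
- move=> k; rewrite /ext; case: (unlift _ _) => [i|]; last exact: v0_TVfin.
  by apply: TVfin_shift; [apply: (@Mfun_bmeas _ _ _ M)|]; case: (hw i).
Qed.

(** A piece may touch the boundary of D only if its datum is that of D; otherwise its closure lies
    inside D. *)
Hypothesis agree : forall i, (forall x, piece i x -> ujump a b (nu i) (x - z i) = ujump a b nu' x) \/ cpiece i `<=` D.

Lemma wg_bdry : near_bdry D wg (ujump a b nu').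
Proof.
have [s hs] := collars.
pose ag i := `[< forall x, piece i x -> ujump a b (nu i) (x - z i) = ujump a b nu' x >].
(* The closed part of the piece where the glued function may differ from the datum of D: only the
   core if the data agree. *)
pose Z i : set V := if ag i then [set x | crect (nu i) (t i - s i) (l i - s i) (x - z i)] else cpiece i.
have ZD i : Z i `<=` D.
  rewrite /Z; case: ifPn => [_ x hx|/asboolPn na]; last by have [] := agree i.
  by apply: (sub (i := i)); apply: crect_rect hx => //; have [? ? ? _] := hs i; lra.
exists (~` \big[setU/set0]_(i < N) Z i); split.
- apply: closed_openC; apply: big_ind => [|A B|i _]; [exact: closed0|exact: closedU|].
  by rewrite /Z; case: ifP => _; apply: closed_shift; exact: closed_crect.
- by move=> x [_ nD] /in_bigsetU[i /ZD].
have hz := leb_bigU0 (fun i => hs4 (hs i)).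
apply: leb_sub0 hz => x [[Dx nZ] /= wx].
have [[i px]|np] := pselect (exists i, piece i x); last first.
  by exfalso; apply: wx; rewrite /wg glue_out// => i px; apply: np; exists i.
apply/in_bigsetU; exists i.
have nZi : ~ Z i x by move=> Zx; apply: nZ; apply/in_bigsetU; exists i.
move: nZi; rewrite /Z /ag; case: ifPn => [/asboolP h nc|_]; last by case; exact: rect_crect.
split => //; first by move=> rx; apply: nc; exact: rect_crect.
by move: wx; rewrite /wg (glue_in _ _ dis px) h.
Qed.

Lemma wg_adm : admW M (ujump a b nu') D wg.
Proof. by split; [exact: wg_Mfun|exact: wg_TVfin|exact: wg_bdry]. Qed.

Variables (g : V -> W -> V -> R) (c : R) (Nset : set V).
Hypotheses (c0 : 0 <= c) (gc : forall x zeta nu, sphere nu -> g x zeta nu <= c).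
(** [Nset] has to contain the points outside the pieces at which a jump may appear. Every other such
    point lies strictly on one and the same side p of the hyperplane of D and of the hyperplane of
    each piece whose closure contains it. *)
Hypothesis hN : forall x, D x -> (forall i, ~ piece i x) -> Nset x \/
  exists p : bool, 0 < sg R p * dotv x nu' /\ forall i, cpiece i x -> 0 < sg R p * dotv (x - z i) (nu i).

(** In a small ball around x one stays on side p and off the cores of the pieces, so the glued
    function is almost everywhere the constant a or b chosen by p. *)
Lemma wg_jdens_out x : D x -> (forall i, ~ piece i x) -> ~ Nset x -> jdens g wg x = -oo%E.
Proof.
move=> Dx np nN; have [//|[p [h1 h2]]] := hN Dx np.
have [s hs] := collars.
have ev0 : \forall y \near x, 0 < sg R p * dotv y nu'.
  have o : open [set y : V | 0 < sg R p * dotv y nu'].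
    by apply: open_ltf; apply: continuous_mul; [exact: continuous_cst_fun|exact: continuous_dotv].
  exact: open_nbhs_nbhs.
have ev i : \forall y \near x, [/\ ~ rect (nu i) (t i - s i) (l i - s i) (y - z i) &
     piece i y -> 0 < sg R p * dotv (y - z i) (nu i)].
  have [s0 st sl _] := hs i.
  have e1 : \forall y \near x, ~ crect (nu i) (t i - s i) (l i - s i) (y - z i).
    apply: open_nbhs_nbhs; split; first by apply: closed_openC; apply: closed_shift; exact: closed_crect.
    by move=> hx; apply: (np i); apply: crect_rect hx => //; lra.
  have e2 : \forall y \near x, piece i y -> 0 < sg R p * dotv (y - z i) (nu i).
    have [cx|ncx] := pselect (cpiece i x).
      have o : open [set y : V | 0 < sg R p * dotv (y - z i) (nu i)].
        apply: open_ltf; apply: continuous_mul; first exact: continuous_cst_fun.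
        apply: (@continuous_lip _ _ _ (enorm (nu i))) => u v; exact: lip_dot.
      have : \forall y \near x, 0 < sg R p * dotv (y - z i) (nu i) by apply: open_nbhs_nbhs; split => //; exact: h2.
      by apply: filterS => y hy _.
    have : \forall y \near x, ~ cpiece i y.
      by apply: open_nbhs_nbhs; split => //; apply: closed_openC; apply: closed_shift; exact: closed_crect.
    by apply: filterS => y ny /(rect_crect (nu1 i)).
  near=> y; split; last by near: y.
  by move=> /(rect_crect (nu1 i)); near: y.
have evA : \forall y \near x, forall i : 'I_N, [/\ ~ rect (nu i) (t i - s i) (l i - s i) (y - z i) &
     piece i y -> 0 < sg R p * dotv (y - z i) (nu i)].
  have FF : Filter (nbhs x) := nbhs_filter x.
  exact: (filter_forall FF ev).
have : nbhs x ([set y | 0 < sg R p * dotv y nu'] `&` [set y | forall i : 'I_N, [/\ ~ rect (nu i) (t i - s i) (l i - s i) (y - z i) &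
     piece i y -> 0 < sg R p * dotv (y - z i) (nu i)]]) by exact: filterI.
rewrite nbhsE; case=> O [oO Ox] OB.
have [r r0 rO] := open_eball_in oO Ox.
have uj y nu2 : 0 < sg R p * dotv y nu2 -> ujump a b nu2 y = if p then b else a.
  rewrite /sg /ujump; case: (p); first by rewrite mul1r => ->.
  by rewrite mulN1r oppr_gt0 => h; rewrite ltNge (ltW h).
apply: (jdens_const g (r0 := r) (c := if p then b else a) r0).
have hz := leb_bigU0 (fun i => hs4 (hs i)).
apply: leb_sub0 hz => y [/rO/OB[hy1 hy2] /= wy].
have [[i px]|npy] := pselect (exists i, piece i y); last first.
  by exfalso; apply: wy; rewrite /wg glue_out ?uj// => i px; apply: npy; exists i.
apply/in_bigsetU; exists i; have [hy3 hy4] := hy2 i; split => //.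
by rewrite (uj _ _ (hy4 px)); move: wy; rewrite /wg (glue_in _ _ dis px).
Unshelve. all: by end_near. Qed.

Lemma wg_energy : (Esurf g wg D <= \sum_(i < N) Esurf (fun y => g (y + z i)%R) (w i) (rect (nu i) (t i) (l i)) + c%:E * H Nset)%E.
Proof.
apply: (@le_trans _ _ (\sum_(i < N) Esurf g (fun x => w i (x - z i)%R) (piece i) + c%:E * H Nset)%E); last first.
  by apply: leeD (lexx _); apply: lee_sum => i _; exact: (@Esurf_shift _ _ _ g (w i) (rect (nu i) (t i) (l i)) (z i)).
apply: (@ointeg_cover _ _ _ _ N (fun i x => if x \in piece i then jdens g (fun y => w i (y - z i)) x else 0%E) Nset c c0) => x.
case: (boolP (x \in D)) => [/set_mem Dx|_]; last by left.
have [[i px]|np] := pselect (exists i, piece i x).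
  right; left; exists i; rewrite (mem_set px).
  have [r r0 rp] := open_eball_in (@open_piece i) px.
  rewrite (@jdens_ae _ _ _ g wg (fun x => w i (x - z i)) x r r0); [exact: lexx|].
  rewrite (_ : _ `&` _ = set0) ?leb_out0// -subset0 => y [/rp py /=]; apply.
  by rewrite /wg (glue_in _ _ dis py).
have [Nx|nN] := pselect (Nset x); first by right; right; split; [exact: Nx|exact: jdens_le].
left; rewrite wg_jdens_out; [exact: leNye|exact: Dx| |exact: nN].
by move=> i px; apply: np; exists i.
Qed.
End Glue.

Section GlueCell.
Variables (R : realType) (n m : nat).
Local Notation V := 'rV[R]_n.+2.
Local Notation W := 'rV[R]_m.
Local Notation H := (@hausdorff R n.+2 n.+1).

Lemma cell_ge0 (M : seq W) (g : V -> W -> V -> R) ub D : (0 <= cell M g ub D)%E.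
Proof.
apply: le_ereal_inf_tmp => _ [u _ <-]; rewrite /Eg; case: asboolP => _ //.
exact: (@Esurf_ge0 R n m g u D).
Qed.

(** Almost optimal competitors of the pieces, each with error e/(N+1), are translated to the [z i]
    and glued; translating the competitor shifts [g] instead. *)
Lemma cell_glue (N : nat) (z nu : 'I_N -> V) (t l : 'I_N -> R) (nu' : V) (t' l' : R) (M : seq W) (a b : W)
  (g : V -> W -> V -> R) (c : R) (Nset : set V) :
  (forall i, sphere (nu i)) -> (forall i, 0 < t i) -> (forall i, 0 < l i) ->
  (forall i j x, piece z nu t l i x -> piece z nu t l j x -> i = j) ->
  sphere nu' -> 0 < t' -> 0 < l' -> a \in M -> b \in M ->
  (forall i, piece z nu t l i `<=` rect nu' t' l') ->
  (forall i, (forall x, piece z nu t l i x -> ujump a b (nu i) (x - z i) = ujump a b nu' x) \/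
      cpiece z nu t l i `<=` rect nu' t' l') ->
  0 <= c -> (forall x zeta nu, sphere nu -> g x zeta nu <= c) ->
  (forall x, rect nu' t' l' x -> (forall i, ~ piece z nu t l i x) -> Nset x \/
    exists p : bool, 0 < sg R p * dotv x nu' /\ forall i, cpiece z nu t l i x -> 0 < sg R p * dotv (x - z i) (nu i)) ->
  (cell M g (ujump a b nu') (rect nu' t' l') <=
   \sum_(i < N) cell M (fun y => g (y + z i)%R) (ujump a b (nu i)) (rect (nu i) (t i) (l i)) + c%:E * H Nset)%E.
Proof.
move=> nu1 t0 l0 dis nu'1 t'0 l'0 aM bM sub agree c0 gc hN.
pose F i := cell M (fun y => g (y + z i)%R) (ujump a b (nu i)) (rect (nu i) (t i) (l i)).
have F0 i : (0 <= F i)%E by exact: cell_ge0.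
have H0 : (0 <= c%:E * H Nset)%E by rewrite mule_ge0// hausdorff_ge0.
have [fin|] := pselect (forall i, (F i < +oo)%E); last first.
  move=> /existsNP[i /negP]; rewrite -leNgt leye_eq => /eqP Fi.
  have -> : (\sum_(i < N) F i)%E = +oo%E by apply/eqP; rewrite esum_eqy; [apply/existsP; exists i; rewrite Fi|move=> j _; rewrite -ltNye (lt_le_trans _ (F0 j))].
  by rewrite addye ?leey// -ltNye (lt_le_trans _ H0).
apply/lee_addgt0Pr => e e0.
have e1 : 0 < e / N.+1%:R by rewrite divr_gt0.
have /choice[w hw] i : exists w, admW M (ujump a b (nu i)) (rect (nu i) (t i) (l i)) w /\
    (Esurf (fun y => g (y + z i)%R) w (rect (nu i) (t i) (l i)) <= F i + (e / N.+1%:R)%:E)%E.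
  have [|w h1 h2] := @cell_adh _ _ _ M (fun y => g (y + z i)%R) (ujump a b (nu i)) (rect (nu i) (t i) (l i)) a (F i + (e / N.+1%:R)%:E)%E aM (@open_rect _ _ (nu i) _ _ (nu1 i)).
    change (F i < F i + (e / N.+1%:R)%:E)%E.
    by rewrite lteDl ?lte_fin// ge0_fin_numE.
  by exists w; split => //; exact: ltW.
have hadm i := (hw i).1.
have h1 := wg_energy nu1 t0 l0 dis hadm c0 gc hN.
have h2 := cell_le g (@open_rect _ _ nu' t' l' nu'1)
  (fun x h => crect_bounded (ltW t'0) (ltW l'0) (rect_crect nu'1 h))
  (wg_adm nu1 t0 l0 dis nu'1 t'0 l'0 aM bM sub hadm agree).
refine (le_trans h2 _); refine (le_trans h1 _).
rewrite addeAC leeD2r//.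
apply: (@le_trans _ _ (\sum_(i < N) (F i + (e / N.+1%:R)%:E))%E); first by apply: lee_sum => i _; exact: (hw i).2.
have h3 : N%:R * (e / N.+1%:R) <= e.
  by rewrite mulrCA ler_piMr ?(ltW e0)// ler_pdivrMr// mul1r ler_nat.
rewrite big_split/=; apply: leeD (lexx _) _.
have -> : (\sum_(i < N) (e / N.+1%:R)%:E)%E = (N%:R * (e / N.+1%:R))%:E.
  rewrite sumEFin; congr EFin; rewrite sumr_const card_ord mulr_natl.
 by [].
by rewrite lee_fin.
Qed.
End GlueCell.

(** * Hausdorff measure of flat pieces *)

Section HausBox.
Variables (R : realType) (n s : nat).
Local Notation V := 'rV[R]_n.
Local Notation H := (@hausdorff R n s.+1).

Definition hdel (d : {posnum R}) (A : set V) := hausd_delta s.+1 d%:num A.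
Let hdel0 d : hdel d set0 = 0%E. Proof. exact: hausd_delta0. Qed.
Let hdel_ge0 d A : (0 <= hdel d A)%E. Proof. exact: hausd_delta_ge0. Qed.
Let hdel_sub d A F : subset_sigma_subadditive (hdel d) A F. Proof. exact: hausd_delta_subset. Qed.
HB.instance Definition _ d := isSubsetOuterMeasure.Build R V (hdel d) (hdel0 d) (hdel_ge0 d) (@hdel_sub d).

Lemma outer_bigU T (mu : {outer_measure set T -> \bar R}) N (F : 'I_N -> set T) A :
  (forall x, A x -> exists i, F i x) -> (mu A <= \sum_(i < N) mu (F i))%E.
Proof.
move=> AF; apply: (@le_trans _ _ (mu (\big[setU/set0]_(i < N) F i))).
  by apply: le_outer_measure => x /AF[i Fx]; apply/in_bigsetU; exists i.
have sub := @outer_measure_subadditive _ _ mu (fun i => if insub i is Some k then F k else set0) N.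
have e : \big[setU/set0]_(i < N) (if insub (i : nat) is Some k then F k else set0) = \big[setU/set0]_(i < N) F i.
  by apply: eq_bigr => i _; rewrite valK.
by rewrite e in sub; apply: (le_trans sub); apply: lee_sum => i _; rewrite valK.
Qed.

Lemma outer_bigU_le T (mu : {outer_measure set T -> \bar R}) N (F : 'I_N -> set T) A (c : R) :
  (forall x, A x -> exists i, F i x) -> (forall i, (mu (F i) <= c%:E)%E) -> (mu A <= (N%:R * c)%:E)%E.
Proof.
move=> AF hF; apply: (le_trans (outer_bigU mu AF)).
apply: (@le_trans _ _ (\sum_(i < N) c%:E)%E); first by apply: lee_sum => i _; exact: hF.
by rewrite sumEFin sumr_const card_ord mulr_natl.
Qed.

Lemma fine_diam_le (A : set V) (h : R) : 0 <= h -> (forall x y, A x -> A y -> enorm (x - y) <= h) -> (diam A <= h%:E)%E.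
Proof. by move=> h0 hA; apply: ge_ereal_sup => _ [->|[[x y] [/= Ax Ay] <-]]; rewrite lee_fin//; exact: hA. Qed.

Lemma hdel_small d (A : set V) (h : R) : 0 <= h -> h < d%:num -> (forall x y, A x -> A y -> enorm (x - y) <= h) ->
  (hdel d A <= (omega R s.+1 * (h / 2) ^+ s.+1)%:E)%E.
Proof.
move=> h0 hd hA; have dA := fine_diam_le h0 hA.
pose C (k : nat) : set V := if k is 0%N then A else set0.
apply: (@le_trans _ _ (\sum_(0 <= k <oo) hterm s (C k))%E).
  apply: ereal_inf_lbound; exists C; split; first by move=> x Ax; exists 0%N.
  by split => // -[|k] /=; [apply: le_lt_trans dA _; rewrite lte_fin|rewrite diam0 lte_fin].
rewrite (nneseries_split 0 1); last by move=> k _; exact: hterm_ge0.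
rewrite eseries0 ?adde0; last by move=> [//|k] _ _; exact: hterm0.
rewrite add0n big_nat1/= lee_fin ler_wpM2l ?omega_ge0//.
have df : 0 <= fine (diam A) by rewrite fine_ge0// diam_ge0.
rewrite lerXn2r ?nnegrE ?divr_ge0//.
rewrite ler_pM2r// -lee_fin fineK//; apply/fin_numPlt/andP; split.
  by apply: lt_le_trans (diam_ge0 A); exact: ltNyr.
by apply: le_lt_trans dA _; exact: ltry.
Qed.

Variables (k : nat) (c : 'I_k -> V -> R) (L : R).
Hypothesis L0 : 0 <= L.
Variables (p q : 'I_k -> R).
Hypothesis q0 : forall j, 0 <= q j.

(** Induction on the coordinates not yet subdivided: cutting along one of them into strips of width
    eta multiplies the number of pieces by at most q/eta + 1. When none is left the set has diameter
    at most L eta. *)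
Lemma hdel_box d (eta : R) (js : seq 'I_k) (A : set V) : 0 < eta -> L * eta < d%:num ->
  (forall x y, A x -> A y -> (forall j, `|c j x - c j y| <= eta) -> enorm (x - y) <= L * eta) ->
  (forall j x, j \in js -> A x -> p j <= c j x <= p j + q j) ->
  (forall j x y, j \notin js -> A x -> A y -> `|c j x - c j y| <= eta) ->
  (hdel d A <= (\prod_(j <- js) (q j / eta + 1) * (omega R s.+1 * (L * eta / 2) ^+ s.+1))%:E)%E.
Proof.
move=> e0 Ld; elim: js A => [|j js IH] A lip hin hout.
  rewrite big_nil mul1r; apply: hdel_small => //; first by rewrite mulr_ge0// ltW.
  by move=> x y Ax Ay; apply: lip => // j; exact: hout.
pose N := (Num.truncn (q j / eta)).+1.
pose F (i : 'I_N) : set V := A `&` [set x | p j + i%:R * eta <= c j x <= p j + i%:R * eta + eta].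
have qe : 0 <= q j / eta by rewrite divr_ge0// ltW.
set P := \prod_(j <- js) (q j / eta + 1) * (omega R s.+1 * (L * eta / 2) ^+ s.+1).
have P0 : 0 <= P.
  rewrite mulr_ge0//; first by apply: prodr_ge0 => i _; rewrite addr_ge0// divr_ge0// ltW.
  by rewrite mulr_ge0 ?omega_ge0// exprn_ge0// divr_ge0// mulr_ge0// ltW.
apply: (@le_trans _ _ (N%:R * P)%:E); last first.
  rewrite lee_fin big_cons -mulrA -/P ler_wpM2r// /N -natr1 lerD2r.
  by rewrite truncn_le.
apply: (@outer_bigU_le _ _ _ F).
  move=> x Ax; have /andP[h1 h2] := hin j x (mem_head _ _) Ax.
  have y0 : 0 <= (c j x - p j) / eta by rewrite divr_ge0 ?subr_ge0// ltW.
  have yN : (Num.truncn ((c j x - p j) / eta) < N)%N.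
    by rewrite ltnS; apply: le_truncn; rewrite ler_pM2r ?invr_gt0// lerBlDl.
  exists (Ordinal yN); split => //=.
  have /andP[h3 h4] := truncn_itv y0.
  move: h3 h4; set T := Num.truncn _; rewrite ler_pdivlMr// ltr_pdivrMr//.
  have -> : T.+1%:R * eta = T%:R * eta + eta by rewrite -natr1 mulrDl mul1r.
  move=> h3 h4.
  by apply/andP; split; lra.
move=> i; apply: IH => [x y [Ax _] [Ay _]|j' x j'js [Ax _]|j' x y j'js [Ax hx] [Ay hy]].
- exact: lip.
- by apply: hin => //; rewrite inE j'js orbT.
- have [jj|jj] := eqVneq j' j; last by apply: hout => //; rewrite inE negb_or jj.
  rewrite jj; move: hx hy => /= /andP[h1 h2] /andP[h3 h4].
  by rewrite ler_norml; apply/andP; split; lra.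
Qed.
End HausBox.

Section HausBox2.
Variables (R : realType) (n s : nat).
Local Notation V := 'rV[R]_n.
Local Notation H := (@hausdorff R n s.+1).

Lemma cvg_prod_shift (k : nat) (q : 'I_k -> R) (r : seq 'I_k) :
  \prod_(j <- r) (q j + eta) @[eta --> (0 : R)] --> \prod_(j <- r) q j.
Proof.
elim: r => [|j r IH]; first by rewrite big_nil; under eq_fun do rewrite big_nil; exact: cvg_cst.
rewrite big_cons; under eq_fun do rewrite big_cons.
apply: cvgM => //; rewrite -[X in _ --> X]addr0; apply: cvgD; [exact: cvg_cst|exact: cvg_id].
Qed.

(** Let eta tend to 0 in [hdel_box]: each factor (q/eta + 1) eta is q + eta, which tends to q. *)
Lemma hausdorff_box (c : 'I_s.+1 -> V -> R) (L : R) (p q : 'I_s.+1 -> R) (A : set V) : 0 <= L ->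
  (forall j, 0 <= q j) -> (forall j x, A x -> p j <= c j x <= p j + q j) ->
  (forall x y h, 0 <= h -> A x -> A y -> (forall j, `|c j x - c j y| <= h) -> enorm (x - y) <= L * h) ->
  (H A <= (omega R s.+1 * (L / 2) ^+ s.+1 * \prod_j q j)%:E)%E.
Proof.
move=> L0 q0 hin lip; set K := omega R s.+1 * (L / 2) ^+ s.+1.
have K0 : 0 <= K by rewrite mulr_ge0 ?omega_ge0// exprn_ge0// divr_ge0.
apply: hausdorff_le => d d0; apply/lee_addgt0Pr => e e0.
have cv : K * \prod_j (q j + eta) @[eta --> (0 : R)] --> K * \prod_j q j.
  by apply: cvgMr; exact: cvg_prod_shift.
have [r r0 hr] : exists2 r : R, 0 < r & forall eta, `|eta| < r -> K * \prod_j (q j + eta) < K * \prod_j q j + e.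
  move/cvgrPdist_lt: cv => /(_ e e0)/nbhs_ballP[r /= r0 h]; exists r => // eta he.
  have : `|K * \prod_j q j - K * \prod_j (q j + eta)| < e.
    by apply: h; rewrite /ball /= sub0r normrN.
  by rewrite ltr_norml => /andP[h1 _]; lra.
pose eta := Num.min (r / 2) (d / (2 * (L + 1))).
have L1 : 0 < 2 * (L + 1) by lra.
have eta0 : 0 < eta by rewrite lt_min !divr_gt0.
have er : eta < r by rewrite gt_min; apply/orP; left; lra.
have Ld : L * eta < d.
  have h : eta <= d / (2 * (L + 1)) by rewrite ge_min lexx orbT.
  move: h; rewrite ler_pdivlMr//; nra.
have := @hdel_box R n s s.+1 c L L0 p q q0 (PosNum d0) eta (index_enum _) A eta0 Ld
  (fun x y Ax Ay => lip x y eta (ltW eta0) Ax Ay) (fun j x _ => hin j x).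
move=> /(_ _)/le_trans; apply; first by move=> j x y; rewrite mem_index_enum.
rewrite -EFinD lee_fin; apply: (@le_trans _ _ (K * \prod_j (q j + eta))); last by apply/ltW/hr; rewrite gtr0_norm.
rewrite le_eqVlt; apply/orP; left; apply/eqP.
have -> : \prod_j (q j + eta) = \prod_j (q j / eta + 1) * eta ^+ s.+1.
  rewrite -[X in eta ^+ X]card_ord -prodr_const -big_split/=; apply: eq_bigr => j _.
  by rewrite mulrDl mul1r divfK ?gt_eqF.
by rewrite /K (_ : L * eta / 2 = L / 2 * eta) ?exprMn; ring.
Qed.
End HausBox2.

Section Faces.
Variables (R : realType) (n : nat).
Local Notation V := 'rV[R]_n.+2.
Local Notation H := (@hausdorff R n.+2 n.+1).
Implicit Types (nu x z : V).

(** A crude ratio between Hausdorff measure and area on faces; n + 2 is the constant of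
    [enorm_le_fr], which bounds the norm by the largest frame coordinate. *)
Definition CH : R := omega R n.+1 * (n.+2%:R / 2) ^+ n.+1.
Lemma CH_ge0 : 0 <= CH.
Proof. by rewrite mulr_ge0 ?omega_ge0// exprn_ge0// divr_ge0. Qed.

Lemma hausdorff_face nu z (j : 'I_n.+2) (e : R) (p q : 'I_n.+1 -> R) (A : set V) : (forall i, 0 <= q i) ->
  (forall x, A x -> dotv (x - z) (fr nu j) = e) ->
  (forall x i, A x -> p i <= dotv (x - z) (fr nu (lift j i)) <= p i + q i) ->
  (H A <= (CH * \prod_i q i)%:E)%E.
Proof.
move=> q0 he hp; apply: (@hausdorff_box R n.+2 n (fun i x => dotv (x - z) (fr nu (lift j i))) n.+2%:R p q A) => //.
- by move=> i x; exact: hp.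
move=> x y h h0 Ax Ay hxy; apply: (@enorm_le_fr _ _ nu) => // j'.
have e1 : x - y = (x - z) - (y - z) by rewrite opprB addrA subrK.
rewrite e1 dotvBl; case: (unliftP j j') => [i ->|->]; first exact: hxy.
by rewrite !he// subrr normr0.
Qed.

Lemma hausdorff_slab nu z (j : 'I_n.+2) (j1 : 'I_n.+1) (e p q T : R) (A : set V) : 0 <= q -> 0 <= T ->
  (forall x, A x -> dotv (x - z) (fr nu j) = e) ->
  (forall x, A x -> p <= dotv (x - z) (fr nu (lift j j1)) <= p + q) ->
  (forall x i, A x -> `|dotv (x - z) (fr nu (lift j i))| <= T / 2) ->
  (H A <= (CH * (q * T ^+ n))%:E)%E.
Proof.
move=> q0 T0 he hp hT.
have := @hausdorff_face nu z j e (fun i => if i == j1 then p else - (T / 2)) (fun i => if i == j1 then q else T) A.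
rewrite (bigD1 j1)//= eqxx (eq_bigr (fun=> T)); last by move=> i /negbTE ->.
rewrite prodr_const cardC1 card_ord /=; apply => //; first by move=> i; case: ifP.
move=> x i Ax; case: eqP => [->|_]; first exact: hp.
by have := hT x i Ax; rewrite ler_norml => /andP[h1 h2]; apply/andP; split; lra.
Qed.

Lemma lift_max (j : 'I_n.+1) : (lift ord_max j : 'I_n.+2) = widen_ord (leqnSn n.+1) j.
Proof. by apply: val_inj; rewrite /= /bump leqNgt ltn_ord. Qed.
Lemma wid_lift (t l : R) (j : 'I_n.+1) : wid t l (lift ord_max j : 'I_n.+2) = t.
Proof. by rewrite /wid lift_max /= ltn_ord. Qed.
Lemma wid_max (t l : R) : wid t l (ord_max : 'I_n.+2) = l.
Proof. by rewrite /wid ltnn. Qed.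

Lemma rectP2 nu (t l : R) x : sphere nu -> rect nu t l x <->
  `|dotv x nu| < l / 2 /\ forall j : 'I_n.+1, `|dotv x (fr nu (lift ord_max j))| < t / 2.
Proof.
move=> h; split; first by move=> /(rectP _ _ _ h) hx; split; [have := hx ord_max; rewrite wid_max fr_last|move=> j; have := hx (lift ord_max j); rewrite wid_lift].
move=> [h1 h2]; apply/(rectP _ _ _ h) => j; case: (unliftP ord_max j) => [i ->|->]; first by rewrite wid_lift.
by rewrite wid_max fr_last.
Qed.
End Faces.

(** * Comparison of cell energies *)

Section Cells.
Variables (R : realType) (n m : nat).
Local Notation V := 'rV[R]_n.+2.
Local Notation W := 'rV[R]_m.
Local Notation H := (@hausdorff R n.+2 n.+1).
Variables (M : seq W) (c : R) (a b : W).
Hypotheses (c0 : 0 <= c) (aM : a \in M) (bM : b \in M).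
Implicit Types (nu x z : V) (g : V -> W -> V -> R).

Definition gle g := forall x zeta nu, sphere nu -> g x zeta nu <= c.

Definition Fc g nu (t l : R) := cell M g (ujump a b nu) (rect nu t l).

(** Pieces of the same direction centred on the hyperplane share the datum of the large rectangle,
    so they may touch its boundary and the mismatch is just the uncovered part of the hyperplane. *)
Lemma Fc_tile N g nu (z : 'I_N -> V) (t l : 'I_N -> R) (T L : R) : gle g -> sphere nu ->
  (forall i, 0 < t i) -> (forall i, 0 < l i) -> 0 < T -> 0 < L ->
  (forall i, dotv (z i) nu = 0) ->
  (forall i j x, piece z (fun=> nu) t l i x -> piece z (fun=> nu) t l j x -> i = j) ->
  (forall i, piece z (fun=> nu) t l i `<=` rect nu T L) ->
  (Fc g nu T L <= \sum_(i < N) Fc (fun y => g (y + z i)%R) nu (t i) (l i) +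
    c%:E * H [set x | [/\ rect nu T L x, (dotv x nu = 0)%R & forall i, ~ piece z (fun=> nu) t l i x]])%E.
Proof.
move=> gc h t0 l0 T0 L0 z0 dis sub.
apply: cell_glue => //.
  by move=> i; left => x _; rewrite /ujump dotvBl z0 subr0.
move=> x Dx np; have [e|/eqP ne] := pselect (dotv x nu = 0); first by left.
right; exists (0 < dotv x nu).
have s : 0 < sg R (0 < dotv x nu) * dotv x nu.
  rewrite /sg; case: (ltP 0 (dotv x nu)) => hx; first by rewrite mul1r.
  by rewrite mulN1r oppr_gt0 lt_neqAle ne.
by split => // i _; rewrite dotvBl z0 subr0.
Qed.

(** One piece of equal width already contains the whole section by the hyperplane, so nothing is
    lost. *)
Lemma Fc_height g nu (t l l' : R) : gle g -> sphere nu -> 0 < t -> 0 < l -> l <= l' ->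
  (Fc g nu t l' <= Fc g nu t l)%E.
Proof.
move=> gc h t0 l0 ll.
have := @Fc_tile 1 g nu (fun=> 0) (fun=> t) (fun=> l) t l' gc h (fun=> t0) (fun=> l0) t0 (lt_le_trans l0 ll).
have e : [set x | [/\ rect nu t l' x, dotv x nu = 0 & forall i : 'I_1, ~ piece (fun=> 0) (fun=> nu) (fun=> t) (fun=> l) i x]] = set0.
  rewrite -subset0 => x [/(rectP2 _ _ _ h)[_ hx] x0 /(_ ord0)]; apply.
  by rewrite /piece /= subr0; apply/(rectP2 _ _ _ h); rewrite x0 normr0 divr_gt0.
rewrite e outer_measure0 mule0 adde0 big_ord1.
have -> : (fun y => g (y + 0)) = g by apply/funext => y; rewrite addr0.
apply.
- by move=> i; rewrite dotvC /dotv big1// => j _; rewrite mxE mulr0.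
- by move=> i j x _ _; rewrite !ord1.
- move=> i x; rewrite /piece /= subr0 => /(rectP2 _ _ _ h)[h1 h2]; apply/(rectP2 _ _ _ h); split => //.
  by apply: (lt_le_trans h1); rewrite ler_pM2r.
Qed.

(** Tiling with no piece at all: the competitor is the flat jump. *)
Lemma Fc_bound g nu (t l : R) : gle g -> sphere nu -> 0 < t -> 0 < l -> (Fc g nu t l <= (c * CH R n * t ^+ n.+1)%:E)%E.
Proof.
move=> gc h t0 l0.
have := @Fc_tile 0 g nu (fun=> 0) (fun=> t) (fun=> l) t l gc h (fun=> t0) (fun=> l0) t0 l0.
move=> /(_ _ _ _)/le_trans; apply; [by case|by case|by case|].
rewrite big_ord0 add0e -mulrA EFinM lee_wpmul2l//.
have -> : t ^+ n.+1 = t * t ^+ n by rewrite exprS.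
apply: (@hausdorff_slab R n nu 0 ord_max ord0 0 (- (t / 2)) t t); [exact: ltW|exact: ltW| | |].
- by move=> x [_ e _]; rewrite subr0 fr_last.
- move=> x [/(rectP2 _ _ _ h)[_ /(_ ord0)] hx _ _]; rewrite subr0.
  by move: hx; rewrite ltr_norml => /andP[h1 h2]; apply/andP; split; lra.
- by move=> x i [/(rectP2 _ _ _ h)[_ hx] _ _]; rewrite subr0 ltW.
Qed.

Lemma hausdorff_pm (A : 'I_n.+1 -> bool -> set V) (B : set V) (q : R) :
  (forall x, B x -> exists j s, A j s x) -> (forall j s, (H (A j s) <= q%:E)%E) -> (H B <= (2 * n.+1%:R * q)%:E)%E.
Proof.
move=> BA hA.
have := @outer_bigU_le R V H (n.+1 + n.+1) (fun i => match fintype.split i with inl j => A j true | inr j => A j false end) B q.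
rewrite natrD (_ : n.+1%:R + n.+1%:R = 2 * n.+1%:R) ; last by ring.
apply.
  move=> x /BA[j [[] Ax]]; first by exists (lshift _ j); rewrite (unsplitK (inl j)).
  by exists (rshift _ j); rewrite (unsplitK (inr j)).
by move=> i; case: (fintype.split i) => j; exact: hA.
Qed.

Lemma Fc_width g nu (t t' l : R) : gle g -> sphere nu -> 0 < t -> t <= t' -> 0 < l ->
  (Fc g nu t' l <= Fc g nu t l + (c * CH R n * n.+1%:R * t' ^+ n * (t' - t))%:E)%E.
Proof.
move=> gc h t0 tt l0.
have := @Fc_tile 1 g nu (fun=> 0) (fun=> t) (fun=> l) t' l gc h (fun=> t0) (fun=> l0) (lt_le_trans t0 tt) l0.
rewrite big_ord1; have -> : (fun y => g (y + 0)) = g by apply/funext => y; rewrite addr0.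
move=> /(_ _ _ _)/le_trans; apply.
- by move=> i; rewrite dotvC /dotv big1// => j _; rewrite mxE mulr0.
- by move=> i j x _ _; rewrite !ord1.
- move=> i x; rewrite /piece /= subr0 => /(rectP2 _ _ _ h)[h1 h2]; apply/(rectP2 _ _ _ h); split => // j.
  by apply: (lt_le_trans (h2 j)); rewrite ler_pM2r.
apply: leeD (lexx _) _.
have -> : c * CH R n * n.+1%:R * t' ^+ n * (t' - t) = c * (2 * n.+1%:R * (CH R n * ((t' - t) / 2 * t' ^+ n))) by field.
rewrite EFinM; apply: lee_wpmul2l; first by rewrite lee_fin.
have t'0 : 0 <= t' by lra.
apply: (@hausdorff_pm (fun j s => [set x | [/\ rect nu t' l x, dotv x nu = 0 & t / 2 <= sg R s * dotv x (fr nu (lift ord_max j))]])).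
  move=> x [Dx x0 /(_ ord0)]; rewrite /piece /= subr0 => np.
  have [/= j /negP] : exists j : 'I_n.+1, ~ (`|dotv x (fr nu (lift ord_max j))| < t / 2).
    by apply/existsNP => hx; apply: np; apply/(rectP2 _ _ _ h); rewrite x0 normr0 divr_gt0.
  rewrite -leNgt ler_normr => /orP[hj|hj]; first by exists j, true; rewrite /sg mul1r.
  by exists j, false; rewrite /sg mulN1r.
move=> j s; apply: (@hausdorff_slab R n nu 0 ord_max j 0 (if s then t / 2 else - (t' / 2)) _ t'); [lra|lra| | |].
- by move=> x [_ e _]; rewrite subr0 fr_last.
- move=> x [/(rectP2 _ _ _ h)[_ /(_ j)] hx _]; rewrite subr0 /sg.
  by move: hx; rewrite ltr_norml => /andP[h1 h2]; case: s => h3; apply/andP; split; lra.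
- by move=> x i [/(rectP2 _ _ _ h)[_ hx] _ _]; rewrite subr0 ltW.
Qed.

(** Here [dl] bounds the change of frame coordinates on the ball of radius K. The tilted piece is
    kept compactly inside, as its datum may differ from that of the large rectangle. The mismatch
    consists of a border [A] of the new hyperplane and of strips [B] of height 2 dl on the sides of
    the piece between the two hyperplanes. *)
Lemma Fc_compare g nu nu' z (t l t' l' dl K : R) : gle g -> sphere nu -> sphere nu' -> 0 < t -> 0 < l -> 0 <= dl ->
  2 * dl < t -> 2 * dl < l -> t + 2 * dl < t' -> l + 2 * dl < l' ->
  (forall x, rect nu' t' l' x -> enorm x <= K) -> (forall x, crect nu t l (x - z) -> enorm x <= K) ->
  (forall x j, enorm x <= K -> `|dotv x (fr nu' j) - dotv (x - z) (fr nu j)| <= dl) ->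
  (Fc g nu' t' l' <= Fc (fun y => g (y + z)%R) nu t l + (c * CH R n * n.+1%:R * t' ^+ n * (t' - t + 6 * dl))%:E)%E.
Proof.
move=> gc h h' t0 l0 d0 dt0 dl0 tt ll DK cK cl.
have dlt : dl <= t / 2 by lra.
have t'0 : 0 < t' by lra. have l'0 : 0 < l' by lra.
have tn : t ^+ n <= t' ^+ n by rewrite lerXn2r ?nnegrE; lra.
have tn0 : 0 <= t ^+ n by rewrite exprn_ge0// ltW.
have q1 : 0 <= t' / 2 - t / 2 + dl by lra.
have csub x : crect nu t l (x - z) -> rect nu' t' l' x.
  move=> cx; apply/(rectP _ _ _ h') => j; have := cl x j (cK x cx); have := cx j.
  rewrite !ler_norml ltr_norml /wid => /andP[h1 h2] /andP[h3 h4].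
  by apply/andP; split; move: h1 h2; case: ifP => _; lra.
pose A (j : 'I_n.+1) (s : bool) : set V := [set x | [/\ rect nu' t' l' x, dotv x nu' = 0 & t / 2 - dl <= sg R s * dotv x (fr nu' (lift ord_max j))]].
pose B (j : 'I_n.+1) (s : bool) : set V := [set x | [/\ crect nu t l (x - z), `|dotv (x - z) nu| <= dl & dotv (x - z) (fr nu (lift ord_max j)) = sg R s * (t / 2)]].
pose Ns : set V := [set x | exists j s, A j s x \/ B j s x].
have out x : `|dotv (x - z) nu| <= dl -> ~ rect nu t l (x - z) -> exists j s, t / 2 <= sg R s * dotv (x - z) (fr nu (lift ord_max j)).
  move=> hd nr; have [/= j /negP] : exists j : 'I_n.+1, ~ (`|dotv (x - z) (fr nu (lift ord_max j))| < t / 2).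
    by apply/existsNP => hx; apply: nr; apply/(rectP2 _ _ _ h); split => //; lra.
  rewrite -leNgt ler_normr => /orP[hj|hj]; first by exists j, true; rewrite /sg mul1r.
  by exists j, false; rewrite /sg mulN1r.
have := @cell_glue R n m 1 (fun=> z) (fun=> nu) (fun=> t) (fun=> l) nu' t' l' M a b g c Ns.
rewrite big_ord1 => key; apply: (le_trans (key _ _ _ _ _ _ _ _ _ _ _ _ _ _)) => //.
- by move=> i j x _ _; rewrite !ord1.
- by move=> i x /(rect_crect h) /csub.
- by move=> i; right => x /csub.
- move=> x Dx /(_ ord0) np; have [hN|nN] := pselect (Ns x); first by left.
  have cx j := cl x j (DK x Dx).
  have cn : `|dotv x nu' - dotv (x - z) nu| <= dl by have := cx ord_max; rewrite !fr_last.
  have ne : dotv x nu' != 0.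
    apply/eqP => x0; apply: nN.
    have hd : `|dotv (x - z) nu| <= dl by move: cn; rewrite x0 sub0r normrN.
    have [j [s hs]] := out x hd np; exists j, s; left; split => //.
    have := cx (lift ord_max j); rewrite ler_norml => /andP[h1 h2].
    move: hs h1 h2; set u := dotv x _; set v := dotv (x - z) _; rewrite /sg; clear; case: s => hs; lra.
  right; exists (0 < dotv x nu').
  have s0 : 0 < sg R (0 < dotv x nu') * dotv x nu'.
    rewrite /sg; case: (ltP 0 (dotv x nu')) => hx; first by rewrite mul1r.
    by rewrite mulN1r oppr_gt0 lt_neqAle ne.
  split => // i cpx; rewrite ltNge; apply/negP => hs; apply: nN.
  have hd : `|dotv (x - z) nu| <= dl.
    move: cn s0 hs; set u := dotv x nu'; set v := dotv (x - z) nu; rewrite !ler_norml /sg.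
    by clear; case: (ltP 0 u) => _ /andP[h1 h2] s0 hs; apply/andP; split; lra.
  have [j [s hj]] := out x hd np; exists j, s; right; split => //.
  have := cpx (lift ord_max j); rewrite wid_lift ler_norml => /andP[h1 h2].
  move: hj h1 h2; set v := dotv (x - z) _; rewrite /sg; clear; case: s => hj; lra.
apply: leeD (lexx _) _.
(* Each of the 2(n+1) sides contributes a border of width (t' - t)/2 + dl and a strip of height 2
   dl, whence t' - t + 6 dl. *)
apply: (@le_trans _ _ (c%:E * (2 * n.+1%:R * (CH R n * ((t' / 2 - t / 2 + dl) * t' ^+ n)) +
    2 * n.+1%:R * (CH R n * (2 * dl * t ^+ n)))%:E)%E); last first.
  have C0 : 0 <= 2 * n.+1%:R * CH R n by rewrite mulr_ge0 ?CH_ge0.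
  have e1 : c * CH R n * n.+1%:R * t' ^+ n * (t' - t + 6 * dl) =
    c * (2 * n.+1%:R * CH R n * ((t' / 2 - t / 2 + dl) * t' ^+ n + 2 * dl * t' ^+ n)) by field.
  have e2 : 2 * n.+1%:R * (CH R n * ((t' / 2 - t / 2 + dl) * t' ^+ n)) + 2 * n.+1%:R * (CH R n * (2 * dl * t ^+ n)) =
    2 * n.+1%:R * CH R n * ((t' / 2 - t / 2 + dl) * t' ^+ n + 2 * dl * t ^+ n) by ring.
  rewrite -EFinM lee_fin e1 e2; apply: ler_wpM2l => //; apply: ler_wpM2l => //.
  by rewrite lerD2l; apply: ler_wpM2l => //; rewrite mulr_ge0.
apply: lee_wpmul2l; first by rewrite lee_fin.
apply: (@le_trans _ _ (H ([set x | exists j s, A j s x] `|` [set x | exists j s, B j s x]))).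
  by apply: le_outer_measure => x [j [s [hx|hx]]]; [left|right]; exists j, s.
apply: (le_trans (outer_measureU2 _ _ _)); rewrite EFinD; apply: leeD.
  apply: (@hausdorff_pm A) => [x [j [s hx]]|j s]; first by exists j, s.
  apply: (@hausdorff_slab R n nu' 0 ord_max j 0 (if s then t / 2 - dl else - (t' / 2)) _ t'); [exact: q1|exact: ltW| | |].
  - by move=> x [_ e _]; rewrite subr0 fr_last.
  - move=> x [/(rectP2 _ _ _ h')[_ /(_ j)] hx _]; rewrite subr0 /sg.
    move=> h3; move: hx; rewrite ltr_norml => /andP[]; move: h3; set u := dotv x _; clear; case: s => h3 h1 h2; apply/andP; split; lra.
  - by move=> x i [/(rectP2 _ _ _ h')[_ hx] _ _]; rewrite subr0 ltW.
apply: (@hausdorff_pm B) => [x [j [s hx]]|j s]; first by exists j, s.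
have [j1 hj1] : exists j1 : 'I_n.+1, lift (lift ord_max j) j1 = ord_max :> 'I_n.+2.
  case: (unliftP (lift ord_max j) ord_max) => [j1 e|e]; first by exists j1; rewrite -e.
  by have := neq_lift ord_max j; rewrite -e eqxx.
apply: (@hausdorff_slab R n nu z (lift ord_max j) j1 (sg R s * (t / 2)) (- dl) _ t); [exact: mulr_ge0|exact: ltW| | |].
- by move=> x [].
- move=> x [_ hx _]; move: hx; rewrite hj1 fr_last// ler_norml; set u := dotv _ _; clear => /andP[h1 h2]; apply/andP; split; lra.
- move=> x i [cx hx _]; case: (unliftP ord_max (lift (lift ord_max j) i)) => [i' ->|->].
    by have := cx (lift ord_max i'); rewrite wid_lift.
  by rewrite fr_last//; apply: le_trans hx dlt.
Qed.
End Cells.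

(** * Disjoint cubes and bricks *)

Section Vitali.
Local Open Scope nat_scope.

(** Take an index of maximal radius, discard everything in conflict with it, and recurse. By
    maximality the discarded indices are among those counted in the hypothesis. *)
Lemma vitali_greedy (I : finType) (conf : rel I) (r w : I -> nat) (C : nat) (G : {set I}) :
  reflexive conf -> symmetric conf ->
  (forall i, i \in G -> #|[set j in G | conf i j && (r j <= r i)]| <= C * w i) ->
  exists S : {set I}, [/\ S \subset G, {in S &, forall i j, conf i j -> i = j} & #|G| <= C * \sum_(i in S) w i].
Proof.
move=> rc sc; have [q] := ubnP #|G|; elim: q G => // q IH G; rewrite ltnS => Gq hG.
have [->|[i0 i0G]] := set_0Vmem G.
  exists finset.set0; split; [exact: finset.sub0set|by move=> i j; rewrite finset.in_set0|by rewrite cards0].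
case: (arg_maxnP r i0G) => i' iG' imax'.
have [i iG imax] : exists2 i, i \in G & forall j, j \in G -> r j <= r i by exists i'.
pose B := [set j in G | conf i j].
have iB : i \in B by rewrite inE iG rc.
have BG : B \subset G by apply/fintype.subsetP => j; rewrite inE => /andP[].
have cG' : #|G :\: B| < q.
  apply: leq_trans Gq; apply: proper_card; apply/properP; split; first exact: subsetDl.
  by exists i => //; rewrite inE iB.
have [|S [SG dS cS]] := IH _ cG'.
  move=> j; rewrite inE => /andP[_ jG]; apply: leq_trans (hG j jG); apply: subset_leq_card.
  by apply/fintype.subsetP => l; rewrite !inE => /andP[/andP[_ ->] ->].
have iS : i \notin S by apply/negP => /(fintype.subsetP SG); rewrite inE iB.
exists (i |: S); split.
- by apply/fintype.subsetP => j /setU1P[->//|/(fintype.subsetP SG)]; rewrite inE => /andP[].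
- have nc j : j \in S -> ~~ conf i j.
    by move=> /(fintype.subsetP SG); rewrite !inE => /andP[+ jG]; rewrite jG.
  move=> j l /setU1P[->|jS] /setU1P[->//|lS] //; first by rewrite (negbTE (nc l lS)).
    by rewrite sc (negbTE (nc j jS)).
  exact: dS.
- rewrite big_setU1//= mulnDr -(cardsID B G) (finset.setIidPr BG).
  apply: leq_add => //; apply: leq_trans (hG i iG); apply: subset_leq_card; apply/fintype.subsetP => j.
  by rewrite !inE => /andP[jG ->]; rewrite jG /=; exact: imax.
Qed.

Lemma card_ord_itv (p a b : nat) : #|[pred y : 'I_p | a <= y < b]| <= b - a.
Proof.
have -> : #|[pred y : 'I_p | a <= y < b]| = #|[pred y : 'I_p | a <= y < minn b p]|.
  by apply: eq_card => y; rewrite !inE leq_min ltn_ord andbT.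
have le : minn b p <= p by exact: geq_minr.
rewrite -sum1_card.
rewrite -(big_ord_widen_cond _ (fun i => a <= i) (fun=> 1) le) -(big_geq_mkord _ _ xpredT (fun=> 1)).
by rewrite sum_nat_const_nat muln1 leq_sub2r// geq_minl.
Qed.

Lemma card_ord_itvE (p a b : nat) : b <= p -> #|[pred y : 'I_p | a <= y < b]| = b - a.
Proof.
move=> le; rewrite -sum1_card.
rewrite -(big_ord_widen_cond _ (fun i => a <= i) (fun=> 1) le) -(big_geq_mkord _ _ xpredT (fun=> 1)).
by rewrite sum_nat_const_nat muln1.
Qed.

Variables (k J : nat).
Definition grid : finType := {ffun 'I_k -> 'I_(2 * J).+1}.
Implicit Types (i z : grid).

Definition cube i (r : nat) : {set grid} := [set z : grid | [forall l, (z l <= i l + r) && (i l <= z l + r)]].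
Definition inside i (r : nat) := [forall l, (r <= i l) && (i l + r <= 2 * J)].

Lemma cubeP i r z : reflect (forall l, (z l <= i l + r) /\ (i l <= z l + r)) (z \in cube i r).
Proof. by rewrite inE; apply: (iffP forallP) => h l; apply/andP; exact: h. Qed.

Lemma insideP i r : reflect (forall l, (r <= i l) /\ (i l + r <= 2 * J)) (inside i r).
Proof. by apply: (iffP forallP) => h l; apply/andP; exact: h. Qed.

Lemma leq_exp_base (p q e : nat) : p <= q -> p ^ e <= q ^ e.
Proof. by move=> pq; elim: e => // e IH; rewrite !expnS leq_mul. Qed.

Lemma card_cube i r : #|cube i r| = \prod_(l < k) #|[pred y : 'I_(2 * J).+1 | i l - r <= y < i l + r + 1]|.
Proof.
transitivity #|family (fun l => [pred y : 'I_(2 * J).+1 | i l - r <= y < i l + r + 1])|; last first.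
  by rewrite card_family foldrE big_image.
apply: eq_card => z; rewrite inE; apply/forallP/familyP => h l; have := h l; rewrite !inE.
  by move=> /andP[h1 h2]; apply/andP; split; lia.
by move=> /andP[h1 h2]; apply/andP; split; lia.
Qed.

Lemma card_cube_le i r : #|cube i r| <= (2 * r + 1) ^ k.
Proof.
rewrite card_cube -[X in _ ^ X]card_ord -prod_nat_const; apply: leq_prod => l _.
by apply: leq_trans (card_ord_itv _ _ _) _; lia.
Qed.

Lemma card_cubeE i r : inside i r -> #|cube i r| = (2 * r + 1) ^ k.
Proof.
move=> /insideP h; rewrite card_cube -[X in _ ^ X]card_ord -prod_nat_const; apply: eq_bigr => l _.
have [h1 h2] := h l; rewrite card_ord_itvE; last by lia.
lia.
Qed.

Lemma cube_self i r : i \in cube i r.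
Proof. by apply/cubeP => l; lia. Qed.

Lemma cube0 i z : z \in cube i 0 -> z = i.
Proof. by move=> /cubeP h; apply/ffunP => l; apply/val_inj/eqP; have := h l; rewrite !addn0 eqn_leq => -[-> ->]. Qed.

(* Greedy choice of disjoint cubes: a cube of smaller radius meeting the cube of centre [i] has its centre in the cube of double radius. *)
Lemma vitali_cubes (r : grid -> nat) (G : {set grid}) : (forall i, i \in G -> inside i (r i)) ->
  exists S : {set grid}, [/\ S \subset G,
    forall i j z, i \in S -> j \in S -> z \in cube i (r i) -> z \in cube j (r j) -> i = j &
    #|G| <= 2 ^ k * \sum_(i in S) (2 * r i + 1) ^ k].
Proof.
move=> hG; pose conf i j := [exists z, (z \in cube i (r i)) && (z \in cube j (r j))].
have [||i iG|S [S1 S2 S3]] := @vitali_greedy grid conf r (fun i => (2 * r i + 1) ^ k) (2 ^ k) G.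
- by move=> i; apply/existsP; exists i; rewrite cube_self.
- by move=> i j; apply/existsP/existsP => -[z /andP[h1 h2]]; exists z; rewrite h2.
- rewrite -expnMn; apply: (@leq_trans ((2 * (2 * r i) + 1) ^ k)); last by apply: leq_exp_base; lia.
  apply: leq_trans (card_cube_le i (2 * r i)); apply: subset_leq_card; apply/fintype.subsetP => j.
  rewrite inE => /andP[_ /andP[/existsP[z /andP[/cubeP h1 /cubeP h2]] rr]].
  by apply/cubeP => l; have := h1 l; have := h2 l; lia.
- exists S; split => // i j z iS jS zi zj; apply: S2 => //; apply/existsP; exists z; exact/andP.
Qed.
End Vitali.

(** * Tiling the hyperplane by cubes of bricks *)

Section Bricks.
Variables (R : realType) (n m : nat).
Local Notation V := 'rV[R]_n.+2.
Local Notation W := 'rV[R]_m.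
Local Notation H := (@hausdorff R n.+2 n.+1).
Variables (M : seq W) (c : R) (a b : W).
Hypotheses (c0 : 0 <= c) (aM : a \in M) (bM : b \in M).
Implicit Types (nu x : V) (g : V -> W -> V -> R).

Lemma outer_fin0 T (mu : {outer_measure set T -> \bar R}) (I : finType) (F : I -> set T) (A : set T) :
  (forall i, mu (F i) = 0%E) -> (forall x : T, A x -> exists i, F i x) -> mu A = 0%E.
Proof.
move=> h hA; apply/eqP; rewrite eq_le outer_measure_ge0 andbT.
have -> : 0%E = (#|I|%:R * 0)%:E :> \bar R by rewrite mulr0.
apply: (@outer_bigU_le R T mu #|I| (fun i => F (enum_val i))); last by move=> i; rewrite h.
by move=> x /hA[i hi]; exists (enum_rank i); rewrite enum_rankK.
Qed.

Definition gpos nu (h : R) (J : nat) (i : 'I_n.+1 -> nat) : V :=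
  \sum_(l < n.+1) (h * ((i l)%:R - J%:R)) *: fr nu (lift ord_max l).

Lemma dotv_suml (I : finType) (F : I -> V) x : dotv (\sum_i F i) x = \sum_i dotv (F i) x.
Proof.
apply: (big_morph (fun y => dotv y x)); first by move=> u v; rewrite dotvDl.
by rewrite /dotv big1// => j _; rewrite mxE mul0r.
Qed.

Lemma gpos_dot nu h J i (l : 'I_n.+1) : dotv (gpos nu h J i) (fr nu (lift ord_max l)) = h * ((i l)%:R - J%:R).
Proof.
rewrite dotv_suml (bigD1 l)//= dotvZl fr_dot eqxx mulr1 big1 ?addr0// => j jl.
by rewrite dotvZl fr_dot (inj_eq lift_inj) (negbTE jl) mulr0.
Qed.

Lemma gpos_nu nu h J i : sphere nu -> dotv (gpos nu h J i) nu = 0.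
Proof.
move=> hn; rewrite dotv_suml big1// => j _; rewrite -[X in dotv _ X](fr_last hn) dotvZl fr_dot.
by rewrite eq_sym (negbTE (neq_lift _ _)) mulr0.
Qed.

(** The cubes partition the grid, so the uncovered part of the hyperplane lies on the grid walls,
    which have measure zero: subadditivity holds without error. *)
Lemma Fc_bricks g nu (h L : R) (J : nat) (A : {set grid n.+1 J}) (r : grid n.+1 J -> nat) :
  gle c g -> sphere nu -> 0 < h ->
  (forall i, i \in A -> inside i (r i)) ->
  (forall i j z, i \in A -> j \in A -> z \in cube i (r i) -> z \in cube j (r j) -> i = j) ->
  (forall z, exists2 i, i \in A & z \in cube i (r i)) ->
  (forall i, i \in A -> h * (2 * r i + 1)%N%:R <= L) ->
  (Fc M a b g nu (h * (2 * J + 1)%N%:R) L <=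
    \sum_(i in A) Fc M a b (fun y => g (y + gpos nu h J (fun l => i l))%R) nu (h * (2 * r i + 1)%N%:R) (h * (2 * r i + 1)%N%:R))%E.
Proof.
move=> gc hn h0 ins dis cov hL.
pose side (q : nat) : R := h * (2 * q + 1)%N%:R.
have side0 q : 0 < side q by rewrite mulr_gt0// ltr0n addn1.
have L0 : 0 < L.
  have [i iA _] := cov [ffun=> ord0]; exact: lt_le_trans (side0 _) (hL i iA).
pose ev (i : 'I_#|A|) : grid n.+1 J := enum_val i.
pose z (i : 'I_#|A|) := gpos nu h J (fun l => ev i l).
pose t (i : 'I_#|A|) := side (r (ev i)).
(* Coordinates in units of h measured from a corner: brick z fills (z, z + 1) and the cube of centre
   i and radius r fills (i - r, i + r + 1). *)
pose y x (l : 'I_n.+1) : R := dotv x (fr nu (lift ord_max l)) / h + J%:R + 1 / 2.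
have sideE q : (2 * q + 1)%N%:R = 2 * q%:R + 1 :> R by rewrite natrD natrM.
have pieceP i x : piece z (fun=> nu) t t i x <-> `|dotv x nu| < t i / 2 /\
    forall l, (ev i l)%:R - (r (ev i))%:R < y x l < (ev i l)%:R + (r (ev i))%:R + 1.
  rewrite /piece /= (rectP2 _ _ _ hn) dotvBl gpos_nu// subr0.
  have E l : (`|dotv (x - z i) (fr nu (lift ord_max l))| < t i / 2) = ((ev i l)%:R - (r (ev i))%:R < y x l < (ev i l)%:R + (r (ev i))%:R + 1).
    rewrite dotvBl gpos_dot /y /t /side sideE.
    set u := dotv x _; have -> : u - h * ((ev i l)%:R - J%:R) = h * (u / h - (ev i l)%:R + J%:R).
      by rewrite !(mulrDr, mulrN) mulrCA divff ?gt_eqF// mulr1; ring.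
    rewrite normrM gtr0_norm// -mulrA ltr_pM2l// ltr_norml.
    by apply/andP/andP => -[h1 h2]; split; lra.
  by split => -[h1 h2]; split => // l; [rewrite -E|rewrite E]; exact: h2.
have DP x : rect nu (side J) L x -> forall l, 0 < y x l < (2 * J + 1)%N%:R.
  move=> /(rectP2 _ _ _ hn)[_ hx] l; have := hx l; rewrite /y /side sideE.
  set u := dotv x _ => hu.
  have : `|u / h| < (2 * J%:R + 1) / 2.
    by rewrite normrM normfV (gtr0_norm h0) ltr_pdivrMr// mulrC mulrA.
  by rewrite ltr_norml => /andP[h1 h2]; apply/andP; split; lra.
pose zt x : grid n.+1 J := [ffun l => inord (Num.truncn (y x l))].
have ztE x l : rect nu (side J) L x -> zt x l = Num.truncn (y x l) :> nat.
  move=> /DP/(_ l)/andP[_ h2]; rewrite ffunE inordK// ltnS truncn_le_nat.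
  by move: h2; rewrite addn1.
have sub i : piece z (fun=> nu) t t i `<=` rect nu (side J) L.
  move=> x /pieceP[h1 h2]; apply/(rectP2 _ _ _ hn); split.
    by apply: (lt_le_trans h1); rewrite ler_pM2r//; apply: hL; exact: enum_valP.
  move=> l; have := h2 l; have /insideP/(_ l)[h3 h4] := ins _ (enum_valP i).
  have h3' : (r (ev i))%:R <= (ev i l)%:R :> R by rewrite ler_nat.
  have h4' : (ev i l)%:R + (r (ev i))%:R <= 2 * J%:R :> R by rewrite -natrD -natrM ler_nat.
  rewrite /y /side sideE; set u := dotv x _ => /andP[h5 h6].
  have : `|u / h| < (2 * J%:R + 1) / 2 by rewrite ltr_norml; apply/andP; split; lra.
  by rewrite normrM normfV (gtr0_norm h0) ltr_pdivrMr// mulrC mulrA.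
have ztin i x : piece z (fun=> nu) t t i x -> zt x \in cube (ev i) (r (ev i)).
  move=> px; have Dx := sub i x px; move/pieceP: px => [_ h2].
  apply/cubeP => l; rewrite ztE//; have /andP[h3 h4] := h2 l.
  have y0 : 0 <= y x l by have /andP[/ltW] := DP x Dx l.
  split; first by rewrite truncn_le_nat -natr1 natrD.
  rewrite addnC -leq_subLR truncn_ge_nat//.
  have /insideP/(_ l)[h5 _] := ins _ (enum_valP i); rewrite natrB//; exact: ltW.
have := @Fc_tile R n m M c a b c0 aM bM #|A| g nu z t t (side J) L gc hn (fun=> side0 _) (fun=> side0 _) (side0 J) L0
  (fun i => gpos_nu _ _ _ hn).
move=> /(_ _ sub) key; apply: (le_trans (key _)).
  move=> i j x /ztin hi /ztin hj; apply: enum_val_inj; exact: dis (enum_valP i) (enum_valP j) hi hj.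
rewrite (_ : H _ = 0%E); last first.
  pose F (p : 'I_n.+1 * 'I_(2 * J).+1) : set V := [set x | [/\ rect nu (side J) L x, dotv x nu = 0 & y x p.1 = p.2%:R]].
  apply: (@outer_fin0 _ _ _ F).
    move=> p; apply/eqP; rewrite eq_le outer_measure_ge0 andbT.
    have -> : 0%E = (CH R n * (0 * (side J) ^+ n))%:E :> \bar R by rewrite mul0r mulr0.
    apply: (@hausdorff_slab R n nu 0 ord_max p.1 0 (h * (p.2%:R - J%:R - 1 / 2)) 0 (side J)); [exact: lexx|exact: ltW| | |].
    - by move=> x [_ e _]; rewrite subr0 fr_last.
    - move=> x [_ _ e]; rewrite subr0 addr0 -e /y; set u := dotv x _.
      have -> : h * (u / h + J%:R + 1 / 2 - J%:R - 1 / 2) = u by field; rewrite gt_eqF.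
      by rewrite lexx.
    - by move=> x i [/(rectP2 _ _ _ hn)[_ hx] _ _]; rewrite subr0 ltW.
  move=> x [Dx x0 np]; have [i iA hi] := cov (zt x).
  have ei : ev (enum_rank_in iA i) = i by rewrite /ev enum_rankK_in.
  apply: contrapT => nF; apply: (np (enum_rank_in iA i)); apply/pieceP; rewrite x0 normr0 divr_gt0 ?side0//; split => // l.
  rewrite ei; have /andP[y0 yJ] := DP x Dx l.
  have /cubeP/(_ l)[h1 h2] := hi; rewrite ztE// in h1 h2.
  have /andP[h3 h4] := truncn_itv (ltW y0).
  have ne : (Num.truncn (y x l))%:R != y x l.
    apply/eqP => e; apply: nF; exists (l, zt x l); split => //=; rewrite ztE//.
  have h1' : (Num.truncn (y x l))%:R <= (i l)%:R + (r i)%:R :> R by rewrite -natrD ler_nat.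
  have h2' : (i l)%:R <= (Num.truncn (y x l))%:R + (r i)%:R :> R by rewrite -natrD ler_nat.
  have h5 : (Num.truncn (y x l))%:R < y x l by rewrite lt_neqAle ne.
  by move: h4; rewrite -natr1 => h4; apply/andP; split; lra.
rewrite mule0 adde0.
have e := @big_enum_val _ (0%E : \bar R) +%E _ [in A] (fun i => Fc M a b (fun y => g (y + gpos nu h J (fun l => i l))%R) nu (side (r i)) (side (r i))).
by rewrite -e.
Qed.
End Bricks.

Lemma half_step (R : realFieldType) (e q : R) : - (e * (1 - 2^-1 * q)) <= - (e * (1 - q)) - e * (2^-1 * q).
Proof. lra. Qed.

(** * Measurable projection *)

Section Souslin.
Variables (R : realType) (d : measure_display) (Om : measurableType d) (P : probability Om R).
Implicit Types (X B : set Om) (y : nat -> nat) (s : seq nat).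
Local Open Scope ereal_scope.

Lemma measurable_hull X : exists B, [/\ measurable B, X `<=` B & forall C, measurable C -> X `<=` C -> P B <= P C].
Proof.
pose S := [set e | exists C, [/\ measurable C, X `<=` C & e = P C]].
have S0 : S !=set0 by exists (P setT), setT.
have i0 : 0 <= ereal_inf S by apply: le_ereal_inf_tmp => _ [C [_ _ ->]]; exact: measure_ge0.
have i1 : ereal_inf S <= 1.
  by apply: ereal_inf_lbound; exists setT; split => //; rewrite probability_setT.
have fi : ereal_inf S \is a fin_num by rewrite ge0_fin_numE// (le_lt_trans i1)// ltry.
have /choice[C hC] n : exists C, [/\ measurable C, X `<=` C & P C <= ereal_inf S + (n.+1%:R^-1)%:E].
  have e0 : (0 < n.+1%:R^-1 :> R)%R by [].
  have [_ [C [mC XC ->]] /ltW h] := lb_ereal_inf_adherent e0 fi.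
  by exists C.
exists (\bigcap_n C n); split.
- by apply: bigcapT_measurable => n; case: (hC n).
- by move=> x Xx n _; case: (hC n) => _ /(_ x Xx).
move=> D mD XD; apply: (@le_trans _ _ (ereal_inf S)); last by apply: ereal_inf_lbound; exists D.
apply/lee_addgt0Pr => e e0.
have [n hn] := filter_ex (near_infty_natSinv_lt (PosNum e0)).
have [mC _ h] := hC n; apply: (@le_trans _ _ (P (C n))).
  by apply: le_measure; rewrite ?inE//; [apply: bigcapT_measurable => k; case: (hC k)|move=> x; exact].
by apply: (le_trans h); rewrite leeD2l// lee_fin ltW.
Qed.

Definition hull X : set Om := projT1 (cid (measurable_hull X)).
Lemma measurable_hullT X : measurable (hull X). Proof. by rewrite /hull; case: cid => B [? ? ?]. Qed.
Lemma sub_hull X : X `<=` hull X. Proof. by rewrite /hull; case: cid => B [? ? ?]. Qed.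
Lemma hull_min X C : measurable C -> X `<=` C -> P (hull X) <= P C.
Proof. by rewrite /hull; case: cid => B [? ? h] /=; exact: h. Qed.

(** Continuity from below of the outer probability. Hulls of increasing sets need not increase, but
    the intersections of all later hulls do. *)
Lemma hull_cup (X : nat -> set Om) (e : R) : (0 < e)%R -> {homo X : m n / (m <= n)%N >-> m `<=` n} ->
  exists m, P (hull (\bigcup_n X n)) - e%:E <= P (hull (X m)).
Proof.
move=> e0 ndX; pose H n := \bigcap_(j in [set j | (n <= j)%N]) hull (X j).
have mH n : measurable (H n) by apply: bigcap_measurableType => j _; exact: measurable_hullT.
have XH n : X n `<=` H n by move=> x Xx j /= nj; apply: sub_hull; exact: ndX Xx.
have Hle n : P (H n) <= P (hull (X n)).
  by apply: le_measure; rewrite ?inE//; [exact: measurable_hullT|move=> x; apply => /=].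
have cv : (P (H n) @[n --> \oo] --> P (\bigcup_n H n)).
  apply: nondecreasing_cvg_mu => //; first exact: bigcupT_measurable.
  by move=> m n mn; apply/subsetPset => x Hx j /= nj; apply: Hx => /=; exact: leq_trans nj.
have lb : P (hull (\bigcup_n X n)) <= P (\bigcup_n H n).
  apply: hull_min; first exact: bigcupT_measurable.
  by move=> x [n _ Xx]; exists n => //; exact: XH.
apply: contrapT => /forallNP nm.
have : P (\bigcup_n H n) <= P (hull (\bigcup_n X n)) - e%:E.
  have <- := cvg_lim (@ereal_hausdorff R) cv; apply: lime_le; first by apply/cvg_ex; eexists; exact: cv.
  by near=> n; apply: (le_trans (Hle n)); have /negP := nm n; rewrite -ltNge => /ltW.
have f : P (hull (\bigcup_n X n)) \is a fin_num by apply: fin_num_measure; exact: measurable_hullT.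
move=> /(le_trans lb); rewrite leeBrDr// -{2}(adde0 (P _)) leeD2lE// lee_fin leNgt e0.
by [].
Unshelve. all: by end_near. Qed.

Lemma prefix_pre y m n : (m <= n)%N -> take m (mkseq y n) = mkseq y m.
Proof. by move=> mn; rewrite /mkseq -map_take take_iota (minn_idPl mn). Qed.

Hypothesis Pc : complete_prob P.
Variable A : seq nat -> set Om.
Hypothesis mA : forall s, measurable (A s).

Let B s := \bigcap_(i in [set i | (i <= size s)%N]) A (take i s).
Let mB s : measurable (B s). Proof. by apply: bigcap_measurableType => i _; exact: mA. Qed.
Let T := [set w | exists y, forall n, A (mkseq y n) w].
(** The part of [T] reached by branches whose first digits are bounded by [ks]. It may fail to be
    measurable, unlike [C] below, which involves finitely long branches only. *)
Let E (ks : seq nat) := [set w | exists y, (forall i, (i < size ks)%N -> (y i <= nth 0%N ks i)%N) /\ forall n, B (mkseq y n) w].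
Let C (k : nat -> nat) n := [set w | exists s, [/\ size s = n, (forall i, (i < n)%N -> (nth 0%N s i <= k i)%N) & B s w]].

Let Bpre s t w : prefix s t -> B t w -> B s w.
Proof.
move=> /prefixP[r ->] h i /= hi; have := h i; rewrite /= size_cat => /(_ (leq_trans hi (leq_addr _ _))).
by rewrite takel_cat.
Qed.

Let measurable_C k n : measurable (C k n).
Proof.
rewrite (_ : C k n = \bigcup_s (if (size s == n) && all (fun i => nth 0%N s i <= k i)%N (iota 0 n) then B s else set0)).
  by apply: (@countable_bigcupT_measurable _ _ _ (fun s => if (size s == n) && all (fun i => nth 0%N s i <= k i)%N (iota 0 n) then B s else set0)) => // s; case: ifP.
apply/seteqP; split => w.
  move=> [s [h1 h2 h3]]; exists s => //; rewrite h1 eqxx /=; case: allP => //; case => i.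
  by rewrite mem_iota add0n => /= hi; exact: h2.
move=> [s _]; case: ifP => [/andP[/eqP h1 /allP h2] h3|_ []]; exists s; split => // i hi.
by apply: h2; rewrite mem_iota.
Qed.

(* By Koenig's lemma a finitely branching tree with arbitrarily long branches has an infinite one. *)
Let CT k : \bigcap_n C k n `<=` T.
Proof.
move=> w hC; pose bd (s : seq nat) := forall i, (i < size s)%N -> (nth 0%N s i <= k i)%N.
pose ext s := forall n, (size s <= n)%N -> exists s', [/\ size s' = n, prefix s s', bd s' & B s' w].
have ext0 : ext [::].
  by move=> n _; have [s [h1 h2 h3]] := hC n I; exists s; split; [|exact: prefix0s|move=> i; rewrite h1; exact: h2|].
have step s : ext s -> exists m, ext (rcons s m).
  move=> es; apply: contrapT => /forallNP no.
  have /choice[f hf] m : exists n, (size (rcons s m) <= n)%N /\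
      ~ exists s', [/\ size s' = n, prefix (rcons s m) s', bd s' & B s' w].
    have := no m; move=> /existsNP[n /not_implyP[h1 h2]]; by exists n.
  pose N := (\max_(i < (k (size s)).+1) f i + (size s).+1)%N.
  have [|s' [h1 h2 h3 h4]] := es N; first by rewrite /N; lia.
  have ss' : (size s < size s')%N by rewrite h1 /N; lia.
  pose m := nth 0%N s' (size s).
  have mk : (m < (k (size s)).+1)%N by rewrite ltnS; exact: h3.
  have ps : rcons s m = take (size s).+1 s'.
    rewrite (take_nth 0%N)//; congr rcons; move/prefixP: h2 => [r ->].
    by rewrite take_size_cat.
  have fN : (f m <= N)%N.
    by apply: leq_trans (leq_addr _ _); exact: (@leq_bigmax _ (fun i : 'I__ => f i) (Ordinal mk)).
  have [g1 g2] := hf m; apply: g2; exists (take (f m) s'); split.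
  - by rewrite size_takel// h1.
  - rewrite ps; move: g1; rewrite size_rcons => g1.
    have -> : take (size s).+1 s' = take (size s).+1 (take (f m) s').
      by rewrite -take_min (minn_idPl g1).
    exact: prefix_take.
  - move=> i; rewrite size_takel ?h1// => hi; rewrite nth_take//.
    by apply: h3; rewrite h1; exact: leq_trans fN.
  - by apply: Bpre h4; exact: prefix_take.
pose nx (s : {s | ext s}) : {s | ext s} := let: exist m hm := cid (step (sval s) (svalP s)) in exist _ (rcons (sval s) m) hm.
pose S n := iter n nx (exist _ [::] ext0).
have SS n : exists m, sval (S n.+1) = rcons (sval (S n)) m.
  by rewrite /S iterS /nx; case: cid => m hm; exists m.
have sS n : size (sval (S n)) = n.
  by elim: n => // n IH; have [m ->] := SS n; rewrite size_rcons IH.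
pose y n := nth 0%N (sval (S n.+1)) n.
have Sy n : sval (S n) = mkseq y n.
  elim: n => // n IH; rewrite mkseqS -IH /y; have [m e] := SS n.
  by rewrite e nth_rcons sS ltnn eqxx.
exists y => n; have [s' [h1 h2 h3 h4]] := svalP (S n) n (eq_leq (sS n)).
have := Bpre h2 h4; rewrite -/(sval _) Sy => /(_ n); rewrite /= size_mkseq => /(_ (leqnn _)).
by rewrite take_oversize ?size_mkseq.
Qed.

Let E_step ks (e : R) : (0 < e)%R -> exists m, P (hull (E ks)) - e%:E <= P (hull (E (rcons ks m))).
Proof.
move=> e0; have [|m hm] := @hull_cup (fun m => E (rcons ks m)) e e0.
  move=> p q pq w [y [h1 h2]]; exists y; split => // i; rewrite size_rcons => hi.
  have := h1 i; rewrite size_rcons => /(_ hi)/leq_trans; apply.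
  by rewrite !nth_rcons; case: ifP => // _; case: ifP.
exists m; apply: le_trans hm; apply: leeB => //; apply: hull_min; first exact: measurable_hullT.
apply: subset_trans (@sub_hull _) => w [y [h1 h2]]; exists (y (size ks)) => //; exists y; split => // i.
rewrite size_rcons ltnS nth_rcons leq_eqVlt => /orP[/eqP ->|hi]; first by rewrite ltnn eqxx.
by rewrite hi; exact: h1.
Qed.

(** Bounds on the digits are chosen one after another, the n-th losing at most e/2^(n+1) of outer
    measure. The resulting finitely branching trees [C k n] are measurable and, by [CT], decrease to
    a subset of [T]. *)
Let inner (e : R) : (0 < e)%R -> exists D, [/\ measurable D, D `<=` T & P (hull T) - e%:E <= P D].
Proof.
move=> e0; have e2 n : (0 < e / (2 ^ n.+1)%:R)%R by rewrite divr_gt0// ltr0n expn_gt0.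
pose nx (ks : seq nat) := rcons ks (projT1 (cid (E_step ks (e2 (size ks))))).
pose S n := iter n nx [::].
have sS n : size (S n) = n by elim: n => // n IH; rewrite /S iterS size_rcons -/(S n) IH.
pose k n := nth 0%N (S n.+1) n.
have Sk n : S n = mkseq k n.
  elim: n => // n IH; rewrite mkseqS -IH /k /S iterS -/(S n) /nx nth_rcons sS ltnn eqxx.
  by [].
have ES n : P (hull (E (S n))) - (e / (2 ^ n.+1)%:R)%:E <= P (hull (E (S n.+1))).
  by rewrite /S iterS -/(S n) /nx; case: cid => m /=; rewrite sS.
have ET : E (S 0%N) = T.
  apply/seteqP; split => w [y]; first by move=> [_ h]; exists y => n; have := h n n; rewrite /= size_mkseq => /(_ (leqnn _)); rewrite take_oversize ?size_mkseq.
  move=> h; exists y; split => // n i; rewrite /= size_mkseq => hi; rewrite prefix_pre//; exact: h.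
have fin X : P (hull X) \is a fin_num by apply: fin_num_measure; exact: measurable_hullT.
have low n : P (hull T) - (e * (1 - (2 ^ n)%:R^-1))%:E <= P (hull (E (S n))).
  elim: n => [|n IH]; first by rewrite expn0 invr1 subrr mulr0 sube0 ET.
  apply: le_trans (ES n); apply: le_trans (leeB IH (lexx _)).
  rewrite -addeA leeD2l// -EFinN -EFinN -EFinD lee_fin expnS natrM invfM.
  exact: half_step.
have EC n : E (S n) `<=` C k n.
  move=> w [y [h1 h2]]; exists (mkseq y n); split; [by rewrite size_mkseq| |exact: h2].
  move=> i hi; rewrite nth_mkseq//; have := h1 i; rewrite sS => /(_ hi); rewrite Sk nth_mkseq//.
exists (\bigcap_n C k n); split; [exact: bigcapT_measurable|exact: CT|].
have cv : (P (C k n) @[n --> \oo] --> P (\bigcap_n C k n)).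
  apply: nonincreasing_cvg_mu => //.
  - by apply: le_lt_trans (probability_le1 _ _) _ => //; exact: ltry.
  - exact: bigcapT_measurable.
  move=> p q pq; apply/subsetPset => w [s [h1 h2 h3]]; exists (take p s); split.
  - by rewrite size_takel// h1.
  - by move=> i hi; rewrite nth_take//; apply: h2; exact: leq_trans pq.
  - by apply: Bpre h3; exact: prefix_take.
have <- := cvg_lim (@ereal_hausdorff R) cv; apply: lime_ge; first by apply/cvg_ex; eexists; exact: cv.
near=> n; apply: (@le_trans _ _ (P (hull (E (S n))))); last exact: hull_min.
apply: le_trans (low n); apply: leeB => //; rewrite lee_fin ler_piMr ?(ltW e0)// lerBlDr lerDl invr_ge0//.
Unshelve. all: by end_near. Qed.

(** [T] lies between a countable union of inner approximations and its hull, which have equal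
    probability; completeness does the rest. *)
Lemma souslin_measurable : measurable [set w | exists y, forall n, A (mkseq y n) w].
Proof.
have /choice[D hD] n := @inner n.+1%:R^-1 (ltac:(by [])).
pose DD := \bigcup_n D n.
have mD : measurable DD by apply: bigcupT_measurable => n; case: (hD n).
have DT : DD `<=` T by move=> w [n _ Dw]; case: (hD n) => _ h _; exact: h.
rewrite -/T (_ : T = DD `|` (T `\` DD)); last by rewrite setDE setUIr setUv setIT; apply/esym/setUidr.
apply: measurableU => //; apply: Pc; exists (hull T `\` DD); split.
- by apply: measurableD => //; exact: measurable_hullT.
- have fin : P (hull T) \is a fin_num by apply: fin_num_measure; exact: measurable_hullT.
  have DH : DD `<=` hull T by apply: subset_trans DT _; exact: sub_hull.
  rewrite measureD//; [|exact: measurable_hullT|by rewrite ltey_eq fin].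
  rewrite (setIidr DH); apply/eqP; rewrite eq_le; apply/andP; split; last first.
    rewrite sube_ge0; last by rewrite orbC fin.
    by apply: le_measure; rewrite ?inE//; exact: measurable_hullT.
  apply/lee_addgt0Pr => e e0; rewrite add0e.
  have [n hn] := filter_ex (near_infty_natSinv_lt (PosNum e0)).
  have [mDn _ h] := hD n; rewrite leeBlDr ?fin_num_measure//.
  have : P (D n) <= P DD by apply: le_measure; rewrite ?inE//; move=> x Dx; exists n.
  move=> /(le_trans h); rewrite leeBlDr// => /le_trans; apply.
  by rewrite addeC leeD2r// lee_fin ltW.
- by move=> w [Tw nD]; split => //; exact: sub_hull.
Qed.
End Souslin.

Section Projection.
Variables (R : realType) (d : measure_display) (Om : measurableType d) (P : probability Om R).
Hypothesis Pc : complete_prob P.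
Implicit Types (y z : nat -> nat) (s r : seq nat).

Definition cylinders : set (set (nat -> nat)) := [set C | exists i j, C = [set y | y i = j]].
Definition Baire := g_sigma_algebraType cylinders.

(** The Souslin operation with parameter y: stage n looks at the first n digits of y and of a
    witness z. Projecting along y merges y with the witness. *)
Definition souslin (B : set (Om * (nat -> nat))) := exists E : nat -> seq nat -> seq nat -> set Om,
  (forall n s r, measurable (E n s r)) /\
  forall w y, B (w, y) <-> exists z, forall n, E n (mkseq y n) (mkseq z n) w.

Lemma souslin_rect (A : set Om) (N : nat) (Q : seq nat -> Prop) : measurable A ->
  souslin [set p | A p.1 /\ Q (mkseq p.2 N)].
Proof.
move=> mA; exists (fun n s _ => if `[< n = N -> Q s >] then A else set0); split.
  by move=> n s r; case: ifP.
move=> w y; split => /=.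
  by move=> [Aw Qy]; exists (fun=> 0%N) => n; rewrite asboolT// => ->.
move=> [z h]; split; first by have := h N.+1; rewrite asboolT// => e; exfalso; move: e; lia.
by have := h N; case: ifP => // /asboolP + _; exact.
Qed.

Lemma souslin_cup (B : nat -> set (Om * (nat -> nat))) : (forall i, souslin (B i)) -> souslin (\bigcup_i B i).
Proof.
move=> /choice[E hE].
exists (fun n s r => if n is n'.+1 then E (nth 0%N r 0) n' (take n' s) (behead r) else setT); split.
  by move=> [|n] s r //; exact: (hE _).1.
have eb (z : nat -> nat) n : behead (mkseq z n.+1) = mkseq (fun n => z n.+1) n.
  by rewrite /mkseq /= -[1%N]/(1 + 0)%N iotaDl -map_comp.
move=> w y; split.
  move=> [i _ /(proj1 ((hE i).2 _ _))[z hz]]; exists (fun n => if n is n'.+1 then z n' else i) => -[//|n].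
  by rewrite eb nth_mkseq// prefix_pre//; exact: hz.
move=> [z hz]; exists (z 0%N) => //; apply/(proj2 ((hE _).2 _ _)); exists (fun n => z n.+1) => n.
by have := hz n.+1; rewrite eb nth_mkseq// prefix_pre.
Qed.

(** One witness stores the witnesses of all [B i] through a pairing of indices; [ok n i j] says that
    stage n already shows the j digits needed to test stage j of [B i]. *)
Lemma souslin_cap (B : nat -> set (Om * (nat -> nat))) : (forall i, souslin (B i)) -> souslin (\bigcap_i B i).
Proof.
move=> /choice[E hE]; pose pk (i q : nat) : nat := choice.pickle (i, q).
pose ok n i j := all (fun q => pk i q < n)%N (iota 0 j) && (j <= n)%N.
exists (fun n s r => \bigcap_i \bigcap_j (if ok n i j then E i j (take j s) (mkseq (fun q => nth 0%N r (pk i q)) j) else setT)); split.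
  move=> n s r; apply: bigcapT_measurable => i; apply: bigcapT_measurable => j.
  by case: ifP => _ //; exact: (hE i).1.
move=> w y; split.
  move=> hB; have /choice[z hz] i : exists z, forall n, E i n (mkseq y n) (mkseq z n) w by apply/((hE i).2); exact: hB.
  exists (fun p => if choice.unpickle p is Some (i, q) then z i q else 0%N) => n i _ j _.
  case: ifP => // /andP[/allP h jn]; rewrite prefix_pre//.
  have -> : mkseq (fun q => nth 0%N (mkseq (fun p => if choice.unpickle p is Some (i, q) then z i q else 0%N) n) (pk i q)) j = mkseq (z i) j.
    apply: (@eq_from_nth _ 0%N) => [|q]; rewrite !size_mkseq// => qj.
    rewrite !nth_mkseq//; last by apply: h; rewrite mem_iota.
    by rewrite /pk choice.pickleK.
  exact: hz.
move=> [z hz] i _; apply/(proj2 ((hE i).2 _ _)); exists (fun q => z (pk i q)) => j.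
pose n := (\max_(q < j) (pk i q).+1 + j)%N.
have okn : ok n i j.
  apply/andP; split; last exact: leq_addl.
  apply/allP => q; rewrite mem_iota add0n => /= qj.
  by apply: leq_trans (leq_addr _ _); exact: (@leq_bigmax _ (fun q : 'I_j => (pk i q).+1) (Ordinal qj)).
have := hz n i I j I; rewrite okn prefix_pre ?leq_addl//.
congr (E i j _ _ w); apply: (@eq_from_nth _ 0%N) => [|q]; rewrite !size_mkseq// => qj.
rewrite !nth_mkseq//; by have /andP[/allP h _] := okn; apply: h; rewrite mem_iota.
Qed.

Lemma souslin_fst (A : set Om) : measurable A -> souslin [set p | A p.1].
Proof.
move=> mA; have := @souslin_rect A 0 (fun=> True) mA; congr souslin.
by apply/seteqP; split => x; [case|split].
Qed.

(** Closure under complements is built in, so these sets form a sigma-algebra containing the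
    measurable rectangles. *)
Let bisouslin (B : set (Om * (nat -> nat))) := souslin B /\ souslin (~` B).

Let bisouslin0 : bisouslin set0.
Proof. by rewrite /bisouslin setC0; split; [exact: (souslin_fst measurable0)|exact: (souslin_fst measurableT)]. Qed.
Let bisouslinC B : bisouslin B -> bisouslin (~` B).
Proof. by move=> [h1 h2]; split => //; rewrite setCK. Qed.
Let bisouslinU (B : nat -> set (Om * (nat -> nat))) : (forall i, bisouslin (B i)) -> bisouslin (\bigcup_i B i).
Proof.
move=> h; split; first by apply: souslin_cup => i; exact: (h i).1.
by rewrite setC_bigcup; apply: souslin_cap => i; exact: (h i).2.
Qed.
Let bisouslinI B C : bisouslin B -> bisouslin C -> bisouslin (B `&` C).
Proof.
move=> hB hC; rewrite -(setCK (B `&` C)) setCI -bigcup2E; apply/bisouslinC/bisouslinU => -[|[|i]] /=.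
- exact: bisouslinC.
- exact: bisouslinC.
- exact: bisouslin0.
Qed.

Lemma measurable_souslin (B : set (Om * Baire)) : measurable B -> souslin B.
Proof.
move=> mB; suff : bisouslin B by case.
move: B mB; rewrite measurable_prod_measurableType.
apply: smallest_sub.
  split.
  - exact: bisouslin0.
  - by move=> A; rewrite setTD; exact: bisouslinC.
  - exact: bisouslinU.
move=> _ [A mA [C mC <-]].
have -> : A `*` C = [set p : Om * (nat -> nat) | A p.1] `&` [set p | C p.2] by apply/seteqP; split.
apply: bisouslinI.
  by split; [exact: (souslin_fst mA)|exact: (souslin_fst (measurableC mA))].
move: C mC; apply: smallest_sub.
  split.
  - exact: bisouslin0.
  - by move=> C hC; rewrite setTD; exact: bisouslinC hC.
  - by move=> F hF; exact: bisouslinU hF.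
move=> _ [i [j ->]].
have h Q := @souslin_rect setT i.+1 Q measurableT.
have e y : nth 0%N (mkseq y i.+1) i = y i by rewrite nth_mkseq.
split.
  have := h (fun s => nth 0%N s i = j); congr souslin; apply/seteqP; split => p /=; rewrite e; first by case.
  by [].
have := h (fun s => nth 0%N s i <> j); congr souslin; apply/seteqP; split => p /=; rewrite e; first by case.
by [].
Qed.

(* A measurable subset of the product is a Souslin set, and the projection of a Souslin set is again one, hence measurable since [P] is complete. *)
Theorem measurable_projection (B : set (Om * Baire)) : measurable B -> measurable [set w | exists y, B (w, y)].
Proof.
move=> /measurable_souslin[E [mE hE]].
pose unz (s : seq nat) : seq nat * seq nat :=
  (mkseq (fun i => if (choice.unpickle (nth 0%N s i) : option (nat * nat)) is Some (p, q) then p else 0%N) (size s),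
   mkseq (fun i => if (choice.unpickle (nth 0%N s i) : option (nat * nat)) is Some (p, q) then q else 0%N) (size s)).
have := @souslin_measurable R _ Om P Pc (fun s => E (size s) (unz s).1 (unz s).2) (fun s => mE _ _ _).
congr measurable; apply/seteqP; split => w.
  move=> [x hx].
  exists (fun i => if (choice.unpickle (x i) : option (nat * nat)) is Some (p, q) then p else 0%N : nat).
  apply/hE; exists (fun i => if (choice.unpickle (x i) : option (nat * nat)) is Some (p, q) then q else 0%N : nat) => n.
  have := hx n; rewrite size_mkseq /unz /= size_mkseq; congr (E n _ _ w).
    by apply/eq_in_map => i; rewrite mem_iota add0n => /= hi; rewrite nth_mkseq.
  by apply/eq_in_map => i; rewrite mem_iota add0n => /= hi; rewrite nth_mkseq.
move=> [y /hE[z hz]]; exists (fun i => choice.pickle (y i, z i)) => n.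
have := hz n; rewrite size_mkseq /unz /= size_mkseq; congr (E n _ _ w).
  by apply/eq_in_map => i; rewrite mem_iota add0n => /= hi; rewrite nth_mkseq// choice.pickleK.
by apply/eq_in_map => i; rewrite mem_iota add0n => /= hi; rewrite nth_mkseq// choice.pickleK.
Qed.
End Projection.

(** * Measurability of the cell energies *)

Section HausMetric.
Variables (R : realType) (n s : nat).
Local Notation V := 'rV[R]_n.+1.
Local Notation hd := (@hausd_delta R n.+1 s.+1).
Definition oH : {outer_measure set V -> \bar R} := @hausdorff R n.+1 s.+1.
Local Notation H := oH.
Local Notation mH := (caratheodory_type oH).
Local Open Scope ereal_scope.

(** A set of diameter below d cannot meet both [A] and [B], so every cover of the union splits in
    two. *)
Lemma hd_separated (A B : set V) (dl d : R) : (0 < d)%R -> (d <= dl)%R ->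
  (forall x y, A x -> B y -> (dl <= enorm (x - y))%R) -> hd d A + hd d B <= hd d (A `|` B).
Proof.
move=> d0 ddl sep; apply: le_ereal_inf_tmp => _ [C [cov [dC ->]]].
have key x y k : A x -> B y -> C k x -> C k y -> False.
  move=> Ax By Cx Cy; have : (enorm (x - y))%:E < d%:E.
    by apply: le_lt_trans (dC k); apply: ereal_sup_ubound; right; exists (x, y).
  by rewrite lte_fin ltNge (le_trans ddl)// sep.
pose mt (S : set V) k := if `[< exists2 x, S x & C k x >] then C k else set0.
have mtd S k : diam (mt S k) < d%:E by rewrite /mt; case: ifP => _; [exact: dC|rewrite diam0 lte_fin].
have mtc S : S `<=` A `|` B -> S `<=` \bigcup_k mt S k.
  move=> SAB x Sx; have [k _ Ck] := cov x (SAB x Sx); exists k => //.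
  by rewrite /mt; case: asboolP => // -[]; exists x.
apply: (@le_trans _ _ (\sum_(0 <= k <oo) (hterm s (mt A k) + hterm s (mt B k)))).
  rewrite nneseriesD; [|by move=> k _ _; exact: hterm_ge0|by move=> k _ _; exact: hterm_ge0].
  apply: leeD; apply: ereal_inf_lbound.
    by exists (mt A); split => //; apply: mtc => x; left.
  by exists (mt B); split => //; apply: mtc => x; right.
apply: lee_nneseries => [k _|k _ /=]; first by rewrite adde_ge0// hterm_ge0.
rewrite /mt; case: asboolP => [[x Ax Cx]|_]; case: asboolP => [[y By Cy]|_].
- by exfalso; exact: key Ax By Cx Cy.
- by rewrite hterm0 adde0.
- by rewrite hterm0 add0e.
- by rewrite hterm0 adde0 hterm_ge0.
Qed.

Lemma H_separated (A B : set V) (dl : R) : (0 < dl)%R ->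
  (forall x y, A x -> B y -> (dl <= enorm (x - y))%R) -> H A + H B <= H (A `|` B).
Proof.
move=> dl0 sep; set x := H (A `|` B).
have [->|xfin] := eqVneq x +oo; first by rewrite leey.
have key d : (0 < d)%R -> hd d A + hd d B <= x.
  move=> d0; pose d' := Num.min d dl; have d'0 : (0 < d')%R by rewrite lt_min d0.
  have h1 := @hausd_delta_anti R n.+1 s d' d A (ltac:(by rewrite ge_min lexx)).
  have h2 := @hausd_delta_anti R n.+1 s d' d B (ltac:(by rewrite ge_min lexx)).
  apply: (le_trans (leeD h1 h2)).
  apply: (le_trans (@hd_separated A B dl d' d'0 _ sep)); first by rewrite ge_min lexx orbT.
  exact: hausd_delta_le.
have x0 : 0 <= x by exact: outer_measure_ge0.
have xf : x \is a fin_num by rewrite ge0_fin_numE// ltey.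
have fA d : (0 < d)%R -> hd d A \is a fin_num.
  move=> d0; rewrite ge0_fin_numE ?hausd_delta_ge0//; apply: (@le_lt_trans _ _ x); last by rewrite ltey.
  by apply: le_trans (key d d0); rewrite leeDl// hausd_delta_ge0.
have HB d : (0 < d)%R -> hd d A + H B <= x.
  move=> d0; rewrite -leeBrDl ?fA//; apply: hausdorff_le => d' d'0; rewrite leeBrDl ?fA//.
  pose e := Num.min d d'; have e0 : (0 < e)%R by rewrite lt_min d0.
  have h1 := @hausd_delta_anti R n.+1 s e d A (ltac:(by rewrite ge_min lexx)).
  have h2 := @hausd_delta_anti R n.+1 s e d' B (ltac:(by rewrite ge_min lexx orbT)).
  exact: le_trans (leeD h1 h2) (key e e0).
have HBf : H B \is a fin_num.
  rewrite ge0_fin_numE ?outer_measure_ge0//; apply: (@le_lt_trans _ _ x); last by rewrite ltey.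
  by apply: le_trans (HB 1%R ltr01); rewrite leeDr// hausd_delta_ge0.
by rewrite -leeBrDr//; apply: hausdorff_le => d d0; rewrite leeBrDr//; exact: HB.
Qed.

(** Caratheodory's argument for metric outer measures. The half-space is cut into shells
    accumulating at the hyperplane; shells of equal parity are separated, so their measures sum to
    at most twice that of X, the tail is small, and what remains is at positive distance from the
    complement. *)
Lemma cara_halfspace i (c : R) : measurable ([set x : V | (c < x ord0 i)%R] : set mH).
Proof.
apply: le_caratheodory_measurable => X; set O := [set x : V | (c < x ord0 i)%R].
have [->|Xoo] := eqVneq (H X) +oo; first by rewrite leey.
pose q (j : nat) : R := (c + j.+1%:R^-1)%R.
have qlt j : (q j.+1 < q j)%R by rewrite /q ltrD2l ltf_pV2 ?posrE ?ltr_nat.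
have qle j l : (j <= l)%N -> (q l <= q j)%R by move=> jl; rewrite /q lerD2l lef_pV2 ?posrE// ler_nat.
pose A j := X `&` [set x : V | (q j < x ord0 i)%R].
pose Rg j := X `&` [set x : V | (q j.+1 < x ord0 i <= q j)%R].
have lip (x y : V) : (x ord0 i - y ord0 i <= enorm (x - y))%R.
  by have := coord_le_enorm (x - y) i; rewrite !mxE => /(le_trans (ler_norm _)).
have par (b p : nat) : \sum_(j < p) H (Rg (2 * j + b)%N) <= H (X `&` \big[setU/set0]_(j < p) Rg (2 * j + b)%N).
  elim: p => [|p IH]; first by rewrite !big_ord0 outer_measure_ge0.
  rewrite !big_ord_recr /= setIUr; apply: (le_trans (leeD IH (lexx _))).
  have -> : X `&` Rg (2 * p + b)%N = Rg (2 * p + b)%N by rewrite /Rg setIA setIid.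
  case: p IH => [|p] _; first by rewrite !big_ord0 setI0 set0U outer_measure0 add0e.
  have g0 : (0 < q (2 * p + b).+1 - q (2 * p.+1 + b)%N)%R.
    by rewrite subr_gt0 (_ : (2 * p.+1 + b)%N = (2 * p + b).+2); [exact: qlt|lia].
  apply: (H_separated g0) => x y [Xx /in_bigsetU[j [_ /andP[h1 _]]]] [_ /andP[_ h2]].
  apply: le_trans (lip x y); apply: lerB => //.
  by apply: le_trans (ltW h1); apply: qle; have := ltn_ord j; lia.
have par' (b p : nat) : \sum_(j < p) H (Rg (2 * j + b)%N) <= H X.
  by apply: (le_trans (par b p)); apply: le_outer_measure; exact: subIsetl.
have tot p : \sum_(j < p) H (Rg j) <= H X + H X.
  have h2 : \sum_(j < 2 * p) H (Rg j) <= H X + H X.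
    have -> : \sum_(j < 2 * p) H (Rg j) = \sum_(j < p) H (Rg (2 * j + 0)%N) + \sum_(j < p) H (Rg (2 * j + 1)%N).
      elim: p => [|p IH]; first by rewrite muln0 !big_ord0 adde0.
      rewrite mulnS addSn add1n !big_ord_recr /= IH addn0 addn1 -!addeA; congr (_ + _).
      by rewrite addeCA.
    exact: leeD.
  apply: le_trans h2; rewrite -(big_mkord xpredT (fun j => H (Rg j))) -(big_mkord xpredT (fun j => H (Rg j))).
  have pp : (p <= 2 * p)%N by lia.
  rewrite [leRHS](@big_cat_nat _ _ _ p 0 (2 * p)%N)//=.
  by rewrite leeDl// sume_ge0// => j _; exact: outer_measure_ge0.
have sfin : \sum_(0 <= j <oo) H (Rg j) < +oo.
  apply: (@le_lt_trans _ _ (H X + H X)); last by rewrite lte_add_pinfty// ltey.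
  apply: lime_le; first by apply: is_cvg_nneseries => k _ _; exact: outer_measure_ge0.
  by near=> p; rewrite big_mkord; exact: tot.
have tl := @nneseries_tail_cvg R (fun j => H (Rg j)) xpredT sfin (fun j _ => outer_measure_ge0 _ _).
apply/lee_addgt0Pr => e e0.
have [N _ /(_ N (leqnn N)) hN] : \forall N \near \oo, \sum_(N <= k <oo) H (Rg k) < e%:E.
  move/fine_cvgP : tl => [f /cvgrPdist_lt/(_ e e0) c0]; near=> N.
  have fN : \sum_(N <= k <oo) H (Rg k) \is a fin_num by near: N.
  have : (`|0 - fine (\sum_(N <= k <oo) H (Rg k))| < e)%R by near: N.
  by rewrite sub0r normrN -[X in X < _]fineK// lte_fin => /(le_lt_trans (ler_norm _)).
have h1 : H (X `&` O) <= H (A N) + \sum_(N <= k <oo) H (Rg k).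
  apply: (@le_trans _ _ (H (A N `|` \bigcup_k Rg (k + N)%N))).
    apply: le_outer_measure => x [Xx Ox]; have [h|h] := ltP (q N) (x ord0 i); first by left.
    right; have x0 : (0 < x ord0 i - c)%R by rewrite subr_gt0; exact: Ox.
    have ex : exists k, (q k < x ord0 i)%R.
      have [k hk] := filter_ex (near_infty_natSinv_lt (PosNum x0)); exists k.
      by have hk' : (k.+1%:R^-1 < x ord0 i - c)%R := hk; rewrite /q -ltrBrDl.
    case: (ex_minnP ex) => -[|k] hk kmin.
      by exfalso; move: hk; rewrite ltNge (le_trans h)// qle.
    have Nk : (N <= k)%N by rewrite leqNgt; apply/negP => kN; move: hk; rewrite ltNge (le_trans h)//; exact: qle.
    exists (k - N)%N => //; rewrite subnK//; split => //=.
    by rewrite hk /= leNgt; apply/negP => /kmin; rewrite ltnn.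
  apply: (le_trans (outer_measureU2 _ _ _)); rewrite leeD2l//.
  apply: (le_trans (outer_measure_sigma_subadditive _ _)).
  by rewrite (nneseries_addn (f := fun k => H (Rg k)))// => k; exact: outer_measure_ge0.
have h2 : H (A N) + H (X `&` ~` O) <= H X.
  have g0 : (0 < N.+1%:R^-1 :> R)%R by [].
  apply: (@le_trans _ _ (H (A N `|` X `&` ~` O))); last by apply: le_outer_measure => x [[]|[]].
  apply: (H_separated g0) => x y [_ /= hx] [_ /= /negP]; rewrite -leNgt => hy.
  by apply: le_trans (lip x y); move: hx hy; rewrite /q; set v := (_^-1)%R; clear; lra.
apply: (le_trans (leeD h1 (lexx _))); rewrite addeAC; apply: leeD => //; exact: ltW.
Unshelve. all: by end_near. Qed.

Lemma cara_obox (lo hi : V) : measurable (obox lo hi : set mH).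
Proof.
have mlt i c : measurable ([set x : V | (x ord0 i < c)%R] : set mH).
  rewrite (_ : [set _ | _] = \bigcup_k ~` [set x : V | (c - k.+1%:R^-1 < x ord0 i)%R]).
    by apply: bigcup_measurable => k _; apply: measurableC; exact: cara_halfspace.
  apply/seteqP; split => x /=.
    move=> xc; have x0 : (0 < c - x ord0 i)%R by rewrite subr_gt0.
    have [k hk] := filter_ex (near_infty_natSinv_lt (PosNum x0)); exists k => //.
    have hk' : (k.+1%:R^-1 < c - x ord0 i)%R := hk.
    by apply/negP; rewrite -leNgt lerBrDr addrC -lerBrDr; exact: ltW.
  move=> [k _ /negP]; rewrite -leNgt => h; apply: (le_lt_trans h).
  by rewrite ltrBlDr ltrDl invr_gt0 ltr0n.
rewrite (_ : obox _ _ = \bigcap_(i in [set: 'I_n.+1]) ([set x : V | (lo ord0 i < x ord0 i)%R] `&` [set x | (x ord0 i < hi ord0 i)%R])).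
  by apply: fin_bigcap_measurable => // i _; apply: measurableI; [exact: cara_halfspace|exact: mlt].
apply/seteqP; split => x /= h i; first by move=> _; have /andP[] := h i.
by apply/andP; have [] := h i I.
Qed.

Lemma cara_open (U : set V) : open U -> measurable (U : set mH).
Proof.
move=> oU; rewrite (open_bigcup_qbox oU); apply: bigcup_measurable => k _.
case: ifPn => _ //; rewrite /qbox; case: choice.unpickle => [[lo hi]|]; [exact: cara_obox|exact: measurable0].
Qed.

Definition VB : Type := g_sigma_algebraType (@open V).
HB.instance Definition _ := Measurable.on VB.

Definition qunion (l : seq nat) : set V := \bigcup_(k in [set` l]) @qbox R n k.

Lemma open_qboxT k : open (@qbox R n k).
Proof. by rewrite /qbox; case: choice.unpickle => [[lo hi]|]; [exact: open_obox|exact: open0]. Qed.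

Lemma open_qunion l : open (qunion l).
Proof. by apply: bigcup_open => k _; exact: open_qboxT. Qed.

Definition fatten (C : set V) (e : R) : set V := [set x | exists2 y, C y & (enorm (x - y) < e)%R].

Lemma open_fatten C e : open (fatten C e).
Proof.
rewrite (_ : fatten C e = \bigcup_(y in C) eball y e); last by apply/seteqP; split => x [y Cy h]; exists y.
by apply: bigcup_open => y _; exact: open_eball.
Qed.

Lemma diam_fatten C (e : R) : (0 <= e)%R -> diam (fatten C e) <= diam C + (2 * e)%:E.
Proof.
move=> e0; apply: ge_ereal_sup => _ [->|[[x x'] [/= [y Cy hy] [y' Cy' hy']] <-]].
  by rewrite adde_ge0 ?diam_ge0// lee_fin mulr_ge0.
apply: (@le_trans _ _ ((enorm (y - y'))%:E + (2 * e)%:E)); last first.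
  by rewrite leeD2r//; apply: ereal_sup_ubound; right; exists (y, y').
rewrite -EFinD lee_fin.
have -> : (x - x' = (y - y') + ((x - y) - (x' - y')))%R by rewrite !opprD !opprK addrCA !addrA subrK addrAC subrK addrC.
apply: (le_trans (enormD _ _)); rewrite lerD2l; apply: (le_trans (enormD _ _)).
by rewrite enormN; lra.
Qed.

Lemma fatten_term C (d e : R) : diam C < d%:E -> (0 < e)%R -> exists2 h : R, (0 < h)%R &
  diam (fatten C h) < d%:E /\ hterm s (fatten C h) <= hterm s C + e%:E.
Proof.
move=> dC e0.
have fC : diam C \is a fin_num by rewrite ge0_fin_numE ?diam_ge0// (lt_trans dC)// ltry.
pose r := fine (diam C); have r0 : (0 <= r)%R by rewrite fine_ge0// diam_ge0.
have rd : (r < d)%R by rewrite -lte_fin fineK.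
have cv : ((omega R s.+1 * ((r + 2 * h) / 2) ^+ s.+1) @[h --> (0 : R)] --> omega R s.+1 * ((r + 2 * 0) / 2) ^+ s.+1)%R.
  apply: cvgMr; apply: (continuous_cvg _ (@exprn_continuous _ _ _)); apply: cvgMl; apply: cvgD; first exact: cvg_cst.
  by apply: cvgMr; exact: cvg_id.
have ev : \forall h \near (0%R : R), ((r + 2 * h < d) && (omega R s.+1 * ((r + 2 * h) / 2) ^+ s.+1 < omega R s.+1 * (r / 2) ^+ s.+1 + e))%R.
  near=> h; apply/andP; split.
    have : (`|0 - h| < (d - r) / 2)%R by near: h; apply/nbhs_ballP; exists ((d - r) / 2)%R => //=; rewrite divr_gt0 ?subr_gt0.
    by rewrite sub0r normrN => /(le_lt_trans (ler_norm _)); lra.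
  have : (`|omega R s.+1 * ((r + 2 * 0) / 2) ^+ s.+1 - omega R s.+1 * ((r + 2 * h) / 2) ^+ s.+1| < e)%R.
    by near: h; move/cvgrPdist_lt: cv; exact.
  by rewrite mulr0 addr0 distrC => /(le_lt_trans (ler_norm _)); lra.
have [rho /= rho0 hrho] := proj1 (nbhs_ballP _ _) ev.
have /andP[h1 h2] := hrho (rho / 2)%R (ltac:(rewrite /ball /= sub0r normrN gtr0_norm ?divr_gt0//; lra)).
exists (rho / 2)%R; first by rewrite divr_gt0.
have dF := diam_fatten C (ltW (divr_gt0 rho0 (ltr0Sn R 1))).
have dF' : diam (fatten C (rho / 2)) <= (r + 2 * (rho / 2))%:E by rewrite EFinD fineK.
split; first by apply: le_lt_trans dF' _; rewrite lte_fin.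
rewrite -EFinD lee_fin; apply: (le_trans _ (ltW h2)).
have ff : diam (fatten C (rho / 2)) \is a fin_num.
  by rewrite ge0_fin_numE ?diam_ge0// (le_lt_trans dF')// ltry.
rewrite ler_wpM2l ?omega_ge0// lerXn2r ?nnegrE ?divr_ge0 ?fine_ge0 ?diam_ge0//; first by lra.
by rewrite ler_pM2r// -lee_fin fineK.
Unshelve. all: by end_near. Qed.

(** Covering sets are fattened to open ones at small cost, compactness leaves finitely many rational
    boxes, and these are regrouped according to the set they came from. The condition thus ranges
    over countably many finite covers. *)
Lemma hd_compact (F : set V) (d c : R) : compact F -> (0 < d)%R ->
  hd d F < c%:E <-> exists ss : seq (seq nat), [/\ all (fun l => `[< diam (qunion l) < d%:E >]) ss,
     F `<=` \bigcup_(l in [set` ss]) qunion l & \sum_(l <- ss) hterm s (qunion l) < c%:E].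
Proof.
move=> cF d0; split; last first.
  move=> [ss [/allP h1 h2 h3]]; apply: le_lt_trans h3.
  pose C k := if (k < size ss)%N then qunion (nth [::] ss k) else set0.
  apply: (@le_trans _ _ (\sum_(0 <= k <oo) hterm s (C k))).
    apply: ereal_inf_lbound; exists C; split.
      move=> x /h2[l /= lss lx]; exists (index l ss) => //; rewrite /C index_mem lss nth_index//.
    split => // k; rewrite /C; case: ifP => hk; last by rewrite diam0 lte_fin.
    exact/asboolP/h1/mem_nth.
  rewrite (nneseries_split 0 (size ss)); last by move=> k _; exact: hterm_ge0.
  rewrite eseries0 ?adde0; last by move=> k; rewrite /= add0n /C => kss _; rewrite ltnNge kss hterm0.
  rewrite add0n (big_nth [::]) !big_mkord.
  by rewrite le_eqVlt; apply/orP; left; apply/eqP; apply: eq_bigr => i _; rewrite /C ltn_ord.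
move=> hlt; have hdf : hd d F \is a fin_num by rewrite ge0_fin_numE ?hausd_delta_ge0// (lt_trans hlt)// ltry.
have [e e0 he] : exists2 e : R, (0 < e)%R & hd d F + e%:E + e%:E < c%:E.
  exists ((c - fine (hd d F)) / 3)%R; first by rewrite divr_gt0// subr_gt0 -lte_fin fineK.
  rewrite -[X in X + _ + _](fineK hdf) -!EFinD lte_fin; have : (fine (hd d F) < c)%R by rewrite -lte_fin fineK.
  lra.
have [_ [C [cov [dC ->]]] hC] := lb_ereal_inf_adherent e0 hdf.
have e2 k : (0 < e / (2 ^ k.+1)%:R)%R by rewrite divr_gt0// ltr0n expn_gt0.
have /choice[h hh] k : exists h : R, (0 < h)%R /\ diam (fatten (C k) h) < d%:E /\ hterm s (fatten (C k) h) <= hterm s (C k) + (e / (2 ^ k.+1)%:R)%:E.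
  by have [h h0 hh] := fatten_term (dC k) (e2 k); exists h.
pose O k := fatten (C k) (h k).
pose D := [set p : nat * nat | @qbox R n p.1 `<=` O p.2].
have [X XD FX] : finite_subset_cover D (fun p => @qbox R n p.1) F.
  move: cF; rewrite compact_cover; apply; first by move=> p _; exact: open_qboxT.
  move=> x /cov[k _ Ckx]; have Ox : O k x by exists x => //; rewrite subrr enorm0; exact: (hh k).1.
  by have [q [qx qO]] := open_qbox (@open_fatten (C k) (h k)) Ox; exists (q, k).
pose N := (\max_(p <- finmap.enum_fset X) p.2).+1.
pose L k := [seq p.1 | p <- finmap.enum_fset X & p.2 == k].
have LO k : qunion (L k) `<=` O k.
  move=> x [q /= /mapP[p]]; rewrite mem_filter => /andP[/eqP <- pX] -> hx.
  by have /set_mem := XD p pX; exact.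
exists [seq L k | k <- iota 0 N]; split.
- apply/allP => l /mapP[k _ ->]; apply/asboolP; apply: le_lt_trans (diam_le (LO k)) _.
  exact: (hh k).2.1.
- move=> x /FX[p pX' px]; have pX : p \in finmap.enum_fset X := pX'; exists (L p.2).
    apply: (map_f L); rewrite mem_iota add0n /N ltnS leq0n andTb.
    exact: (@leq_bigmax_seq _ _ xpredT (fun p : nat * nat => p.2)).
  by exists p.1 => //=; apply/mapP; exists p => //; rewrite mem_filter eqxx.
- rewrite big_map; apply: le_lt_trans he.
  apply: (@le_trans _ _ (\sum_(0 <= k <oo) (hterm s (C k) + (e / (2 ^ k.+1)%:R)%:E))).
    have -> : \sum_(k <- iota 0 N) hterm s (qunion (L k)) = \sum_(0 <= k < N) hterm s (qunion (L k)) by rewrite /index_iota subn0.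
    apply: (@le_trans _ _ (\sum_(0 <= k < N) (hterm s (C k) + (e / (2 ^ k.+1)%:R)%:E))).
      apply: lee_sum => k _; apply: le_trans (hh k).2.2.
      have dO : diam (O k) \is a fin_num by rewrite ge0_fin_numE ?diam_ge0// (lt_trans (hh k).2.1)// ltry.
      have dL := diam_le (LO k).
      have dLf : diam (qunion (L k)) \is a fin_num by rewrite ge0_fin_numE ?diam_ge0// (le_lt_trans dL)// ltey_eq dO.
      rewrite lee_fin ler_wpM2l ?omega_ge0// lerXn2r ?nnegrE ?divr_ge0 ?fine_ge0 ?diam_ge0//.
      by rewrite ler_pM2r//; exact: fine_le.
    by apply: nneseries_lim_ge => k _ _; rewrite adde_ge0 ?hterm_ge0// lee_fin ltW.
  apply: (le_trans (epsilon_trick _ _ (ltW e0))); first by move=> k; exact: hterm_ge0.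
  by rewrite leeD2r// ltW.
Qed.

Lemma H_compact_measurable d (Y : measurableType d) (F : Y -> set V) : (forall y, compact (F y)) ->
  (forall l, measurable [set y | F y `<=` qunion l]) -> measurable_fun setT (fun y => H (F y)).
Proof.
move=> cF mF.
have mU (ss : seq (seq nat)) : measurable [set y | F y `<=` \bigcup_(l in [set` ss]) qunion l].
  have -> : \bigcup_(l in [set` ss]) qunion l = qunion (flatten ss); last exact: mF.
  apply/seteqP; split => x; first by move=> [l /= lss [k /= kl kx]]; exists k => //=; apply/flattenP; exists l.
  by move=> [k /= /flattenP[l lss kl] kx]; exists l => //; exists k.
have md (dl c : R) : (0 < dl)%R -> measurable [set y | hd dl (F y) < c%:E].
  move=> d0; pose G (ss : seq (seq nat)) := `[< all (fun l => `[< diam (qunion l) < dl%:E >]) ss /\ \sum_(l <- ss) hterm s (qunion l) < c%:E >].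
  rewrite (_ : [set y | _] = \bigcup_ss (if G ss then [set y | F y `<=` \bigcup_(l in [set` ss]) qunion l] else set0)).
    by apply: (@countable_bigcupT_measurable _ _ _ (fun ss => if G ss then [set y | F y `<=` \bigcup_(l in [set` ss]) qunion l] else set0)) => // ss; case: ifP.
  apply/seteqP; split => y.
    by move=> /(hd_compact c (cF y) d0)[ss [h1 h2 h3]]; exists ss => //; rewrite /G asboolT.
  move=> [ss _]; case: ifP => [/asboolP[h1 h3] h2|_ []].
  by apply/(hd_compact c (cF y) d0); exists ss.
apply: (measurability _ (ErealGenOInfty.measurableE R)).
move=> _ [_ [c ->] <-]; rewrite setTI.
rewrite (_ : _ @^-1` _ = \bigcup_k \bigcup_j ~` [set y | hd k.+1%:R^-1 (F y) < (c + j.+1%:R^-1)%:E]).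
  by do 2!(apply: bigcupT_measurable => ?); apply: measurableC; exact: md.
apply/seteqP; split => y; rewrite /preimage /= in_itv /= andbT.
  move=> hc; have [k hk] : exists k : nat, c%:E < hd k.+1%:R^-1 (F y).
    apply: contrapT => /forallNP hn; move: hc; rewrite ltNge => /negP; apply.
    apply: hausdorff_le => d0 d00; have [k hk] := filter_ex (near_infty_natSinv_lt (PosNum d00)).
    apply: (@le_trans _ _ (hd k.+1%:R^-1 (F y))); first by apply: hausd_delta_anti; exact: ltW.
    by rewrite leNgt; apply/negP/hn.
  have [r [r1 r2]] := rat_between hk.
  have r0 : (0 < ratr r - c)%R by rewrite subr_gt0.
  have [j hj] := filter_ex (near_infty_natSinv_lt (PosNum r0)).
  exists k => //; exists j => //=; apply/negP; rewrite -leNgt; apply: ltW; apply: le_lt_trans r2.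
  by have hj' : (j.+1%:R^-1 < ratr r - c)%R := hj; rewrite lee_fin -lerBrDl; exact: ltW.
move=> [k _ [j _ /= /negP]]; rewrite -leNgt => h; apply: (@lt_le_trans _ _ (c + j.+1%:R^-1)%:E).
  by rewrite lte_fin ltrDl.
by apply: le_trans h _; exact: hausd_delta_le.
Qed.
End HausMetric.

(** * Coding competitors by Baire space *)

Section Codes.
Variables (R : realType) (n m : nat).
Local Notation V := 'rV[R]_n.+1.
Local Notation W := 'rV[R]_m.
Local Notation leb := (@leb_out R n.+1).
Local Notation mV := (caratheodory_type (oleb R n)).
Variables (M : seq W) (a0 : W).
Hypothesis a0M : a0 \in M.
Implicit Types (y : Baire) (x : V).

(* A point [y] of Baire space codes countably many G_delta sets; [ucode y] takes the value of the first one containing [x], so that every measurable function with values in [M] is coded up to a null set. *)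
Definition gdelta y (i : nat) : set V :=
  \bigcap_(j : nat) \bigcup_(k : nat) @qbox R n (y (choice.pickle (i, j, k))).

Fixpoint ucode_rec (s : seq W) (i : nat) y x : W :=
  if s is a :: s' then if `[< gdelta y i x >] then a else ucode_rec s' i.+1 y x else a0.
Definition ucode y x := ucode_rec M 0 y x.

Lemma measurable_gdelta i : measurable ([set p | gdelta p.1 i p.2] : set (Baire * mV)).
Proof.
have -> : [set p : Baire * mV | gdelta p.1 i p.2] =
  \bigcap_(j : nat) \bigcup_(k : nat) \bigcup_(c : nat) ([set y : Baire | y (choice.pickle (i, j, k)) = c] `*` @qbox R n c).
  apply/seteqP; split => -[y x] /= h j _; have [k _ hk] := h j I; exists k => //.
    by exists (y (choice.pickle (i, j, k))).
  by move: hk => [c _ [/= ->]].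
apply: bigcapT_measurable => j; apply: bigcupT_measurable => k; apply: bigcupT_measurable => c.
apply: measurableX; last exact: measurable_qbox.
by apply: sub_sigma_algebra; exists (choice.pickle (i, j, k)), c.
Qed.

Lemma ucode_rec_mem s i y x : {subset s <= M} -> ucode_rec s i y x \in M.
Proof.
elim: s i => //= a s IH i sM; case: ifP => _; first by apply: sM; exact: mem_head.
by apply: IH => b bs; apply: sM; rewrite inE bs orbT.
Qed.
Lemma ucode_mem y x : ucode y x \in M. Proof. exact: ucode_rec_mem. Qed.

Lemma measurable_ucode_rec s i (Q : W -> Prop) : measurable ([set p | Q (ucode_rec s i p.1 p.2)] : set (Baire * mV)).
Proof.
elim: s i => [|a s IH] i /=.
  by have [q|q] := pselect (Q a0); [rewrite (_ : [set _ | _] = setT)//; apply/seteqP; split|rewrite (_ : [set _ | _] = set0)//; apply/seteqP; split].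
rewrite (_ : [set _ | _] = ([set p | gdelta p.1 i p.2] `&` (if `[< Q a >] then setT else set0)) `|`
   (~` [set p | gdelta p.1 i p.2] `&` [set p | Q (ucode_rec s i.+1 p.1 p.2)])).
  apply: measurableU; apply: measurableI => //; [exact: measurable_gdelta|by case: ifP|].
  by apply: measurableC; exact: measurable_gdelta.
apply/seteqP; split => -[y x] /= h; have [g|ng] := pselect (gdelta y i x).
- by left; split => //; move: h; rewrite (asboolT g) => h; rewrite asboolT.
- by right; split => //; move: h; rewrite (asboolF ng).
- by rewrite (asboolT g); move: h => [[_]|[]//]; case: (asboolP (Q a)).
- by rewrite (asboolF ng); move: h => [[]|[]].
Qed.

Lemma measurable_ucode (Q : W -> Prop) : measurable ([set p | Q (ucode p.1 p.2)] : set (Baire * mV)).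
Proof. exact: measurable_ucode_rec. Qed.

Lemma ucode_Mfun y : Mfun M (ucode y).
Proof.
split; first by move=> x; exact: ucode_mem.
move=> a; apply/lmeasP; have := measurable_xsection y (measurable_ucode (fun v => v = a)).
by congr measurable; apply/seteqP; split => x; rewrite /xsection /= inE.
Qed.

Lemma leb_outer_regular (A : set V) (e : R) : (leb A < +oo)%E -> lmeas A -> 0 < e ->
  exists O, [/\ open O, A `<=` O & (leb (O `\` A) <= e%:E)%E].
Proof.
move=> Afin mA e0; have fA : leb A \is a fin_num by rewrite ge0_fin_numE// leb_out_ge0.
have [_ [lo [hi [cov ->]]] h] := lb_ereal_inf_adherent e0 fA.
exists (\bigcup_k obox (lo k) (hi k)); split => //; first by apply: bigcup_open => k _; exact: open_obox.
set O := \bigcup_k _.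
have lO : (leb O <= leb A + e%:E)%E.
  apply: le_trans (ltW h); apply: (le_trans (outer_measure_sigma_subadditive (oleb R n) _)).
  apply: lee_nneseries => k _; first by move=> _; exact: outer_measure_ge0.
  exact: leb_le_box.
have := mA O; rewrite (setIidr cov) -setDE => eO.
have : (leb A + leb (O `\` A) <= leb A + e%:E)%E by rewrite -eO.
by rewrite leeD2lE.
Qed.

Lemma open_qseq (U : set V) : open U -> exists q : nat -> nat, U = \bigcup_k @qbox R n (q k).
Proof.
move=> oU; pose k0 : nat := choice.pickle ((0, 0) : 'rV[rat]_n.+1 * 'rV[rat]_n.+1).
have q0 : @qbox R n k0 = set0.
  rewrite /qbox /k0 choice.pickleK -subset0 => x /(_ ord0); rewrite !mxE => /andP[h1 h2].
  by have := lt_trans h1 h2; rewrite ltxx.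
exists (fun k => if `[< @qbox R n k `<=` U >] then k else k0).
rewrite {1}(open_bigcup_qbox oU); apply: eq_bigcup => // k _.
by case: ifP => _ //; rewrite q0.
Qed.

(** Outer regularity: each level set of [w] in D is, up to a null set, an intersection of open sets,
    and these are unions of rational boxes. *)
Lemma ucode_onto (D : set V) (K : R) (w : V -> W) : open D -> (forall x, D x -> enorm x <= K) -> Mfun M w ->
  exists y, leb (D `&` [set x | ucode y x <> w x]) = 0%E.
Proof.
move=> oD DK hw; pose A (i : nat) : set V := D `&` w @^-1` [set nth a0 M i].
have mA i : lmeas (A i).
  apply/lmeasP; apply: measurableI; first exact: measurable_open.
  exact: (proj1 (lmeasP _) (hw.2 _)).
have fA i : (leb (A i) < +oo)%E by apply: (leb_bounded_fin (K := K)) => x [/DK].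
have exO (p : nat * nat) : exists O, [/\ open O, A p.1 `<=` O & (leb (O `\` A p.1) <= (p.2.+1%:R^-1)%:E)%E].
  exact: leb_outer_regular.
have [U hU] := choice exO.
have /choice[q hq] p : exists q : nat -> nat, U p = \bigcup_k @qbox R n (q k) by apply: open_qseq; case: (hU p).
pose y : Baire := fun c => if (choice.unpickle c : option (nat * nat * nat)) is Some (i, j, k) then q (i, j) k else 0%N.
have gy i : gdelta y i = \bigcap_j U (i, j).
  by apply: eq_bigcap => // j _; rewrite hq; apply: eq_bigcup => // k _; rewrite /y choice.pickleK.
have null i : leb (gdelta y i `\` A i) = 0%E.
  apply/eqP; rewrite eq_le leb_out_ge0 andbT; apply/lee_addgt0Pr => e e0; rewrite add0e.
  have [j hj] := filter_ex (near_infty_natSinv_lt (PosNum e0)).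
  apply: (@le_trans _ _ (leb (U (i, j) `\` A i))).
    by apply: leb_le; rewrite gy => x [h nA]; split => //; exact: (h j I).
  by have [_ _ h] := hU (i, j); apply: (le_trans h); rewrite lee_fin; exact: ltW.
exists y; pose B := \big[setU/set0]_(i < size M) (gdelta y i `\` A i).
have nB : leb B = 0%E by apply: (@outer_fin0 R _ (oleb R n) _ (fun i : 'I_(size M) => gdelta y i `\` A i)) => [i|x /in_bigsetU//]; exact: null.
apply: leb_sub0 nB => x [Dx /= ne]; apply: contrapT => nBx; apply: ne.
have hi i : (i < size M)%N -> gdelta y i x <-> w x = nth a0 M i.
  move=> iM; split => [g|wx].
    apply: contrapT => nw; apply: nBx; apply/in_bigsetU; exists (Ordinal iM); split => //= -[_].
    exact: nw.
  rewrite gy => j _; case: (hU (i, j)) => _ + _; apply; split => //.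
have wM := hw.1 x; rewrite /ucode.
suff key s i : drop i M = s -> w x \in s -> ucode_rec s i y x = w x by apply: (key M 0%N) => //; rewrite drop0.
elim: s i => // a s IH i ds; rewrite inE => hin /=.
have iM : (i < size M)%N by rewrite ltnNge; apply/negP => /drop_oversize e; move: ds; rewrite e.
have [a_ s_] : a = nth a0 M i /\ s = drop i.+1 M.
  by move: ds; rewrite (drop_nth a0 iM) => -[-> ->].
case: asboolP => [/(hi i iM) -> //|ng]; apply: IH => //.
by move: hin; case: eqP => // e; exfalso; apply: ng; apply/(hi i iM); rewrite e.
Qed.

Lemma measurable_ucode_leb (A : set V) (Q : V -> W -> Prop) :
  measurable ([set p | A p.2 /\ Q p.2 (ucode p.1 p.2)] : set (Baire * mV)) ->
  measurable_fun setT (fun y : Baire => leb (A `&` [set x | Q x (ucode y x)])).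
Proof.
move=> mA; have := measurable_fun_xsection (mleb R n) mA.
congr measurable_fun; apply/funext => y /=; congr leb.
by apply/seteqP; split => x; rewrite /xsection /= inE.
Qed.

Lemma measurable_ucode_cst (A : set V) (Q : W -> Prop) : measurable (A : set mV) ->
  measurable_fun setT (fun y : Baire => leb (A `&` [set x | Q (ucode y x)])).
Proof.
move=> mA; apply: (@measurable_ucode_leb A (fun _ => Q)).
rewrite (_ : [set p | _] = (setT `*` A) `&` [set p : Baire * mV | Q (ucode p.1 p.2)]); last by apply/seteqP; split => p /= [] // [].
by apply: measurableI; [exact: measurableX|exact: measurable_ucode].
Qed.

Lemma measurable_Tint (D : set V) Phi : testfield D Phi -> measurable_fun setT (fun y : Baire => Tint (ucode y) Phi).
Proof.
move=> tf; apply: measurable_sum => al.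
have [mphi _] := divg_bcs (tf.1 al).
pose F (p : Baire * mV) : R := ucode p.1 p.2 ord0 al * divg (Phi al) p.2.
have mF : measurable_fun setT F.
  apply: measurable_funM; last exact: measurableT_comp.
  move=> _ B mB; rewrite setTI; exact: (measurable_ucode (fun v => B (v ord0 al))).
have mFe : measurable_fun setT (EFin \o F) by exact/measurable_EFinP.
have -> : (fun y : Baire => J (fun x => ucode y x ord0 al * divg (Phi al) x)) =
  fine \o (fun y => (fubini_F (mleb R n) (EFin \o F)^\+ y - fubini_F (mleb R n) (EFin \o F)^\- y)%E).
  by apply/funext => y; rewrite /J /Rintegral integralE /=; congr (fine (_ - _)%E); apply: eq_integral => x _; rewrite ?funeposE ?funenegE.
apply: measurableT_comp => //; apply: emeasurable_funB.
  by apply: measurable_fun_fubini_tonelli_F => //; exact: measurable_funepos.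
by apply: measurable_fun_fubini_tonelli_F => //; exact: measurable_funeneg.
Qed.
End Codes.

Section TVcodes.
Variables (R : realType) (n m : nat).
Local Notation V := 'rV[R]_n.+1.
Local Notation W := 'rV[R]_m.
Local Notation mV := (caratheodory_type (oleb R n)).
Variables (M : seq W) (a0 : W).
Hypothesis a0M : a0 \in M.

(** Finitely many boxes covering a ball, each with an integer vector within 2 of [f]. Rounding down
    gives an error below 1, the slack makes the condition open, and two functions with the same code
    differ by at most 4. *)
Definition divcode (K : R) (s : seq (nat * {ffun 'I_m -> int})) (f : 'I_m -> V -> R) :=
  (forall x, enorm x <= K -> exists2 p, p \in s & @qbox R n p.1 x) /\
  forall p x al, p \in s -> @qbox R n p.1 x -> `|f al x - (p.2 al)%:~R| <= 2.

Lemma divcode_ex (K : R) (f : 'I_m -> V -> R) : (forall al, continuous (f al)) -> exists s, divcode K s f.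
Proof.
move=> cf; pose U (v : {ffun 'I_m -> int}) : set V := \bigcap_(al in [set: 'I_m]) [set x | `|f al x - (v al)%:~R| < 2].
have oU v : open (U v).
  rewrite /U bigcap_fset_set; last exact: finite_finset.
  apply: big_ind => [|A B|al _]; [exact: openT|exact: openI|].
  have cc : continuous (fun x => f al x - (v al)%:~R) by exact: continuous_add (cf al) (@continuous_cst_fun _ _ _).
  rewrite (_ : [set x | _] = [set x | f al x - (v al)%:~R < 2] `&` [set x | -2 < f al x - (v al)%:~R]).
    by apply: openI; [exact: open_gtf|exact: open_ltf].
  by apply/seteqP; split => x /=; rewrite ltr_norml; [move=> /andP[]|move=> [-> ->]].
pose D := [set p : nat * {ffun 'I_m -> int} | @qbox R n p.1 `<=` U p.2].
have cK : compact [set x : V | enorm x <= K].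
  by apply: (@compact_closed_enorm _ _ _ K) => //; apply: closed_lef; exact: continuous_enorm.
have [X XD FX] : finite_subset_cover D (fun p => @qbox R n p.1) [set x : V | enorm x <= K].
  move: cK; rewrite compact_cover; apply; first by move=> p _; exact: open_qboxT.
  move=> x _; pose v : {ffun 'I_m -> int} := [ffun al => Num.floor (f al x)].
  have Ux : U v x.
    move=> al _ /=; rewrite ffunE; have h1 := floor_le_tmp (f al x); have h2 := floorD1_gt (f al x).
    by rewrite ger0_norm ?subr_ge0//; move: h2; rewrite intrD; lra.
  by have [q [qx qU]] := open_qbox (oU v) Ux; exists (q, v).
exists (finmap.enum_fset X); split.
  by move=> x /FX[p pX px]; exists p.
by move=> p x al pX px; have /set_mem := XD p pX => /(_ x px al I) /ltW.
Qed.

Lemma divcode_close (K : R) s f f' x al : divcode K s f -> divcode K s f' -> enorm x <= K -> `|f al x - f' al x| <= 4.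
Proof.
move=> [h1 h2] [_ h2'] /h1[p ps px]; have := h2 p x al ps px; have := h2' p x al ps px.
by rewrite !ler_norml => /andP[? ?] /andP[? ?]; apply/andP; split; lra.
Qed.

Lemma divg_continuous (D : set V) (Phi : 'I_n.+1 -> V -> R) : (forall i, C1c D (Phi i)) -> continuous (divg Phi).
Proof.
move=> h; rewrite /divg; elim: (index_enum _) => [|i r IH].
  by under eq_fun do rewrite big_nil; exact: continuous_cst_fun.
under eq_fun do rewrite big_cons; apply: continuous_add => //; exact: ((h i).2 i).2.
Qed.

(* Test fields whose divergences have the same code give nearly the same value, and there are countably many codes. *)
Lemma TVfin_countable (D : set V) (K : R) : (forall x, D x -> enorm x <= K) -> exists Psi : nat -> 'I_m -> 'I_n.+1 -> V -> R,
  (forall k, testfield D (Psi k)) /\ forall w, Mfun M w -> (TVfin D w <-> exists C : nat, forall k, Tint w (Psi k) <= C%:R).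
Proof.
move=> DK.
have tf0 : testfield D (fun (_ : 'I_m) (_ : 'I_n.+1) (_ : V) => 0 : R).
  split; last by move=> x; rewrite big1// => al _; rewrite big1// => i _; rewrite expr0n.
  move=> al i; apply: (C1d_C1c (@C1d_cst R n 0) (K := set0)) => //; exact: compact0.
pose good (s : seq (nat * {ffun 'I_m -> int})) Phi := testfield D Phi /\ divcode K s (fun al => divg (Phi al)).
have /choice[P hP] s : exists Phi, testfield D Phi /\ ((exists Phi', good s Phi') -> good s Phi).
  have [[Phi' h]|no] := pselect (exists Phi', good s Phi'); first by exists Phi'; split; [exact: h.1|].
  by exists (fun _ _ _ => 0); split => // /no.
pose Psi k := if (choice.unpickle k : option (seq (nat * {ffun 'I_m -> int}))) is Some s then P s else (fun _ _ _ => 0).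
have tPsi k : testfield D (Psi k) by rewrite /Psi; case: choice.unpickle => [s|] //; exact: (hP s).1.
exists Psi; split => //.
move=> w hw; have bw := Mfun_bmeas hw; split.
  move=> [C hC]; exists (Num.truncn C).+1 => k; apply: (@le_trans _ _ C); last exact/ltW/truncnS_gt.
  exact: hC.
move=> [C hC]; have [[B hB] _] := bw.
pose A := [set x : V | enorm x <= K].
have fA : leb_out A \is a fin_num.
  by rewrite ge0_fin_numE ?leb_out_ge0//; apply: (leb_bounded_fin (K := K)).
(* Replacing a field by the chosen one with the same code changes the pairing by a fixed amount,
   which is harmless as only boundedness is tested. *)
exists (C%:R + \sum_(al < m) `|B| * 4 * fine (leb_out A)) => Phi tPhi.
have [s hs] := @divcode_ex K (fun al => divg (Phi al)) (fun al => divg_continuous (tPhi.1 al)).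
have [tP /(_ (ex_intro _ Phi (conj tPhi hs)))[_ hPs]] := hP s.
have := hC (choice.pickle s); rewrite /Psi choice.pickleK => hCs.
have dif : Tint w Phi - Tint w (P s) <= \sum_(al < m) `|B| * 4 * fine (leb_out A).
  rewrite /Tint -sumrB; apply: ler_sum => al _.
  rewrite -JB; [|exact: (bmeas_bcs al bw tPhi)|exact: (bmeas_bcs al bw tP)].
  apply: (le_trans (ler_norm _)); apply: (@J_bound _ _ _ A _ K).
  - by apply: bcsB; [exact: (bmeas_bcs al bw tPhi)|exact: (bmeas_bcs al bw tP)].
  - by apply: measurable_closed; apply: closed_lef; exact: continuous_enorm.
  - by [].
  - move=> x; rewrite -mulrBr normrM; have [xA|nA] := pselect (A x).
      apply: ler_pM => //; first exact: le_trans (hB x al) (ler_norm _).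
      exact: (divcode_close al hs hPs).
    have off Phi0 : testfield D Phi0 -> divg (Phi0 al) x = 0.
      move=> t0; have [S hS] := testfield_supp al t0.
      apply: (@divg_off _ _ D _ x S) => [i|i|i]; have [c1 c2 c3] := hS i; [exact: compact_closedV|exact: c3|by move=> /c2 /DK].
    by rewrite !off// subrr normr0 mulr0 mulr_ge0.
  - move=> x nA; have off Phi0 : testfield D Phi0 -> divg (Phi0 al) x = 0.
      move=> t0; have [S hS] := testfield_supp al t0.
      apply: (@divg_off _ _ D _ x S) => [i|i|i]; have [c1 c2 c3] := hS i; [exact: compact_closedV|exact: c3|by move=> /c2 /DK].
    by rewrite !off// mulr0 subrr.
by rewrite -lerBlDl; apply: (le_trans _ dif); rewrite lerB.
Qed.

Lemma measurable_TVfin (D : set V) (K : R) : (forall x, D x -> enorm x <= K) ->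
  measurable [set y : Baire | TVfin D (ucode M a0 y)].
Proof.
move=> DK; have [Psi [h1 h2]] := TVfin_countable DK.
rewrite (_ : [set y | _] = \bigcup_C \bigcap_k [set y : Baire | Tint (ucode M a0 y) (Psi k) <= C%:R]).
  apply: bigcupT_measurable => C; apply: bigcapT_measurable => k.
  have := measurable_Tint M a0 (h1 k) measurableT (measurable_itv `]-oo, C%:R]).
  by rewrite setTI; congr measurable; apply/seteqP; split => y; rewrite /preimage /= in_itv.
apply/seteqP; split => y /=.
  by move=> /(proj1 (h2 _ (ucode_Mfun n a0M y)))[C hC]; exists C => // k _; exact: hC.
by move=> [C _ hC]; apply/(proj2 (h2 _ (ucode_Mfun n a0M y))); exists C => k; exact: hC.
Qed.
End TVcodes.

Section CellCode.
Variables (R : realType) (n m : nat).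
Local Notation V := 'rV[R]_n.+2.
Local Notation W := 'rV[R]_m.
Local Notation leb := (@leb_out R n.+2).
Local Notation mV := (caratheodory_type (oleb R n.+1)).
Variables (M : seq W) (a0 : W).
Hypothesis a0M : a0 \in M.
Variables (nu : V) (t l : R) (ub : V -> W).
Hypotheses (nu1 : sphere nu) (t0 : 0 < t) (l0 : 0 < l) (hub : Mfun M ub).
Let D := rect nu t l.
Let K := n.+2%:R * (t + l).
Let DK x : D x -> enorm x <= K.
Proof. by move=> /(rect_crect nu1); apply: crect_bounded; exact: ltW. Qed.
Let oD : open D. Proof. exact: open_rect. Qed.

(** By compactness of the boundary the arbitrary neighbourhood may be replaced by one of countably
    many collars. *)
Lemma near_bdryP (w : V -> W) : near_bdry D w ub <-> exists q : nat,
  leb ((D `\` rect nu (t - q.+1%:R^-1) (l - q.+1%:R^-1)) `&` [set x | w x <> ub x]) = 0%E.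
Proof.
split.
  move=> [U [oU bU hU]]; have [s [s0 st sl h]] := rect_collar nu1 t0 l0 oU bU.
  have [q hq] := filter_ex (near_infty_natSinv_lt (PosNum s0)); exists q.
  apply: leb_sub0 hU => x [[Dx nx] wx]; split => //; split => //; apply: h => // hx; apply: nx.
  have hq' : q.+1%:R^-1 < s := hq.
  by apply: crect_rect (rect_crect nu1 hx) => //; rewrite ltrD2l ltrN2.
move=> [q hq]; have q0 : 0 < q.+1%:R^-1 :> R by [].
exists (~` crect nu (t - q.+1%:R^-1) (l - q.+1%:R^-1)); split.
- by apply: closed_openC; exact: closed_crect.
- move=> x [_ nD] cx; apply: nD; apply: crect_rect cx => //; by rewrite ltrBlDr ltrDl.
- apply: leb_sub0 hq => x [[Dx nx] wx]; split => //; split => // hx; apply: nx; exact: rect_crect.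
Qed.

Definition adm (y : Baire) : Prop := TVfin D (ucode M a0 y) /\ near_bdry D (ucode M a0 y) ub.

Lemma adm_admW y : adm y -> admW M ub D (ucode M a0 y).
Proof. by move=> [h1 h2]; split => //; exact: ucode_Mfun. Qed.

Lemma measurable_adm : measurable adm.
Proof.
rewrite (_ : adm = [set y | TVfin D (ucode M a0 y)] `&` [set y | near_bdry D (ucode M a0 y) ub])//.
apply: measurableI; first exact: (measurable_TVfin a0M DK).
rewrite (_ : [set y | _] = \bigcup_q [set y : Baire | leb ((D `\` rect nu (t - q.+1%:R^-1) (l - q.+1%:R^-1)) `&` [set x | ucode M a0 y x <> ub x]) = 0%E]).
  apply: bigcupT_measurable => q; set A := D `\` _.
  have mA : measurable (A : set mV) by apply: measurableD; apply: measurable_open => //; exact: open_rect.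
  have := @measurable_ucode_leb R n.+1 m M a0 A (fun x v => v <> ub x).
  move=> /(_ _)/(_ measurableT [set 0%E] (emeasurable_set1 _)); rewrite setTI; apply.
  rewrite (_ : [set p | _] = (setT `*` A) `&` \big[setU/set0]_(i < size M) ([set p : Baire * mV | ucode M a0 p.1 p.2 = nth a0 M i] `&` (setT `*` (~` (ub @^-1` [set nth a0 M i]))))).
    apply: measurableI; first exact: measurableX.
    apply: bigsetU_measurable => i _; apply: measurableI; first exact: (@measurable_ucode R n.+1 m M a0 (fun v => v = nth a0 M i)).
    by apply: measurableX => //; apply: measurableC; exact: (proj1 (lmeasP _) (hub.2 _)).
  apply/seteqP; split => -[y x] /=.
    move=> [Ax ne]; split => //; apply/in_bigsetU.
    have uM := ucode_mem a0M y x; have iM : (index (ucode M a0 y x) M < size M)%N by rewrite index_mem.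
    exists (Ordinal iM); rewrite /= nth_index//; split => //; split => //= e; exact: ne.
  by move=> [[_ Ax] /in_bigsetU[i [/= -> [_ h]]]]; split => // e; apply: h; rewrite /preimage /= e.
apply/seteqP; split => y; first by move=> /near_bdryP[q hq]; exists q.
by move=> [q _ hq]; apply/near_bdryP; exists q.
Qed.

(** With a strict inequality the infimum becomes an existential statement over Baire space, to which
    projection applies. *)
Lemma cell_code (g : V -> W -> V -> R) (s : \bar R) : (cell M g ub D < s)%E <->
  exists y, adm y /\ (Esurf g (ucode M a0 y) D < s)%E.
Proof.
split; last first.
  by move=> [y [ay lt]]; apply: le_lt_trans lt; apply: (cell_le g oD DK); exact: adm_admW.
move=> /(cell_adh a0M oD)[w [hw tv nb] lt].
have [y hy] := ucode_onto a0 oD DK hw.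
have hyS := ae_sym hy.
exists y; split; last by rewrite (Esurf_ae g oD hy).
split.
  have [C hC] := tv; exists C => Phi tP.
  by rewrite (Tint_ae (Mfun_bmeas (ucode_Mfun n.+1 a0M y)) (Mfun_bmeas hw) tP hy); exact: hC.
move: nb => [U [oU bU hU]]; exists U; split => //.
apply/eqP; rewrite eq_le leb_out_ge0 andbT -(adde0 0%E) -{1}hU -hy.
apply: le_trans (outer_measureU2 (oleb R n.+1) _ _); apply: leb_le => x [[Dx Ux] /= ux].
have [e|e] := pselect (ucode M a0 y x = w x); last by right.
by left; split => //= e2; apply: ux; rewrite e.
Qed.
End CellCode.

(** * Jump points through densities of half balls *)

Section Density.
Variables (R : realType) (n m : nat).
Local Notation V := 'rV[R]_n.+1.
Local Notation W := 'rV[R]_m.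
Local Notation leb := (@leb_out R n.+1).
Local Notation mV := (caratheodory_type (oleb R n)).
Variables (va vb : W).
Implicit Types (x z nu : V) (w : V -> W) (K : set V).

Definition rq (q : nat) : R := q.+1%:R^-1.
Lemma rq_gt0 q : 0 < rq q. Proof. by rewrite invr_gt0. Qed.
Lemma rq_le1 q : rq q <= 1. Proof. by rewrite invf_le1// ler1n. Qed.

(** A half ball with a margin h. Moving x and nu by dl costs 2 dl of margin ([shape_sub]), which
    turns a large bad measure into an open condition on (x, nu). *)
Definition shape (h : R) x nu (r : R) (p : bool) : set V :=
  [set z | enorm (z - x) < r - h /\ h < sg R p * dotv (z - x) nu].

Lemma shape0 x nu r p : shape 0 x nu r p = halfball x nu r p.
Proof. by apply/seteqP; split => z; rewrite /shape /= subr0 => h; apply/halfballP. Qed.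

Lemma open_shape h x nu r p : open (shape h x nu r p).
Proof.
have -> : shape h x nu r p = eball x (r - h) `&` [set z | h < sg R p * dotv (z - x) nu] by [].
apply: openI; first exact: open_eball.
apply: open_ltf; apply: continuous_mul; first exact: continuous_cst_fun.
by apply: (@continuous_lip _ _ _ (enorm nu)) => u v; rewrite -dotvBl (_ : u - x - (v - x) = u - v); [rewrite mulrC; exact: dotv_CS|by rewrite opprB addrA subrK].
Qed.

Lemma shape_mono h h' x nu r p : h' <= h -> shape h x nu r p `<=` shape h' x nu r p.
Proof. by move=> hh z [h1 h2]; split; [apply: lt_le_trans h1 _; rewrite lerB|exact: le_lt_trans h2]. Qed.

Lemma sg_norm p (u : R) : `|sg R p * u| = `|u|.
Proof. by case: p; rewrite /sg ?mul1r// mulN1r normrN. Qed.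

Lemma shape_sub h dl x x' nu nu' r p : 0 <= h -> 0 <= dl -> r <= 1 -> sphere nu' ->
  enorm (x - x') <= dl -> enorm (nu - nu') <= dl -> shape h x nu r p `<=` shape (h - 2 * dl) x' nu' r p.
Proof.
move=> h0 d0 r1 n1 xx nn z [h1 h2]; split.
  have -> : z - x' = (z - x) + (x - x') by rewrite addrA subrK.
  by apply: (le_lt_trans (enormD _ _)); lra.
have e : dotv (z - x') nu' = dotv (z - x) nu - dotv (z - x) (nu - nu') + dotv (x - x') nu'.
  by rewrite dotvBr opprB addrCA subrr addr0 -dotvDl addrA subrK.
have b1 : `|dotv (z - x) (nu - nu')| <= dl.
  apply: (le_trans (dotv_CS _ _)); rewrite -(mul1r dl); apply: ler_pM => //; [exact: sqrtr_ge0|exact: sqrtr_ge0|lra].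
have b2 : `|dotv (x - x') nu'| <= dl by apply: (le_trans (dotv_CS _ _)); rewrite n1 mulr1.
rewrite e; move: h2 b1 b2; rewrite /sg.
set u := dotv _ nu; set v := dotv _ (nu - nu'); set s := dotv _ nu'.
by rewrite !ler_norml => h2 /andP[? ?] /andP[? ?]; move: h2; case: p; lra.
Qed.

Definition vv (p : bool) : W := if p then vb else va.
Definition bad w (h : R) (q : nat) (p : bool) (x nu : V) : \bar R :=
  leb (shape h x nu (rq q) p `&` [set z | w z <> vv p]).

Lemma bad_mono w h h' q p x nu : h' <= h -> (bad w h q p x nu <= bad w h' q p x nu)%E.
Proof. by move=> hh; apply: leb_le => z [h1 h2]; split => //; exact: shape_mono h1. Qed.

Lemma bad_cont M w q p x nu (c : \bar R) : Mfun M w -> (c < bad w 0 q p x nu)%E ->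
  exists N : nat, (c < bad w N.+1%:R^-1 q p x nu)%E.
Proof.
move=> hw hc; pose A (N : nat) : set mV := shape N.+1%:R^-1 x nu (rq q) p `&` [set z | w z <> vv p].
have mB : measurable ([set z | w z <> vv p] : set mV).
  by apply: measurableC; exact: (proj1 (lmeasP _) (hw.2 (vv p))).
have mA N : measurable (A N) by apply: measurableI => //; apply: measurable_open; exact: open_shape.
have eA : \bigcup_N A N = shape 0 x nu (rq q) p `&` [set z | w z <> vv p].
  apply/seteqP; split => z; first by move=> [N _ [h1 h2]]; split => //; apply: shape_mono h1.
  move=> [[h1 h2] hz]; rewrite subr0 in h1.
  have d0 : 0 < Num.min (rq q - enorm (z - x)) (sg R p * dotv (z - x) nu) by rewrite lt_min subr_gt0 h1.
  have [N hN] := filter_ex (near_infty_natSinv_lt (PosNum d0)); exists N => //; split => //.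
  have : N.+1%:R^-1 < Num.min (rq q - enorm (z - x)) (sg R p * dotv (z - x) nu) := hN.
  by rewrite lt_min => /andP[h3 h4]; split => //; rewrite ltrBrDl -ltrBrDr.
have cv : (mleb R n (A N) @[N --> \oo] --> mleb R n (\bigcup_N A N)).
  apply: nondecreasing_cvg_mu => //; first exact: bigcupT_measurable.
  move=> i j ij; apply/subsetPset => z [h1 h2]; split => //; apply: shape_mono h1.
  by rewrite lef_pV2 ?posrE// ler_nat.
apply: contrapT => /forallNP no.
have : (mleb R n (\bigcup_N A N) <= c)%E.
  have <- := cvg_lim (@ereal_hausdorff R) cv; apply: lime_le; first by apply/cvg_ex; eexists; exact: cv.
  by near=> N; have /negP := no N; rewrite -leNgt.
by rewrite eA leNgt => /negP; apply.
Unshelve. all: by end_near. Qed.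

Section Fset.
Variables (eps : R) (Q : nat) (K W0 : set V).
Hypotheses (cK : compact K) (cW : closed W0).
Let S0 : set V := W0 `&` [set nu | sphere nu].

(** Points with a normal at which, from scale Q on, both half balls carry the right value up to the
    fraction eps. *)
Definition Zset w : set (V * V) := [set p | [/\ K p.1, S0 p.2 &
  forall q b, (Q <= q)%N -> (bad w 0 q b p.1 p.2 <= (eps * rq q ^+ n.+1)%:E)%E]].
Definition Fset w : set V := [set x | exists nu, Zset w (x, nu)].
(** A witness at stage N that (x, nu) is outside [Zset]: finitely many scales and a margin 1/(N+1),
    hence stable under small moves. *)
Definition PN w (N : nat) (x nu : V) := exists q b, [/\ (Q <= q)%N, (q <= N)%N &
  ((eps * rq q ^+ n.+1)%:E < bad w N.+1%:R^-1 q b x nu)%E].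

Let compact_S0 : compact S0.
Proof.
apply: (@compact_closed_enorm _ _ _ 1); last by move=> x [_ /= ->].
apply: closedI => //; rewrite (_ : [set nu | _] = [set nu : V | enorm nu <= 1] `&` [set nu : V | 1 <= enorm nu]).
  by apply: closedI; [apply: closed_lef|apply: closed_gef]; exact: continuous_enorm.
apply/seteqP; split => x /=; first by move=> ->.
by move=> [h1 h2]; apply/eqP; rewrite eq_le h1.
Qed.

Let PN_mono w N N' x nu : (N <= N')%N -> PN w N x nu -> PN w N' x nu.
Proof.
move=> NN [q [b [h1 h2 h3]]]; exists q, b; split => //; first exact: leq_trans NN.
by apply: (lt_le_trans h3); apply: bad_mono; rewrite lef_pV2 ?posrE// ler_nat.
Qed.

Let PN_ex M w x nu : Mfun M w -> K x -> S0 nu -> ~ Zset w (x, nu) -> exists N, PN w N x nu.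
Proof.
move=> hw Kx Sn nZ; have [q [b [h1 h2]]] : exists q b, (Q <= q)%N /\ ((eps * rq q ^+ n.+1)%:E < bad w 0 q b x nu)%E.
  apply: contrapT => no; apply: nZ; split => // q b Qq; rewrite leNgt; apply/negP => lt; apply: no; by exists q, b.
have [N hN] := bad_cont hw h2; exists (maxn N q); exists q, b; split => //; first exact: leq_maxr.
by apply: (lt_le_trans hN); apply: bad_mono; rewrite lef_pV2 ?posrE// ler_nat ltnS leq_maxl.
Qed.

(** Chosen so that the margin 1/(N+1) - 2 [dN N] is exactly 1/(2N+2), the margin of stage 2N + 1. *)
Let dN (N : nat) : R := (4 * N.+1%:R)^-1.
Let PN_near w N x nu x' nu' : sphere nu' -> PN w N x nu -> enorm (x - x') <= dN N -> enorm (nu - nu') <= dN N ->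
  PN w (2 * N + 1) x' nu'.
Proof.
move=> n1 [q [b [h1 h2 h3]]] xx nn; exists q, b; split => //; first by lia.
apply: (lt_le_trans h3); apply: leb_le => z [sz wz]; split => //.
have := @shape_sub N.+1%:R^-1 (dN N) x x' nu nu' (rq q) b _ _ (rq_le1 q) n1 xx nn z sz.
have -> : N.+1%:R^-1 - 2 * dN N = (2 * N + 1).+1%:R^-1.
  have -> : (2 * N + 1).+1 = (2 * N.+1)%N by lia.
  rewrite /dN natrM; have : N.+1%:R != 0 :> R by rewrite pnatr_eq0.
  by set u := N.+1%:R => u0; field.
by apply; rewrite invr_ge0.
Qed.

Let PN_Z w N x nu : PN w N x nu -> ~ Zset w (x, nu).
Proof.
move=> [q [b [h1 _ h3]]] [_ _ /(_ q b h1)]; rewrite leNgt => /negP; apply.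
by apply: (lt_le_trans h3); exact: bad_mono.
Qed.

Let dN0 N : 0 < dN N. Proof. by rewrite invr_gt0 mulr_gt0. Qed.

Lemma open_setX (A B : set V) : open A -> open B -> open (A `*` B).
Proof.
move=> oA oB; have -> : A `*` B = (fst @^-1` A) `&` (snd @^-1` B) by [].
by apply: openI; apply: open_comp => // p _; [exact: cvg_fst|exact: cvg_snd].
Qed.

Let compact_sub (A B : set V) : compact A -> closed B -> compact (A `&` B).
Proof.
move=> cA cB; have [C hC] := compact_enorm_bounded cA.
apply: (@compact_closed_enorm _ _ _ C); last by move=> x [/hC].
by apply: closedI => //; exact: compact_closedV.
Qed.

(** Failure is an open condition by [PN_near], so [Zset] is closed in a compact set, and [Fset] is
    its projection. *)
Lemma compact_Fset M w : Mfun M w -> compact (Fset w).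
Proof.
move=> hw; have cX : compact (K `*` S0) by exact: compact_setX.
have clZ : closed (Zset w).
  move=> [x nu] cl; have cX2 : closed (K `*` S0).
    exact: (compact_closed (@norm_hausdorff _ _) cX).
  have [Kx Sn] : (K `*` S0) (x, nu).
    by apply: cX2; apply: (closure_subset _ cl) => p [h1 h2 _]; split.
  apply: contrapT => nZ; have [N hN] := PN_ex hw Kx Sn nZ.
  have nb : nbhs (x, nu) (eball x (dN N) `*` eball nu (dN N)).
    apply: open_nbhs_nbhs; split; first by apply: open_setX; exact: open_eball.
    by split; rewrite /eball /= subrr enorm0.
  have [[x' nu'] [Z' [/= h1 h2]]] := cl _ nb.
  have [_ [_ n1] _] := Z'; apply: (PN_Z (N := 2 * N + 1)) Z'.
  by apply: PN_near hN _ _ => //; rewrite -enormN opprB; exact: ltW.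
have cZ : compact (Zset w) by apply: subclosed_compact clZ cX _ => p [h1 h2 _]; split.
have -> : Fset w = fst @` Zset w.
  by apply/seteqP; split => x; [move=> [nu h]; exists (x, nu)|move=> [[x' nu] h <-]; exists nu].
by apply: continuous_compact => //; apply: continuous_subspaceT => p; exact: cvg_fst.
Qed.

(** The inclusion says that every pair over the compact set K minus U fails; by compactness one
    stage N serves all pairs. Conversely, one tested pair in each product of rational boxes
    suffices, since failure spreads to nearby pairs. *)
Lemma measurable_Fset_sub (M : seq W) a0 (U : set V) : a0 \in M -> open U ->
  measurable [set y : Baire | Fset (ucode M a0 y) `<=` U].
Proof.
move=> a0M oU; pose A : set (V * V) := (K `&` ~` U) `*` S0.
have cA : compact A by apply: compact_setX => //; apply: compact_sub => //; exact: open_closedC.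
have /choice[pt hpt] (ij : nat * nat) : exists p : V * V, (A `&` (@qbox R n ij.1 `*` @qbox R n ij.2)) !=set0 ->
   (A `&` (@qbox R n ij.1 `*` @qbox R n ij.2)) p.
  have [[p hp]|no] := pselect ((A `&` (@qbox R n ij.1 `*` @qbox R n ij.2)) !=set0); first by exists p.
  by exists (0, 0) => /no.
pose ok (ij : nat * nat) := `[< (A `&` (@qbox R n ij.1 `*` @qbox R n ij.2)) !=set0 >].
have mP N p : measurable [set y : Baire | PN (ucode M a0 y) N p.1 p.2].
  have -> : [set y : Baire | PN (ucode M a0 y) N p.1 p.2] = \bigcup_(q : nat) \bigcup_(b : bool)
     (if (Q <= q <= N)%N then [set y : Baire | ((eps * rq q ^+ n.+1)%:E < bad (ucode M a0 y) N.+1%:R^-1 q b p.1 p.2)%E] else set0).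
    apply/seteqP; split => y; first by move=> [q [b [h1 h2 h3]]]; exists q => //; exists b => //; rewrite h1 h2.
    by move=> [q _ [b _]]; case: ifP => // /andP[h1 h2] h3; exists q, b.
  apply: bigcupT_measurable => q; apply: countable_bigcupT_measurable => // b; case: ifP => // _.
  have ms : measurable (shape N.+1%:R^-1 p.1 p.2 (rq q) b : set mV) by apply: measurable_open; exact: open_shape.
  have := @measurable_ucode_cst R n m M a0 _ (fun v => v <> vv b) ms.
  move=> /emeasurable_fun_o_infty/(_ (eps * rq q ^+ n.+1)%:E); rewrite setTI; apply; exact: measurableT.
rewrite (_ : [set y | _] = \bigcup_N \bigcap_ij (if ok ij then [set y : Baire | PN (ucode M a0 y) N (pt ij).1 (pt ij).2] else setT)).
  apply: bigcupT_measurable => N; rewrite -(setCK (\bigcap_ij _)) setC_bigcap; apply: measurableC.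
  apply: (@countable_bigcupT_measurable _ _ _ (fun ij => ~` (if ok ij then [set y : Baire | PN (ucode M a0 y) N (pt ij).1 (pt ij).2] else setT))) => // ij.
  by apply: measurableC; case: ifP => // _; exact: mP.
apply/seteqP; split => y; have hw := ucode_Mfun n a0M y; set w := ucode M a0 y in hw *.
  move=> FU; have := proj1 (compact_near_coveringP A) cA nat \oo (fun N p => A p -> PN w N p.1 p.2) _.
  have key (p : V * V) : A p -> \forall p' \near p & N \near \oo, A p' -> PN w N p'.1 p'.2.
    move=> [[Kx nU] Sn]; have [N hN] : exists N, PN w N p.1 p.2.
      by apply: PN_ex hw Kx Sn _ => hZ; apply: nU; apply: FU; exists p.2.
    exists (eball p.1 (dN N) `*` eball p.2 (dN N), [set i | (2 * N + 1 <= i)%N]).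
      split => /=; last by exists (2 * N + 1)%N.
      apply: open_nbhs_nbhs; split; first by apply: open_setX; exact: open_eball.
      by split; rewrite /eball /= subrr enorm0.
    move=> [p' i] [/= [h1 h2] hi] [_ [_ n1]]; apply: PN_mono hi _.
    by apply: PN_near hN _ _ => //; rewrite -enormN opprB; exact: ltW.
  move=> /(_ _ key)/filter_ex[N hN]; exists N => // ij _; case: ifPn => // /asboolP /hpt[pA _].
  exact: hN.
move=> [N _ hN] x [nu hZ]; apply: contrapT => nU; have [Kx Sn _] := hZ.
have ox z : eball z (dN N) z by rewrite /eball /= subrr enorm0.
have [i [xi iU]] := open_qbox (@open_eball _ _ x (dN N)) (ox x).
have [j [nj jU]] := open_qbox (@open_eball _ _ nu (dN N)) (ox nu).
have ne : (A `&` (@qbox R n i `*` @qbox R n j)) !=set0 by exists (x, nu).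
have := hN (i, j) I; rewrite /ok asboolT// => hP; have [_ [/iU h1 /jU h2]] := hpt (i, j) ne.
by apply: PN_Z hZ; apply: PN_near hP _ _; [exact: Sn.2|exact: ltW|exact: ltW].
Qed.

Lemma measurable_H_Fset s (M : seq W) a0 : a0 \in M ->
  measurable_fun setT (fun y : Baire => @hausdorff R n.+1 s.+1 (Fset (ucode M a0 y))).
Proof.
move=> a0M; apply: (@H_compact_measurable R n s _ Baire) => [y|l].
  by apply: compact_Fset; exact: (ucode_Mfun n a0M y).
by apply: measurable_Fset_sub => //; exact: open_qunion.
Qed.
End Fset.

Lemma Fset_mono w eps eps' Q Q' K W0 : eps <= eps' -> (Q <= Q')%N -> Fset eps Q K W0 w `<=` Fset eps' Q' K W0 w.
Proof.
move=> ee QQ x [nu [h1 h2 h3]]; exists nu; split => // q b Qq.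
apply: (le_trans (h3 q b (leq_trans QQ Qq))); rewrite lee_fin ler_wpM2r// exprn_ge0// ltW// rq_gt0.
by [].
Qed.
End Density.

Section JumpSets.
Variables (R : realType) (n m : nat).
Local Notation V := 'rV[R]_n.+1.
Local Notation W := 'rV[R]_m.
Local Notation leb := (@leb_out R n.+1).
Implicit Types (x z nu : V) (w : V -> W) (K : set V).

Lemma slab_ball : exists2 C : R, 0 <= C & forall nu x (h r : R), sphere nu -> 0 <= h -> 0 < r ->
  (leb (eball x r `&` [set z | (`|dotv (z - x)%R nu| <= h * r)%R]) <= (C * h * r ^+ n.+1)%:E)%E.
Proof.
have [C C0 hC] := @leb_slab R n 1; exists C => // nu x h r n1 h0 r0.
pose T : set V := [set u | enorm u <= 1 /\ `|dotv u nu - 0| <= h].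
apply: (@le_trans _ _ (leb [set z | (fun u => T (r^-1 *: u)) (z + (- x))%R])).
  apply: leb_le => z [z1 z2]; split => /=.
    by rewrite enormZ gtr0_norm ?invr_gt0// ler_pdivrMl// mulr1 ltW.
  by rewrite subr0 dotvZl normrM gtr0_norm ?invr_gt0// ler_pdivrMl// mulrC.
rewrite (@leb_shift R n (fun u => T (r^-1 *: u)) (- x)) (@leb_scale R n T) ?invr_gt0//.
rewrite exprVn invrK mulrC EFinM; apply: lee_wpmul2l; first by rewrite lee_fin exprn_ge0// ltW.
exact: hC.
Qed.

(** Finiteness of M lets the condition eps < |w - a| be traded for w different from a. *)
Lemma value_gap (M : seq W) (v : W) : exists2 e : R, 0 < e & forall a, a \in M -> a != v -> e < enorm (a - v).
Proof.
elim: M => [|b M [e e0 he]]; first by exists 1.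
have [->|bv] := eqVneq b v.
  exists e => // a; rewrite inE => /orP[/eqP ->|aM]; first by rewrite eqxx.
  exact: he.
have d0 : 0 < enorm (b - v).
  by rewrite lt_def sqrtr_ge0 andbT; rewrite enorm_eq0 subr_eq0.
exists (Num.min e (enorm (b - v) / 2)); first by rewrite lt_min e0 divr_gt0.
move=> a; rewrite inE => /orP[/eqP ->|aM] av; first by rewrite gt_min; apply/orP; right; lra.
by rewrite gt_min he.
Qed.

Variables (M : seq W) (va vb : W).

Lemma rq_small (r0 : R) : 0 < r0 -> exists Q, forall q, (Q <= q)%N -> rq R q < r0.
Proof.
move=> r00; have [Q _ hQ] := near_infty_natSinv_lt (PosNum r00); exists Q => q /hQ; exact.
Qed.

(** The approximate limits over all radii are tested on the radii 1/(q+1), because every small r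
    lies within a factor 2 of one of them. *)
Lemma jump_bad w x nu : Mfun M w -> va != vb -> jumptriple w x va vb nu <-> sphere nu /\
  forall j, exists Q, forall q b, (Q <= q)%N -> (bad va vb w 0 q b x nu <= (j.+1%:R^-1 * rq R q ^+ n.+1)%:E)%E.
Proof.
move=> hw vab; split.
  move=> [n1 _ hb ha]; split => // j.
  have al b : aplim_half w x nu b (vv va vb b) by case: b.
  have key b : exists Q, forall q, (Q <= q)%N -> (bad va vb w 0 q b x nu <= (j.+1%:R^-1 * rq R q ^+ n.+1)%:E)%E.
    have [e e0 he] := value_gap M (vv va vb b).
    have j0 : 0 < j.+1%:R^-1 :> R by [].
    have [r0 r00 hr] := aplim_fact (al b) e0 j0.
    have [Q hQ] := rq_small r00; exists Q => q /hQ qr.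
    apply: le_trans (hr _ (rq_gt0 R q) qr); apply: leb_le => z [sz wz]; split; first by rewrite -shape0.
    by apply: he; [exact: hw.1|apply/eqP].
  have [Q1 h1] := key true; have [Q2 h2] := key false; exists (maxn Q1 Q2) => q b.
  by rewrite geq_max => /andP[q1 q2]; case: b; [exact: h1|exact: h2].
move=> [n1 h]; have vp : 0 < vball R n by exact: vball_gt0.
have al b : aplim_half w x nu b (vv va vb b).
  move=> eps eps0; apply/cvgrPdist_lt => e e0; rewrite near_withinE.
  (* The power of 2 comes from comparing radii; the other factor from a ball of radius r/4 inside
     the half ball, which bounds the denominator from below. *)
  pose C := 2 ^+ n.+1 * 4 ^+ n.+1 / vball R n; have C0 : 0 < C by rewrite divr_gt0// mulr_gt0// exprn_gt0.
  have eC : 0 < e / C by rewrite divr_gt0.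
  have [j hj] := filter_ex (near_infty_natSinv_lt (PosNum eC)).
  have hj' : j.+1%:R^-1 < e / C := hj.
  have [Q hQ] := h j.
  apply/nbhs_ballP; exists (rq R Q) => /=; first exact: rq_gt0.
  move=> r; rewrite /ball /= sub0r normrN => hr r0; rewrite gtr0_norm// in hr.
  (* Then r is at most 1/(q+1), which is at most 2r. *)
  pose q := (Num.truncn r^-1).-1.
  have ri : 1 <= r^-1 by rewrite invf_ge1// ltW// (lt_le_trans hr)// rq_le1.
  have ti := truncn_itv (le_trans ler01 ri); have t0 : (0 < Num.truncn r^-1)%N by rewrite truncn_gt0.
  have qE : q.+1 = Num.truncn r^-1 by rewrite prednK.
  have q1 : r <= rq R q.
    by rewrite /rq qE -[leLHS]invrK lef_pV2 ?posrE ?invr_gt0 ?ltr0n//; case/andP: ti.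
  have q2 : rq R q <= 2 * r.
    have h1 : r^-1 < q.+1%:R + 1 by rewrite natr1 qE; case/andP: ti.
    have q0 : 1 <= q.+1%:R :> R by rewrite ler1n.
    rewrite /rq -[leLHS]mul1r ler_pdivrMr ?ltr0n//.
    have : r * r^-1 = 1 by rewrite divff ?gt_eqF.
    by nra.
  have Qq : (Q <= q)%N.
    rewrite -ltnS qE truncn_ge_nat; last exact: le_trans ler01 ri.
    by rewrite -[leLHS]invrK lef_pV2 ?posrE ?invr_gt0 ?ltr0n//; exact: ltW.
  set A := leb (_ `&` _); set B := leb (halfball _ _ _ _).
  have fA : A \is a fin_num by exact: halfball_fin.
  have fB : B \is a fin_num by rewrite /B -(setIT (halfball _ _ _ _)); exact: halfball_fin.
  have A0 : 0 <= fine A by rewrite fine_ge0// leb_out_ge0.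
  have dd : (rq R q) ^+ n.+1 <= 2 ^+ n.+1 * r ^+ n.+1.
    by rewrite -exprMn; apply: lerXn2r; rewrite ?nnegrE; [exact/ltW/rq_gt0|by rewrite mulr_ge0// ltW|exact: q2].
  have A1 : fine A <= j.+1%:R^-1 * (2 ^+ n.+1 * r ^+ n.+1).
    rewrite -lee_fin fineK//; apply: (@le_trans _ _ (j.+1%:R^-1 * rq R q ^+ n.+1)%:E); last by rewrite lee_fin ler_wpM2l.
    apply: le_trans (hQ q b Qq); apply: leb_le => z [hz wz]; split.
      by rewrite shape0; move/halfballP: hz => [z1 z2]; apply/halfballP; split => //; exact: lt_le_trans q1.
    by move=> e1; move: wz; rewrite /= e1 subrr enorm0 ltNge (ltW eps0).
  have B1 : vball R n * (r / 4) ^+ n.+1 <= fine B.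
    have r4 : 0 < r / 4 by rewrite divr_gt0.
    rewrite -lee_fin fineK// -(leb_eball (x + r *: ((sg R b / 2) *: nu)) r4); apply: leb_le.
    apply: (halfball_ball n1 r0).
      have s1 : `|sg R b| = 1 by rewrite /sg; case: (b); rewrite ?normrN normr1.
      have h2 : `|2^-1 : R| = 2^-1 by rewrite ger0_norm.
      by rewrite enormZ n1 mulr1 normrM s1 h2; lra.
    by rewrite dotvZl sphere_dot// mulr1 mulrA sg_sq; lra.
  have rp : 0 < r ^+ n.+1 by rewrite exprn_gt0.
  have vr : 0 < vball R n * (r / 4) ^+ n.+1 by rewrite mulr_gt0// exprn_gt0// divr_gt0.
  have B0 : 0 < fine B by exact: lt_le_trans B1.
  rewrite sub0r normrN ger0_norm ?divr_ge0 ?(ltW B0)// ltr_pdivrMr//.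
  apply: (le_lt_trans A1); apply: (@lt_le_trans _ _ (e * (vball R n * (r / 4) ^+ n.+1))); last by rewrite ler_wpM2l// ltW.
  have -> : e * (vball R n * (r / 4) ^+ n.+1) = (e / C) * (2 ^+ n.+1 * r ^+ n.+1).
    have p2 : (2 : R) ^+ n.+1 != 0 by rewrite expf_neq0.
    have p4 : (4 : R) ^+ n.+1 != 0 by rewrite expf_neq0.
    rewrite /C exprMn exprVn; set u := 2 ^+ _ in p2 *; set v := 4 ^+ _ in p4 *; set s := r ^+ _.
    by field; rewrite p2 p4 gt_eqF.
  by rewrite ltr_pM2r// mulr_gt0// exprn_gt0.
by split; [exact: n1|rewrite eq_sym|exact: (al true)|exact: (al false)].
Qed.

(** On the right the normal may depend on the precision j. A cluster point of these normals works
    for all j, since tilting a normal by eta alters the half ball only in a slab whose measure is of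
    order eta times that of the ball. *)
Lemma Jset_eq w (K W0 : set V) : Mfun M w -> va != vb -> compact K -> closed W0 ->
  [set x | K x /\ exists nu, W0 nu /\ jumptriple w x va vb nu] =
  \bigcap_(j : nat) \bigcup_(Q : nat) Fset va vb j.+1%:R^-1 Q K W0 w.
Proof.
move=> hw vab cK cW; apply/seteqP; split => x.
  move=> [Kx [nu [Wn /(jump_bad _ _ hw vab)[n1 h]]]] j _; have [Q hQ] := h j; exists Q => //.
  by exists nu; split => // q b; exact: hQ.
move=> hx; have /choice[Q /choice[nu hQ]] j : exists Q, exists nu, Zset va vb j.+1%:R^-1 Q K W0 w (x, nu).
  by have [Q _ [nu h]] := hx j I; exists Q, nu.
have Kx : K x by have [] := hQ 0%N.
split => //; pose S0 : set V := W0 `&` [set nu | enorm nu = 1].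
have cS : compact S0.
  apply: (@compact_closed_enorm _ _ _ 1); last by move=> z [_ /= ->].
  apply: closedI => //; rewrite (_ : [set nu | _] = [set nu : V | enorm nu <= 1] `&` [set nu : V | 1 <= enorm nu]).
    by apply: closedI; [apply: closed_lef|apply: closed_gef]; exact: continuous_enorm.
  apply/seteqP; split => z /=; first by move=> ->.
  by move=> [h1 h2]; apply/eqP; rewrite eq_le h1.
have nS j : S0 (nu j) by have [_ []] := hQ j.
have [nu0 [[Wn0 n01] cl]] : S0 `&` cluster (nu @ \oo) !=set0.
  by apply: cS; exists 0%N => // j _; exact: nS.
exists nu0; split => //; apply/(jump_bad _ _ hw vab); split => // j.
have [C C0 hC] := slab_ball.
pose eta : R := (2 * (C + 1) * j.+1%:R)^-1.
have eta0 : 0 < eta by rewrite invr_gt0 !mulr_gt0// ltr_wpDl.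
have [z [jz' hz]] : [set nu i | i in [set i | (2 * j.+1 <= i)%N]] `&` eball nu0 eta !=set0.
  apply: cl; first by exists (2 * j.+1)%N => // i hi; exists i.
  by apply: open_nbhs_nbhs; split; [exact: open_eball|rewrite /eball /= subrr enorm0].
move: jz' => [i /= ij zi]; exists (Q i) => q b Qq.
have [_ _ /(_ q b Qq) hb] := hQ i; have r0 := rq_gt0 R q.
apply: (@le_trans _ _ (bad va vb w 0 q b x (nu i) + leb (eball x (rq R q) `&` [set z | (`|dotv (z - x)%R nu0| <= eta * rq R q)%R]))%E).
  apply: le_trans (outer_measureU2 (oleb R n) _ _); apply: leb_le => y [[y1 y2] wy].
  rewrite subr0 in y1; have [y3|y3] := ltP 0 (sg R b * dotv (y - x) (nu i)).
    by left; split => //; split => //; rewrite subr0.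
  right; split => //=; rewrite -(sg_norm b).
  have : `|sg R b * dotv (y - x) nu0 - sg R b * dotv (y - x) (nu i)| <= eta * rq R q.
    rewrite -mulrBr sg_norm -dotvBr mulrC; apply: (le_trans (dotv_CS _ _)).
    by apply: ler_pM; [exact: sqrtr_ge0|exact: sqrtr_ge0|exact: ltW|rewrite -enormN opprB zi; exact: ltW].
  rewrite (ger0_norm (ltW y2)); apply: le_trans; apply: le_trans (ler_norm _); lra.
have h2 := hC nu0 x eta (rq R q) n01 (ltW eta0) r0.
apply: (le_trans (leeD hb h2)); rewrite -EFinD lee_fin -mulrDl ler_wpM2r ?exprn_ge0 ?(ltW r0)//.
have j0 : 0 < j.+1%:R :> R by [].
have e1 : i.+1%:R^-1 <= (2 * j.+1%:R)^-1 :> R by rewrite lef_pV2 ?posrE ?mulr_gt0// -natrM ler_nat ltnW.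
have e2 : C * eta <= (2 * j.+1%:R)^-1.
  have C1 : 0 < C + 1 by rewrite ltr_wpDl.
  have -> : C * eta = (2 * j.+1%:R)^-1 * (C / (C + 1)).
    by rewrite /eta; set u := j.+1%:R in j0 *; field; rewrite !gt_eqF.
  by apply: ler_piMr; [rewrite invr_ge0 mulr_ge0|rewrite ler_pdivrMr// mul1r lerDl].
have e3 : (2 * j.+1%:R)^-1 + (2 * j.+1%:R)^-1 = j.+1%:R^-1 :> R.
  by have := gt_eqF j0; set u := j.+1%:R => /negbT u0; field.
by rewrite -e3 lerD.
Qed.
End JumpSets.

Section BumpArithmetic.
Variable R : realType.
Lemma indicator_gain_le (E r i : R) : 0 < E * r -> 0 <= i -> i <= 1 -> E * (7 / 64) * r * i <= E * r.
Proof. by move=> h i0 i1; have : 0 <= E * r * i <= E * r; [rewrite mulr_ge0 ?(ltW h)//= ler_piMr// ltW|move=> /andP[]; lra]. Qed.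

Lemma sub_le_of_bounds (u v a b : R) : - a <= u -> v <= b -> v - (a + b) <= u.
Proof. lra. Qed.

Lemma paraboloid_lower (r d : R) : 0 < r -> 0 <= d -> d <= 3 / 4 * r -> 7 / 16 * r ^+ 2 <= r ^+ 2 + (-1) * d ^+ 2.
Proof. move=> r0 d0 h; have : d ^+ 2 <= (3 / 4 * r) ^+ 2 by rewrite lerXn2r ?nnegrE// mulr_ge0// ltW. by rewrite exprMn; lra. Qed.

Lemma radius_upper (r d : R) : d < r * 4^-1 -> r / 2 + d <= 3 / 4 * r.
Proof. lra. Qed.

Lemma height_lower (r d u : R) : d < r * 4^-1 -> - d <= u -> r / 4 <= r * 2^-1 + u.
Proof. lra. Qed.
End BumpArithmetic.

(** * Finite Hausdorff measure from finite total variation *)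

Section FiniteJumpMeasure.
Variables (R : realType) (n m : nat).
Local Notation V := 'rV[R]_n.+2.
Local Notation W := 'rV[R]_m.
Local Notation leb := (@leb_out R n.+2).
Local Notation H := (@hausdorff R n.+2 n.+1).
Local Notation mV := (caratheodory_type (oleb R n.+1)).
Variables (M : seq W) (va vb : W) (w : V -> W) (D : set V).
Hypotheses (hw : Mfun M w) (vab : va != vb).
Let e := vb - va.
Let e0 : 0 < enorm e.
Proof. by rewrite lt_def sqrtr_ge0 andbT enorm_eq0 subr_eq0 eq_sym. Qed.

Definition bump (rho : R) (p z : V) : R := pos2 (rho ^+ 2 + (-1) * dotv (z - p) (z - p)).
Definition dbump (rho : R) (p : V) (j : 'I_n.+2) (z : V) : R :=
  2 * Num.max (rho ^+ 2 + (-1) * dotv (z - p) (z - p)) 0 * (0 + (-1) * (2 * (z - p) ord0 j)).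
(** Up to the factor -4 this is the derivative of [bump] in direction nu. It is odd about p, so its
    integral vanishes. *)
Definition chi (rho : R) (p nu z : V) : R := Num.max (rho ^+ 2 + (-1) * dotv (z - p) (z - p)) 0 * dotv (z - p) nu.

Lemma bump_C1d (rho : R) (p : V) : C1d (bump rho p) (dbump rho p).
Proof.
apply: (C1d_comp (@pos2_derive R) (@continuous_pos1 R)).
by apply: C1dD; [exact: C1d_cst|apply: C1dZ; exact: C1d_sqdist].
Qed.

Lemma bump_off (rho : R) (p z : V) : 0 <= rho -> rho <= enorm (z - p) -> rho ^+ 2 + (-1) * dotv (z - p) (z - p) <= 0.
Proof. by move=> r0 h; rewrite mulN1r subr_le0 -sqr_enorm lerXn2r ?nnegrE// sqrtr_ge0. Qed.

Lemma bump_le (rho : R) (p z : V) : 0 <= rho -> 0 <= bump rho p z <= rho ^+ 4.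
Proof.
move=> r0; have h : rho ^+ 2 + (-1) * dotv (z - p) (z - p) <= rho ^+ 2 by rewrite mulN1r gerBl dotvv_ge0.
rewrite /bump; set s := _ + _ in h *; apply/andP; split; first by rewrite /pos2 exprn_even_ge0.
have -> : rho ^+ 4 = (rho ^+ 2) ^+ 2 by rewrite -exprM.
by rewrite /pos2; apply: lerXn2r; rewrite ?nnegrE ?le_max ?lexx ?orbT ?sqr_ge0// ge_max h sqr_ge0.
Qed.

Lemma chi_le (rho : R) (p nu z : V) : 0 < rho -> sphere nu -> `|chi rho p nu z| <= rho ^+ 3.
Proof.
move=> r0 n1; have [h|h] := leP rho (enorm (z - p)).
  by rewrite /chi max_r ?mul0r ?normr0 ?exprn_ge0 ?bump_off// ltW.
have h1 : rho ^+ 2 + (-1) * dotv (z - p) (z - p) <= rho ^+ 2 by rewrite mulN1r gerBl dotvv_ge0.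
rewrite /chi normrM [rho ^+ 3]exprSr; apply: ler_pM => //.
  by rewrite ger0_norm ?le_max ?lexx ?orbT// ge_max h1 sqr_ge0.
by apply: (le_trans (dotv_CS _ _)); rewrite n1 mulr1 ltW.
Qed.

Lemma chi_continuous (rho : R) (p nu : V) : continuous (chi rho p nu).
Proof.
have cc := (C1dD (@C1d_cst R n.+1 (rho ^+ 2)) (C1dZ (-1) (C1d_sqdist p))).1.
have -> : chi rho p nu = (fun z => (2^-1 * (2 * Num.max (rho ^+ 2 + (-1) * dotv (z - p) (z - p)) 0)) * dotv (z - p) nu).
  by apply/funext => z; rewrite /chi mulrA mulVf// mul1r.
apply: continuous_mul; last by apply: (@continuous_lip _ _ _ (enorm nu)) => u v; exact: lip_dot.
apply: continuous_mul; first exact: continuous_cst_fun.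
by move=> z; exact: (continuous_comp (cc z) (@continuous_pos1 R _)).
Qed.

Lemma enorm_ball_bound (p z : V) (rho : R) : enorm (z - p) < rho -> enorm z <= enorm p + rho.
Proof. by move=> h; rewrite -[z](subrK p) addrC; apply: (le_trans (enormD _ _)); rewrite lerD2l ltW. Qed.

Lemma chi_bcs (rho : R) (p nu : V) : 0 < rho -> bcs (chi rho p nu).
Proof.
move=> r0; apply: (@cont_bcs _ _ _ (enorm p + rho)); first exact: chi_continuous.
move=> z hz; rewrite /chi max_r ?mul0r// bump_off ?(ltW r0)// leNgt; apply/negP => /enorm_ball_bound.
by rewrite leNgt hz.
Qed.

Lemma chi_J0 (rho : R) (p nu : V) : 0 < rho -> J (chi rho p nu) = 0.
Proof.
move=> r0; have b0 : bcs (chi rho 0 nu) by exact: chi_bcs.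
have e1 : J (chi rho p nu) = J (chi rho 0 nu).
  rewrite -[RHS](J_shift (- p) b0); congr J; apply/funext => z.
  by rewrite /chi subr0.
have := J_opp b0; rewrite (_ : (fun x => chi rho 0 nu (- x)) = (fun x => -1 * chi rho 0 nu x)).
  by rewrite JZ// mulN1r e1 => h; move: h; set u := J _; lra.
by apply/funext => z; rewrite /chi !subr0 dotvNl !dotvNr dotvNl opprK; ring.
Qed.

(** The component of w - va along the jump: 0 where w = va and |e|^2 where w = vb. *)
Let S (z : V) : R := \sum_al e ord0 al * (w z ord0 al - va ord0 al).
Let SB := \sum_al `|e ord0 al| * (projT1 (cid (Mfun_bmeas hw).1) + `|va ord0 al|).
Let S_le z : `|S z| <= SB.
Proof.
apply: (le_trans (ler_norm_sum _ _ _)); apply: ler_sum => al _; rewrite normrM ler_wpM2l//.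
apply: (le_trans (ler_normB _ _)); rewrite lerD2r; case: cid => B hB /=; exact: hB.
Qed.
Let SB0 : 0 <= SB. Proof. exact: le_trans (normr_ge0 _) (S_le 0). Qed.
Let S_b z : w z = vb -> S z = enorm e ^+ 2.
Proof. by move=> h; rewrite sqr_enorm /S h; apply: eq_bigr => al _; rewrite /e !mxE. Qed.
Let S_a z : w z = va -> S z = 0.
Proof. by move=> h; rewrite /S h big1// => al _; rewrite subrr mulr0. Qed.

Let v4 := vball R n.+1 / 4 ^+ n.+2.
Let c3 := enorm e ^+ 2 * (7 / 64) * v4.
(** The two exceptional sets, of total measure at most 2 [eps0] rho^(n+2), then destroy at most half
    of the gain [c3]. In [c3], 7/64 is 7/16 times 1/4, lower bounds for the two factors of [chi] on
    a ball of radius rho/4. *)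
Let eps0 := c3 / (4 * (SB + enorm e ^+ 2)).

(** Where [w] has the expected value the integrand is nonnegative: [S] vanishes below p, and both
    factors are nonnegative above. On a ball around p + rho nu / 2 it is of order rho^3. *)
Lemma bump_gain (rho : R) (p nu : V) : 0 < rho -> sphere nu ->
  (forall b, (leb (halfball p nu rho b `&` [set z | w z <> vv va vb b]) <= (eps0 * rho ^+ n.+2)%:E)%E) ->
  bcs (fun z => S z * chi rho p nu z) /\ c3 / 2 * rho ^+ n.+2 * rho ^+ 3 <= J (fun z => S z * chi rho p nu z).
Proof.
move=> r0 n1 hb; have bS : bcs (fun z => S z * chi rho p nu z).
  have -> : (fun z => S z * chi rho p nu z) = (fun z => \sum_al e ord0 al * (w z ord0 al * chi rho p nu z - va ord0 al * chi rho p nu z)).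
    by apply/funext => z; rewrite /S mulr_suml; apply: eq_bigr => al _ /=; ring.
  apply: bcs_sum => al; apply: bcsZ; apply: bcsB; last by apply: bcsZ; exact: chi_bcs.
  have [[B hB] mw] := Mfun_bmeas hw.
  by apply: (@bcsMl _ _ (fun z => w z ord0 al) _ B); [exact: mw|move=> x; exact: hB|exact: chi_bcs].
split => //.
pose B1 : set V := eball (p + rho *: (2^-1 *: nu)) (rho * 4^-1).
pose B2 : set V := \bigcup_(b in [set: bool]) (halfball p nu rho b `&` [set z | w z <> vv va vb b]).
have E0 : 0 < enorm e ^+ 2 by rewrite exprn_gt0.
have SE : 0 < SB + enorm e ^+ 2 by rewrite ltr_wpDl.
have B1h : B1 `<=` halfball p nu rho true.
  apply: (halfball_ball n1 r0); first by rewrite enormZ n1 mulr1 ger0_norm//; lra.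
  by rewrite dotvZl sphere_dot// mulr1 /sg mul1r; lra.
have B1k x : B1 x -> enorm x <= enorm p + rho by move/B1h => /halfball_sub /enorm_ball_bound.
have B2k x : B2 x -> enorm x <= enorm p + rho by move=> [b _ [/halfball_sub /enorm_ball_bound]].
have mB1 : measurable (B1 : set mV) by apply: measurable_open; exact: open_eball.
have mB2 : measurable (B2 : set mV).
  rewrite /B2; apply: fin_bigcup_measurable; first exact: finite_finset.
  move=> b _; apply: measurableI; first by rewrite -shape0; apply: measurable_open; exact: open_shape.
  by apply/lmeasP; exact: (Mfun_preim [set a | a <> vv va vb b] hw).
have bb1 := bcsZ (enorm e ^+ 2 * (7 / 64) * rho ^+ 3) (bcs_indic mB1 B1k).
have bb2 := bcsZ ((SB + enorm e ^+ 2) * rho ^+ 3) (bcs_indic mB2 B2k).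
have key z : enorm e ^+ 2 * (7 / 64) * rho ^+ 3 * \1_B1 z - (SB + enorm e ^+ 2) * rho ^+ 3 * \1_B2 z <= S z * chi rho p nu z.
  have r3 : 0 < rho ^+ 3 by rewrite exprn_gt0.
  have i1 : 0 <= (\1_B1 z : R) <= 1 by rewrite indicE ler0n lern1; case: (_ \in _).
  have [hB2|hB2] := pselect (B2 z).
    rewrite [\1_B2 z]indicE mem_set// mulr1.
    have h1 : enorm e ^+ 2 * (7 / 64) * rho ^+ 3 * \1_B1 z <= enorm e ^+ 2 * rho ^+ 3.
      by case/andP: i1; apply: indicator_gain_le; rewrite mulr_gt0.
    have h2 : `|S z * chi rho p nu z| <= SB * rho ^+ 3.
      by rewrite normrM; apply: ler_pM; [exact: normr_ge0|exact: normr_ge0|exact: S_le|exact: chi_le].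
    move: h2; rewrite ler_norml => /andP[h2 _].
    by rewrite [(SB + _) * _]mulrDl; exact: (sub_le_of_bounds h2 h1).
  rewrite [\1_B2 z]indicE memNset// mulr0 subr0.
  have gd b : halfball p nu rho b z -> w z = vv va vb b.
    by move=> hz; apply: contrapT => ne; apply: hB2; exists b.
  have [hB1|hB1] := pselect (B1 z).
    rewrite indicE mem_set// mulr1 (S_b (gd true (B1h _ hB1))) -mulrA ler_wpM2l ?sqr_ge0//.
    set q := rho *: (2^-1 *: nu); have z1 : z - p = q + (z - (p + q)) by rewrite opprD (addrA z) [RHS]addrC subrK.
    have q1 : enorm q = rho / 2 by rewrite !enormZ n1 mulr1 !ger0_norm// ltW.
    have h1 : enorm (z - p) <= 3 / 4 * rho.
      rewrite z1; apply: (le_trans (enormD _ _)); by rewrite q1; exact: radius_upper.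
    have h2 : rho / 4 <= dotv (z - p) nu.
      rewrite z1 dotvDl !dotvZl sphere_dot// mulr1; have := dotv_CS (z - (p + q)) nu.
      by rewrite n1 mulr1 ler_norml => /andP[h _]; exact: height_lower h.
    have h3 : 7 / 16 * rho ^+ 2 <= rho ^+ 2 + (-1) * dotv (z - p) (z - p).
      by rewrite -sqr_enorm; apply: paraboloid_lower => //; exact: enorm_ge0.
    rewrite /chi max_l; last by apply: le_trans h3; rewrite mulr_ge0// sqr_ge0.
    apply: (@le_trans _ _ ((7 / 16 * rho ^+ 2) * (rho / 4))); first by rewrite exprSr; set r2 := rho ^+ 2; lra.
    by apply: ler_pM => //; [rewrite mulr_ge0// sqr_ge0|rewrite divr_ge0// ltW].
  rewrite indicE memNset// mulr0.
  have [h|h] := leP rho (enorm (z - p)); first by rewrite /chi max_r ?mul0r ?mulr0 ?bump_off// ltW.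
  have [d0|d0|d0] := ltgtP (dotv (z - p) nu) 0.
  - by rewrite (S_a (gd false _)) ?mul0r.
  - rewrite (S_b (gd true _)); last by apply/halfballP; rewrite /sg mul1r.
    apply: mulr_ge0; first exact: sqr_ge0.
    by apply: mulr_ge0; [rewrite le_max lexx orbT|exact: ltW].
  - by rewrite /chi d0 !mulr0.
apply: le_trans (J_le (bcsB bb1 bb2) bS key); rewrite JB// !JZ; [|exact: bcs_indic B2k|exact: bcs_indic B1k].
have j1 : J (\1_B1 : V -> R) = v4 * rho ^+ n.+2.
  apply: EFin_inj; rewrite (J_indic mB1 B1k) leb_eball ?mulr_gt0// /v4 exprMn exprVn.
  by apply: (congr1 EFin); ring.
have j2 : J (\1_B2 : V -> R) <= 2 * (eps0 * rho ^+ n.+2).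
  rewrite -lee_fin (J_indic mB2 B2k) /B2 mulr_natl mulr2n EFinD.
  apply: le_trans (leeD (hb true) (hb false)); apply: le_trans (outer_measureU2 (oleb R n.+1) _ _).
  by apply: leb_le => z [[] _ hz]; [left|right].
rewrite j1; have rd : 0 < rho ^+ n.+2 by rewrite exprn_gt0.
have r3 : 0 < rho ^+ 3 by rewrite exprn_gt0.
have e2 : (SB + enorm e ^+ 2) * rho ^+ 3 * J (\1_B2 : V -> R) <= c3 / 2 * rho ^+ n.+2 * rho ^+ 3.
  apply: (@le_trans _ _ ((SB + enorm e ^+ 2) * rho ^+ 3 * (2 * (eps0 * rho ^+ n.+2)))).
    by rewrite ler_wpM2l// mulr_ge0 ?(ltW SE)// ltW.
  rewrite /eps0; set T := SB + _ in SE *; set rn := rho ^+ n.+2; set r3' := rho ^+ 3; set c := c3.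
  by rewrite le_eqVlt; apply/orP; left; apply/eqP; field; rewrite gt_eqF.
rewrite lerBrDr; apply: (le_trans (lerD (lexx _) e2)); rewrite /c3.
by set E := enorm e ^+ 2; set rn := rho ^+ n.+2; set r3' := rho ^+ 3; set v := v4; rewrite le_eqVlt; apply/orP; left; apply/eqP; field.
Qed.

Let c30 : 0 < c3.
Proof. by rewrite /c3 /v4 !mulr_gt0// ?exprn_gt0// ?divr_gt0 ?vball_gt0 ?exprn_gt0. Qed.

Lemma eps0_gt0 : 0 < eps0.
Proof. by rewrite /eps0 divr_gt0// mulr_gt0// ltr_wpDl// exprn_gt0. Qed.

(* Disjoint bumps of equal radius form a test field. *)
Lemma separated_bound (C : R) (K W0 : set V) (q Q N : nat) (p nu : 'I_N -> V) :
  (forall Phi, testfield D Phi -> Tint w Phi <= C) -> (Q <= q)%N ->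
  (forall k, Zset va vb eps0 Q K W0 w (p k, nu k)) ->
  (forall k z, enorm (z - p k) <= rq R q -> D z) ->
  (forall k l, k != l -> 2 * rq R q <= enorm (p k - p l)) ->
  N%:R * (2 * c3 / enorm e * rq R q ^+ n.+1) <= C.
Proof.
move=> hC Qq hZ hD sep; set rho := rq R q in hD sep *; have r0 : 0 < rho by exact: rq_gt0.
(* Normalises the field, since a bump is at most rho^4; the sign makes the pairing positive against
   -4 [chi]. *)
pose kap := - (enorm e * rho ^+ 4)^-1.
have n1 k : sphere (nu k) by have [_ []] := hZ k.
have gain k : bcs (fun z => S z * chi rho (p k) (nu k) z) /\ c3 / 2 * rho ^+ n.+2 * rho ^+ 3 <= J (fun z => S z * chi rho (p k) (nu k) z).
  by apply: bump_gain => // b; have [_ _ /(_ q b Qq)] := hZ k; rewrite /bad shape0.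
pose Phi (al : 'I_m) (i : 'I_n.+2) (z : V) : R := \sum_(k < N) kap * e ord0 al * nu k ord0 i * bump rho (p k) z.
have dPhi al i : C1d (Phi al i) (fun j z => \sum_(k < N) kap * e ord0 al * nu k ord0 i * dbump rho (p k) j z).
  by apply: C1d_sum => k; apply: C1dZ; exact: bump_C1d.
have off k z : rho <= enorm (z - p k) -> bump rho (p k) z = 0.
  by move=> h; rewrite /bump pos2_le0// bump_off// ltW.
have tf : testfield D Phi.
  split => [al i|z].
    apply: (@C1d_C1c _ _ _ _ _ (\big[setU/set0]_(k < N) [set z : V | enorm (z - p k) <= rho]) (dPhi al i)).
    - apply: bigsetU_compact => k _; apply: (@compact_closed_enorm _ _ _ (enorm (p k) + (rho + 1))).
        by apply: closed_lef; exact: continuous_enormB.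
      by move=> z /= h; apply: enorm_ball_bound; lra.
    - by move=> z /in_bigsetU[k /=]; exact: hD.
    - move=> z nz; rewrite /Phi big1// => k _; rewrite off ?mulr0//.
      by apply/ltW; rewrite ltNge; apply/negP => h; apply: nz; apply/in_bigsetU; exists k.
  have [[k hk]|hk] := pselect (exists k, enorm (z - p k) < rho).
    have PE al i : Phi al i z = kap * e ord0 al * nu k ord0 i * bump rho (p k) z.
      rewrite /Phi (bigD1 k)//= big1 ?addr0// => l lk; rewrite off ?mulr0// leNgt; apply/negP => h.
      have := sep l k lk; apply/negP; rewrite -ltNge.
      apply: (le_lt_trans (enorm_sub_le _ z _)); rewrite enormB; move: h hk; lra.
    have -> : \sum_(al < m) \sum_(i < n.+2) Phi al i z ^+ 2 = (kap * bump rho (p k) z) ^+ 2 * dotv e e.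
      rewrite mulr_sumr; apply: eq_bigr => al _; rewrite -[RHS]mulr1 -(sphere_dot (n1 k)) mulr_sumr; apply: eq_bigr => i _.
      by rewrite PE; ring.
    rewrite -sqr_enorm -exprMn.
    have [b0 b1] := andP (bump_le (p k) z (ltW r0)).
    have -> : (kap * bump rho (p k) z * enorm e) ^+ 2 = (bump rho (p k) z / rho ^+ 4) ^+ 2.
      rewrite /kap; set B := bump _ _ _; set E := enorm e; set r4 := rho ^+ 4.
      have r40 : r4 != 0 by rewrite expf_neq0// gt_eqF.
      have E0 : E != 0 by rewrite gt_eqF.
      by field; rewrite r40 E0.
    by rewrite exprn_ile1// ?divr_ge0// ?exprn_ge0// ?(ltW r0)// ler_pdivrMr ?mul1r// exprn_gt0.
  rewrite big1// => al _; rewrite big1// => i _; rewrite /Phi big1 ?expr0n// => k _; rewrite off ?mulr0//.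
  by rewrite leNgt; apply/negP => h; apply: hk; exists k.
have dvg al z : divg (Phi al) z = \sum_(k < N) (-4 * kap) * (e ord0 al * chi rho (p k) (nu k) z).
  have -> : divg (Phi al) z = \sum_(i < n.+2) \sum_(k < N) kap * e ord0 al * nu k ord0 i * dbump rho (p k) i z.
    by apply: eq_bigr => i _; have [_ /(_ i)[h _]] := dPhi al i; exact: (@derive_val _ _ _ _ _ _ _ (h z)).
  rewrite exchange_big; apply: eq_bigr => k _; rewrite /chi /dbump; set mx := Num.max _ _.
  transitivity ((-4 * kap * e ord0 al * mx) * dotv (z - p k) (nu k)); last by ring.
  by rewrite mulr_sumr; apply: eq_bigr => i _; ring.
(* The part of [w] along e is [S] plus this constant, whose pairing with [chi] is zero. *)
pose cst := \sum_al e ord0 al * va ord0 al.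
have bk k : bcs (fun z => -4 * kap * (S z * chi rho (p k) (nu k) z + cst * chi rho (p k) (nu k) z)).
  by apply: bcsZ; apply: bcsD; [exact: (gain k).1|apply: bcsZ; exact: chi_bcs].
have TE : Tint w Phi = \sum_(k < N) (-4 * kap) * J (fun z => S z * chi rho (p k) (nu k) z).
  rewrite /Tint -(@J_sum _ _ _ _ (fun al x => w x ord0 al * divg (Phi al) x)); last first.
    by move=> al; exact: (bmeas_bcs (D := D) al (Mfun_bmeas hw) tf).
  rewrite (_ : (fun x => _) = (fun z => \sum_(k < N) -4 * kap * (S z * chi rho (p k) (nu k) z + cst * chi rho (p k) (nu k) z))).
    rewrite (J_sum _ bk); apply: eq_bigr => k _; rewrite JZ; last first.
      by apply: bcsD; [exact: (gain k).1|apply: bcsZ; exact: chi_bcs].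
    rewrite JD; [|exact: (gain k).1|by apply: bcsZ; exact: chi_bcs].
    by rewrite (JZ cst (chi_bcs (p k) (nu k) r0)) (chi_J0 (p k) (nu k) r0) mulr0 addr0.
  apply/funext => z; under eq_bigr do rewrite dvg mulr_sumr.
  rewrite exchange_big; apply: eq_bigr => k _ /=; rewrite -mulrDl /S /cst -big_split /= mulr_suml mulr_sumr.
  by apply: eq_bigr => al _; ring.
have := hC _ tf; rewrite TE; apply: le_trans; rewrite -[X in X%:R]card_ord mulr_natl -sumr_const.
apply: ler_sum => k _; apply: (@le_trans _ _ (-4 * kap * (c3 / 2 * rho ^+ n.+2 * rho ^+ 3))).
  rewrite le_eqVlt; apply/orP; left; apply/eqP; rewrite /kap.
  have -> : rho ^+ n.+2 = rho ^+ n.+1 * rho by rewrite exprSr.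
  have -> : rho ^+ 4 = rho ^+ 3 * rho by rewrite exprSr.
  set r3 := rho ^+ 3; have r30 : r3 != 0 by rewrite expf_neq0// gt_eqF.
  set rn := rho ^+ n.+1; set E := enorm e; set c := c3; have E0 : E != 0 by rewrite gt_eqF.
  by field; rewrite r30 E0 gt_eqF.
rewrite ler_wpM2l//; last exact: (gain k).2.
by rewrite /kap mulrN mulNr opprK mulr_ge0// invr_ge0 mulr_ge0 ?(ltW e0)// exprn_ge0// ltW.
Qed.

(** A maximal 2 rho-separated subset of [Fset] has at most C/(A rho^(n+1)) points by
    [separated_bound], and the balls of radius 2 rho about them cover. The bound does not depend on
    rho or Q. *)
Lemma hausdorff_Fset_bounded (K W0 : set V) (dl : R) : TVfin D w -> 0 < dl -> (forall x z, K x -> enorm (z - x) <= dl -> D z) ->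
  exists2 eps : R, 0 < eps & exists C : R, forall Q, (H (Fset va vb eps Q K W0 w) <= C%:E)%E.
Proof.
move=> tv dl0 KD; exists eps0; first exact: eps0_gt0.
move: tv => [C hC]; pose A := 2 * c3 / enorm e; have A0 : 0 < A by rewrite divr_gt0// mulr_gt0.
exists (omega R n.+1 * 2 ^+ n.+1 * (`|C| / A)) => Q; apply: hausdorff_le => d d0.
have m0 : 0 < Num.min (d / 4) dl by rewrite lt_min dl0 divr_gt0.
have [Q' hQ'] := rq_small m0; pose q := maxn Q Q'.
have := hQ' q (leq_maxr _ _); rewrite lt_min => /andP[rd rdl]; set rho := rq R q in rd rdl.
have r0 : 0 < rho by exact: rq_gt0.
pose F := Fset va vb eps0 Q K W0 w.
pose P (N : nat) := `[< exists p : 'I_N -> V, (forall k, F (p k)) /\ forall k l, k != l -> 2 * rho <= enorm (p k - p l) >].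
have bnd N : P N -> N%:R * (A * rho ^+ n.+1) <= C.
  move=> /asboolP[p [hp sep]]; have [nu hnu] := choice hp.
  apply: (@separated_bound C K W0 q Q N p nu) => //; first exact: leq_maxl.
  by move=> k z hz; have [Kp _ _] := hnu k; apply: (KD _ _ Kp); exact: (le_trans hz (ltW rdl)).
have Ar : 0 < A * rho ^+ n.+1 by rewrite mulr_gt0// exprn_gt0.
have P0 : exists N, P N by exists 0%N; apply/asboolP; exists (fun=> 0); split => [[]|[]].
have Pb N : P N -> (N <= (Num.truncn (C / (A * rho ^+ n.+1))))%N.
  move=> hN; have := bnd N hN; rewrite -ler_pdivlMr// => h.
  by rewrite truncn_ge_nat// (le_trans _ h).
case: (ex_maxnP P0 Pb) => N /[dup] PN' /asboolP[p [hp sep]] mx.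
have cov x : F x -> exists k, eball (p k) (2 * rho) x.
  move=> Fx; apply: contrapT => nk.
  have : P N.+1.
    apply/asboolP; exists (fun i => if unlift ord_max i is Some j then p j else x); split.
      by move=> i; case: unliftP => [j _|_] //; exact: hp.
    have far k : 2 * rho <= enorm (x - p k).
      by rewrite leNgt; apply/negP => h; apply: nk; exists k.
    move=> k l kl; case: (unliftP ord_max k) kl => [k' ->|->]; case: (unliftP ord_max l) => [l' ->|->] kl.
    - by apply: sep; apply: contraNneq kl => ->.
    - by rewrite enormB; exact: far.
    - exact: far.
    - by rewrite eqxx in kl.
  by move/mx; rewrite ltnn.
pose dd := PosNum d0.
have hh : (hdel n dd F <= (N%:R * (omega R n.+1 * (4 * rho / 2) ^+ n.+1))%:E)%E.
  apply: (@outer_bigU_le _ _ (hdel n dd) N (fun k => eball (p k) (2 * rho))) => // k.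
  apply: hdel_small; rewrite ?mulr_ge0 ?(ltW r0)//=; first by move: rd; lra.
  move=> x y hx hy; apply: (le_trans (enorm_sub_le _ (p k) _)); move: hx hy; rewrite /eball /= (enormB y); lra.
apply: (le_trans hh); rewrite lee_fin.
have -> : 4 * rho / 2 = 2 * rho by field.
rewrite exprMn; have om := omega_ge0 R n.+1.
have hN := bnd N PN'; have hN2 : N%:R * rho ^+ n.+1 <= `|C| / A.
  by rewrite ler_pdivlMr// -mulrA (mulrC _ A) (le_trans hN)// ler_norm.
have -> : N%:R * (omega R n.+1 * (2 ^+ n.+1 * rho ^+ n.+1)) = omega R n.+1 * 2 ^+ n.+1 * (N%:R * rho ^+ n.+1) by ring.
by rewrite ler_wpM2l// mulr_ge0// exprn_ge0.
Qed.
End FiniteJumpMeasure.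

(** * Uniqueness of the jump triple *)

Section JumpUnique.
Variables (R : realType) (n m : nat).
Local Notation V := 'rV[R]_n.+1.
Local Notation W := 'rV[R]_m.
Implicit Types (w : V -> W) (nu x : V).

(** Two half balls overlap unless their inward directions are opposite: a ball of radius (1 + c)/4
    about a quarter of the sum of these directions lies in both, c being the cosine of their
    angle. *)
Lemma aplim_overlap w x nu nu' s s' a a' : sphere nu -> sphere nu' -> sg R s *: nu + sg R s' *: nu' != 0 ->
  aplim_half w x nu s a -> aplim_half w x nu' s' a' -> a = a'.
Proof.
move=> n1 n1' ne al al'; pose c := sg R s * sg R s' * dotv nu nu'.
have sN (b : bool) : `|sg R b| = 1 by rewrite /sg; case: b; rewrite ?normrN normr1.
have E : dotv (sg R s *: nu + sg R s' *: nu') (sg R s *: nu + sg R s' *: nu') = 2 + 2 * c.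
  rewrite dotvDl !dotvDr !dotvZl !dotvZr (dotvC nu' nu) !sphere_dot// !mulr1 !sg_sq /c.
  by set u := sg R s; set v := sg R s'; set d := dotv _ _; ring.
have c0 : 0 < 1 + c.
  have : 0 < 2 + 2 * c by rewrite -E lt_def dotvv_ge0 dotvv_eq0 ne.
  lra.
have c1 : c <= 1.
  apply: (le_trans (ler_norm _)); rewrite /c !normrM !sN !mul1r; apply: (le_trans (dotv_CS _ _)).
  by rewrite n1 n1' mulr1.
apply: (@aplim_meet _ _ _ w x nu s a nu' s' a' (4^-1 *: (sg R s *: nu + sg R s' *: nu')) ((1 + c) / 4) n1 n1' al al').
- by rewrite divr_gt0.
- have h4 : `|4^-1 : R| = 4^-1 by rewrite ger0_norm.
  have := enormD (sg R s *: nu) (sg R s' *: nu'); rewrite [enorm (4^-1 *: _)]enormZ h4 (enormZ (sg R s)) (enormZ (sg R s')) !sN n1 n1' !mulr1.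
  set N := enorm _ => hN; lra.
- rewrite dotvZl dotvDl !dotvZl (dotvC nu' nu) sphere_dot// mulr1.
  have := sg_sq R s; rewrite /c; set u := sg R s; set v := sg R s'; set d := dotv _ _ => h.
  by rewrite le_eqVlt; apply/orP; left; apply/eqP; transitivity ((u * u + u * v * d) / 4); [rewrite h|ring].
- rewrite dotvZl dotvDl !dotvZl sphere_dot// mulr1.
  have := sg_sq R s'; rewrite /c; set u := sg R s; set v := sg R s'; set d := dotv _ _ => h.
  by rewrite le_eqVlt; apply/orP; left; apply/eqP; transitivity ((v * v + u * v * d) / 4); [rewrite h; ring|ring].
Qed.

Lemma jt_unique w x va vb nu va' vb' nu' : jumptriple w x va vb nu -> jumptriple w x va' vb' nu' ->
  (nu' = nu /\ va' = va /\ vb' = vb) \/ (va' = vb /\ vb' = va).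
Proof.
move=> [n1 ne hp hm] [n1' ne' hp' hm'].
have key s s' : sg R s *: nu + sg R s' *: nu' == 0 -> nu' = (- (sg R s * sg R s')) *: nu.
  rewrite addrC addr_eq0 => /eqP h; have : sg R s' *: (sg R s' *: nu') = sg R s' *: - (sg R s *: nu) by rewrite h.
  by rewrite scalerA sg_sq scale1r scalerN scalerA mulrC => ->; rewrite scaleNr.
have [e|e] := eqVneq (sg R true *: nu + sg R true *: nu') 0.
  have en := key true true (introT eqP e); right.
  have nz s : sg R s *: nu + sg R (~~ s) *: nu' != 0.
    apply/eqP => h0; have := key _ _ (introT eqP h0); rewrite en => h1.
    have : dotv (- (sg R true * sg R true) *: nu) nu = dotv (- (sg R s * sg R (~~ s)) *: nu) nu by rewrite h1.
    by rewrite !dotvZl sphere_dot// !mulr1 /sg; case: (s) => /=; rewrite ?mulr1 ?mul1r ?mulN1r ?mulrN1 ?opprK => h; move: h; lra.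
  split; first by apply: esym; exact: (aplim_overlap n1 n1' (nz true) hp hm').
  by apply: esym; exact: (aplim_overlap n1 n1' (nz false) hm hp').
have bb := aplim_overlap n1 n1' e hp hp'.
have e2 : sg R false *: nu + sg R false *: nu' != 0 by rewrite /sg !scaleN1r -opprD oppr_eq0; rewrite /sg !scale1r in e.
have aa := aplim_overlap n1 n1' e2 hm hm'.
left; split => //; apply: contrapT => nn.
have e3 : sg R true *: nu + sg R false *: nu' != 0.
  by rewrite /sg scale1r scaleN1r subr_eq0 eq_sym; apply/eqP.
by have := aplim_overlap n1 n1' e3 hp hm' => h; move: ne; rewrite h aa eqxx.
Qed.

Lemma aplim_mem (M : seq W) w x nu s a : Mfun M w -> sphere nu -> aplim_half w x nu s a -> a \in M.
Proof.
move=> hw n1 al; apply: contrapT => /negP aM; have [e e0 he] := value_gap M a.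
have vp : 0 < vball R n := vball_gt0 R n.
have p4 : 0 < (4 : R) ^+ n.+1 by rewrite exprn_gt0.
have eta0 : 0 < vball R n / 4 ^+ n.+1 / 2 by rewrite !divr_gt0.
have [r0 r00 hr] := aplim_fact al e0 eta0.
have r1 : 0 < r0 / 2 by rewrite divr_gt0.
have r2 : r0 / 2 < r0 by rewrite ltr_pdivrMr// ltr_pMr// ltr1n.
have := hr _ r1 r2; move: (r0 / 2) r1 r2 => r r1 r2; apply/negP; rewrite -ltNge.
have r4 : 0 < r / 4 by rewrite divr_gt0.
apply: (@lt_le_trans _ _ (vball R n * (r / 4) ^+ n.+1)%:E).
  rewrite lte_fin exprMn exprVn; have : 0 < r ^+ n.+1 by rewrite exprn_gt0.
  set u := r ^+ _; set v := 4 ^+ _ in p4 eta0 *; move=> u0.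
  have -> : vball R n * (u / v) = vball R n / v * u by ring.
  by rewrite ltr_pM2r//; lra.
rewrite -(leb_eball (x + r *: ((sg R s / 2) *: nu)) r4); apply: leb_le => y hy; split; last first.
  by apply: he; [exact: hw.1|apply: contraNneq aM => <-; exact: hw.1].
apply: (halfball_ball n1 r1) hy.
  have s1 : `|sg R s| = 1 by rewrite /sg; case: (s); rewrite ?normrN normr1.
  have h2 : `|2^-1 : R| = 2^-1 by rewrite ger0_norm.
  by rewrite enormZ n1 mulr1 normrM s1 h2; lra.
by rewrite dotvZl sphere_dot// mulr1 mulrA sg_sq; lra.
Qed.

Lemma halfball_opp x nu : halfball x (- nu) = fun r s => halfball x nu r (~~ s).
Proof.
apply/funext => r; apply/funext => s; apply/funext => y; rewrite /halfball /= dotvNr.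
by case: s; rewrite ?oppr_gt0 ?oppr_lt0.
Qed.

Lemma jt_flip w x va vb nu : jumptriple w x va vb nu -> jumptriple w x vb va (- nu).
Proof.
move=> [n1 ne hp hm]; split; [by rewrite /sphere /= enormN|by rewrite eq_sym| |].
  by rewrite /aplim_half halfball_opp; exact: hm.
by rewrite /aplim_half halfball_opp; exact: hp.
Qed.
End JumpUnique.

(** * Measurable dependence of jump sets on the code and on the level *)

Section JumpMeasure.
Variables (R : realType) (n m : nat).
Local Notation V := 'rV[R]_n.+2.
Local Notation W := 'rV[R]_m.
Local Notation H := (@oH R n.+1 n).
Local Notation mH := (caratheodory_type H).
Implicit Types (w : V -> W) (K C : set V).

Definition muH : set mH -> \bar R := H.
HB.instance Definition _ := Measure.copy muH (H : set mH -> \bar R).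

Lemma cara_closed C : closed C -> measurable (C : set mH).
Proof. by move=> cC; rewrite -(setCK C); apply: measurableC; apply: cara_open; exact: closed_openC. Qed.

Definition Es K (va vb : W) (S : set (V * V)) w : set V :=
  [set x | K x /\ exists nu, S (x, nu) /\ jumptriple w x va vb nu].

Variables (M : seq W) (a0 : W) (va vb : W).
Hypotheses (a0M : a0 \in M) (vab : va != vb).

Let Gj (K C2 : set V) w j := \bigcup_Q Fset va vb j.+1%:R^-1 Q K C2 w.

Lemma Es_rect K (C1 C2 : set V) w : Mfun M w -> compact K -> closed C1 -> closed C2 ->
  Es K va vb (C1 `*` C2) w = \bigcap_j Gj (K `&` C1) C2 w j.
Proof.
move=> hw cK c1 c2; rewrite -(Jset_eq hw vab _ c2).
  apply/seteqP; split => x; first by move=> [Kx [nu [[/= h1 h2] jt]]]; split => //; exists nu.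
  by move=> [[Kx h1] [nu [h2 jt]]]; split => //; exists nu.
apply: (subclosed_compact _ cK); [apply: closedI => //; exact: compact_closedV|by move=> x []].
Qed.

Let cF K C2 w j Q : Mfun M w -> compact K -> closed C2 -> measurable (Fset va vb j.+1%:R^-1 Q K C2 w : set mH).
Proof. by move=> hw cK c2; apply: cara_closed; apply: compact_closedV; exact: (@compact_Fset _ _ _ va vb _ Q _ _ cK c2 M). Qed.

Let cG K C2 w j : Mfun M w -> compact K -> closed C2 -> measurable (Gj K C2 w j : set mH).
Proof. by move=> hw cK c2; apply: bigcupT_measurable => Q; exact: cF. Qed.

Let cI K C1 : compact K -> closed C1 -> compact (K `&` C1).
Proof. by move=> cK c1; apply: (subclosed_compact _ cK); [apply: closedI => //; exact: compact_closedV|by move=> x []]. Qed.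

Lemma measurable_Es_rect K C1 C2 w : Mfun M w -> compact K -> closed C1 -> closed C2 ->
  measurable (Es K va vb (C1 `*` C2) w : set mH).
Proof. by move=> hw cK c1 c2; rewrite Es_rect//; apply: bigcapT_measurable => j; apply: cG => //; exact: cI. Qed.

Let G_cvg K C2 w j : Mfun M w -> compact K -> closed C2 ->
  (H (Fset va vb j.+1%:R^-1 Q K C2 w)) @[Q --> \oo] --> H (Gj K C2 w j).
Proof.
move=> hw cK c2; apply: (@nondecreasing_cvg_mu _ _ _ muH (fun Q => Fset va vb j.+1%:R^-1 Q K C2 w)).
- by move=> Q; exact: cF.
- exact: cG.
- by move=> Q Q' QQ; apply/subsetPset; exact: Fset_mono.
Qed.

Let G_fin K C2 w (D : set V) dl : Mfun M w -> TVfin D w -> 0 < dl -> (forall x z, K x -> enorm (z - x) <= dl -> D z) ->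
  compact K -> closed C2 -> exists j0 : nat, forall j, (j0 <= j)%N -> (H (Gj K C2 w j) < +oo)%E.
Proof.
move=> hw tv dl0 KD cK c2; have [e e0 [C hC]] := hausdorff_Fset_bounded hw vab C2 tv dl0 KD.
have [j0 _ hj] := near_infty_natSinv_lt (PosNum e0); exists j0 => j /hj hj'.
have h' : j.+1%:R^-1 < e := hj'.
apply: (@le_lt_trans _ _ C%:E); last exact: ltry.
have h := G_cvg (j := j) hw cK c2; rewrite -(cvg_lim (@ereal_hausdorff R) h).
apply: lime_le; first by apply/cvg_ex; exists (H (Gj K C2 w j)).
near=> Q; apply: le_trans (hC Q); apply: (@le_outer_measure _ _ H).
by apply: Fset_mono => //; exact: ltW.
Unshelve. all: by end_near. Qed.

(** Finiteness is what differences of jump sets require below. *)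
Lemma Es_fin K S w (D : set V) dl : Mfun M w -> TVfin D w -> 0 < dl -> (forall x z, K x -> enorm (z - x) <= dl -> D z) ->
  compact K -> (H (Es K va vb S w) < +oo)%E.
Proof.
move=> hw tv dl0 KD cK.
have KD' x z : (K `&` setT) x -> enorm (z - x) <= dl -> D z by move=> [Kx _]; exact: KD.
have [j0 hj] := G_fin hw tv dl0 KD' (cI cK (@closedT _)) (@closedT _).
apply: le_lt_trans (hj j0 (leqnn _)); apply: (@le_outer_measure _ _ H) => x [Kx [nu [_ jt]]].
have : Es K va vb (setT `*` setT) w x by split => //; exists nu.
by rewrite (Es_rect hw cK (@closedT _) (@closedT _)) => /(_ j0 I).
Qed.

(** The jump set is a decreasing intersection over j of increasing unions over Q of compact sets
    with measurable Hausdorff measure. The limit in j starts at an index [j0], depending on the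
    code, from which the measures are finite. *)
Lemma measurable_H_rect K C1 C2 (D : set V) dl (A : set Baire) : measurable A ->
  (forall y, A y -> TVfin D (ucode M a0 y)) -> 0 < dl -> (forall x z, K x -> enorm (z - x) <= dl -> D z) ->
  compact K -> closed C1 -> closed C2 ->
  measurable_fun A (fun y : Baire => H (Es K va vb (C1 `*` C2) (ucode M a0 y))).
Proof.
move=> mA tv dl0 KD cK c1 c2; have cK1 := cI cK c1.
have hw y := @ucode_Mfun R n.+1 m M a0 a0M y.
have mG j : measurable_fun A (fun y : Baire => H (Gj (K `&` C1) C2 (ucode M a0 y) j)).
  apply: (@emeasurable_fun_cvg _ _ _ _ (fun Q y => H (Fset va vb j.+1%:R^-1 Q (K `&` C1) C2 (ucode M a0 y)))).
    by move=> Q; apply: measurable_funTS; exact: (@measurable_H_Fset R n.+1 m va vb _ Q _ _ cK1 c2 n M a0 a0M).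
  by move=> y Ay; exact: G_cvg.
apply: (emeasurable_fun_cvg _ _ mG) => y Ay; rewrite Es_rect//.
have KD' x z : (K `&` C1) x -> enorm (z - x) <= dl -> D z by move=> [Kx _]; exact: KD.
have [j0 hj] := G_fin (hw y) (tv y Ay) dl0 KD' cK1 c2.
have mono i j : (i <= j)%N -> Gj (K `&` C1) C2 (ucode M a0 y) j `<=` Gj (K `&` C1) C2 (ucode M a0 y) i.
  by move=> ij x [Q _ hx]; exists Q => //; apply: Fset_mono hx => //; rewrite lef_pV2 ?posrE// ler_nat.
rewrite -(cvg_shiftn j0).
have -> : \bigcap_j Gj (K `&` C1) C2 (ucode M a0 y) j = \bigcap_j Gj (K `&` C1) C2 (ucode M a0 y) (j + j0)%N.
  apply/seteqP; split => x hx j _; first exact: hx.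
  by apply: (mono j (j + j0)%N _ x (hx j I)); exact: leq_addr.
apply: (@nonincreasing_cvg_mu _ _ _ muH (fun j => Gj (K `&` C1) C2 (ucode M a0 y) (j + j0)%N)).
- by apply: hj; rewrite add0n.
- by move=> j; exact: cG.
- by apply: bigcapT_measurable => j; exact: cG.
- by move=> i j ij; apply/subsetPset; apply: mono; rewrite leq_add2r.
Qed.

Section Dynkin.
Variables (dZ : measure_display) (Z : measurableType dZ).
Definition closed_rects : set (set (Z * (V * V))) :=
  [set T | exists (A : set Z) C1 C2, [/\ measurable A, closed C1, closed C2 & T = A `*` (C1 `*` C2)]].
Definition slice (T : set (Z * (V * V))) z : set (V * V) := [set p | T (z, p)].
Variables (K D : set V) (dl : R) (A : set Baire).
Hypotheses (mA : measurable A) (tv : forall y, A y -> TVfin D (ucode M a0 y)) (dl0 : 0 < dl).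
Hypotheses (KD : forall x z, K x -> enorm (z - x) <= dl -> D z) (cK : compact K).

Let hw y := @ucode_Mfun R n.+1 m M a0 a0M y.
Let DD : set (Z * Baire) := setT `*` A.
Let mDD : measurable DD. Proof. exact: measurableX. Qed.
Let good (T : set (Z * (V * V))) := (forall w z, Mfun M w -> measurable (Es K va vb (slice T z) w : set mH)) /\
  measurable_fun DD (fun q : Z * Baire => H (Es K va vb (slice T q.1) (ucode M a0 q.2))).

Let good_rect : closed_rects `<=` good.
Proof.
move=> T [B [C1 [C2 [mB c1 c2 ->]]]].
have sl z : slice (B `*` (C1 `*` C2)) z = if `[< B z >] then C1 `*` C2 else set0.
  by case: ifPn => /asboolP Bz; apply/seteqP; split => p //=; [move=> []|move=> []].
have E0 w : Es K va vb set0 w = set0 by apply/seteqP; split => x // [_ [? []]].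
split => [w z Mw|].
  by rewrite sl; case: ifP => _; [exact: measurable_Es_rect|rewrite E0; exact: measurable0].
have -> : (fun q : Z * Baire => H (Es K va vb (slice (B `*` (C1 `*` C2)) q.1) (ucode M a0 q.2))) =
  (fun q => (\1_B q.1)%:E * H (Es K va vb (C1 `*` C2) (ucode M a0 q.2)))%E.
  apply/funext => q; rewrite sl indicE; case: ifPn => /asboolP Bz; first by rewrite mem_set// mul1e.
  by rewrite memNset// mul0e E0 outer_measure0.
apply: emeasurable_funM.
  apply: measurable_funTS; rewrite (_ : (fun x => _) = EFin \o \1_(B `*` [set: Baire])).
    by apply/measurable_EFinP; apply: measurable_indic; exact: measurableX.
  by apply/funext => -[z y] /=; rewrite !indicE in_setX in_setT andbT.
apply: (@measurable_comp _ _ _ _ _ _ A (fun y : Baire => H (Es K va vb (C1 `*` C2) (ucode M a0 y))) DD snd) => //.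
- by move=> _ [q [_ h] <-].
- exact: (measurable_H_rect mA tv dl0 KD cK c1 c2).
- exact: measurable_funTS.
Qed.

Let fin q S : DD q -> (H (Es K va vb S (ucode M a0 q.2)) < +oo)%E.
Proof. by move=> [_ Aq]; exact: (Es_fin S (hw q.2) (tv Aq) dl0 KD cK). Qed.

(** A monotone class argument from closed rectangles. Proper differences pass through because the
    normal is unique once the ordered pair (va, vb) is fixed, and because the measures are
    finite. *)
Lemma measurable_H_Es T : <<s closed_rects >> T -> (forall w z, Mfun M w -> measurable (Es K va vb (slice T z) w : set mH)) /\
  measurable_fun DD (fun q : Z * Baire => H (Es K va vb (slice T q.1) (ucode M a0 q.2))).
Proof.
suff [LI LS] : setI_closed closed_rects /\ lambda_system setT good.
  by move: T; exact: (lambda_system_subset LI LS good_rect (fun _ _ => @subsetT _ _)).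
split; last split.
- move=> _ _ [B [C1 [C2 [mB c1 c2 ->]]]] [B' [C1' [C2' [mB' c1' c2' ->]]]].
  exists (B `&` B'), (C1 `&` C1'), (C2 `&` C2'); split; [exact: measurableI|exact: closedI|exact: closedI|].
  by apply/seteqP; split => -[z [x nu]] /=; [move=> [[? [? ?]] [? [? ?]]]|move=> [[? ?] [[? ?] [? ?]]]].
- by [].
- by apply: good_rect; exists setT, setT, setT; split; [exact: measurableT|exact: closedT|exact: closedT|rewrite !setXTT].
- move=> T1 T2 sub [h1 h2] [h1' h2'].
  have ED w z : Es K va vb (slice (T1 `\` T2) z) w = Es K va vb (slice T1 z) w `\` Es K va vb (slice T2 z) w.
    apply/seteqP; split => x.
      move=> [Kx [nu [[Tn nT] jt]]]; split; first by split => //; exists nu.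
      move=> [_ [nu' [Tn' jt']]]; have [[e _]|[e _]] := jt_unique jt jt'; first by apply: nT; rewrite -e.
      by move: vab; rewrite e eqxx.
    move=> [[Kx [nu [Tn jt]]] nE]; split => //; exists nu; split => //; split => // Tn'.
    by apply: nE; split => //; exists nu.
  split => [w z Mw|]; first by rewrite ED; apply: measurableD; [exact: h1|exact: h1'].
  apply: (eq_measurable_fun (fun q : Z * Baire => H (Es K va vb (slice T1 q.1) (ucode M a0 q.2)) - H (Es K va vb (slice T2 q.1) (ucode M a0 q.2))))%E; last exact: emeasurable_funB.
  move=> q /set_mem Dq; rewrite ED.
  rewrite [RHS](measureD (mu := muH) (h1 _ _ (hw _)) (h1' _ _ (hw _)) (fin _ Dq)); congr (_ - _)%E.
  congr (H _); apply/seteqP; split => x; last by move=> [].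
  move=> [Kx [nu [Tn jt]]]; split; last by split => //; exists nu.
  by split => //; exists nu; split => //; exact: sub.
- move=> F ndF hF.
  have EU w z : Es K va vb (slice (\bigcup_i F i) z) w = \bigcup_i Es K va vb (slice (F i) z) w.
    apply/seteqP; split => x; first by move=> [Kx [nu [[i _ Fi] jt]]]; exists i => //; split => //; exists nu.
    by move=> [i _ [Kx [nu [Fi jt]]]]; split => //; exists nu; split => //; exists i.
  split => [w z Mw|]; first by rewrite EU; apply: bigcupT_measurable => i; exact: (hF i).1.
  apply: (@emeasurable_fun_cvg _ _ _ _ (fun i q => H (Es K va vb (slice (F i) q.1) (ucode M a0 q.2)))); first by move=> i; exact: (hF i).2.
  move=> q _; rewrite EU.
  apply: (@nondecreasing_cvg_mu _ _ _ muH (fun i => Es K va vb (slice (F i) q.1) (ucode M a0 q.2))).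
  + by move=> i; exact: (hF i).1.
  + by apply: bigcupT_measurable => i; exact: (hF i).1.
  + move=> i j /ndF/subsetPset Fij; apply/subsetPset => x [Kx [nu [Fi jt]]]; split => //; exists nu; split => //; exact: Fij.
Qed.
End Dynkin.
End JumpMeasure.

(** * Measurability of the cell infimum *)

Section CellMeasurable.
Variables (R : realType) (n m : nat).
Local Notation V := 'rV[R]_n.+2.
Local Notation W := 'rV[R]_m.
Local Notation H := (@oH R n.+1 n).
Local Notation mH := (caratheodory_type H).
Variables (M : seq W) (a0 : W).
Hypothesis a0M : a0 \in M.

(** Each unordered pair of distinct values is kept once: reversing the normal exchanges the traces,
    so both orders would count the same jump points twice. *)
Definition mpairs : seq (W * W) :=
  [seq p <- undup [seq (a, b) | a <- M, b <- M] | (index p.1 M < index p.2 M)%N].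

Lemma mpairsP p : p \in mpairs <-> [/\ p.1 \in M, p.2 \in M & (index p.1 M < index p.2 M)%N].
Proof.
rewrite mem_filter mem_undup; split.
  by move=> /andP[h /allpairsP[[a b] /= [aM bM pe]]]; move: h; rewrite pe.
by move=> [h1 h2 ->] /=; apply/allpairsP; exists p; split => //; case: p {h1 h2}.
Qed.

Lemma mpairs_neq p : p \in mpairs -> p.1 != p.2.
Proof. by move=> /mpairsP[_ _]; apply: contraTneq => ->; rewrite ltnn. Qed.

Definition Tg (g : V -> W -> V -> R) (s : R) (p : W * W) : set (V * V) :=
  [set q | sphere q.2 /\ s < g q.1 (p.2 - p.1) q.2].

Lemma Esurf_level (g : V -> W -> V -> R) w (D K : set V) (s : R) : Mfun M w -> K `<=` D -> 0 < s ->
  (forall x zeta nu, sphere nu -> g x zeta nu = g x (- zeta) (- nu)) ->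
  K `&` [set x | (s%:E < (if x \in D then jdens g w x else 0))%E] =
  \bigcup_(p in [set` mpairs]) Es K p.1 p.2 (Tg g s p) w.
Proof.
move=> hw KD s0 gs; apply/seteqP; split => x; last first.
  move=> [p _ [Kx [nu [[n1 /= sg] jt]]]]; split => //=; rewrite mem_set; last exact: KD.
  by apply: lt_le_trans (_ : ((g x (p.2 - p.1) nu)%:E <= _)%E); [rewrite lte_fin|apply: ereal_sup_ubound; exists p.1, p.2, nu].
move=> [Kx /=]; rewrite mem_set; last exact: KD.
move=> /ereal_sup_gt[_ [um [up [nu [jt ->]]]]]; rewrite lte_fin => sg.
have [n1 ne hp hm] := jt.
have upM := aplim_mem hw n1 hp; have umM := aplim_mem hw n1 hm.
have [lt|gt|e] := ltngtP (index um M) (index up M).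
- by exists (um, up); [apply/mpairsP|split => //; exists nu].
- exists (up, um); first by apply/mpairsP.
  split => //; exists (- nu); split; last exact: jt_flip.
  split => /=; first by rewrite /sphere /= enormN.
  by rewrite gs ?opprK ?opprB// /sphere /= enormN.
- by move: ne; rewrite -(nth_index 0 upM) -(nth_index 0 umM) e eqxx.
Qed.

Lemma mpairs_disj (S : W * W -> set (V * V)) w (K : set V) :
  trivIset [set` mpairs] (fun p => Es K p.1 p.2 (S p) w).
Proof.
move=> p q /mpairsP[_ _ ip] /mpairsP[_ _ iq] [x [[_ [nu [_ jt]]] [_ [nu' [_ jt']]]]].
have [[_ [e1 e2]]|[e1 e2]] := jt_unique jt jt'; first by rewrite [p]surjective_pairing [q]surjective_pairing e1 e2.
by move: iq; rewrite e1 e2 ltnNge (ltnW ip).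
Qed.

Variables (dO : measure_display) (Om : measurableType dO) (P : probability Om R).
Hypothesis Pc : complete_prob P.
Variable (g : Om -> V -> W -> V -> R).
Hypothesis ga : admissible_rst g.
Variables (nu : V) (t l : R) (ub : V -> W).
Hypotheses (nu1 : sphere nu) (t0 : 0 < t) (l0 : 0 < l) (hub : Mfun M ub).
Let D := rect nu t l.
Let oD : open D. Proof. exact: open_rect. Qed.
Let rr (q : nat) : R := q.+1%:R^-1.
Let Kq q : set V := crect nu (t - rr q) (l - rr q).
Let rr0 q : 0 < rr q. Proof. by rewrite invr_gt0. Qed.
Let widE (e : R) (j : 'I_n.+2) : wid (t - e) (l - e) j = wid t l j - e :> R. Proof. by rewrite /wid; case: ifP. Qed.

Let K_margin q x z : Kq q x -> enorm (z - x) <= rr q / 4 -> D z.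
Proof.
move=> Kx zx; apply/(rectP _ _ _ nu1) => j; have := Kx j; rewrite widE => h.
have h2 : `|dotv (z - x) (fr nu j)| <= rr q / 4.
  by apply: (le_trans (dotv_CS _ _)); rewrite fr_unit mulr1.
rewrite -[z](subrK x) dotvDl; apply: (le_lt_trans (ler_normD _ _)); have := rr0 q.
by move: h h2; set u := `|_|; set v := `|_|; lra.
Qed.

Let KD q : Kq q `<=` D.
Proof. by move=> x Kx; apply: (K_margin Kx); rewrite subrr enorm0 divr_ge0// ltW. Qed.

Let compact_K q : compact (Kq q).
Proof.
apply: (@compact_closed_enorm _ _ _ (n.+2%:R * (t + l))); first exact: closed_crect.
by move=> x /KD /(rect_crect nu1); apply: crect_bounded; exact: ltW.
Qed.

Let K_mono q q' : (q <= q')%N -> Kq q `<=` Kq q'.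
Proof.
move=> qq x Kx j; apply: le_trans (Kx j) _; rewrite !widE ler_pM2r// lerD2l lerN2.
by rewrite lef_pV2 ?posrE// ler_nat.
Qed.

Let K_cup : \bigcup_q Kq q = D.
Proof.
apply/seteqP; split => x; first by move=> [q _]; exact: KD.
move=> Dx; have [r r0 hr] := open_eball_in oD Dx.
have [q hq] := filter_ex (near_infty_natSinv_lt (PosNum r0)); have hq' : rr q < r := hq.
exists q => // j; rewrite widE; set d := dotv x _.
pose e : R := if 0 <= d then 1 else -1.
have de : e * d = `|d|.
  by rewrite /e; case: (leP 0 d) => h; [rewrite mul1r ger0_norm|rewrite mulN1r ltr0_norm].
have ee : e * e = 1 by rewrite /e; case: ifP; rewrite ?mulr1// mulrNN mulr1.
have en : `|e| = 1 by rewrite /e; case: ifP; rewrite ?normrN normr1.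
have : D (x + (rr q * e) *: fr nu j).
  apply: hr; rewrite /eball /= addrC addKr enormZ fr_unit mulr1 normrM en mulr1 ger0_norm//; exact: ltW.
move=> /(rectP _ _ _ nu1) /(_ j); rewrite dotvDl dotvZl fr_dot eqxx mulr1 -/d => h.
have h2 : `|d| + rr q <= `|d + rr q * e|.
  rewrite -[leRHS]mul1r -en -normrM mulrDr de mulrCA ee mulr1; exact: ler_norm.
by have := rr0 q; move: h h2; set u := `|d|; set v := `|_ + _|; lra.
Qed.

Let adm' := adm M a0 nu t l ub.
Let mA : measurable adm'. Proof. exact: (measurable_adm a0M nu1 t0 l0 hub). Qed.
Let tv y : adm' y -> TVfin D (ucode M a0 y). Proof. by case. Qed.

Let Z := (Om * measurableTypeR R)%type.
Let Tp (p : W * W) : set (Z * (V * V)) := [set q | sphere q.2.2 /\ q.1.2 < g q.1.1 q.2.1 (p.2 - p.1) q.2.2].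

(** Closed sets exhausting an open one, to pass from closed rectangles to the open ones generating
    the measurability of [g]. *)
Let closedC_in (U : set V) (k : nat) : set V := ~` fatten (~` U) (rr k).
Let closed_closedC U k : closed (closedC_in U k). Proof. by apply: open_closedC; exact: open_fatten. Qed.
Let closedC_cup U : open U -> \bigcup_k closedC_in U k = U.
Proof.
move=> oU; apply/seteqP; split => x.
  move=> [k _ hx]; apply: contrapT => nU; apply: hx; exists x => //; by rewrite subrr enorm0.
move=> Ux; have [r r0 hr] := (proj1 (openE_enorm U)) oU x Ux.
have [k hk] := filter_ex (near_infty_natSinv_lt (PosNum r0)); have hk' : rr k < r := hk.
exists k => // -[y nU xy]; apply: nU; apply: hr; rewrite enormB; exact: lt_trans xy hk'.
Qed.

Let SG (T : set (Z * (V * V))) := <<s @closed_rects R n _ Z >> T.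
Let SGsigma : sigma_algebra setT SG. Proof. exact: smallest_sigma_algebra. Qed.
Let SGU (F : nat -> set (Z * (V * V))) : (forall i, SG (F i)) -> SG (\bigcup_i F i). Proof. by case: SGsigma => _ _ h; exact: h. Qed.
Let SGC T : SG T -> SG (~` T). Proof. by have [_ h _] := SGsigma; move=> /h; rewrite setTD. Qed.
Let SG0 : SG set0. Proof. by have [] := SGsigma. Qed.
Let SGI T T' : SG T -> SG T' -> SG (T `&` T').
Proof.
move=> h h'; rewrite -[T `&` T']setCK setCI -bigcup2E; apply: SGC; apply: SGU => -[|[|i]] //=; exact: SGC.
Qed.

Let SG_open (B : set Z) (U1 U2 : set V) : measurable B -> open U1 -> open U2 -> SG (B `*` (U1 `*` U2)).
Proof.
move=> mB o1 o2; rewrite -(closedC_cup o1) -(closedC_cup o2).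
rewrite (_ : _ `*` _ = \bigcup_k \bigcup_k' (B `*` (closedC_in U1 k `*` closedC_in U2 k'))).
  do 2!(apply: SGU => ?); apply: sub_gen_smallest; do 3!eexists; split; [exact: mB| | |reflexivity]; exact: closed_closedC.
apply/seteqP; split => -[z [x y]] /=; first by move=> [Bz [[k _ h] [k' _ h']]]; exists k => //; exists k'.
by move=> [k _ [k' _ [Bz [h h']]]]; split => //; split; [exists k|exists k'].
Qed.

(** Freezes the jump amplitude, which takes finitely many values, and forgets the level. *)
Let psi (zeta : W) (q : Z * (V * V)) : Om * (V * (W * V)) := (q.1.1, (q.2.1, (zeta, q.2.2))).
Let SG_psi zeta (S : set (Om * (V * (W * V)))) : smallest (sigma_algebra setT) (@rects R dO Om n.+2 m) S -> SG (psi zeta @^-1` S).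
Proof.
move: S; apply: smallest_sub.
  split => /=; first by rewrite preimage_set0.
  - by move=> S hS; rewrite setTD preimage_setC; exact: SGC.
  - by move=> F hF; rewrite preimage_bigcup; exact: SGU.
move=> _ [A [U1 [U2 [U3 [mA' o1 o2 o3 ->]]]]] /=.
have [h|h] := pselect (U2 zeta).
  rewrite (_ : _ @^-1` _ = (A `*` setT) `*` (U1 `*` U3)).
    by apply: SG_open => //; exact: measurableX.
  by apply/seteqP; split => -[[w r] [x y]] /=; [move=> [? [? [? ?]]]|move=> [[? ?] [? ?]]].
rewrite (_ : _ @^-1` _ = set0)//; apply/seteqP; split => -[[w r] [x y]] //=.
by move=> [? [? [? ?]]].
Qed.

Let SG_Tp p : SG (Tp p).
Proof.
pose r_ (k : nat) : R := if (choice.unpickle k : option rat) is Some q then ratr q else 0.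
rewrite (_ : Tp p = \bigcup_k ((([set w | True] `*` [set r : measurableTypeR R | r < r_ k]) `*` (setT `*` setT)) `&`
   (psi (p.2 - p.1) @^-1` [set q | sphere q.2.2.2 /\ r_ k < g q.1 q.2.1 q.2.2.1 q.2.2.2]))).
  apply: SGU => k; apply: SGI; last by apply: SG_psi; exact: ga.1.
  apply: SG_open; [|exact: openT|exact: openT].
  apply: measurableX; first exact: measurableT.
  by rewrite -(set_itvNyo (r_ k)); exact: (measurable_itv (R := R) `]-oo, r_ k[).
apply/seteqP; split => -[[w s] [x nu']] /=.
  move=> [n1 /rat_in_itvoo[q]]; rewrite in_itv /= => /andP[h1 h2].
  by exists (choice.pickle q) => //=; rewrite /r_ choice.pickleK.
by move=> [k _ [[[_ h1] _] [n1 h2]]]; split => //; exact: lt_trans h1 h2.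
Qed.

Let F (q : (Om * Baire) * measurableTypeR R) : \bar R :=
  H [set x | (q.2%:E < (if x \in D then jdens (g q.1.1) (ucode M a0 q.1.2) x else 0))%E].
Let DD : set ((Om * Baire) * measurableTypeR R) := (setT `*` adm') `*` [set s | 0 < s].
Let hw y := @ucode_Mfun R n.+1 m M a0 a0M y.

Let gsym w x zeta nu' : sphere nu' -> g w x zeta nu' = g w x (- zeta) (- nu').
Proof. by have [_ [c [_ h]]] := ga; move=> n1; have [] := h w x zeta nu' n1. Qed.

Let mE p q : p \in mpairs -> (forall w z, Mfun M w -> measurable (Es (Kq q) p.1 p.2 (slice (Tp p) z) w : set mH)) /\
  measurable_fun (setT `*` adm') (fun r : Z * Baire => H (Es (Kq q) p.1 p.2 (slice (Tp p) r.1) (ucode M a0 r.2))).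
Proof.
move=> pp; have dl0 : 0 < rr q / 4 by rewrite divr_gt0.
exact: (measurable_H_Es a0M (mpairs_neq pp) mA tv dl0 (@K_margin q) (@compact_K q) (SG_Tp p)).
Qed.

Let mDD : measurable DD.
Proof.
apply: measurableX; first exact: measurableX.
exact: measurable_pos.
Qed.

Let F_level q r : 0 < r.2 -> muH (R := R) (n := n) (Kq q `&` [set x | (r.2%:E < (if x \in D then jdens (g r.1.1) (ucode M a0 r.1.2) x else 0))%E]) =
  (\sum_(p <- mpairs) H (Es (Kq q) p.1 p.2 (slice (Tp p) (r.1.1, r.2)) (ucode M a0 r.1.2)))%E.
Proof.
move=> r0; rewrite (Esurf_level (hw r.1.2) (@KD q) r0); last by move=> *; exact: gsym.
rewrite (@measure_fin_bigcup _ _ _ (@muH R n) _ [set` mpairs] (fun p => Es (Kq q) p.1 p.2 (Tg (g r.1.1) r.2 p) (ucode M a0 r.1.2))).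
- by rewrite -fsbig_seq// filter_uniq// undup_uniq.
- exact: finite_seq.
- exact: mpairs_disj.
- by move=> p pp; exact: ((mE q pp).1 _ (r.1.1, r.2) (hw r.1.2)).
Qed.

Let mF : measurable_fun DD F.
Proof.
apply: (@emeasurable_fun_cvg _ _ _ _ (fun q r => \sum_(p <- mpairs) H (Es (Kq q) p.1 p.2 (slice (Tp p) (r.1.1, r.2)) (ucode M a0 r.1.2)))%E).
  move=> q; rewrite (_ : (fun r => _) = (fun r : (Om * Baire) * measurableTypeR R => \sum_(i < size mpairs)
    (let p := nth (a0, a0) mpairs i in H (Es (Kq q) p.1 p.2 (slice (Tp p) (r.1.1, r.2)) (ucode M a0 r.1.2))))%E); last first.
    by apply/funext => r; rewrite (big_nth (a0, a0)) big_mkord.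
  apply: emeasurable_sum => i; set p := nth _ _ _.
  have pp : p \in mpairs by exact: mem_nth.
  apply: (@measurable_comp _ _ _ _ _ _ (setT `*` adm') (fun r : Z * Baire => H (Es (Kq q) p.1 p.2 (slice (Tp p) r.1) (ucode M a0 r.2))) DD
     (fun r : (Om * Baire) * measurableTypeR R => (((r.1.1, r.2) : Z), r.1.2))).
  - exact: measurableX.
  - by move=> _ [r [[_ h] _] <-].
  - exact: (mE q pp).2.
  - apply: measurable_funTS; apply/measurable_fun_pairP; split.
      apply/measurable_fun_pairP; split; last exact: measurable_snd.
      exact: (measurableT_comp measurable_fst measurable_fst).
    exact: (measurableT_comp measurable_snd measurable_fst).
move=> r [_ r0]; rewrite /F.
set A := [set x | _].
have AE : A = \bigcup_q (Kq q `&` A).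
  rewrite -setI_bigcupl K_cup setIidr// => x; rewrite /A /=; case: (pselect (D x)) => // nD.
  by rewrite memNset// lte_fin => /lt_trans/(_ r0); rewrite ltxx.
have mKA q : measurable (Kq q `&` A : set mH).
  rewrite (Esurf_level (hw r.1.2) (@KD q) r0); last by move=> *; exact: gsym.
  apply: fin_bigcup_measurable => [|p pp]; first exact: finite_seq.
  exact: ((mE q pp).1 _ (r.1.1, r.2) (hw r.1.2)).
rewrite [X in _ --> H X]AE; under eq_fun do rewrite -F_level//.
apply: (@nondecreasing_cvg_mu _ _ _ (@muH R n) (fun q => Kq q `&` A)) => //.
- exact: bigcupT_measurable.
- by move=> i j ij; apply/subsetPset; apply: setSI; exact: K_mono.
Qed.

(** By Tonelli in the level the energy is jointly measurable in omega and the code; each strict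
    sublevel set of the infimum is the projection of a measurable set. *)
Theorem measurable_cell : measurable_fun setT (fun w => cell M (g w) ub D).
Proof.
have mF' : measurable_fun setT (F \_ DD) by apply/measurable_restrict; [exact: mDD|exact: measurableT|rewrite setTI; exact: mF].
have F0 q : (0 <= (F \_ DD) q)%E by rewrite patchE; case: ifP => // _; exact: outer_measure_ge0.
have mI := @measurable_fun_fubini_tonelli_F _ _ _ _ _ (@lebesgue_measure R) _ mF' F0.
have IE w y : adm' y -> fubini_F (@lebesgue_measure R) (F \_ DD) (w, y) = Esurf (g w) (ucode M a0 y) D.
  move=> ay; rewrite /fubini_F /Esurf /ointeg [RHS]integral_mkcond; apply: eq_integral => s _.
  rewrite !patchE /F; congr (if _ then _ else _).
  by apply/idP/idP => /set_mem h; apply/mem_set; [case: h|split].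
apply: (measurability _ (ErealGenInftyO.measurableE R)).
move=> _ [_ [c ->] <-]; rewrite setTI.
rewrite (_ : _ @^-1` _ = [set w | exists y, ((setT `*` adm') `&` [set q | (fubini_F (@lebesgue_measure R) (F \_ DD) q < c%:E)%E]) (w, y)]).
  apply: (measurable_projection Pc); apply: measurableI; first exact: measurableX.
  by have := emeasurable_fun_infty_o measurableT mI c%:E; rewrite setTI.
apply/seteqP; split => w; rewrite /preimage /= in_itv /=.
  by move=> /(cell_code a0M ub nu1 t0 l0)[y [ay h]]; exists y; split => //; rewrite IE.
by move=> [y [[_ ay] h]]; apply/(cell_code a0M ub nu1 t0 l0); exists y; split => //; rewrite -IE.
Qed.
End CellMeasurable.

(** * The ergodic argument *)

Section LowerLimit.
Variable R : realType.
Implicit Types (u v : nat -> R) (C : R).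

Definition freq u : set R := [set x | forall N, exists2 n, (N <= n)%N & u n < x].
(** The lower limit as a real number: the infimum of the thresholds below which u falls infinitely
    often. *)
Definition lowlim u : R := inf (freq u).

Lemma freq_inf u C : (forall n, 0 <= u n <= C) -> has_inf (freq u).
Proof.
move=> h; split; last by exists 0 => x /(_ 0%N)[n _]; have /andP[h0 _] := h n; move/(le_lt_trans h0)/ltW.
by exists (C + 1) => N; exists N => //; have /andP[_ h1] := h N; rewrite (le_lt_trans h1)// ltrDl.
Qed.

Lemma lowlim_freq u C e : (forall n, 0 <= u n <= C) -> 0 < e -> forall N, exists2 n, (N <= n)%N & u n < lowlim u + e.
Proof.
move=> h e0 N; have [x xS xl] := inf_adherent e0 (freq_inf h).
by have [n Nn un] := xS N; exists n => //; exact: lt_trans xl.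
Qed.

Lemma lowlim_ev u C e : (forall n, 0 <= u n <= C) -> 0 < e -> exists N, forall n, (N <= n)%N -> lowlim u - e <= u n.
Proof.
move=> h e0; apply: contrapT => /forallNP hn.
have : freq u (lowlim u - e).
  by move=> N; have /existsNP[n /not_implyP[Nn /negP]] := hn N; rewrite -ltNge; exists n.
move=> /(ge_inf (freq_inf h).2); rewrite -/(lowlim u); lra.
Qed.

Lemma lowlim_ge u C x : (forall n, 0 <= u n <= C) -> (forall e, 0 < e -> exists N, forall n, (N <= n)%N -> x - e <= u n) -> x <= lowlim u.
Proof.
move=> h hx; rewrite leNgt; apply/negP => lx.
pose e := (x - lowlim u) / 2; have e0 : 0 < e by rewrite divr_gt0// subr_gt0.
have [N hN] := hx e e0; have [n Nn un] := lowlim_freq h e0 N.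
by have := hN n Nn; move: un; rewrite /e; lra.
Qed.

Lemma lowlim_le u C x : (forall n, 0 <= u n <= C) -> (forall e, 0 < e -> forall N, exists2 n, (N <= n)%N & u n <= x + e) -> lowlim u <= x.
Proof.
move=> h hx; apply/ler_addgt0Pr => e e0.
have e2 : 0 < e / 2 by rewrite divr_gt0.
apply: ge_inf; first exact: (freq_inf h).2.
by move=> N; have [n Nn un] := hx _ e2 N; exists n => //; apply: (le_lt_trans un); lra.
Qed.

Lemma lowlim_ge0 u C : (forall n, 0 <= u n <= C) -> 0 <= lowlim u.
Proof. by move=> h; apply: (lowlim_ge h) => e e0; exists 0%N => n _; have /andP[h0 _] := h n; lra. Qed.

Lemma lowlim_shift u v C C' s : (forall n, 0 <= u n <= C) -> (forall n, 0 <= v n <= C') ->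
  (forall e, 0 < e -> exists N, forall n, (N <= n)%N -> u (n + s)%N <= v n + e) -> lowlim u <= lowlim v.
Proof.
move=> hu hv h; apply: (lowlim_le hu) => e e0 N; have e2 : 0 < e / 2 by rewrite divr_gt0.
have [N' hN'] := h _ e2; have [n Nn un] := lowlim_freq hv e2 (maxn N N').
have [Nn1 Nn2] : (N <= n)%N /\ (N' <= n)%N by move: Nn; rewrite geq_max => /andP[].
exists (n + s)%N; first exact: leq_trans (leq_addr _ _).
by apply: (le_trans (hN' n Nn2)); move: un; lra.
Qed.

Lemma measurable_lowlim d (T : measurableType d) (u : T -> nat -> R) C : (forall w n, 0 <= u w n <= C) ->
  (forall n, measurable_fun setT (fun w => u w n)) -> measurable_fun setT (fun w => lowlim (u w)).
Proof.
move=> h mu; apply: (measurability _ (RGenInftyO.measurableE R)).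
move=> _ [_ [s ->] <-]; rewrite setTI.
pose r_ (k : nat) : R := if (choice.unpickle k : option rat) is Some q then ratr q else 0.
rewrite (_ : _ @^-1` _ = \bigcup_k (if r_ k < s then \bigcap_N \bigcup_n [set w | (N <= n)%N /\ u w n < r_ k] else set0)).
  apply: bigcupT_measurable => k; case: ifP => _ //; apply: bigcapT_measurable => N; apply: bigcupT_measurable => n.
  have [Nn|Nn] := leqP N n; last by rewrite (_ : [set w | _] = set0)//; apply/seteqP; split => w // [].
  rewrite (_ : [set w | _] = (fun w => u w n) @^-1` `]-oo, r_ k[%classic).
    by rewrite -[X in measurable X]setTI; apply: mu => //; exact: measurable_itv.
  by apply/seteqP; split => w /=; rewrite in_itv /=; [move=> []|].
apply/seteqP; split => w; rewrite /preimage /= in_itv /=.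
  move=> hl; have [q] := rat_in_itvoo hl; rewrite in_itv /= => /andP[h1 h2].
  exists (choice.pickle q) => //; rewrite /r_ choice.pickleK h2 => N _.
  have e0 : 0 < ratr q - lowlim (u w) by rewrite subr_gt0.
  have [n Nn un] := lowlim_freq (h w) e0 N; exists n => //; split => //; move: un; lra.
move=> [k _]; case: ifP => // rs hk; apply: le_lt_trans rs; apply: ge_inf; first exact: (freq_inf (h w)).2.
by move=> N; have [n _ [Nn un]] := hk N I; exists n.
Qed.
End LowerLimit.

(** * Normalised cell energies as real numbers *)

Section RealCell.
Variables (R : realType) (n m : nat).
Local Notation V := 'rV[R]_n.+2.
Local Notation W := 'rV[R]_m.
Variables (M : seq W) (c : R) (a b : W).
Hypotheses (c0 : 0 <= c) (aM : a \in M) (bM : b \in M).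

Definition C0 : R := c * CH R n.
Lemma C0_ge0 : 0 <= C0. Proof. by rewrite mulr_ge0// CH_ge0. Qed.

Definition Xr (g : V -> W -> V -> R) nu (t l : R) : R := fine (Fc M a b g nu t l).
Definition Xn (g : V -> W -> V -> R) nu (t l : R) : R := Xr g nu t l / t ^+ n.+1.

Lemma XrE g nu (t l : R) : gle c g -> sphere nu -> 0 < t -> 0 < l -> Fc M a b g nu t l = (Xr g nu t l)%:E.
Proof.
move=> gc n1 t0 l0; rewrite /Xr fineK// ge0_fin_numE; last exact: cell_ge0.
by apply: le_lt_trans (Fc_bound c0 aM bM gc n1 t0 l0) _; exact: ltry.
Qed.

Lemma le_of_EFin (x y : R) (X Y : \bar R) : X = x%:E -> Y = y%:E -> (X <= Y)%E -> x <= y.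
Proof. by move=> -> ->; rewrite lee_fin. Qed.

Lemma le_of_EFinD (x y e : R) (X Y : \bar R) : X = x%:E -> Y = y%:E -> (X <= Y + e%:E)%E -> x <= y + e.
Proof. by move=> -> ->; rewrite -EFinD lee_fin. Qed.

Lemma Xr_ge0 g nu (t l : R) : 0 <= Xr g nu t l.
Proof. by rewrite fine_ge0//; exact: cell_ge0. Qed.

Lemma Xn_ge0 g nu (t l : R) : 0 < t -> 0 <= Xn g nu t l.
Proof. by move=> t0; rewrite divr_ge0 ?Xr_ge0// exprn_ge0// ltW. Qed.

Lemma Xr_bound g nu (t l : R) : gle c g -> sphere nu -> 0 < t -> 0 < l -> Xr g nu t l <= C0 * t ^+ n.+1.
Proof. by move=> gc n1 t0 l0; exact: (le_of_EFin (XrE gc n1 t0 l0) erefl (Fc_bound c0 aM bM gc n1 t0 l0)). Qed.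

Lemma Xn_bound g nu (t l : R) : gle c g -> sphere nu -> 0 < t -> 0 < l -> 0 <= Xn g nu t l <= C0.
Proof. by move=> gc n1 t0 l0; rewrite Xn_ge0//= ler_pdivrMr ?exprn_gt0//; exact: Xr_bound. Qed.

Lemma Xn_height g nu (t l l' : R) : gle c g -> sphere nu -> 0 < t -> 0 < l -> l <= l' -> Xn g nu t l' <= Xn g nu t l.
Proof.
move=> gc n1 t0 l0 ll; have l0' : 0 < l' by exact: lt_le_trans ll.
apply: ler_wpM2r; first by rewrite invr_ge0 exprn_ge0// ltW.
exact: (le_of_EFin (XrE gc n1 t0 l0') (XrE gc n1 t0 l0) (Fc_height c0 aM bM gc n1 t0 l0 ll)).
Qed.

Lemma Xn_step (x y e t t' : R) : 0 < t -> t <= t' -> 0 <= y -> x <= y + C0 * n.+1%:R * t' ^+ n * e ->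
  x / t' ^+ n.+1 <= y / t ^+ n.+1 + C0 * n.+1%:R * e / t'.
Proof.
move=> t0 tt y0 h; have t0' : 0 < t' by exact: lt_le_trans tt.
have tn : 0 < t' ^+ n by rewrite exprn_gt0.
apply: (@le_trans _ _ (y / t' ^+ n.+1 + C0 * n.+1%:R * e / t')).
  rewrite ler_pdivrMr ?exprn_gt0//; apply: (le_trans h); rewrite mulrDl divfK ?gt_eqF ?exprn_gt0//.
  rewrite lerD2l exprS; move: (C0 * _) => K; move: (t' ^+ n) tn => u u0.
  by rewrite le_eqVlt; apply/orP; left; apply/eqP; field; rewrite gt_eqF.
rewrite lerD2r; apply: ler_wpM2l => //; rewrite lef_pV2 ?posrE ?exprn_gt0//.
by apply: lerXn2r => //; rewrite nnegrE; exact: ltW.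
Qed.

Lemma Xn_width g nu (t t' l : R) : gle c g -> sphere nu -> 0 < t -> t <= t' -> 0 < l ->
  Xn g nu t' l <= Xn g nu t l + C0 * n.+1%:R * (t' - t) / t'.
Proof.
move=> gc n1 t0 tt l0; have t0' : 0 < t' by exact: lt_le_trans tt.
apply: (Xn_step t0 tt (Xr_ge0 _ _ _ _)).
exact: (le_of_EFinD (XrE gc n1 t0' l0) (XrE gc n1 t0 l0) (Fc_width c0 aM bM gc n1 t0 tt l0)).
Qed.

(** Near monotonicity: the cost is the relative increase of the size, so sizes may be rounded up to
    integers or to multiples of a brick. *)
Lemma Xn_diag g nu (t t' : R) : gle c g -> sphere nu -> 0 < t -> t <= t' ->
  Xn g nu t' t' <= Xn g nu t t + C0 * n.+1%:R * (t' - t) / t'.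
Proof.
move=> gc n1 t0 tt; have t0' : 0 < t' by exact: lt_le_trans tt.
exact: le_trans (Xn_height gc n1 t0' t0 tt) (Xn_width gc n1 t0 tt t0).
Qed.

Lemma Xn_compare g nu nu' z (t l t' l' dl K : R) : gle c g -> sphere nu -> sphere nu' -> 0 < t -> 0 < l -> 0 <= dl ->
  2 * dl < t -> 2 * dl < l -> t + 2 * dl < t' -> l + 2 * dl < l' ->
  (forall x, rect nu' t' l' x -> enorm x <= K) -> (forall x, crect nu t l (x - z) -> enorm x <= K) ->
  (forall x j, enorm x <= K -> `|dotv x (fr nu' j) - dotv (x - z) (fr nu j)| <= dl) ->
  Xn g nu' t' l' <= Xn (fun y => g (y + z)) nu t l + C0 * n.+1%:R * (t' - t + 6 * dl) / t'.
Proof.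
move=> gc n1 n1' t0 l0 d0 h1 h2 h3 h4 h5 h6 h7.
have tt : t <= t' by apply: ltW; apply: le_lt_trans h3; rewrite lerDl mulr_ge0.
have ll : l <= l' by apply: ltW; apply: le_lt_trans h4; rewrite lerDl mulr_ge0.
have gc' : gle c (fun y => g (y + z)) by move=> x; exact: gc.
apply: (Xn_step t0 tt (Xr_ge0 _ _ _ _)).
apply: (le_of_EFinD (XrE gc n1' (lt_le_trans t0 tt) (lt_le_trans l0 ll)) (XrE gc' n1 t0 l0)); exact: (Fc_compare c0 aM bM gc n1 n1' t0 l0 d0 h1 h2 h3 h4 h5 h6 h7).
Qed.

Lemma Xn_shift g nu z (t t' s : R) : gle c g -> sphere nu -> enorm z <= s -> 2 * s < t -> t + 2 * s < t' ->
  Xn g nu t' t' <= Xn (fun y => g (y + z)) nu t t + C0 * n.+1%:R * (t' - t + 6 * s) / t'.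
Proof.
move=> gc n1 zs h1 h2; have s0 : 0 <= s by apply: le_trans zs; exact: enorm_ge0.
have t0 : 0 < t by apply: le_lt_trans h1; rewrite mulr_ge0.
have t0' : 0 < t' by apply: le_lt_trans h2; rewrite addr_ge0 ?(ltW t0)// mulr_ge0.
have N0 : 0 <= n.+2%:R :> R by [].
apply: (@Xn_compare g nu nu z t t t' t' s (n.+2%:R * (t' + t') + n.+2%:R * (t + t) + enorm z)) => //.
- move=> x /(rect_crect n1) h; apply: (le_trans (crect_bounded (ltW t0') (ltW t0') h)).
  rewrite -addrA lerDl; apply: addr_ge0; last exact: enorm_ge0.
  by apply: mulr_ge0 => //; apply: addr_ge0; exact: ltW.
- move=> x h; rewrite -[x](subrK z); apply: (le_trans (enormD _ _)); rewrite lerD2r.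
  apply: (le_trans (crect_bounded (ltW t0) (ltW t0) h)); rewrite lerDr.
  by apply: mulr_ge0 => //; apply: addr_ge0; exact: ltW.
- move=> x j _; rewrite -dotvBl opprB addrC subrK; apply: (le_trans (dotv_CS _ _)).
  by rewrite fr_unit mulr1.
Qed.

Lemma Xr_bricks g nu (h L : R) (J : nat) (A : {set grid n.+1 J}) (r : grid n.+1 J -> nat) :
  gle c g -> sphere nu -> 0 < h -> 0 < L ->
  (forall i, i \in A -> inside i (r i)) ->
  (forall i j z, i \in A -> j \in A -> z \in cube i (r i) -> z \in cube j (r j) -> i = j) ->
  (forall z, exists2 i, i \in A & z \in cube i (r i)) ->
  (forall i, i \in A -> h * (2 * r i + 1)%N%:R <= L) ->
  Xr g nu (h * (2 * J + 1)%N%:R) L <=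
    \sum_(i in A) Xr (fun y => g (y + gpos nu h J (fun l => i l))%R) nu (h * (2 * r i + 1)%N%:R) (h * (2 * r i + 1)%N%:R).
Proof.
move=> gc n1 h0 L0 h1 h2 h3 h4.
have p0 q : 0 < h * (2 * q + 1)%N%:R by rewrite mulr_gt0// ltr0n addn1.
apply: (le_of_EFin (XrE gc n1 (p0 J) L0) _ (Fc_bricks c0 aM bM gc n1 h0 h1 h2 h3 h4)); rewrite -sumEFin.
apply: eq_bigr => i _; have gc' : gle c (fun y => g (y + gpos nu h J (fun l => i l))%R) by move=> x; exact: gc.
exact: (XrE gc' n1 (p0 _) (p0 _)).
Qed.
End RealCell.

Section CubeFamilies.
Variables (R : realType) (k J : nat) (S : {set grid k J}) (r : grid k J -> nat).
Hypothesis disj : forall i j z, i \in S -> j \in S -> z \in cube i (r i) -> z \in cube j (r j) -> i = j.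

Definition covered (z : grid k J) := [exists i in S, z \in cube i (r i)].

Lemma covered_sum z : \sum_(i in S) (z \in cube i (r i))%:R = (covered z)%:R :> R.
Proof.
have [/exists_inP[i iS zi]|h] := boolP (covered z).
  rewrite (bigD1 i)//= zi big1 ?addr0// => j /andP[jS ji].
  by case: (boolP (z \in cube j (r j))) => // zj; rewrite (disj iS jS zi zj) eqxx in ji.
rewrite big1// => i iS; case: (boolP (z \in cube i (r i))) => // zi.
by case/negP: h; apply/exists_inP; exists i.
Qed.

Lemma sum_cubes (F : grid k J -> R) : \sum_(i in S) \sum_(z in cube i (r i)) F z = \sum_(z | covered z) F z.
Proof.
transitivity (\sum_z \sum_(i in S) (z \in cube i (r i))%:R * F z).
  rewrite exchange_big; apply: eq_bigr => i _; rewrite big_mkcond; apply: eq_bigr => z _.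
  by case: ifP; rewrite ?mul1r ?mul0r.
rewrite [RHS]big_mkcond; apply: eq_bigr => z _; rewrite -mulr_suml covered_sum.
by case: (covered z); rewrite ?mul1r ?mul0r.
Qed.

Lemma card_covered : (forall i, i \in S -> inside i (r i)) ->
  \sum_(i in S) ((2 * r i + 1) ^ k)%:R = \sum_(z | covered z) 1 :> R.
Proof.
move=> ins; rewrite -sum_cubes; apply: eq_bigr => i iS; rewrite -(card_cubeE (ins i iS)).
by rewrite sumr_const.
Qed.
End CubeFamilies.

(** The cube of radius J - r about the centre consists of such points, and its side is at least half
    that of the grid. *)
Lemma inside_card k J r : (2 * r <= J)%N -> ((2 * J + 1) ^ k <= 2 ^ k * #|[set i : grid k J | inside i r]%SET|)%N.
Proof.
move=> rJ; pose i0 : grid k J := [ffun=> inord J].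
have i0E l : nat_of_ord (i0 l) = J by rewrite ffunE inordK// ltnS leq_pmull.
have ins : inside i0 (J - r) by apply/insideP => l; rewrite i0E; lia.
apply: (@leq_trans (2 ^ k * #|cube i0 (J - r)|)); last first.
  rewrite leq_mul2l; apply/orP; right; apply: subset_leq_card; apply/fintype.subsetP => z /cubeP hz.
  by rewrite inE; apply/insideP => l; have := hz l; rewrite i0E; lia.
by rewrite card_cubeE// -expnMn; apply: leq_exp_base; lia.
Qed.

Lemma side_nat_le h J : (h * (2 * J + 1) <= J.+1 * (2 * h))%N.
Proof. nia. Qed.

Lemma side_nat_ge h J : (J.+2 * (2 * h) <= 3 * h + h * (2 * J + 1))%N.
Proof. nia. Qed.

Lemma multiple_le q h s : (s < 2 * h)%N -> (q * (2 * h) + s <= h * (2 * q.+1 + 1))%N.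
Proof. nia. Qed.

Lemma multiple_ge q h s : (h * (2 * q.+1 + 1) <= 3 * h + (q * (2 * h) + s))%N.
Proof. nia. Qed.

(** * Convergence in a fixed direction *)

Section ErgodicCells.
Variables (R : realType) (n m : nat).
Local Notation V := 'rV[R]_n.+2.
Local Notation W := 'rV[R]_m.
Local Notation k := n.+1.
Variables (M : seq W) (c : R) (a b : W).
Hypotheses (c0 : 0 <= c) (aM : a \in M) (bM : b \in M).
Variables (dO : measure_display) (Om : measurableType dO) (P : probability Om R).
Hypothesis Pc : complete_prob P.
Variables (g : Om -> V -> W -> V -> R) (tau : V -> Om -> Om).
Hypotheses (ga : admissible_rst g) (htau : mp_action P tau) (hstat : stationary g tau).
Hypothesis gc : forall w, gle c (g w).
Variable nu : V.
Hypothesis nu1 : sphere nu.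

Let mtau z : measurable_fun setT (tau z). Proof. by case: htau. Qed.
Let tauD z1 z2 w : tau (z1 + z2) w = tau z2 (tau z1 w).
Proof. by case: htau => _ _ _ /(_ z1 z2) ->. Qed.
Let tau0 w : tau 0 w = w. Proof. by case: htau => _ _ -> _. Qed.

Lemma mp_preimage z A : measurable A -> P (tau z @^-1` A) = P A.
Proof.
move=> mA; have [_ h _ _] := htau; rewrite -(h (- z) A mA); congr (P _); apply/seteqP; split => w.
  by move=> /= Aw; exists (tau z w) => //; rewrite -tauD subrr tau0.
by move=> [w' Aw' <-] /=; rewrite -tauD addNr tau0.
Qed.

Lemma gtau z w : (fun y => g w (y + z)) = g (tau z w).
Proof. by apply/funext => x; apply/funext => ze; apply/funext => v; rewrite hstat. Qed.

Lemma measurable_ltset (f1 f2 : Om -> R) : measurable_fun setT f1 -> measurable_fun setT f2 -> measurable [set w | f1 w < f2 w].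
Proof. by move=> m1 m2; have := measurable_fun_ltr m1 m2 measurableT (Y := [set true]) I; rewrite setTI. Qed.

Section Lattice.
Variable h : R.
Hypothesis h0 : 0 < h.
Definition gact J (i : grid k J) w := tau (gpos nu h J (fun l => i l)) w.

(** The brick z of a small grid, seen from centre i of the large one; the truncated subtraction and
    [inord] are exact when the cube lies inside. *)
Definition gshift J (i : grid k J) r (z : grid k r) : grid k J := [ffun l => inord (i l + z l - r)].

Lemma gshiftE J (i : grid k J) r (z : grid k r) l : inside i r -> nat_of_ord (gshift i z l) = (i l + z l - r)%N.
Proof. by move=> /insideP/(_ l)[h1 h2]; rewrite ffunE inordK//; have := ltn_ord (z l); lia. Qed.

Lemma gact_shift J (i : grid k J) r (z : grid k r) w : inside i r -> gact (gshift i z) w = gact z (gact i w).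
Proof.
move=> ins; rewrite /gact -tauD; congr (tau _ w); rewrite /gpos -big_split /=; apply: eq_bigr => l _.
rewrite -scalerDl gshiftE//; congr (_ *: _); rewrite -mulrDr; congr (_ * _).
have /insideP/(_ l)[h1 h2] := ins; rewrite natrB ?natrD; last lia.
by ring.
Qed.

Definition cnt (B : set Om) r w : R := \sum_(z : grid k r) \1_B (gact z w).

Lemma cnt_le B J (i : grid k J) r w : inside i r -> cnt B r (gact i w) <= \sum_(z in cube i r) \1_B (gact z w).
Proof.
move=> ins.
have inj : {in [set: grid k r]%SET &, injective (@gshift J i r)}.
  move=> z z' _ _ e; apply/ffunP => l; apply: ord_inj.
  have e1 := gshiftE z l ins; have e2 := gshiftE z' l ins; have /insideP/(_ l)[h1 h2] := ins.
  by rewrite e e2 in e1; move: e1 h1; set x := nat_of_ord (z l); set y := nat_of_ord (z' l); set u := nat_of_ord (i l); lia.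
have -> : cnt B r (gact i w) = \sum_(z in [set: grid k r]%SET) \1_B (gact (gshift i z) w).
  by apply: eq_big => z; rewrite ?inE// gact_shift.
rewrite -(@big_imset _ _ _ _ _ _ _ (fun z => \1_B (gact z w)) inj) [leLHS]big_mkcond [leRHS]big_mkcond /=.
apply: ler_sum => z _; case: ifPn => [/imsetP[z' _ ->]|_]; last by case: ifP => // _; rewrite indicE ler0n.
suff -> : gshift i z' \in cube i r by [].
apply/cubeP => l; rewrite gshiftE//; have := ltn_ord (z' l); have /insideP/(_ l)[h1 h2] := ins; lia.
Qed.

Lemma measurable_gact J (i : grid k J) B : measurable B -> measurable (@gact J i @^-1` B).
Proof. by move=> mB; rewrite -[X in measurable X]setTI; exact: mtau. Qed.

Lemma measurable_cnt B r : measurable B -> measurable_fun setT (cnt B r).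
Proof.
move=> mB; apply: measurable_sum => z; rewrite (_ : (fun w => _) = \1_(@gact r z @^-1` B)); last by apply/funext => w; rewrite !indicE.
by apply: measurable_indic; exact: measurable_gact.
Qed.

Lemma integral_gact J (A : pred (grid k J)) B : measurable B ->
  (\int[P]_w (\sum_(i | A i) \1_B (gact i w))%:E = (#|A|%:R)%:E * P B)%E.
Proof.
move=> mB; under eq_integral do rewrite -sumEFin -big_filter.
rewrite ge0_integral_sum//; last first.
  move=> i; apply/measurable_EFinP; rewrite (_ : (fun w => _) = \1_(@gact J i @^-1` B)); last by apply/funext => w; rewrite !indicE.
  by apply: measurable_indic; exact: measurable_gact.
rewrite big_filter (eq_bigr (fun=> P B)); last first.
  move=> i _; rewrite -(mp_preimage (gpos nu h J (fun l => i l)) mB) -[X in _ = P X]setIT.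
  rewrite -(integral_indic P measurableT); last by rewrite -[X in measurable X]setTI; exact: mtau.
  by apply: eq_integral => w _; rewrite !indicE.
rewrite -(fineK (fin_num_measure P B mB)) sumEFin sumr_const -EFinM mulr_natl.
by [].
Qed.

Definition dense_at B (al : R) r : set Om := [set w | al * ((2 * r + 1) ^ k)%:R < cnt B r w].

Lemma measurable_dense_at B al r : measurable B -> measurable (dense_at B al r).
Proof. by move=> mB; apply: measurable_ltset; [exact: measurable_cst|exact: measurable_cnt]. Qed.

(* Maximal inequality: the disjoint cubes given by Vitali's lemma are all rich in points of [B]. *)
Lemma max_ineq B (al : R) R' : measurable B -> 0 < al ->
  (P (\bigcup_(r in [set r | (r <= R')%N]) dense_at B al r) <= (4 ^+ k / al)%:E * P B)%E.
Proof.
move=> mB al0; set E := \bigcup_(r in _) _.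
have mE : measurable E by apply: bigcup_measurable => r _; exact: measurable_dense_at.
pose J := (2 * R')%N; pose N : R := ((2 * J + 1) ^ k)%:R; pose I0 : R := #|[set i : grid k J | inside i R']%SET|%:R.
have N0 : 0 < N by rewrite ltr0n expn_gt0 addn1.
have NI : N <= 2 ^+ k * I0 by rewrite -natrX -natrM ler_nat inside_card.
(* The inequality holds along each orbit; integrating it and using invariance of P transfers it to
   probabilities. The constant 4^k is 2^k from Vitali times 2^k from the bricks too close to the
   border. *)
have key w : \sum_(i : grid k J | inside i R') \1_E (gact i w) <= 2 ^+ k / al * \sum_(z : grid k J) \1_B (gact z w).
  pose G := [set i : grid k J | inside i R' && (gact i w \in E)]%SET.
  have exr (i : grid k J) : exists r, i \in G -> [/\ (r <= R')%N & dense_at B al r (gact i w)].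
    case: (boolP (i \in G)) => [|_]; last by exists 0%N.
    by rewrite inE => /andP[_ /set_mem[r rR hr]]; exists r.
  have [r hr] := choice exr.
  have ins i : i \in G -> inside i (r i).
    move=> iG; have [rR _] := hr i iG; move: iG; rewrite inE => /andP[/insideP h1 _].
    by apply/insideP => l; have := h1 l; lia.
  have [S [SG disj cG]] := vitali_cubes ins.
  apply: (@le_trans _ _ (\sum_(i in G) 1)).
    rewrite [leLHS]big_mkcond [leRHS]big_mkcond; apply: ler_sum => i _ /=.
    by rewrite inE indicE; case: (inside i R') => //=; case: (_ \in E).
  rewrite sumr_const.
  apply: (@le_trans _ _ (2 ^+ k * \sum_(i in S) ((2 * r i + 1) ^ k)%:R)).
    by rewrite -natrX -natr_sum -natrM ler_nat.
  rewrite -mulrA ler_wpM2l ?exprn_ge0//.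
  rewrite [leRHS]mulrC ler_pdivlMr// mulr_suml.
  apply: (@le_trans _ _ (\sum_(i in S) \sum_(z in cube i (r i)) \1_B (gact z w))).
    apply: ler_sum => i iS; have iG := fintype.subsetP SG i iS; have [_ hd] := hr i iG.
    by apply: le_trans (cnt_le B w (ins i iG)); rewrite [leLHS]mulrC; exact: ltW.
  rewrite (sum_cubes disj) [leRHS](bigID (covered S r)) /= lerDl.
  by apply: sumr_ge0 => z _; rewrite indicE ler0n.
have mS (A : pred (grid k J)) D : measurable D -> measurable_fun setT (fun w => \sum_(i | A i) \1_D (gact i w) : R).
  move=> mD; rewrite (_ : (fun w => _) = (fun w => \sum_(i <- [seq i <- index_enum _ | A i]) \1_D (gact i w))); last first.
    by apply/funext => w; rewrite big_filter.
  apply: measurable_sum => i; rewrite (_ : (fun w => _) = \1_(@gact J i @^-1` D)); last by apply/funext => w; rewrite !indicE.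
  by apply: measurable_indic; exact: measurable_gact.
have h1 : (\int[P]_w (\sum_(i : grid k J | inside i R') \1_E (gact i w))%:E <=
  \int[P]_w (2 ^+ k / al * \sum_(z : grid k J) \1_B (gact z w))%:E)%E.
  apply: ge0_le_integral.
  - exact: measurableT.
  - by move=> w _; rewrite lee_fin sumr_ge0// => i _; rewrite indicE ler0n.
  - by apply/measurable_EFinP; exact: mS.
  - by apply/measurable_EFinP; apply: measurable_funM; [exact: measurable_cst|exact: mS].
  - by move=> w _; rewrite lee_fin; exact: key.
rewrite integral_gact// in h1.
have fE := fin_num_measure P E mE; have fB := fin_num_measure P B mB.
have h2 : (\int[P]_w (2 ^+ k / al * \sum_(z : grid k J) \1_B (gact z w))%:E = (2 ^+ k / al)%:E * (N%:E * P B))%E.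
  under eq_integral do rewrite EFinM.
  rewrite ge0_integralZl_EFin//; first 1 last.
  - by move=> w _; rewrite lee_fin sumr_ge0// => i _; rewrite indicE ler0n.
  - by apply/measurable_EFinP; exact: mS.
  - by rewrite divr_ge0 ?exprn_ge0// ltW.
  by rewrite integral_gact//= /N card_ffun !card_ord addn1.
move: h1; rewrite h2 -(fineK fE) -(fineK fB) -!EFinM !lee_fin.
have -> : #|[pred i : grid k J | inside i R']|%:R = I0 by congr (_%:R); apply: eq_card => i; rewrite inE.
have fB0 : 0 <= fine (P B) by rewrite fine_ge0.
have fE0 : 0 <= fine (P E) by rewrite fine_ge0.
move: fE0 fB0; set x := fine (P E); set y := fine (P B) => x0 y0 h1.
have h3 : N * x <= N * (4 ^+ k / al * y).
  apply: (@le_trans _ _ (2 ^+ k * (I0 * x))); first by rewrite mulrA ler_wpM2r.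
  apply: (@le_trans _ _ (2 ^+ k * (2 ^+ k / al * (N * y)))); first by rewrite ler_wpM2l// exprn_ge0.
  have -> : 4 ^+ k = 2 ^+ k * 2 ^+ k :> R by rewrite -exprMn -natrM.
  by rewrite le_eqVlt; apply/orP; left; apply/eqP; ring.
by rewrite ler_pM2l in h3.
Qed.
End Lattice.

Local Notation C := (C0 n c).
Local Notation X w t l := (Xn M a b (g w) nu t l).

Let Xb w t l : 0 < t -> 0 < l -> 0 <= X w t l <= C.
Proof. by move=> t0 l0; exact: (Xn_bound c0 aM bM (gc w) nu1 t0 l0). Qed.

Definition ulow w N := X w N.+1%:R N.+1%:R.
Definition fs w := lowlim (ulow w).
(** The upper limit, written through [lowlim] so that the same lemmas serve both limits. *)
Definition fS w := C - lowlim (fun N => C - ulow w N).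

Let ub w N : 0 <= ulow w N <= C. Proof. by apply: Xb. Qed.
Let ub' w N : 0 <= C - ulow w N <= C. Proof. by have := ub w N; lra. Qed.
Let C_ge0 : 0 <= C. Proof. exact: C0_ge0. Qed.

Lemma err_small (K e : R) : 0 < e -> exists N0 : nat, forall t, N0%:R <= t -> K / t <= e.
Proof.
move=> e0; exists (Num.truncn (`|K| / e)).+1 => t ht.
have t0 : 0 < t by apply: lt_le_trans ht.
rewrite ler_pdivrMr//; apply: (le_trans (ler_norm _)); rewrite mulrC -ler_pdivrMr//; apply: le_trans ht.
by apply: ltW; have /andP[] := truncn_itv (divr_ge0 (normr_ge0 K) (ltW e0)).
Qed.

(** The translated rectangle fits in one whose size is larger by a fixed s, and the relative cost of
    this enlargement tends to 0. *)
Lemma ulow_shift z w : exists s : nat, forall e, 0 < e -> exists N0, forall N, (N0 <= N)%N ->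
  ulow w (N + s)%N <= ulow (tau z w) N + e.
Proof.
pose q := (Num.truncn (enorm z)).+1.
have zq : enorm z <= q%:R by apply: ltW; have /andP[] := truncn_itv (enorm_ge0 z).
exists (2 * q + 1)%N => e e0; have [N1 hN1] := err_small (C * k%:R * ((2 * q + 1)%N%:R + 6 * q%:R)) e0.
exists (N1 + 2 * q)%N => N hN.
have h1 : 2 * q%:R < N.+1%:R :> R by rewrite -natrM ltr_nat; lia.
have h2 : N.+1%:R + 2 * q%:R < (N + (2 * q + 1)).+1%:R :> R by rewrite -natrM -natrD ltr_nat; lia.
have := Xn_shift c0 aM bM (gc w) nu1 zq h1 h2; rewrite gtau => h; apply: (le_trans h); rewrite lerD2l.
have -> : (N + (2 * q + 1)).+1%:R - N.+1%:R = (2 * q + 1)%N%:R :> R by rewrite -addSn natrD addrC addKr.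
by apply: hN1; rewrite ler_nat; lia.
Qed.

Lemma fs_inv z w : fs (tau z w) = fs w.
Proof.
have le z' w' : fs w' <= fs (tau z' w').
  by have [s hs] := ulow_shift z' w'; exact: (lowlim_shift (ub w') (ub (tau z' w')) hs).
apply: le_anti; apply/andP; split; last exact: (le z w).
by have h := le (- z) (tau z w); rewrite -tauD subrr tau0 in h.
Qed.

Lemma fS_inv z w : fS (tau z w) = fS w.
Proof.
have le z' w' : fS w' <= fS (tau z' w').
  rewrite /fS lerD2l lerN2; have [s hs] := ulow_shift z' w'.
  apply: (lowlim_ge (ub' w')) => e e0; have e2 : 0 < e / 2 by rewrite divr_gt0.
  have [N1 h1] := hs _ e2; have [N2 h2] := lowlim_ev (ub' (tau z' w')) e2.
  exists (N1 + N2 + s)%N => N hN; have sN : (s <= N)%N by apply: leq_trans hN; exact: leq_addl.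
  have i1 : (N1 <= N - s)%N by rewrite leq_subRL// addnC (leq_trans _ hN)// leq_add2r leq_addr.
  have i2 : (N2 <= N - s)%N by rewrite leq_subRL// addnC (leq_trans _ hN)// leq_add2r leq_addl.
  have := h1 _ i1; have := h2 _ i2; rewrite subnK//.
  by set x := lowlim _; set y := ulow _ _; set y' := ulow _ _; lra.
apply: le_anti; apply/andP; split; last exact: (le z w).
by have h := le (- z) (tau z w); rewrite -tauD subrr tau0 in h.
Qed.

Lemma fs_fS w : fs w <= fS w.
Proof.
apply/ler_addgt0Pr => e e0; have e2 : 0 < e / 2 by rewrite divr_gt0.
have [N1 h1] := lowlim_ev (ub w) e2; have [N2 h2] := lowlim_ev (ub' w) e2.
have := h1 (N1 + N2)%N (leq_addr _ _); have := h2 (N1 + N2)%N (leq_addl _ _); rewrite /fS /fs.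
by set x := lowlim _; set y := ulow _ _; set z := lowlim _; lra.
Qed.

Lemma fS_ev w e : 0 < e -> exists N0, forall N, (N0 <= N)%N -> ulow w N <= fS w + e.
Proof.
move=> e0; have [N1 h1] := lowlim_ev (ub' w) e0; exists N1 => N /h1.
by rewrite /fS; set x := lowlim _; set y := ulow _ _; lra.
Qed.

Lemma measurable_X t l : 0 < t -> 0 < l -> measurable_fun setT (fun w => X w t l).
Proof.
move=> t0 l0; apply: measurable_funM; last exact: measurable_cst.
apply: (measurableT_comp (f := fine)) => //.
have hm := measurable_cell aM Pc ga nu1 t0 l0 (Mfun_ujump nu aM bM).
exact hm.
Qed.

Lemma measurable_fs : measurable_fun setT fs.
Proof. by apply: (measurable_lowlim (C := C)) => [w N|N]; [exact: ub|exact: measurable_X]. Qed.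

Lemma measurable_fS : measurable_fun setT fS.
Proof.
apply: measurable_funB; first exact: measurable_cst.
apply: (measurable_lowlim (C := C)) => [w N|N]; first exact: ub'.
by apply: measurable_funB; [exact: measurable_cst|exact: measurable_X].
Qed.

Definition side (h : R) (r : nat) : R := h * (2 * r + 1)%N%:R.
Let side_gt0 h r : 0 < h -> 0 < side h r. Proof. by move=> h0; rewrite mulr_gt0// ltr0n addn1. Qed.

Definition bad1 h e : set Om := [set w | fS w + e < X w h h].
Definition bad2 h e r : set Om := [set w | fs w + e < X w (side h r) (side h r)].
(** A brick is bad if its own energy is well above [fS], or if no cube of radius at most R' about it
    has energy close to [fs]. *)
Definition Bad h R' e : set Om := bad1 h e `|` \bigcap_(r in [set r | (r <= R')%N]) bad2 h e r.

Lemma measurable_bad1 h e : 0 < h -> measurable (bad1 h e).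
Proof.
by move=> h0; apply: measurable_ltset; [apply: measurable_funD; [exact: measurable_fS|exact: measurable_cst]|exact: measurable_X].
Qed.

Lemma measurable_bad2 h e r : 0 < h -> measurable (bad2 h e r).
Proof.
move=> h0; apply: measurable_ltset; last by apply: measurable_X; exact: side_gt0.
by apply: measurable_funD; [exact: measurable_fs|exact: measurable_cst].
Qed.

Lemma measurable_bad2s h e R' : 0 < h -> measurable (\bigcap_(r in [set r | (r <= R')%N]) bad2 h e r).
Proof. by move=> h0; apply: bigcap_measurable => [|r _]; [exists 0%N|exact: measurable_bad2]. Qed.

Lemma measurable_Bad h R' e : 0 < h -> measurable (Bad h R' e).
Proof. by move=> h0; apply: measurableU; [exact: measurable_bad1|exact: measurable_bad2s]. Qed.

Lemma volume_bound (p N I0 G cB al v : R) : 0 < p -> N <= p * I0 -> I0 <= G + cB -> cB <= al * N -> 0 <= N ->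
  al <= p^-1 / 2 -> G <= p * v -> (p * p)^-1 / 2 * N <= v.
Proof.
move=> p0 h1 h2 h3 N0 h4 h5.
have h6 : al * N <= p^-1 / 2 * N by rewrite ler_wpM2r.
have h7 : p^-1 * N <= I0 by rewrite ler_pdivrMl.
have h8 : p^-1 * N / 2 <= p * v.
  have -> : p^-1 * N / 2 = p^-1 * N - p^-1 / 2 * N by field; rewrite gt_eqF.
  by move: h2 h3 h5 h6 h7; set x := p^-1 * N; set y := p^-1 / 2 * N; set z := p * v; set u := al * N; lra.
have -> : (p * p)^-1 / 2 * N = p^-1 * (p^-1 * N / 2) by rewrite invfM; ring.
by rewrite ler_pdivrMl.
Qed.

(** One factor 2^-k for the bricks far enough from the border, one for Vitali's lemma, and 1/2
    because at most half of the former are bad; see [volume_bound]. *)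
Definition theta : R := (2 ^+ k * 2 ^+ k)^-1 / 2.

(* Bricks of side [h] are grouped into disjoint cubes on which the energy is nearly minimal; the remaining ones have energy at most [fS] up to a small proportion. *)
Lemma cover h R' e (al : R) J w : 0 < h -> 0 <= e -> (2 * R' <= J)%N -> al <= (2 ^+ k)^-1 / 2 ->
  cnt h (Bad h R' e) J w <= al * ((2 * J + 1) ^ k)%:R ->
  X w (side h J) (side h R') <= fs w + (1 - theta) * (fS w - fs w) + e + C * al.
Proof.
move=> h0 ee0 RJ al1 hB; set B := Bad h R' e in hB; set N : R := ((2 * J + 1) ^ k)%:R in hB.
pose G := [set i : grid k J | inside i R' && (gact h i w \notin B)]%SET.
have exr (i : grid k J) : exists r, i \in G -> (r <= R')%N /\ X (gact h i w) (side h r) (side h r) <= fs w + e.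
  case: (boolP (i \in G)) => [|_]; last by exists 0%N.
  rewrite inE => /andP[_ /negP nB]; apply: contrapT => /forallNP hn; apply: nB; apply/mem_set; right => r /= rR.
  have /not_implyP[_ /not_andP[//|/negP]] := hn r; rewrite -ltNge /bad2 /= fs_inv; exact.
have [r hr] := choice exr.
have ins i : i \in G -> inside i (r i).
  move=> iG; have [rR _] := hr i iG; move: iG; rewrite inE => /andP[/insideP h1 _].
  by apply/insideP => l; have := h1 l; lia.
have [S [SG disj cG]] := vitali_cubes ins.
have iS_G i : i \in S -> i \in G by move=> iS; exact: (fintype.subsetP SG).
have cov_self i : i \in S -> covered S r i by move=> iS; apply/exists_inP; exists i => //; exact: cube_self.
(* The centres of the selected cubes together with the uncovered bricks, taken as cubes of radius 0,
   form a partition of the grid. *)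
pose A := [set i : grid k J | (i \in S) || ~~ covered S r i]%SET.
pose r' i := if i \in S then r i else 0%N.
have A_ncov i : i \in A -> i \notin S -> ~~ covered S r i by rewrite inE => /orP[->|].
have hA1 i : i \in A -> inside i (r' i).
  rewrite /r'; case: ifPn => [iS _|_ _]; first exact: ins (iS_G _ iS).
  by apply/insideP => l; split; [exact: leq0n|rewrite addn0 -ltnS; exact: ltn_ord].
have hA2 i j z : i \in A -> j \in A -> z \in cube i (r' i) -> z \in cube j (r' j) -> i = j.
  move=> iA jA; rewrite /r'; case: ifPn => iS; case: ifPn => jS.
  - exact: disj.
  - move=> zi /cube0 zj; case/negP: (A_ncov j jA jS); apply/exists_inP; exists i => //; by rewrite -zj.
  - move=> /cube0 zi zj; case/negP: (A_ncov i iA iS); apply/exists_inP; exists j => //; by rewrite -zi.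
  - by move=> /cube0 <- /cube0 <-.
have hA3 z : exists2 i, i \in A & z \in cube i (r' i).
  have [/exists_inP[i iS zi]|nc] := boolP (covered S r z).
    by exists i; [rewrite inE iS|rewrite /r' iS].
  by exists z; [rewrite inE nc orbT|exact: cube_self].
have hA4 i : i \in A -> side h (r' i) <= side h R'.
  move=> iA; rewrite /side ler_pM2l// ler_nat leq_add2r leq_mul2l /=; rewrite /r'; case: ifPn => // iS.
  by have [] := hr i (iS_G _ iS).
have := Xr_bricks c0 aM bM (gc w) nu1 h0 (side_gt0 R' h0) hA1 hA2 hA3 hA4.
rewrite -/(side h J) => hX.
have hk : 0 < h ^+ k by rewrite exprn_gt0.
have sk q : side h q ^+ k = h ^+ k * ((2 * q + 1) ^ k)%:R by rewrite exprMn natrX.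
have XrX w' q : Xr M a b (g w') nu (side h q) (side h q) = X w' (side h q) (side h q) * side h q ^+ k.
  by rewrite /Xn divfK// gt_eqF// exprn_gt0// side_gt0.
pose F (z : grid k J) : R := \1_B (gact h z w).
have F0 z : 0 <= F z by rewrite /F indicE ler0n.
(* A selected cube costs at most [fs] + e per brick. An uncovered brick costs at most [fS] + e, or
   at most C if it is bad. *)
have bound : Xr M a b (g w) nu (side h J) (side h R') <= h ^+ k *
  ((fs w + e) * \sum_(i in S) ((2 * r i + 1) ^ k)%:R + \sum_(z | ~~ covered S r z) (fS w + e + C * F z)).
  apply: (le_trans hX); rewrite (bigID (mem S)) /= mulrDr; apply: lerD.
    rewrite !mulr_sumr (eq_bigl (mem S)); last by move=> i /=; rewrite !inE; case: (i \in S) => //=; rewrite andbF.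
    apply: ler_sum => i iS'; have iS : i \in S := iS'; rewrite gtau /r' iS -/(side h (r i)) -/(gact h i w) XrX sk.
    have [_ h1] := hr i (iS_G _ iS).
    rewrite [leRHS]mulrCA; apply: ler_wpM2r => //; by rewrite mulr_ge0// ltW.
  rewrite mulr_sumr (eq_bigl (fun i => ~~ covered S r i)); last first.
    by move=> i; rewrite inE; case: (boolP (i \in S)) => iS /=; [rewrite (cov_self i iS)|rewrite andbT].
  apply: ler_sum => z nz; have zS : z \notin S by apply: contraNN nz => /cov_self.
  rewrite gtau /r' (negbTE zS) -/(side h 0) -/(gact h z w) XrX sk.
  have -> : ((2 * 0 + 1) ^ k)%:R = 1 :> R by rewrite muln0 add0n exp1n.
  rewrite mulr1 mulrC ler_pM2l//; have s0 : side h 0 = h by rewrite /side muln0 add0n mulr1.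
  rewrite s0 /F indicE; case: (boolP (_ \in B)) => zB.
    rewrite mulr1; have /andP[_ h1] := Xb (gact h z w) h0 h0; apply: (le_trans h1); rewrite lerDr.
    by apply: addr_ge0 => //; apply: le_trans (fs_fS w); exact: (lowlim_ge0 (ub w)).
  rewrite mulr0 addr0 leNgt; apply/negP => h1; case/negP: zB; apply/mem_set; left.
  by rewrite /bad1 /= fS_inv.
set v := \sum_(i in S) _ in bound.
have vE : v = \sum_(z | covered S r z) 1 by apply: card_covered => // i iS; exact: ins (iS_G _ iS).
pose u : R := \sum_(z | ~~ covered S r z) 1.
have Nvu : N = v + u.
  have -> : N = \sum_(z : grid k J) 1 by rewrite sumr_const card_ffun !card_ord /N addn1.
  by rewrite (bigID (covered S r)) /= vE.
have cB : \sum_(z | ~~ covered S r z) F z <= al * N.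
  apply: le_trans hB; rewrite /cnt [leRHS](bigID (covered S r)) /= lerDr.
  by apply: sumr_ge0 => z _; exact: F0.
have N0 : 0 < N by rewrite ltr0n expn_gt0 addn1.
have p0 : 0 < (2 : R) ^+ k by rewrite exprn_gt0.
have thN : theta * N <= v.
  apply: (volume_bound p0 (I0 := #|[set i : grid k J | inside i R']%SET|%:R) (G := #|G|%:R) (cB := cnt h B J w) (al := al)) => //.
  - by rewrite -natrX -natrM ler_nat inside_card.
  - rewrite /cnt -!sumr_const [leLHS]big_mkcond [Y in _ <= Y + _]big_mkcond /= -big_split /=; apply: ler_sum => i _.
    rewrite !inE indicE; case: (inside i R') => /=; last by rewrite add0r ler0n.
    by case: (boolP (_ \in B)) => _ /=; rewrite ?addr0 ?add0r.
  - by rewrite /v -natr_sum -natrX -natrM ler_nat.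
rewrite /Xn ler_pdivrMr ?exprn_gt0 ?side_gt0//; apply: (le_trans bound).
rewrite sk mulrCA -/N; apply: ler_wpM2l; first exact: ltW.
rewrite big_split /= -mulr_sumr.
have -> : \sum_(z | ~~ covered S r z) (fS w + e) = (fS w + e) * u.
  by rewrite /u mulr_sumr; apply: eq_bigr => z _; rewrite mulr1.
have d0 : 0 <= fS w - fs w by rewrite subr_ge0 fs_fS.
have h1 : (fS w - fs w) * u <= (fS w - fs w) * ((1 - theta) * N).
  by apply: ler_wpM2l => //; move: thN; rewrite Nvu; set t := theta; rewrite mulrDr !mulrBl; lra.
have h2 : C * \sum_(z | ~~ covered S r z) F z <= C * (al * N) by apply: ler_wpM2l.
apply: (@le_trans _ _ ((fs w + e) * N + (fS w - fs w) * u + C * \sum_(z | ~~ covered S r z) F z)).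
  by rewrite Nvu; set x := fs w; set y := fS w; set q := \sum_(z | _) F z; lra.
apply: (le_trans (lerD (lerD (lexx _) h1) h2)).
by rewrite le_eqVlt; apply/orP; left; apply/eqP; ring.
Qed.

Lemma decr_small (F : nat -> set Om) (lam : R) : (forall i, measurable (F i)) -> (forall i j, (i <= j)%N -> F j `<=` F i) ->
  \bigcap_i F i = set0 -> 0 < lam -> exists N, (P (F N) <= lam%:E)%E.
Proof.
move=> mF dF F0 l0.
have : P (F i) @[i --> \oo] --> P (\bigcap_i F i).
  apply: nonincreasing_cvg_mu => //; first by rewrite -ge0_fin_numE//; exact: fin_num_measure.
  - exact: bigcapT_measurable.
  - by move=> i j ij; apply/subsetPset; exact: dF.
rewrite F0 measure0 => /fine_cvgP[_ /cvgrPdist_lt/(_ _ l0)[N _ hN]]; exists N.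
have := hN N (leqnn _); rewrite /= sub0r normrN => h.
rewrite -(fineK (fin_num_measure P _ (mF N))) lee_fin; apply/ltW; apply: le_lt_trans h; exact: ler_norm.
Qed.

(** A large integer size almost attaining [fs] is rounded up to an odd multiple of h; this adds at
    most 3h. *)
Lemma freq_multiple h e w : (0 < h)%N -> 0 < e -> exists r, X w (side h%:R r) (side h%:R r) <= fs w + e.
Proof.
move=> h0 e0; have e2 : 0 < e / 2 by rewrite divr_gt0.
have [N1 hN1] := err_small (C * k%:R * (3 * h)%N%:R) e2.
have [N hN uN] := lowlim_freq (ub w) e2 N1.
pose q := (N.+1 %/ (2 * h))%N; exists q.+1; set t := side _ _.
have tE : t = (h * (2 * q.+1 + 1))%N%:R by rewrite /t /side natrM.
have h2 : (0 < 2 * h)%N by rewrite muln_gt0.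
have d1 := divn_eq N.+1 (2 * h); have d2 := ltn_pmod N.+1 h2; rewrite -/q in d1.
have tN : N.+1%:R <= t.
  by rewrite tE ler_nat d1; exact: multiple_le.
have td : t - N.+1%:R <= (3 * h)%N%:R.
  by rewrite lerBlDr tE -natrD ler_nat d1; exact: multiple_ge.
have N0 : 0 < N.+1%:R :> R by [].
have t0 : 0 < t by apply: lt_le_trans tN.
have e1 : N1%:R <= t by apply: le_trans tN; rewrite ler_nat; exact: leqW.
apply: (le_trans (Xn_diag c0 aM bM (gc w) nu1 N0 tN)).
have h3 : C * k%:R * (t - N.+1%:R) / t <= e / 2.
  apply: le_trans (hN1 t e1); rewrite ler_wpM2r ?invr_ge0 ?(ltW t0)//; apply: ler_wpM2l => //.
  by rewrite mulr_ge0.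
move: uN h3; rewrite -/(fs w) /ulow; set x := Xn _ _ _ _ _ _ _; set y := fs w; set z := _ / t; lra.
Qed.

(** First h is fixed so large that the first kind of badness is rare; then R' is increased for that
    h, as [freq_multiple] shows that every realization has some admissible radius. *)
Lemma bad_small e (lam : R) : 0 < e -> 0 < lam -> exists h R' : nat, (0 < h)%N /\ (P (Bad h%:R R' e) <= lam%:E)%E.
Proof.
move=> e0 l0; have l2 : 0 < lam / 2 by rewrite divr_gt0.
pose D N : set Om := \bigcup_(i in [set i | (N <= i)%N]) bad1 i.+1%:R e.
have [N hN] : exists N, (P (D N) <= (lam / 2)%:E)%E.
  apply: decr_small => //.
  - by move=> i; apply: bigcup_measurable => j _; exact: measurable_bad1.
  - by move=> i j ij w [l jl hl]; exists l => //; exact: leq_trans jl.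
  apply/seteqP; split => // w hw; have [N0 h0] := fS_ev w e0.
  have [i /= Ni] := hw N0 I; rewrite /bad1 /= ltNge => /negP; apply; exact: h0.
pose h := N.+1; have h0 : 0 < h%:R :> R by [].
have [R' hR'] : exists R', (P (\bigcap_(r in [set r | (r <= R')%N]) bad2 h%:R e r) <= (lam / 2)%:E)%E.
  apply: (@decr_small (fun R' => \bigcap_(r in [set r | (r <= R')%N]) bad2 h%:R e r)) => //.
  - by move=> i; exact: measurable_bad2s.
  - by move=> i j ij w hw r /= ri; apply: hw => /=; exact: leq_trans ij.
  apply/seteqP; split => // w hw; have [r hr] := @freq_multiple h e w isT e0.
  by have := hw r I r (leqnn _); rewrite /bad2 /= ltNge hr.
exists h, R'; split => //; rewrite [lam]splitr EFinD.
have mb := measurable_bad1 e h0; have mb2 := measurable_bad2s e R' h0.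
apply: le_trans (measureU2 P mb mb2) _ || apply: (le_trans (measureU2 _ mb mb2)).
apply: leeD => //; apply: le_trans hN; apply: le_measure; rewrite ?inE//.
  by apply: bigcup_measurable => j _; exact: measurable_bad1.
by move=> w hw; exists N => /=; [exact: leqnn|exact: hw].
Qed.

Definition level e w := exists2 L, 0 < L & exists T0, forall T, T0 <= T -> X w T L <= fs w + (1 - theta) * (fS w - fs w) + e.

(** By the maximal inequality, outside a set of probability at most eta the bad bricks have density
    at most [al] in the cubes of all radii at once, so [cover] applies to every large box with one
    height L. *)
Lemma level_set e eta : 0 < e -> 0 < eta -> exists E, [/\ measurable E, (P E <= eta%:E)%E & forall w, ~ E w -> level e w].
Proof.
move=> e0 eta0; have e3 : 0 < e / 3 by rewrite divr_gt0.
have p0 : 0 < (2 : R) ^+ k by rewrite exprn_gt0.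
have C1 : 0 < C + 1 by rewrite ltr_wpDl.
pose al : R := Num.min ((2 ^+ k)^-1 / 2) (e / 3 / (C + 1)).
have al0 : 0 < al by rewrite lt_min !divr_gt0// invr_gt0.
have al1 : al <= (2 ^+ k)^-1 / 2 by rewrite ge_min lexx.
have al2 : C * al <= e / 3.
  apply: (@le_trans _ _ ((C + 1) * al)); first by rewrite ler_pM2r// lerDl.
  by rewrite mulrC -ler_pdivlMr// ge_min lexx orbT.
have p4 : 0 < (4 : R) ^+ k by rewrite exprn_gt0.
(* This probability of badness makes the right-hand side of the maximal inequality equal to eta. *)
have lam0 : 0 < eta * al / 4 ^+ k by rewrite divr_gt0// mulr_gt0.
have [h [R' [h0 hB]]] := bad_small e3 lam0.
have hR : 0 < h%:R :> R by rewrite ltr0n.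
pose B := Bad h%:R R' (e / 3); have mB : measurable B by exact: measurable_Bad.
pose ER R2 := \bigcup_(r in [set r | (r <= R2)%N]) dense_at h%:R B al r.
have mER R2 : measurable (ER R2) by apply: bigcup_measurable => r _; exact: measurable_dense_at.
have mE : measurable (\bigcup_R2 ER R2) by exact: bigcupT_measurable.
exists (\bigcup_R2 ER R2); split => //.
  have cv : P (ER i) @[i --> \oo] --> P (\bigcup_i ER i).
    apply: nondecreasing_cvg_mu => // i j ij; apply/subsetPset => w [r ri hr]; exists r => //; exact: leq_trans ij.
  rewrite -(cvg_lim (@ereal_hausdorff R) cv); apply: lime_le; first by apply/cvg_ex; exists (P (\bigcup_i ER i)).
  near=> R2; apply: (le_trans (max_ineq hR R2 mB al0)).
  apply: (@le_trans _ _ ((4 ^+ k / al)%:E * (eta * al / 4 ^+ k)%:E)%E).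
    by apply: lee_wpmul2l => //; rewrite lee_fin divr_ge0// ltW.
  by rewrite -EFinM lee_fin le_eqVlt; apply/orP; left; apply/eqP; field; rewrite !gt_eqF.
move=> w nE; exists (side h%:R R'); first exact: side_gt0.
have [N1 hN1] := err_small (C * k%:R * (3 * h)%N%:R) e3.
exists (N1%:R + (2 * h * (2 * R' + 1))%N%:R) => T hT.
have h2 : 0 < (2 * h)%N%:R :> R by rewrite ltr0n muln_gt0.
have T1 : N1%:R <= T by apply: le_trans hT; rewrite lerDl.
have T2 : (2 * h * (2 * R' + 1))%N%:R <= T by apply: le_trans hT; rewrite lerDr.
have T0 : 0 < T by apply: lt_le_trans T2; rewrite ltr0n !muln_gt0 h0 addn1.
pose q := Num.truncn (T / (2 * h)%N%:R).
have /andP[q1 q2] := truncn_itv (divr_ge0 (ltW T0) (ltW h2)); rewrite -/q in q1 q2.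
have qR : (2 * R' + 1 <= q)%N.
  by rewrite /q truncn_ge_nat ?divr_ge0 ?(ltW T0) ?(ltW h2)// ler_pdivlMr// -natrM mulnC.
have [J qJ] : exists J, q = J.+1 by exists q.-1; rewrite prednK// (leq_trans _ qR)// addn1.
have JR : (2 * R' <= J)%N by rewrite -ltnS -qJ -addn1.
have ST : side h%:R J <= T.
  rewrite ler_pdivlMr// -natrM in q1; apply: le_trans q1; rewrite /side -natrM ler_nat qJ; exact: side_nat_le.
have TS : T - side h%:R J <= (3 * h)%N%:R.
  rewrite ltr_pdivrMr// -natrM in q2; rewrite lerBlDr; apply: (le_trans (ltW q2)).
  by rewrite /side -natrM -natrD ler_nat qJ; exact: side_nat_ge.
have cB : cnt h%:R B J w <= al * ((2 * J + 1) ^ k)%:R.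
  by rewrite leNgt; apply/negP => hd; apply: nE; exists J => //; exists J => /=.
have h3 := cover hR (ltW e3) JR al1 cB.
apply: (le_trans (Xn_width c0 aM bM (gc w) nu1 (side_gt0 J hR) ST (side_gt0 R' hR))).
have h4 : C * k%:R * (T - side h%:R J) / T <= e / 3.
  apply: le_trans (hN1 T T1); rewrite ler_wpM2r ?invr_ge0 ?(ltW T0)//; apply: ler_wpM2l => //.
  by rewrite mulr_ge0.
move: h3 h4 al2; set x := Xn _ _ _ _ _ _ _; set y := (1 - theta) * _; set z := _ / T; set u := C * al; set v := fs w; lra.
Unshelve. all: by end_near. Qed.

Lemma theta_gt0 : 0 < theta. Proof. by rewrite divr_gt0// invr_gt0 mulr_gt0// exprn_gt0. Qed.

(** For T at least L, X(T, T) is at most X(T, L), so the bound of [level] also bounds [fS]; hence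
    theta ([fS] - [fs]) is at most every e > 0. *)
Lemma level_all w : (forall j : nat, level j.+1%:R^-1 w) ->
  fS w <= fs w /\ forall e, 0 < e -> exists2 L, 0 < L & exists T0, forall T, T0 <= T -> X w T L <= fs w + e.
Proof.
move=> hl; have le1 : fS w <= fs w.
  have key e : 0 < e -> theta * (fS w - fs w) <= e.
    move=> e0; have [j hj] := filter_ex (near_infty_natSinv_lt (PosNum e0)); have hj' : j.+1%:R^-1 < e := hj.
    have [L L0 [T0 hT]] := hl j.
    suff : fS w <= fs w + (1 - theta) * (fS w - fs w) + j.+1%:R^-1.
      by move: hj'; set q := j.+1%:R^-1; rewrite mulrBl mul1r; set z := theta * _; set x := fS w; set y := fs w; lra.
    set bd := _ + j.+1%:R^-1 in hT *; rewrite /fS lerBlDr -lerBlDl.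
    apply: (lowlim_ge (ub' w)) => e' e0'; pose N := (Num.truncn (`|T0| + L)).+1.
    exists N => i Ni; have iT : `|T0| + L <= i.+1%:R.
      apply: (@le_trans _ _ N%:R); last by rewrite ler_nat; exact: leqW.
      by apply: ltW; have /andP[] := truncn_itv (addr_ge0 (normr_ge0 T0) (ltW L0)).
    have i0 : 0 < i.+1%:R :> R by [].
    have iL : L <= i.+1%:R by apply: le_trans iT; rewrite lerDr.
    have iT0 : T0 <= i.+1%:R by apply: le_trans iT; rewrite (le_trans (ler_norm _))// lerDl ltW.
    have h1 := hT _ iT0; have h2 := Xn_height c0 aM bM (gc w) nu1 i0 L0 iL.
    by move: h1 h2; rewrite /ulow; set x := Xn _ _ _ _ _ _ _; set y := Xn _ _ _ _ _ _ _; set z := C0 _ _; lra.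
  rewrite -subr_le0 leNgt; apply/negP => h0; have tp := mulr_gt0 theta_gt0 h0.
  have := key (theta * (fS w - fs w) / 2); rewrite divr_gt0// => /(_ isT).
  by move: tp; set z := theta * _; lra.
split => // e e0; have [j hj] := filter_ex (near_infty_natSinv_lt (PosNum e0)); have hj' : j.+1%:R^-1 < e := hj.
have [L L0 [T0 hT]] := hl j; exists L => //; exists T0 => T /hT h; apply: (le_trans h).
have e1 : fS w = fs w by apply: le_anti; rewrite le1 fs_fS.
by rewrite e1 subrr mulr0 addr0 lerD2l ltW.
Qed.

Theorem ergodic_cells : P.-negligible (~` [set w | fS w <= fs w /\
  forall e, 0 < e -> exists2 L, 0 < L & exists T0, forall T, T0 <= T -> X w T L <= fs w + e]).
Proof.
set Q := [set w | _]; have sub : ~` Q `<=` \bigcup_j ~` [set w | level j.+1%:R^-1 w].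
  by move=> w hw; apply: contrapT => hn; apply: hw; apply: level_all => j; apply: contrapT => hj; apply: hn; exists j.
apply: (negligibleS sub); apply: negligible_bigcup => j.
have j0 : 0 < j.+1%:R^-1 :> R by [].
have ex (i : nat) : exists E, [/\ measurable E, (P E <= (i.+1%:R^-1)%:E)%E & forall w, ~ E w -> level j.+1%:R^-1 w].
  by apply: level_set.
have [E hE] := choice ex.
have mI : measurable (\bigcap_i E i) by apply: bigcapT_measurable => i; have [] := hE i.
exists (\bigcap_i E i); split => //.
  apply/eqP; rewrite eq_le measure_ge0 andbT; apply/lee_addgt0Pr => e e0; rewrite add0e.
  have [i hi] := filter_ex (near_infty_natSinv_lt (PosNum e0)); have hi' : i.+1%:R^-1 < e := hi.
  have [mE PE _] := hE i; apply: (@le_trans _ _ (P (E i))).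
    by apply: le_measure; rewrite ?inE// => w; apply.
  by apply: (le_trans PE); rewrite lee_fin ltW.
move=> w hw i _; apply: contrapT => hi; apply: hw; have [_ _ h] := hE i; exact: h.
Qed.
End ErgodicCells.

(** * All directions *)

Section FrameDensity.
Variables (R : realType) (n : nat).
Local Notation V := 'rV[R]_n.+2.
Local Notation ed := (ebase R n.+2 n.+1).

Lemma unit_close (u v : V) : u != 0 -> v != 0 ->
  enorm ((enorm u)^-1 *: u - (enorm v)^-1 *: v) <= 2 * enorm (u - v) / enorm u.
Proof.
move=> u0 v0; have nu0 : 0 < enorm u by rewrite lt_def enorm_ge0 enorm_eq0 u0.
have nv0 : 0 < enorm v by rewrite lt_def enorm_ge0 enorm_eq0 v0.
have -> : (enorm u)^-1 *: u - (enorm v)^-1 *: v = (enorm u)^-1 *: (u - v) + ((enorm u)^-1 - (enorm v)^-1) *: v.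
  by rewrite scalerBr scalerBl addrA subrK.
apply: (le_trans (enormD _ _)); rewrite !enormZ gtr0_norm ?invr_gt0//.
have -> : (enorm u)^-1 - (enorm v)^-1 = (enorm v - enorm u) / (enorm u * enorm v) by field; rewrite !gt_eqF.
rewrite normrM normfV [`|enorm u * _|]gtr0_norm ?mulr_gt0//.
have h := enorm_lip v u; rewrite enormB in h.
have -> : `|enorm v - enorm u| / (enorm u * enorm v) * enorm v = `|enorm v - enorm u| / enorm u by field; rewrite !gt_eqF.
by rewrite mulrC -mulrDl ler_wpM2r ?invr_ge0 ?(ltW nu0)//; move: h; set x := `|_|; set y := enorm _; lra.
Qed.

Definition refl (u x : V) : V := (2 * dotv x u) *: u - x.

Lemma refl_close (u v x : V) : enorm x = 1 -> enorm u = 1 -> enorm v = 1 -> enorm (refl u x - refl v x) <= 4 * enorm (u - v).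
Proof.
move=> x1 u1 v1.
have -> : refl u x - refl v x = (2 * dotv x (u - v)) *: u + (2 * dotv x v) *: (u - v).
  rewrite /refl dotvBr opprB addrA subrK mulrBr scalerBl scalerBr -!addrA; congr (_ + _).
  by rewrite addrA addNr add0r.
apply: (le_trans (enormD _ _)); rewrite !enormZ u1 mulr1 !normrM.
have h2 : `|2 : R| = 2 by rewrite ger0_norm.
have h3 := dotv_CS x (u - v); have h4 := dotv_CS x v; rewrite x1 mul1r in h3; rewrite x1 v1 mulr1 in h4.
rewrite h2; have h5 := ler_wpM2r (enorm_ge0 (u - v)) h4; move: h3 h5; rewrite mul1r.
rewrite -[2 * `|dotv x v| * _]mulrA; set a := `|_|; set b := `|_| * _; lra.
Qed.

Lemma Onu_refl (nu x : V) : nu != - ed -> Onu nu x = refl ((enorm (nu + ed))^-1 *: (nu + ed)) x.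
Proof.
move=> ne; rewrite /Onu (negbTE ne) /refl; congr (_ - _); rewrite scalerA dotvZr; congr (_ *: _).
by rewrite -sqr_enorm expr2 invfM; ring.
Qed.

(** The frame is the image of the basis under the reflection of axis nu + e_d, which depends
    continuously on nu as long as that vector is nonzero. *)
Lemma frames_close (nu : V) (eta : R) : nu != - ed -> 0 < eta -> exists2 dl, 0 < dl &
  forall nu', enorm (nu' - nu) <= dl -> forall j, enorm (fr nu' j - fr nu j) <= eta.
Proof.
move=> ne e0; set w := nu + ed; have w0 : w != 0 by rewrite addr_eq0.
have r0 : 0 < enorm w by rewrite lt_def enorm_ge0 enorm_eq0 w0.
exists (Num.min (enorm w / 2) (eta * enorm w / 8)); first by rewrite lt_min !divr_gt0// mulr_gt0.
move=> nu' hn j; set w' := nu' + ed.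
have ww : enorm (w - w') <= Num.min (enorm w / 2) (eta * enorm w / 8).
  by rewrite /w /w' opprD addrACA subrr addr0 enormB.
have w0' : w' != 0.
  apply: contraTneq ww => ->; rewrite subr0 -ltNge gt_min; apply/orP; left; lra.
have ne' : nu' != - ed by rewrite -addr_eq0.
rewrite /fr !Onu_refl// enormB.
have un (x : V) : x != 0 -> enorm ((enorm x)^-1 *: x) = 1.
  by move=> x0; have p : 0 < enorm x; [rewrite lt_def enorm_ge0 enorm_eq0 x0|rewrite enormZ gtr0_norm ?invr_gt0// mulVf// gt_eqF].
apply: (le_trans (refl_close (enorm_ebase R (n := n.+1) j) (un _ w0) (un _ w0'))).
have h1 := unit_close w0 w0'; have h2 : enorm (w - w') <= eta * enorm w / 8 by apply: (le_trans ww); rewrite ge_min lexx orbT.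
have h3 : 2 * enorm (w - w') / enorm w <= eta / 4.
  by rewrite ler_pdivrMr//; move: h2; set x := enorm (w - w'); set y := enorm w; lra.
by apply: (@le_trans _ _ (4 * (eta / 4))); [rewrite ler_pM2l// (le_trans h1)|lra].
Qed.

Lemma frames_dense : exists D0 : nat -> V, (forall i, sphere (D0 i)) /\
  forall nu, sphere nu -> forall eta, 0 < eta -> exists i, forall j, enorm (fr (D0 i) j - fr nu j) <= eta.
Proof.
have ed1 : enorm (- ed) = 1 by rewrite enormN; exact: (enorm_ebase R (n := n.+1) ord_max).
pose q_ (i : nat) : V := if (choice.unpickle i : option 'rV[rat]_n.+2) is Some q then map_mx ratr q else 0.
(* Normalised rational vectors; the zero vector supplies the exceptional direction, whose frame is
   approximated only by itself. *)
pose D0 i : V := if q_ i == 0 then - ed else (enorm (q_ i))^-1 *: q_ i.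
exists D0; split.
  move=> i; rewrite /sphere /= /D0; case: (eqVneq (q_ i) 0) => // q0.
  have p : 0 < enorm (q_ i) by rewrite lt_def enorm_ge0 enorm_eq0 q0.
  by rewrite enormZ gtr0_norm ?invr_gt0// mulVf// gt_eqF.
move=> nu n1 eta e0; have [e|ne] := eqVneq nu (- ed).
  exists (choice.pickle (0 : 'rV[rat]_n.+2)) => j; rewrite /D0 /q_ choice.pickleK map_mx0 eqxx e subrr enorm0; exact: ltW.
have [dl dl0 hdl] := frames_close ne e0.
pose d := Num.min (1 / 2) (dl / 2) / n.+2%:R; have d0 : 0 < d by rewrite divr_gt0// lt_min !divr_gt0.
have ex (l : 'I_n.+2) : exists q : rat, `|nu ord0 l - ratr q| <= d.
  have h : nu ord0 l - d < nu ord0 l + d by lra.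
  have [q] := rat_in_itvoo h; rewrite in_itv /= => /andP[h1 h2]; exists q; rewrite ler_norml; lra.
have [q hq] := choice ex.
pose i := choice.pickle (\row_l q l); exists i => j; apply: hdl.
set v : V := map_mx ratr (\row_l q l); have qE : q_ i = v by rewrite /q_ /i choice.pickleK.
have nv : enorm (nu - v) <= Num.min (1 / 2) (dl / 2).
  apply: (le_trans (enorm_le_sum _)); apply: (@le_trans _ _ (\sum_(l < n.+2) d)).
    by apply: ler_sum => l _; rewrite !mxE; exact: hq.
  by rewrite sumr_const card_ord -[d *+ _]mulr_natr /d divfK.
have v0 : v != 0.
  by apply: contraTneq nv => ->; rewrite subr0 n1 -ltNge gt_min; apply/orP; left; lra.
have nu0 : nu != 0 by rewrite -enorm_eq0 n1 oner_eq0.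
rewrite /D0 qE (negbTE v0) enormB; have := unit_close nu0 v0; rewrite n1 invr1 scale1r mulr1 => h.
apply: (le_trans h); have : enorm (nu - v) <= dl / 2 by apply: (le_trans nv); rewrite ge_min lexx orbT.
by set x := enorm _; lra.
Qed.
End FrameDensity.

Section Assembly.
Variables (R : realType) (n m : nat).
Local Notation V := 'rV[R]_n.+2.
Local Notation W := 'rV[R]_m.
Local Notation k := n.+1.
Variables (M : seq W) (c : R) (c0 : 0 <= c).
Local Notation C := (C0 n c).

(** Points of the larger rectangle have norm at most 2(n+2)t', so the frame coordinates move by at
    most dl = 2(n+2) eta t'. The constant 16 makes 8 dl = s t', leaving room for the margins of
    [Xn_compare]. *)
Lemma Xn_rot a b (g : V -> W -> V -> R) (nu nu' : V) (eta s t : R) : a \in M -> b \in M -> gle c g -> sphere nu -> sphere nu' -> 0 < eta ->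
  (forall j, enorm (fr nu' j - fr nu j) <= eta) -> s = 16 * n.+2%:R * eta -> s <= 1 -> 0 < t ->
  Xn M a b g nu' ((1 + s) * t) ((1 + s) * t) <= Xn M a b g nu t t + C * k%:R * (2 * s).
Proof.
move=> aM bM gc n1 n1' e0 he sE s1 t0; set t' := (1 + s) * t.
have N0 : 0 < n.+2%:R :> R by [].
have s0 : 0 < s by rewrite sE !mulr_gt0.
have tt : t' = t + s * t by rewrite /t' mulrDl mul1r.
have st0 : 0 < s * t by rewrite mulr_gt0.
have st1 : s * t <= t by rewrite ler_piMl// ltW.
have t0' : 0 < t' by rewrite tt addr_gt0.
pose K := n.+2%:R * (t' + t').
pose dl := eta * K.
have dlE : 8 * dl = s * t' by rewrite /dl /K sE; ring.
have st' : s * t' = s * t + s * (s * t) by rewrite tt mulrDr.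
have sst : s * (s * t) <= s * t by rewrite ler_piMl// ltW.
have CK : 0 <= C * k%:R by rewrite mulr_ge0// C0_ge0.
have dl0 : 0 <= dl by rewrite /dl mulr_ge0// ?(ltW e0)// /K mulr_ge0// addr_ge0// ltW.
have h := @Xn_compare R n m M c a b c0 aM bM g nu nu' 0 t t t' t' dl K gc n1 n1' t0 t0 dl0.
have gz : (fun y => g (y + 0)) = g by apply/funext => y; rewrite addr0.
rewrite gz in h; apply: (le_trans (h _ _ _ _ _ _ _)).
- by move: dlE st' sst st1 t0; set x := s * t'; set y := s * t; set z := s * y; lra.
- by move: dlE st' sst st1 t0; set x := s * t'; set y := s * t; set z := s * y; lra.
- by rewrite tt; move: dlE st' sst st0; rewrite tt; set x := s * (_ + _); set y := s * t; set z := s * y; lra.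
- by rewrite tt; move: dlE st' sst st0; rewrite tt; set x := s * (_ + _); set y := s * t; set z := s * y; lra.
- move=> x /(rect_crect n1') hx; exact: (crect_bounded (ltW t0') (ltW t0') hx).
- move=> x; rewrite subr0 => hx; apply: (le_trans (crect_bounded (ltW t0) (ltW t0) hx)).
  by rewrite /K ler_pM2l// tt; move: st0; set y := s * t; lra.
- move=> x j hx; rewrite subr0 -dotvBr; apply: (le_trans (dotv_CS _ _)); rewrite /dl mulrC.
  by apply: ler_pM => //; exact: enorm_ge0.
rewrite lerD2l -mulrA; apply: ler_wpM2l => //; rewrite ler_pdivrMr//.
have -> : t' - t = s * t by rewrite tt addrC addKr.
have sst0 : 0 < s * (s * t) by rewrite mulr_gt0.
move: dlE st' st0 dl0 sst sst0; rewrite -mulrA.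
by set x := s * t'; set y := s * t; set z := s * y; lra.
Qed.

Variables (dO : measure_display) (Om : measurableType dO) (P : probability Om R).
Hypothesis Pc : complete_prob P.
Variables (g : Om -> V -> W -> V -> R) (tau : V -> Om -> Om).
Hypotheses (ga : admissible_rst g) (htau : mp_action P tau) (hstat : stationary g tau).
Hypothesis gc : forall w, gle c (g w).
Local Notation F a b nu w := (fs M a b g nu w).

Definition lim_at (x : R -> R) (l : R) := forall e, 0 < e -> exists T0, forall t, T0 <= t -> `|x t - l| <= e.

Lemma Xcell_cvg a b nu w (ell : R -> R) l : (forall t, 0 < t -> 0 < ell t) -> a \in M -> b \in M -> sphere nu ->
  lim_at (fun t => Xn M a b (g w) nu t (ell t)) l -> Xcell M (g w) a b nu t (ell t) @[t --> +oo] --> l%:E.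
Proof.
move=> hell aM bM n1 hl.
have cv : (fun t => Xn M a b (g w) nu t (ell t)) @ +oo --> l.
  apply/cvgrPdist_le => e e0; have [T0 hT] := hl e e0; near=> t.
  rewrite distrC; apply: hT; near: t; apply: nbhs_pinfty_ge; exact: num_real.
have cvE : (Xn M a b (g w) nu t (ell t))%:E @[t --> +oo] --> l%:E by apply: cvg_EFin; [near=> t|exact: cv].
apply: cvg_trans cvE; apply: near_eq_cvg; near=> t.
have t0 : 0 < t by near: t; apply: nbhs_pinfty_gt; exact: num_real.
have lt0 := hell t t0.
have E := XrE c0 aM bM (gc w) n1 t0 lt0.
rewrite /Xcell -/(cell M (g w) (ujump a b nu) (rect nu t (ell t))) -/(Fc M a b (g w) nu t (ell t)) E -EFinM.
by rewrite /Xn mulrC.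
Unshelve. all: by end_near. Qed.

(** A real size t is compared with the next integer through [Xn_diag]. *)
Lemma F_lower a b nu w e : a \in M -> b \in M -> sphere nu -> 0 < e ->
  exists T0, forall t, T0 <= t -> 0 < t -> F a b nu w - e <= Xn M a b (g w) nu t t.
Proof.
move=> aM bM n1 e0; have e2 : 0 < e / 2 by rewrite divr_gt0.
have ub N : 0 <= ulow M a b g nu w N <= C by exact: (Xn_bound c0 aM bM (gc w) n1).
have [N hN] := lowlim_ev ub e2; have [N1 hN1] := err_small (C * k%:R) e2.
exists (N%:R + N1%:R) => t ht t0; pose q := Num.truncn t.
have /andP[q1 q2] := truncn_itv (ltW t0); rewrite -/q in q1 q2.
have Nq : (N <= q)%N.
  by rewrite truncn_ge_nat ?(ltW t0)//; apply: le_trans ht; rewrite lerDl.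
have h1 := hN q Nq; have h2 := Xn_diag c0 aM bM (gc w) n1 t0 (ltW q2).
have h3 : C * k%:R * (q.+1%:R - t) / q.+1%:R <= e / 2.
  apply: le_trans (hN1 q.+1%:R _); last by apply: le_trans (ltW q2); apply: le_trans ht; rewrite lerDr.
  rewrite ler_wpM2r ?invr_ge0//; apply: ler_piMr; first by rewrite mulr_ge0// C0_ge0.
  by rewrite lerBlDr -natr1 addrC lerD2l.
have h1' : F a b nu w - e / 2 <= Xn M a b (g w) nu q.+1%:R q.+1%:R := h1.
move: h1' h2 h3; set x := fs _ _ _ _ _ _; set y := Xn _ _ _ _ _ q.+1%:R _; set z := Xn _ _ _ _ _ _ _; set u := C0 n c * _ * _ / _; lra.
Qed.

Definition good_at a b nu w := forall e, 0 < e -> exists2 L, 0 < L & exists T0, forall T, T0 <= T -> Xn M a b (g w) nu T L <= F a b nu w + e.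

(** X(t, ell t) lies between X(t, t), bounded below by the lower limit, and X(t, L) for a fixed L,
    bounded above by [good_at]. *)
Lemma good_lim a b nu w (ell : R -> R) : a \in M -> b \in M -> sphere nu -> good_at a b nu w ->
  (forall t, 0 < t -> 0 < ell t <= t) -> (forall L, exists T0, forall t, T0 <= t -> L <= ell t) ->
  lim_at (fun t => Xn M a b (g w) nu t (ell t)) (F a b nu w).
Proof.
move=> aM bM n1 hg hell he e e0; have [L L0 [T1 h1]] := hg e e0; have [T2 h2] := he L.
have [T3 h3] := F_lower w aM bM n1 e0.
exists (`|T1| + `|T2| + `|T3| + 1) => t ht.
have a1 := normr_ge0 T1; have a2 := normr_ge0 T2; have a3 := normr_ge0 T3.
have b1 := ler_norm T1; have b2 := ler_norm T2; have b3 := ler_norm T3.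
have t0 : 0 < t by lra.
have tT1 : T1 <= t by lra.
have tT2 : T2 <= t by lra.
have tT3 : T3 <= t by lra.
have /andP[l0 lt] := hell t t0.
have u1 := Xn_height c0 aM bM (gc w) n1 t0 L0 (h2 t tT2); have u2 := h1 t tT1.
have u3 := Xn_height c0 aM bM (gc w) n1 t0 l0 lt; have u4 := h3 t tT3 t0.
rewrite ler_distl; move: u1 u2 u3 u4.
set x := Xn _ _ _ _ _ _ _; set y := Xn _ _ _ _ _ _ _; set z := Xn _ _ _ _ _ _ _; set f := fs _ _ _ _ _ _.
by move=> u1 u2 u3 u4; apply/andP; split; lra.
Qed.

Lemma close_lim a b nu w (x : R) e : a \in M -> b \in M -> sphere nu -> (exists T0, forall t, T0 <= t -> `|Xn M a b (g w) nu t t - x| <= e) ->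
  `|F a b nu w - x| <= e.
Proof.
move=> aM bM n1 [T0 hT].
have ub N : 0 <= ulow M a b g nu w N <= C by exact: (Xn_bound c0 aM bM (gc w) n1).
have big N0 : exists N : nat, (N0 <= N)%N /\ forall i, (N <= i)%N -> T0 <= i.+1%:R.
  exists (N0 + (Num.truncn `|T0|).+1)%N; split; first exact: leq_addr.
  move=> i hi; apply: (le_trans (ler_norm _)); apply: ltW; apply: (@lt_le_trans _ _ (Num.truncn `|T0|).+1%:R).
    by have /andP[] := truncn_itv (normr_ge0 T0).
  by rewrite ler_nat; apply: leqW; apply: leq_trans hi; exact: leq_addl.
rewrite ler_distl; apply/andP; split.
  apply: (lowlim_ge ub) => e' e0'; have [N [_ hN]] := big 0%N; exists N => i /hN /hT.
  by rewrite ler_distl /ulow => /andP[h _]; move: h; set y := Xn _ _ _ _ _ _ _; lra.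
apply: (lowlim_le ub) => e' e0' N0; have [N [hN1 hN]] := big N0; exists N => //; have := hT _ (hN N (leqnn _)).
by rewrite ler_distl /ulow => /andP[_ h]; move: h; set y := Xn _ _ _ _ _ _ _; lra.
Qed.

(** [Xn_rot] is used in both directions, from t to (1 + s)t and from t/(1 + s) to t, to trap X for
    nu between two values for nu'. *)
Lemma near_good a b nu nu' w e : a \in M -> b \in M -> sphere nu -> sphere nu' -> 0 < e -> good_at a b nu' w ->
  forall eta, 0 < eta -> 16 * n.+2%:R * eta <= 1 -> C * k%:R * (2 * (16 * n.+2%:R * eta)) <= e ->
  (forall j, enorm (fr nu' j - fr nu j) <= eta) ->
  exists T0, forall t, T0 <= t -> `|Xn M a b (g w) nu t t - F a b nu' w| <= 2 * e.
Proof.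
move=> aM bM n1 n1' e0 hg eta et0 s1 Ce hf; set s := 16 * _ * _ in s1 Ce.
have s0 : 0 < s by rewrite /s !mulr_gt0.
have idl t : 0 < t -> 0 < (id t : R) <= t by move=> ->; rewrite lexx.
have [T0 hT] := good_lim aM bM n1' hg idl (fun L => ex_intro _ L (fun t h => h)) e0.
exists (2 * `|T0| + 1) => t ht; have a1 := normr_ge0 T0; have b1 := ler_norm T0.
have t0 : 0 < t by lra.
have hf' j : enorm (fr nu j - fr nu' j) <= eta by rewrite enormB.
have s1' : 0 < 1 + s by lra.
have r1 := Xn_rot aM bM (gc w) n1 n1' et0 hf erefl s1 t0.
have t1 : 0 < t / (1 + s) by rewrite divr_gt0.
have r2 := Xn_rot aM bM (gc w) n1' n1 et0 hf' erefl s1 t1.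
rewrite -/s in r1 r2; rewrite mulrCA divff ?gt_eqF// mulr1 in r2.
have q1 : T0 <= (1 + s) * t by have : 0 < s * t by [rewrite mulr_gt0]; rewrite mulrDl mul1r; lra.
have q2 : T0 <= t / (1 + s).
  rewrite ler_pdivlMr//; have : `|T0| * (1 + s) <= `|T0| * 2 by apply: ler_wpM2l => //; lra.
  have : T0 * (1 + s) <= `|T0| * (1 + s) by rewrite ler_pM2r.
  by set p := T0 * _; set q := `|T0| * (1 + s); lra.
have := hT _ q1; have := hT _ q2; rewrite !ler_distl => /andP[_ k2] /andP[k1 _].
move: r1 r2 k1 k2 Ce; set x := Xn _ _ _ _ nu t t; set y := Xn _ _ _ _ _ _ _; set z := Xn _ _ _ _ _ _ _; set f := fs _ _ _ _ _ _; set u := C0 n c * _ * _.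
by move=> r1 r2 k1 k2 Ce; apply/andP; split; lra.
Qed.

(** The second clause keeps the same approximating direction for another realization, so that limits
    at two realizations can be compared. *)
Lemma all_directions (D0 : nat -> V) a b w : a \in M -> b \in M -> (forall i, sphere (D0 i)) ->
  (forall nu, sphere nu -> forall eta, 0 < eta -> exists i, forall j, enorm (fr (D0 i) j - fr nu j) <= eta) ->
  (forall i, good_at a b (D0 i) w) -> forall nu, sphere nu -> forall e, 0 < e ->
  exists i, (exists T0, forall t, T0 <= t -> `|Xn M a b (g w) nu t t - F a b (D0 i) w| <= e) /\
  forall w', (forall i, good_at a b (D0 i) w') -> exists T0, forall t, T0 <= t -> `|Xn M a b (g w') nu t t - F a b (D0 i) w'| <= e.
Proof.
move=> aM bM D1 dD hg nu n1 e e0; have e2 : 0 < e / 2 by rewrite divr_gt0.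
have N0 : 0 < 16 * n.+2%:R :> R by rewrite mulr_gt0.
have C1 : 0 < C * k%:R + 1 by rewrite ltr_wpDl// mulr_ge0// C0_ge0.
pose s := Num.min 1 (e / 2 / (2 * (C * k%:R + 1))); have s0 : 0 < s by rewrite lt_min ltr01 !divr_gt0// mulr_gt0.
pose eta := s / (16 * n.+2%:R); have eta0 : 0 < eta by rewrite divr_gt0.
have sE : 16 * n.+2%:R * eta = s by rewrite /eta mulrC divfK// gt_eqF.
have s1 : 16 * n.+2%:R * eta <= 1 by rewrite sE ge_min lexx.
have Ce : C * k%:R * (2 * (16 * n.+2%:R * eta)) <= e / 2.
  rewrite sE; apply: (@le_trans _ _ ((C * k%:R + 1) * (2 * s))).
    by rewrite ler_pM2r ?lerDl// mulr_gt0.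
  have : s <= e / 2 / (2 * (C * k%:R + 1)) by rewrite ge_min lexx orbT.
  rewrite ler_pdivlMr ?mulr_gt0//; apply: le_trans; rewrite le_eqVlt; apply/orP; left; apply/eqP; ring.
have [i hi] := dD nu n1 eta eta0.
have key w' : (forall i, good_at a b (D0 i) w') -> exists T0, forall t, T0 <= t -> `|Xn M a b (g w') nu t t - F a b (D0 i) w'| <= e.
  move=> hg'; have [T0 hT] := near_good aM bM n1 (D1 i) e2 (hg' i) eta0 s1 Ce hi.
  by exists T0 => t /hT h; apply: (le_trans h); rewrite mulrC divfK.
by exists i; split; [exact: key|exact: key].
Qed.
End Assembly.

Lemma dist_half (R : realType) (a b x e : R) : `|a - b| <= e / 2 -> `|x - b| <= e / 2 -> `|x - a| <= e.
Proof. by rewrite !ler_distl => /andP[? ?] /andP[? ?]; apply/andP; split; lra. Qed.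

(** * Exceptional sets and the homogenized density *)

Section Homogenization.
Variables (R : realType) (n m : nat).
Local Notation V := 'rV[R]_n.+2.
Local Notation W := 'rV[R]_m.
Variables (M : seq W) (c : R) (c0 : 0 <= c).
Variables (dO : measure_display) (Om : measurableType dO) (P : probability Om R).
Hypothesis Pc : complete_prob P.
Variables (g : Om -> V -> W -> V -> R) (tau : V -> Om -> Om).
Hypotheses (ga : admissible_rst g) (htau : mp_action P tau) (hstat : stationary g tau).
Hypothesis gc : forall w, gle c (g w).
Local Notation F a b nu w := (fs M a b g nu w).
Local Notation good a b nu w := (good_at M g a b nu w).

Lemma negligible_good a b nu : a \in M -> b \in M -> sphere nu -> P.-negligible (~` [set w | good a b nu w]).
Proof.
move=> aM bM n1; apply: negligibleS (ergodic_cells c0 aM bM Pc ga htau hstat gc n1) => w hn h; apply: hn.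
by have [_] := h.
Qed.

Definition pairs_set (S : W -> W -> set Om) : set Om :=
  \bigcup_i \bigcup_j (if (i < size M)%N && (j < size M)%N then S (nth 0 M i) (nth 0 M j) else set0).

Lemma negligible_pairs S : (forall a b, a \in M -> b \in M -> P.-negligible (S a b)) -> P.-negligible (pairs_set S).
Proof.
move=> h; do 2!(apply: negligible_bigcup => ?); case: ifPn => [/andP[i1 i2]|_]; last exact: negligible_set0.
by apply: h; exact: mem_nth.
Qed.

Lemma pairs_setP S a b w : a \in M -> b \in M -> ~ pairs_set S w -> ~ S a b w.
Proof.
move=> aM bM hn h; apply: hn; exists (index a M) => //; exists (index b M) => //.
by rewrite !index_mem aM bM /= !nth_index.
Qed.

Variable D0 : nat -> V.
Hypotheses (D1 : forall i, sphere (D0 i))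
  (dD : forall nu, sphere nu -> forall eta, 0 < eta -> exists i, forall j, enorm (fr (D0 i) j - fr nu j) <= eta).

Definition lim_bad : set Om := pairs_set (fun a b => \bigcup_q ~` [set w | good a b (D0 q) w]).

Lemma negligible_lim_bad : P.-negligible lim_bad.
Proof.
by apply: negligible_pairs => a b aM bM; apply: negligible_bigcup => q; exact: negligible_good.
Qed.

Lemma lim_badP a b w : a \in M -> b \in M -> ~ lim_bad w -> forall i, good a b (D0 i) w.
Proof.
move=> aM bM /(pairs_setP aM bM) hn i; apply: contrapT => h; apply: hn; exists i => //.
Qed.

Lemma lim_all a b nu w : a \in M -> b \in M -> sphere nu -> ~ lim_bad w ->
  lim_at (fun t => Xn M a b (g w) nu t t) (F a b nu w).
Proof.
move=> aM bM n1 /(lim_badP aM bM) hg e e0; have e2 : 0 < e / 2 by rewrite divr_gt0.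
have [i [[T0 hT] _]] := all_directions c0 gc aM bM D1 dD hg n1 e2.
have h1 := close_lim c0 gc aM bM n1 (ex_intro _ T0 hT).
exists T0 => t /hT h2; exact: (dist_half h1 h2).
Qed.

Definition rat_seq (i : nat) : R := if (choice.unpickle i : option rat) is Some q then ratr q else 0.
Definition lev a b q r : set Om := [set w | F a b (D0 q) w < rat_seq r].
(** By ergodicity each rational sublevel set has probability 0 or 1; this collects the null one of
    the set and its complement. Outside it [fs] takes a single value in every direction of the dense
    family. *)
Definition erg_bad : set Om := pairs_set (fun a b => \bigcup_q \bigcup_r
  (if P (lev a b q r) == 0%E then lev a b q r else ~` lev a b q r)).

Lemma negligible_erg_bad : ergodic P tau -> P.-negligible erg_bad.
Proof.
move=> he; apply: negligible_pairs => a b aM bM; do 2!(apply: negligible_bigcup => ?).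
set q := (X in lev a b X _); set r := (X in lev a b q X); set A := lev a b q r.
have mA : measurable A.
  apply: measurable_ltset; last exact: measurable_cst.
  exact: (measurable_fs c0 aM bM Pc ga gc (D1 q)).
have tA z : tau z @` A = A.
  have inv w : F a b (D0 q) (tau z w) = F a b (D0 q) w by exact: (fs_inv c0 aM bM htau hstat gc (D1 q)).
  apply/seteqP; split => w; first by move=> [w' Aw' <-]; rewrite /A /lev /= inv.
  move=> Aw; exists (tau (- z) w); last first.
    by have [_ _ t0 tD] := htau; have := congr1 (fun f => f w) (tD (- z) z); rewrite addNr t0 /= => <-.
  rewrite /A /lev /= (fs_inv c0 aM bM htau hstat gc (D1 q)) //.
case: ifPn => [/eqP PA|PA]; first by exists A; split.
have tA0 z : P ((tau z @` A `\` A) `|` (A `\` tau z @` A)) = 0%E by rewrite tA setDv setU0 measure0.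
have [PA0|PA1] := he A mA tA0; first by rewrite PA0 eqxx in PA.
have PC : P (~` A) = 0%E by rewrite (probability_setC P mA) PA1 subee.
by exists (~` A); split; [exact: measurableC|exact: PC|by []].
Qed.

Lemma erg_badP a b q w w0 : a \in M -> b \in M -> ~ erg_bad w -> ~ erg_bad w0 -> F a b (D0 q) w = F a b (D0 q) w0.
Proof.
move=> aM bM h1 h2.
have le u v : ~ erg_bad u -> ~ erg_bad v -> F a b (D0 q) u <= F a b (D0 q) v.
  move=> /(pairs_setP aM bM) hu /(pairs_setP aM bM) hv; rewrite leNgt; apply/negP => h.
  have [x] := rat_in_itvoo h; rewrite in_itv /= => /andP[x1 x2].
  pose r := choice.pickle x; have rE : rat_seq r = ratr x by rewrite /rat_seq /r choice.pickleK.
  case: (eqVneq (P (lev a b q r)) 0%E) => h0.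
    by apply: hv; exists q => //; exists r => //; rewrite h0 eqxx /lev /= rE.
  by apply: hu; exists q => //; exists r => //; rewrite (negbTE h0) /lev /= rE; apply/negP; rewrite -leNgt ltW.
by apply: le_anti; apply/andP; split; exact: le.
Qed.

Lemma erg_const a b nu w w0 : a \in M -> b \in M -> sphere nu -> ~ lim_bad w -> ~ lim_bad w0 -> ~ erg_bad w -> ~ erg_bad w0 ->
  F a b nu w = F a b nu w0.
Proof.
move=> aM bM n1 l1 l2 h1 h2.
have le u v : ~ lim_bad u -> ~ lim_bad v -> ~ erg_bad u -> ~ erg_bad v -> F a b nu u <= F a b nu v.
  move=> /(lim_badP aM bM) gu /(lim_badP aM bM) gv hu hv; apply/ler_addgt0Pr => e e0.
  have e2 : 0 < e / 2 by rewrite divr_gt0.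
  have [i [hu' hall]] := all_directions c0 gc aM bM D1 dD gu n1 e2.
  have k1 := close_lim c0 gc aM bM n1 hu'; have k2 := close_lim c0 gc aM bM n1 (hall v gv).
  rewrite -(erg_badP i aM bM hu hv) in k2; have k3 := dist_half k1 k2.
  by rewrite -lerBlDl; apply: (le_trans (ler_norm _)); rewrite distrC.
by apply: le_anti; apply/andP; split; exact: le.
Qed.

(** The map [sel] is the identity unless the action is ergodic; then it is constant, equal to a
    realization outside the exceptional set, so that determinism holds everywhere and not just
    almost surely. *)
Lemma homogenized : exists (sel : Om -> Om) (N : set Om), [/\ P.-negligible N,
  forall w, ~ N w -> forall a b nu, a \in M -> b \in M -> sphere nu ->
    lim_at (fun t => Xn M a b (g w) nu t t) (F a b nu (sel w)) /\ F a b nu w = F a b nu (sel w),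
  forall z w a b nu, a \in M -> b \in M -> sphere nu -> F a b nu (sel (tau z w)) = F a b nu (sel w) &
  ergodic P tau -> forall w1 w2, sel w1 = sel w2].
Proof.
have [he|he] := pselect (ergodic P tau); last first.
  exists id, lim_bad; split.
  - exact: negligible_lim_bad.
  - by move=> w hw a b nu aM bM n1; split; [exact: lim_all|reflexivity].
  - by move=> z w a b nu aM bM n1; exact: (fs_inv c0 aM bM htau hstat gc n1).
  - by move=> /he.
have nN : P.-negligible (lim_bad `|` erg_bad).
  by apply: negligibleU; [exact: negligible_lim_bad|exact: negligible_erg_bad].
have [w0 hw0] : exists w0, ~ (lim_bad `|` erg_bad) w0.
  apply: contrapT => /forallNP hn; have [A [mA PA sA]] := nN.
  have AT : A = setT by apply/seteqP; split => // w _; apply: sA; exact: contrapT (hn w).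
  by move: PA; rewrite AT probability_setT => /eqP; rewrite onee_eq0.
have [l0 e0] : ~ lim_bad w0 /\ ~ erg_bad w0 by split => h; apply: hw0; [left|right].
exists (fun=> w0), (lim_bad `|` erg_bad); split; [exact: nN| |reflexivity|reflexivity].
move=> w hw a b nu aM bM n1.
have [l1 e1] : ~ lim_bad w /\ ~ erg_bad w by split => h; apply: hw; [left|right].
have E := erg_const aM bM n1 l1 l0 e1 e0.
by split; [rewrite -E; exact: lim_all|exact: E].
Qed.
End Homogenization.

Unset Implicit Arguments. Set Strict Implicit. Set Printing Implicit Defensive.

Theorem theorem3p1 (R : realType) (d m : nat) (hd : (2 <= d)%N) (hm : (0 < m)%N)
    (M : seq 'rV[R]_m)
    (dO : measure_display) (Om : measurableType dO) (P : probability Om R)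
    (Pcomplete : complete_prob P)
    (g : Om -> 'rV[R]_d -> 'rV[R]_m -> 'rV[R]_d -> R)
    (tau : 'rV[R]_d -> Om -> Om)
    (hg : admissible_rst g) (htau : mp_action P tau) (hstat : stationary g tau) :
  exists ghom : Om -> 'rV[R]_m -> 'rV[R]_m -> 'rV[R]_d -> R,
    [/\ (forall w a b nu, sphere nu -> 0 <= ghom w a b nu),
        {ae P, forall w, forall a b nu, a \in M -> b \in M -> sphere nu ->
           Xcell M (g w) a b nu t t @[t --> +oo] --> (ghom w a b nu)%:E},
        (forall z w a b nu, ghom (tau z w) a b nu = ghom w a b nu),
        (ergodic P tau ->
           forall w1 w2 a b nu, sphere nu -> ghom w1 a b nu = ghom w2 a b nu)
      & (forall nu, sphere nu ->
         forall ell : R -> R,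
           (forall t, 0 < t -> 0 < ell t <= t) ->
           ell t @[t --> +oo] --> +oo ->
           {ae P, forall w, forall a b, a \in M -> b \in M ->
              Xcell M (g w) a b nu t (ell t) @[t --> +oo] --> (ghom w a b nu)%:E})].
Proof.
move: hd g tau hg htau hstat; case: d => [|[|n]] // _ g tau hg htau hstat.
have [_ [c [c1 hc]]] := hg.
have c0 : 0 <= c by apply: le_trans c1.
have gc w : gle c (g w) by move=> x zeta nu n1; have [] := hc w x zeta nu n1.
have [D0 [D1 dD]] := frames_dense R n.
have [sel [N [nN hN hinv herg]]] := homogenized M c0 Pcomplete hg htau hstat gc D1 dD.
pose ok (a b : 'rV[R]_m) (nu : 'rV[R]_n.+2) : Prop := [/\ a \in M, b \in M & sphere nu].
(* The value 0 off M x M x sphere makes positivity, invariance and determinism hold for all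
   arguments. *)
pose ghom (w : Om) (a b : 'rV[R]_m) (nu : 'rV[R]_n.+2) : R := if pselect (ok a b nu) then fs M a b g nu (sel w) else 0.
have ghomE (w : Om) (a b : 'rV[R]_m) (nu : 'rV[R]_n.+2) : a \in M -> b \in M -> sphere nu -> ghom w a b nu = fs M a b g nu (sel w).
  by move=> aM bM n1; rewrite /ghom; case: pselect => [p|no] /=; [reflexivity|exfalso; apply: no; split].
exists ghom; split.
- move=> w a b nu n1; rewrite /ghom; case: pselect => [[aM bM n1']|no] /=; last exact: lexx.
  by apply: (lowlim_ge0 (C := C0 n c)) => i; exact: (Xn_bound c0 aM bM (gc (sel w)) n1).
- apply: negligibleS nN => w hw; apply: contrapT => nw; apply: hw => a b nu aM bM n1; rewrite ghomE//.
  by apply: (Xcell_cvg c0 gc) => //; have [] := hN w nw a b nu aM bM n1.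
- by move=> z w a b nu; rewrite /ghom; case: pselect => [[aM bM n1]|no] /=; [exact: hinv|reflexivity].
- by move=> he w1 w2 a b nu _; rewrite /ghom (herg he w1 w2).
move=> nu n1 ell hell hoo.
have hoo' L : exists T0, forall t, T0 <= t -> L <= ell t.
  have /cvgryPge/(_ L)[T0 [_ hT]] := hoo; exists (T0 + 1) => t ht; apply: hT; apply: lt_le_trans ht; by rewrite ltrDl.
(* [N] gives convergence of X(t, t) in every direction. Heights below t also need the fixed-height
   bound at nu itself, whence a further null set depending on nu. *)
pose N' := pairs_set M (fun a b => ~` [set w | good_at M g a b nu w]).
have nN' : P.-negligible (N `|` N').
  by apply: negligibleU => //; apply: negligible_pairs => a b aM bM; exact: (negligible_good c0 Pcomplete hg htau hstat gc).
apply: negligibleS nN' => w hw; apply: contrapT => nw; apply: hw => a b aM bM; rewrite ghomE//.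
have [nw1 nw2] : ~ N w /\ ~ N' w by split => h; apply: nw; [left|right].
have gw : good_at M g a b nu w by apply: contrapT; exact: (pairs_setP aM bM nw2).
apply: (Xcell_cvg c0 gc) => //; first by move=> t /hell/andP[].
have [_ <-] := hN w nw1 a b nu aM bM n1.
exact: (good_lim c0 gc).
Qed.
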